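(* Let $(X_i)_{i\in\mathbb Z}$ be the $p$-dimensional Gaussian linear process described in the context with $p<n$, and suppose Conditions (A) and (G) of the context hold with constants $\beta>3/4$, $C_0>0$, $c_0>0$, and that the eigenvalues of $\Sigma$ satisfy $0<c_e\le\lambda_{\min}(\Sigma)\le\lambda_{\max}(\Sigma)\le C_e$. Let $\tilde\beta=(4\beta-3)\wedge(2\beta-1)$, $\Omega=\Sigma^{-1}$, $\hat\Omega_n=\hat\Sigma_n^{-1}$, and $$\rho^\Omega(n)=\sup_{u\in\mathbb R}\left|\mathbb P\left(n^{1/2}|\hat\Omega_n-\Omega|_\infty\ge u\right)-\mathbb P\left(|Z^\Omega|_\infty\ge u\right)\right|,$$ $$\Psi^\Omega(p,n)=\frac{|\Omega|_1^2\log^{(5\tilde\beta+12)/(4\tilde\beta+8)}(pn)}{n^{\tilde\beta/(4\tilde\beta+8)}}+\frac{p^4\log^{5/2}(n)}{n^{(2\beta-1/2)\wedge 3/2}}+\frac{|\Omega|_1p^2\log(p)}{n^{(\beta-1/4)\wedge3/4}}.$$ Then there is a constant $C'>0$ depending only on $C_0,c_0,C_e,c_e$ (and the fixed exponent $\beta$) such that $$\rho^\Omega(n)\le C'\,\Psi^\Omega(p,n).$$ In particular, if $\Psi^\Omega(p,n)\to0$ as $n\to\infty$ (with $p=p_n$ allowed to vary), then $\rho^\Omega(n)\to0$.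
   Context: Setting. Let $(\epsilon_t)_{t\in\mathbb Z}$ be i.i.d. $N(0,I_d)$ vectors in $\mathbb R^d$, let $A_t\in\mathbb R^{p\times d}$ ($t\ge0$), and let $X_i=\sum_{t=0}^\infty A_t\epsilon_{i-t}\in\mathbb R^p$, $i\in\mathbb Z$. Put $\Sigma=\mathbb E[X_iX_i^\top]$, $\Gamma_k=\mathrm{Cov}(X_t,X_{t-k})$ for $k\in\mathbb Z$, and $\hat\Sigma_n=n^{-1}\sum_{i=1}^nX_iX_i^\top$. Condition (A): for some $\beta>3/4$ and $C_0>0$, for all $t\ge0$, $\max_{1\le j\le p}\left(\sum_{l=1}^d (A_t)_{jl}^2\right)^{1/2}\le C_0(1\vee t)^{-\beta}$. Condition (G): there is $c_0>0$ such that for all $1\le s,t\le p$, $\sum_{k=-\infty}^\infty\left((\Gamma_k)_{ss}(\Gamma_k)_{tt}+(\Gamma_k)_{st}(\Gamma_k)_{ts}\right)\ge c_0$. Standing assumptions for precision matrices: $p<n$ and the sample covariance $\hat\Sigma_n$ is (almost surely) invertible; $0<c_e\le\lambda_{\min}(\Sigma)\le\lambda_{\max}(\Sigma)\le C_e$. Notation: $\mathrm{Vec}(\cdot)$ stacks the columns of a matrix; $|\cdot|_\infty$ is the maximum absolute entry; $|\cdot|_1$ is the matrix 1-norm (maximum absolute column sum); $a\wedge b=\min$, $a\vee b=\max$; $\log^a(x)=(\log x)^a$. $Z^\Omega$ is a $p^2$-dimensional Gaussian vector with mean zero and the same covariance matrix as $n^{1/2}\mathrm{Vec}(\hat\Omega_n-\Omega)$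 (implicitly, this covariance is finite). *)

(* Defs.v *)
From HB Require Import structures.
From mathcomp Require Export all_boot all_order all_algebra.
From mathcomp Require Export all_classical all_reals all_analysis.
Export Order.TTheory GRing.Theory Num.Theory.
Export numFieldNormedType.Exports.

Set Implicit Arguments.
Unset Strict Implicit.
Unset Printing Implicit Defensive.

Local Open Scope classical_set_scope.
Local Open Scope ring_scope.

(* Stacks the columns; mxvec is row-major, hence the transpositions. *)
Definition Vec (R : realType) m n (B : 'M[R]_(m, n)) : 'cV[R]_(n * m) :=
  (mxvec B^T)^T.

(* Maximum absolute column sum. *)
Definition mx_norm1 (R : realType) m n (B : 'M[R]_(m, n)) : R :=
  \big[Num.max/0]_(j < n) \sum_(i < m) `|B i j|.

(* For p = 0 the condition is void; for p > 0 it says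
   c <= lambda_min B and lambda_max B <= C when B is symmetric. *)
Definition spectrum_within (R : realType) p (B : 'M[R]_p) (c C : R) : Prop :=
  forall a : R, eigenvalue B a -> c <= a <= C.

(* Sum over all the integers, as the sum of the two one-sided series. *)
Definition zseries (R : realType) (f : int -> R) : R :=
  limn (series (fun k : nat => f k%:Z)) +
  limn (series (fun k : nat => f (- (k.+1)%:Z))).

Section random_matrices.
Context (R : realType) (d : measure_display) (T : measurableType d).
Variable P : probability T R.

Definition measurable_mx m n (Y : T -> 'M[R]_(m, n)) : Prop :=
  forall i j, measurable_fun setT (fun w => Y w i j).

Definition mean_mx m n (Y : T -> 'M[R]_(m, n)) : 'M[R]_(m, n) :=
  \matrix_(i, j) fine ('E_P[(fun w => Y w i j)])%E.

Definition cross_cov m n (Y : T -> 'cV[R]_m) (W : T -> 'cV[R]_n) :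
    'M[R]_(m, n) :=
  \matrix_(i, j) fine (covariance P (fun w => Y w i 0) (fun w => W w j 0)).

Definition cov_mx m (Y : T -> 'cV[R]_m) : 'M[R]_m := cross_cov Y Y.

Definition square_integrable m n (Y : T -> 'M[R]_(m, n)) : Prop :=
  forall i j, (fun w => Y w i j) \in Lfun P 2%:E.

(* N(m, s^2), including the point mass at m when s = 0 (normal_prob is not
   degenerate there). *)
Definition gaussian_law (m s : R) : set R -> \bar R :=
  if s == 0 then \d_m else normal_prob m s.

(* Every linear combination of the coordinates is (possibly degenerate)
   normal, so that singular covariance matrices are allowed. *)
Definition gaussian_vector k (Y : T -> 'cV[R]_k) : Prop :=
  forall u : 'cV[R]_k, exists m s : R, forall B : set R, measurable B ->
    P [set w | B ((u^T *m Y w) 0 0)] = gaussian_law m s B.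

Definition standard_gaussian k (Y : T -> 'cV[R]_k) : Prop :=
  [/\ gaussian_vector Y, mean_mx Y = 0 & cov_mx Y = 1%:M].

(* The sigma-algebra generated by a random vector. *)
Definition sigma_vector k (Y : T -> 'cV[R]_k) : set (set T) :=
  g_sigma_preimage (fun (i : 'I_k) w => Y w i 0).

Definition independent_vectors (I : choiceType) k (Y : I -> T -> 'cV[R]_k) :
    Prop :=
  forall (J : seq I) (E : I -> set T), uniq J ->
    (forall i, i \in J -> sigma_vector (Y i) (E i)) ->
    P (\bigcap_(i in [set` J]) E i) = (\prod_(i <- J) P (E i))%E.

End random_matrices.

(* X_i is the almost sure limit of the partial sums of
   \sum_(t >= 0) A_t eps_(i - t). *)
Record linear_process (R : realType) (p : nat) := LinearProcess {
  lp_display : measure_display ;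
  lp_space : measurableType lp_display ;
  lp_prob : probability lp_space R ;
  lp_dim : nat ;
  lp_eps : int -> lp_space -> 'cV[R]_lp_dim ;
  lp_coef : nat -> 'M[R]_(p, lp_dim) ;
  lp_X : int -> lp_space -> 'cV[R]_p ;
  lp_eps_measurable : forall t, measurable_mx (lp_eps t) ;
  lp_eps_gaussian : forall t, standard_gaussian lp_prob (lp_eps t) ;
  lp_eps_independent : independent_vectors lp_prob lp_eps ;
  lp_X_measurable : forall i, measurable_mx (lp_X i) ;
  lp_X_series : forall i, {ae lp_prob, forall w,
    (fun N : nat => \sum_(0 <= t < N) lp_coef t *m lp_eps (i - t%:Z) w)
      @ \oo --> lp_X i w} }.

Record gaussian_rv (R : realType) (k : nat) := GaussianRV {
  gv_display : measure_display ;
  gv_space : measurableType gv_display ;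
  gv_prob : probability gv_space R ;
  gv_fun :> gv_space -> 'cV[R]_k ;
  gv_measurable : measurable_mx gv_fun ;
  gv_gaussian : gaussian_vector gv_prob gv_fun }.

Section precision_matrix.
Context (R : realType) (p : nat) (M : linear_process R p).
Local Notation P := (lp_prob M).
Local Notation X := (@lp_X R p M).

(* By stationarity the time index 0 may be replaced by any other, here and in
   Gamma. *)
Definition Sigma : 'M[R]_p := mean_mx P (fun w => X 0 w *m (X 0 w)^T).

Definition Gamma (k : int) : 'M[R]_p := cross_cov P (X 0) (X (0 - k)).

Definition Sigma_hat (n : nat) (w : lp_space M) : 'M[R]_p :=
  n%:R^-1 *: \sum_(1 <= i < n.+1) X i%:Z w *m (X i%:Z w)^T.

Definition Omega : 'M[R]_p := invmx Sigma.

Definition Omega_hat (n : nat) (w : lp_space M) : 'M[R]_p :=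
  invmx (Sigma_hat n w).

Definition Omega_err (n : nat) (w : lp_space M) : 'M[R]_p :=
  Num.sqrt n%:R *: (Omega_hat n w - Omega).

Definition condition_A (beta C0 : R) : Prop :=
  forall t : nat,
    \big[Num.max/0]_(j < p)
       Num.sqrt (\sum_(l < lp_dim M) (lp_coef M t j l) ^+ 2)
      <= C0 * (maxn 1 t)%:R `^ (- beta).

Definition condition_G (c0 : R) : Prop :=
  forall s t : 'I_p,
    c0 <= zseries (fun k => Gamma k s s * Gamma k t t +
                            Gamma k s t * Gamma k t s).

(* Z is distributed as the Gaussian vector with mean zero and the covariance
   matrix of n^(1/2) Vec(Omega_hat - Omega), which is required to be finite. *)
Definition is_ZOmega (n : nat) (Z : gaussian_rv R (p * p)) : Prop :=
  [/\ square_integrable P (Omega_err n),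
      mean_mx (gv_prob Z) Z = 0 &
      cov_mx (gv_prob Z) Z = cov_mx P (fun w => Vec (Omega_err n w))].

Definition assumptions (beta C0 c0 ce Ce : R) (n : nat)
    (Z : gaussian_rv R (p * p)) : Prop :=
  [/\ (0 < p < n)%N,
      condition_A beta C0 /\ condition_G c0,
      spectrum_within Sigma ce Ce,
      {ae P, forall w, Sigma_hat n w \in unitmx} &
      is_ZOmega n Z].

(* mx_norm is the maximum absolute entry. *)
Definition rho_Omega (n : nat) (Z : gaussian_rv R (p * p)) : R :=
  sup [set `| fine (P [set w | u <= Num.sqrt n%:R *
                               mx_norm (Omega_hat n w - Omega)])
              - fine (gv_prob Z [set w | u <= mx_norm (Z w)]) |
       | u in [set: R]].

Definition Psi_Omega (beta : R) (n : nat) : R :=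
  let tbeta := Num.min (4 * beta - 3) (2 * beta - 1) in
  mx_norm1 Omega ^+ 2
    * ln (p%:R * n%:R) `^ ((5 * tbeta + 12) / (4 * tbeta + 8))
    / n%:R `^ (tbeta / (4 * tbeta + 8))
  + p%:R ^+ 4 * ln n%:R `^ (5 / 2)
    / n%:R `^ (Num.min (2 * beta - 1 / 2) (3 / 2))
  + mx_norm1 Omega * p%:R ^+ 2 * ln p%:R
    / n%:R `^ (Num.min (beta - 1 / 4) (3 / 4)).

End precision_matrix.

(* Main.v *)
From HB Require Import structures.
Require Import Defs.
From mathcomp Require Import ring lra zify measurable_realfun.

Set Implicit Arguments.
Unset Strict Implicit.
Unset Printing Implicit Defensive.
Import HBNNSimple.

Local Open Scope classical_set_scope.
Local Open Scope ring_scope.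

(** The law of the data X_1, ..., X_n depends only on its covariances, so the data and Z can be realised as
    linear images of independent parts of one standard Gaussian vector. With D = Sigma_hat - Sigma,
<<
      sqrt n (Omega_hat - Omega) = - sqrt n Omega D Omega + sqrt n Omega D Omega D Omega - ...
>>
    and the first term L is a vector of centred quadratic forms Q_j = x M_j x^T - tr M_j. It is compared with Z
    by differentiating a smooth maximum of sin th L + cos th Z in th: by Gaussian integration by parts the
    derivative only involves <M_j x, M_k x> - Cov (Z_j, Z_k) / 2, which is small because the moments of
    quadratic forms are bounded by powers of |M_j M_k|_F, and the second derivatives of the smooth maximum live
    in a thin band around the level, whose probability is controlled by anti-concentration. The latter is
    obtained, along the whole path, from the Cameron-Martin formula: translates of the band in the directions
    of Z are disjoint and of comparable probability.
    The remaining terms are small on an event whose complement has very small probability, and the negative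
    moments of Sigma_hat, which follow from a small-ball estimate for Gaussian vectors and a grid of directions,
    make the complement harmless for the covariances too.
    Since tbeta / (4 tbeta + 8) < 1/4, all errors are smaller than Psi by a power of n; this absorbs every
    logarithm, and moment bounds of high order replace exponential tails. *)

(** * The standard Gaussian measure *)

(** The covariance of [Z] is that of the whole error, not of its leading term L. The second-order
    term R2 therefore enters through third moments E L R2, which are explicit traces, and the
    remainder through second moments that must be finite and small also where Sigma_hat is nearly
    singular; this is why negative moments are needed.

    Along the path only [cos th * Z] can be translated. The band probability at angle [th] is of
    order X / cos^2 th, with X the band width up to powers of [N], and X sin th cos th / cos^2 th is
    not integrable at pi / 2. Combined with the trivial bound 1 it becomes 2 X / (cos^2 th + X),
    whose integral against sin th cos th is only of order X ln (1 / X).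

    Components of [Z] may have small variance. The band argument needs just one component with
    variance bounded below; a diagonal entry serves, because [Om j j >= 1 / Ce].

    A single parameter [N], a small power of n, stands for all logarithms: deviations are measured
    in [N] standard deviations and fail with probability at most [eta], a high negative power of
    n. *)

Definition pushforward_measure d d' (T1 : measurableType d)
    (T2 : measurableType d') (R : realType) (m : {measure set T1 -> \bar R})
    (f : T1 -> T2) (mf : measurable_fun setT f) : {measure set T2 -> \bar R} :=
  measure_function_pushforward__canonical__measure_function_Measure m mf.

Lemma eq_leW (R : numDomainType) (x y : R) : x = y -> x <= y. Proof. by move=> ->. Qed.

Lemma measurable_cosR (R : realType) : measurable_fun setT (@cos R).
Proof. exact: continuous_measurable_fun (@continuous_cos R). Qed.

Lemma measurable_sinR (R : realType) : measurable_fun setT (@sin R).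
Proof. exact: continuous_measurable_fun (@continuous_sin R). Qed.

Section density.
Context d (T : measurableType d) (R : realType).
Variables (mu nu : {measure set T -> \bar R}) (g : T -> R).
Hypotheses (mg : measurable_fun setT g) (g0 : forall x, 0 <= g x).
Hypothesis nuE : forall A, measurable A -> nu A = (\int[mu]_(x in A) (g x)%:E)%E.

Let int_indic A : measurable A ->
  (\int[nu]_x (\1_A x)%:E = \int[mu]_x ((\1_A x)%:E * (g x)%:E))%E.
Proof.
move=> mA; rewrite integral_indic// setIT nuE// integral_mkcond.
apply: eq_integral => x _; rewrite patchE indicE.
by case: (x \in A); rewrite ?mul1e ?mul0e.
Qed.

Let int_nnsfun (h : {nnsfun T >-> R}) :
  (\int[nu]_x (h x)%:E = \int[mu]_x ((h x)%:E * (g x)%:E))%E.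
Proof.
under [LHS]eq_integral do rewrite fimfunE -fsumEFin//.
rewrite [LHS]ge0_integral_fsum//; last 2 first.
  - by move=> r; exact/measurable_EFinP/measurableT_comp.
  - by move=> n x _; rewrite EFinM nnfun_muleindic_ge0.
under [RHS]eq_integral.
  move=> x xD; rewrite fimfunE -fsumEFin// ge0_mule_fsuml; last first.
    by move=> r; rewrite EFinM nnfun_muleindic_ge0.
  over.
rewrite [RHS]ge0_integral_fsum//; last 2 first.
  - move=> r; apply: emeasurable_funM; last exact/measurable_EFinP.
    by apply/measurable_EFinP; do 2 apply/measurableT_comp => //.
  - move=> n x _; rewrite EFinM mule_ge0//; first by rewrite nnfun_muleindic_ge0.
    by rewrite lee_fin.
apply: eq_fsbigr => r rh.
have r0 : (0 <= r)%R.
  by have /set_mem[x _ <-] := rh.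
under [LHS]eq_integral do rewrite EFinM.
under [RHS]eq_integral do rewrite EFinM -muleA.
rewrite ge0_integralZl//; last exact/measurable_EFinP.
rewrite [RHS]ge0_integralZl//; last 2 first.
  - by apply: emeasurable_funM; exact/measurable_EFinP.
  - by move=> x _; rewrite mule_ge0// lee_fin.
by rewrite int_indic.
Qed.

(** [nuE] is the case of indicators; linearity gives simple functions and monotone convergence along
    [nnsfun_approx] gives [f]. *)
Lemma ge0_integral_density (f : T -> \bar R) : measurable_fun setT f ->
  (forall x, 0 <= f x)%E ->
  (\int[nu]_x f x = \int[mu]_x (f x * (g x)%:E))%E.
Proof.
move=> mf f0; pose h := nnsfun_approx measurableT mf.
have fE x : f x = lim ((EFin \o h n) x @[n --> \oo]).
  by apply/esym/cvg_lim => //; exact: cvg_nnsfun_approx.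
have -> : (\int[nu]_x f x = lim (\int[nu]_x (EFin \o h n) x @[n --> \oo]))%E.
  under eq_integral => x _ do rewrite fE.
  apply: monotone_convergence => //.
  - by move=> n; apply/measurable_EFinP.
  - by move=> n x _ //=; rewrite lee_fin.
  - by move=> x _ a b ab; rewrite lee_fin; exact/lefP/nd_nnsfun_approx.
have -> : (\int[mu]_x (f x * (g x)%:E) =
    lim (\int[mu]_x ((EFin \o h n) x * (g x)%:E) @[n --> \oo]))%E.
  have fg x : (f x * (g x)%:E = lim ((EFin \o h n) x * (g x)%:E @[n --> \oo]))%E.
    by apply/esym/cvg_lim => //; apply: cvgeZr => //; exact: cvg_nnsfun_approx.
  under eq_integral => x _ do rewrite fg.
  apply: monotone_convergence => //.
  - by move=> n; apply/emeasurable_funM; apply/measurable_EFinP.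
  - by move=> n x _ /=; rewrite mule_ge0 ?lee_fin.
  - move=> x _ a b ab/=; rewrite lee_wpmul2r ?lee_fin//; exact/lefP/nd_nnsfun_approx.
by apply: congr_lim; apply/funext => n; exact: int_nnsfun.
Qed.
End density.

Section normal1.
Context {R : realType}.
Notation mu := (@lebesgue_measure R).

(** Lebesgue measure is determined by its values on half-open intervals, and [s] times its image
    under [x |-> m + s * x] takes the same values, since preimages of intervals have their length
    divided by [s]. *)
Lemma ge0_integral_affine (m s : R) (f : R -> \bar R) : 0 < s ->
  measurable_fun setT f -> (forall x, 0 <= f x)%E ->
  (\int[mu]_x f x = s%:E * \int[mu]_x f (m + s * x)%R)%E.
Proof.
move=> s0 mf f0.
pose phi := fun x : measurableTypeR R => (m + s * x : measurableTypeR R).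
have mphi : measurable_fun setT phi.
  by apply: measurable_funD => //; apply: measurable_funM.

have s0' : 0 <= s by exact: ltW.
pose nu := mscale (NngNum s0') (pushforward_measure mu mphi).
have E : forall A, measurable A -> mu A = nu A.
  apply: lebesgue_measure_unique => X [[a b] _ <-].
rewrite [RHS](_ : _ = s%:E * mu (phi @^-1` `]a, b]%classic))%E//.
  rewrite (_ : _ @^-1` _ = `](a - m) / s, (b - m) / s]%classic); last first.
    apply/seteqP; split => x /=; rewrite /phi !in_itv/= ltr_pdivrMr// ler_pdivlMr// mulrC.
      by move=> /andP[h1 h2]; apply/andP; split; lra.
    by move=> /andP[h1 h2]; apply/andP; split; lra.
  rewrite [LHS]lebesgue_measure_itv [in RHS]lebesgue_measure_itv/= !lte_fin.
  rewrite ltr_pM2r ?invr_gt0// ltrD2r; case: ifPn => _; last by rewrite mule0.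
  rewrite -!EFinB -EFinM; congr EFin; field; exact: lt0r_neq0.
rewrite (eq_measure_integral nu); last by move=> A mA _; exact: E.
rewrite /nu ge0_integral_mscale// ge0_integral_pushforward//.
Qed.

Lemma ge0_integral_normal (m s : R) (f : R -> \bar R) : s != 0 ->
  measurable_fun setT f -> (forall x, 0 <= f x)%E ->
  (\int[normal_prob m s]_x f x = \int[mu]_x (f x * (normal_pdf m s x)%:E))%E.
Proof.
move=> s0 mf f0; apply: ge0_integral_density => //.
- exact: measurable_normal_pdf.
- by move=> x; exact: normal_pdf_ge0.
Qed.

(** The absolute value appears because [normal_prob m s] also makes sense for negative [s] and
    depends on [s ^+ 2] only. *)
Lemma ge0_integral_normal_std (m s : R) (f : R -> \bar R) : s != 0 ->
  measurable_fun setT f -> (forall x, 0 <= f x)%E ->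
  (\int[normal_prob m s]_x f x = \int[normal_prob 0 1]_x f (m + `|s| * x)%R)%E.
Proof.
move=> s0 mf f0; rewrite ge0_integral_normal//.
have ns : 0 < `|s| by rewrite normr_gt0.
have mphi : measurable_fun setT (fun x : R => m + `|s| * x).
  by apply: measurable_funD => //; apply: measurable_funM.
rewrite (@ge0_integral_affine m `|s|)//; last 2 first.
- apply: emeasurable_funM => //; apply/measurable_EFinP.
  exact: measurable_normal_pdf.
- by move=> x; rewrite mule_ge0// lee_fin normal_pdf_ge0.
rewrite ge0_integral_normal ?oner_eq0//; last exact: measurableT_comp mf mphi.
rewrite -ge0_integralZl//; last 2 first.
- apply: emeasurable_funM => //; first exact: measurableT_comp mf mphi.
  apply/measurable_EFinP; apply: (measurableT_comp _ mphi).
  exact: measurable_normal_pdf.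
- by move=> x _; rewrite mule_ge0// lee_fin normal_pdf_ge0.
apply: eq_integral => x _; rewrite muleCA -EFinM; congr (_ * _%:E)%E.
rewrite !normal_pdfE ?oner_eq0// /normal_peak /normal_fun.
have -> : Num.sqrt (s ^+ 2 * pi *+ 2) = `|s| * Num.sqrt (1 ^+ 2 * pi *+ 2) :> R.
  by rewrite expr1n mul1r -mulrnAr sqrtrM ?sqr_ge0// sqrtr_sqr.
rewrite invfM -!mulrA mulVKf ?gt_eqF//; congr (_ * expR _).
have -> : m + `|s| * x - m = `|s| * x by ring.
by rewrite exprMn real_normK ?num_real//; field.
Qed.

(** Completing the square: the density at [x - c] is the density at [x] times the exponential
    factor. *)
Lemma cameron_martin1 (c : R) (f : R -> \bar R) :
  measurable_fun setT f -> (forall x, 0 <= f x)%E ->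
  (\int[normal_prob 0 1]_x f (c + x)%R =
   \int[normal_prob 0 1]_x (f x * (expR (c * x - c ^+ 2 / 2))%:E))%E.
Proof.
move=> mf f0.
have := @ge0_integral_normal_std c 1 f (oner_neq0 _) mf f0.
rewrite normr1; under [in X in _ = X -> _]eq_integral do rewrite mul1r.
move=> <-; rewrite !ge0_integral_normal ?oner_neq0//; last 2 first.
- apply: emeasurable_funM => //; apply/measurable_EFinP.
  by apply: measurableT_comp => //; apply: measurable_funB => //; apply: measurable_funM.
- by move=> x; rewrite mule_ge0// lee_fin expR_ge0.
apply: eq_integral => x _; rewrite -muleA -EFinM; congr (_ * _%:E)%E.
rewrite !normal_pdfE ?oner_eq0// /normal_fun mulrCA -expRD.
by congr (_ * expR _); field.
Qed.

End normal1.

Section gauss.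
Context {R : realType}.

Definition cons_tup K (z : measurableTypeR R * K.-tuple R) : K.+1.-tuple R :=
  [tuple of (z.1 : R) :: z.2].

Lemma measurable_cons_tup K :
  measurable_fun setT (@cons_tup K).
Proof. exact: measurable_cons. Qed.

Definition cons_tup_mfun K :
    {mfun (measurableTypeR R * K.-tuple R)%type >-> K.+1.-tuple R} :=
  mfun_Sub (mem_set (@measurable_cons_tup K)).

(** Defined by recursion on the length so that Tonelli peels off one coordinate at a time; in length
    0 it is the point mass at the empty tuple. *)
Fixpoint gauss (K : nat) : probability (K.-tuple R) R :=
  match K return probability (K.-tuple R) R with
  | 0%N => dirac [tuple]
  | K'.+1 => distribution (normal_prob 0 1 \x gauss K')%E (cons_tup_mfun K')
  end.

Lemma ge0_integral_gaussS K (f : K.+1.-tuple R -> \bar R) :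
  measurable_fun setT f -> (forall x, 0 <= f x)%E ->
  (\int[gauss K.+1]_t f t =
   \int[normal_prob 0 1]_x \int[gauss K]_t f (cons_tup (x, t)))%E.
Proof.
move=> mf f0; rewrite /= ge0_integral_distribution//.
rewrite fubini_tonelli1//; last by move=> z; exact: f0.
exact: measurableT_comp mf (@measurable_cons_tup K).
Qed.

Definition shiftt K (t : K.-tuple R) (v : 'rV[R]_K) : K.-tuple R :=
  [tuple tnth t i + v 0 i | i < K].

Definition lin K (v : 'rV[R]_K) (t : K.-tuple R) : R := \sum_i v 0 i * tnth t i.

Definition dotp K (u v : 'rV[R]_K) : R := \sum_i u 0 i * v 0 i.

Lemma measurable_shiftt K (v : 'rV[R]_K) : measurable_fun setT (fun t => shiftt t v).
Proof.
apply/measurable_fun_tnthP => i.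
rewrite (_ : _ \o _ = fun t => tnth t i + v 0 i); last first.
  by apply/funext => t /=; rewrite tnth_mktuple.
by apply: measurable_funD => //; exact: measurable_tnth.
Qed.

Lemma measurable_lin K (v : 'rV[R]_K) : measurable_fun setT (lin v).
Proof.
apply: measurable_sum => i; apply: measurable_funM => //; exact: measurable_tnth.
Qed.

(** Tonelli, with the one-dimensional formula in the first coordinate and the induction hypothesis
    in the others. Nonnegative integrands keep integrability out of the induction. *)
Lemma cameron_martin K (v : 'rV[R]_K) (f : K.-tuple R -> \bar R) :
  measurable_fun setT f -> (forall x, 0 <= f x)%E ->
  (\int[gauss K]_t f (shiftt t v) =
   \int[gauss K]_t (f t * (expR (lin v t - dotp v v / 2))%:E))%E.
Proof.
elim: K v f => [v f mf f0|K IH v f mf f0].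
  rewrite /= integral_dirac//; last exact: measurableT_comp mf (measurable_shiftt v).
  rewrite integral_dirac//; last first.
    apply: emeasurable_funM => //; apply/measurable_EFinP.
    apply: measurableT_comp => //; apply: measurable_funB => //.
    exact: measurable_lin.
  rewrite /lin /dotp !big_ord0 mul0r subr0 expR0 mule1; congr (_ * f _)%E.
  by rewrite [LHS]tuple0.
have me : measurable_fun setT (fun t => expR (lin v t - dotp v v / 2)).
  by apply: measurableT_comp => //; apply: measurable_funB => //; exact: measurable_lin.
rewrite [LHS]ge0_integral_gaussS//; last exact: measurableT_comp mf (measurable_shiftt v).
rewrite [RHS]ge0_integral_gaussS//; last 2 first.
- by apply: emeasurable_funM => //; exact/measurable_EFinP.
- by move=> x; rewrite mule_ge0// lee_fin expR_ge0.
pose v' : 'rV[R]_K := \row_i v 0 (lift ord0 i).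
have shE x t : shiftt (cons_tup (x, t)) v = cons_tup (v 0 0 + x, shiftt t v').
  apply/eq_from_tnth => i; rewrite tnth_mktuple.
  case: (unliftP ord0 i) => [j|] ->.
    by rewrite !tnthS tnth_mktuple mxE.
  by rewrite !tnth0 addrC.
have liE x t : lin v (cons_tup (x, t)) = v 0 0 * x + lin v' t.
  rewrite /lin big_ord_recl tnth0; congr +%R; apply: eq_bigr => j _.
  by rewrite mxE tnthS.
have doE : dotp v v = v 0 0 ^+ 2 + dotp v' v'.
  by rewrite /dotp big_ord_recl expr2; congr +%R; apply: eq_bigr => j _; rewrite mxE.
have mfx x : measurable_fun setT (fun t : K.-tuple R => f (cons_tup (x, t))).
  apply: (measurableT_comp mf); apply: measurable_cons; first exact: measurable_cst.
  exact: measurable_id.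
transitivity (\int[normal_prob 0 1]_x \int[gauss K]_t
    (f (cons_tup ((v 0 0 + x)%R, t)) * (expR (lin v' t - dotp v' v' / 2))%:E))%E.
  apply: eq_integral => x _; rewrite -(IH v' (fun t => f (cons_tup (v 0 0 + x, t))))//.
  by apply: eq_integral => t _; rewrite shE.
have mF : measurable_fun setT (fun z : measurableTypeR R * K.-tuple R =>
    f (cons_tup z) * (expR (lin v' z.2 - dotp v' v' / 2))%:E)%E.
  apply: emeasurable_funM; first exact: measurableT_comp mf (@measurable_cons_tup K).
  apply/measurable_EFinP; apply: measurableT_comp => //; apply: measurable_funB => //.
  by apply: (measurableT_comp (@measurable_lin K v')).
rewrite (@cameron_martin1 _ (v 0 0) (fun x => \int[gauss K]_t
  (f (cons_tup (x, t)) * (expR (lin v' t - dotp v' v' / 2))%:E))%E); last 2 first.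
- apply: (measurable_fun_fubini_tonelli_F _ mF).
  by move=> z; rewrite mule_ge0// lee_fin expR_ge0.
- by move=> x; apply: integral_ge0 => t _; rewrite mule_ge0// lee_fin expR_ge0.
apply: eq_integral => x _.
rewrite -ge0_integralZr//; last 2 first.
- apply: emeasurable_funM => //; apply/measurable_EFinP; apply: measurableT_comp => //.
  by apply: measurable_funB => //; exact: measurable_lin.
- by move=> t _; rewrite mule_ge0// lee_fin expR_ge0.
apply: eq_integral => t _; rewrite -muleA -EFinM -expRD liE doE.
by congr (_ * (expR _)%:E)%E; field.
Qed.

End gauss.

(** * Integration by parts *)

Section tame.
Context {R : realType}.
Implicit Types K : nat.

Definition gE K (f : K.-tuple R -> R) : R := \int[gauss K]_t f t.

Definition growth K (c : R) (t : K.-tuple R) : R :=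
  expR (c * (1 + \sum_i `|tnth t i|)).

(** Growth of the form exp (c |x|_1) is stable under sums, products and translations, and integrable
    for every [c]; all integrability questions about polynomials, exponentials and bounded functions
    of the Gaussian vector reduce to this predicate. *)
Definition tame K (f : K.-tuple R -> R) : Prop :=
  measurable_fun setT f /\ exists2 c, 0 <= c & forall t, `|f t| <= growth c t.

Lemma growth_base_ge1 K (t : K.-tuple R) : 1 <= 1 + \sum_i `|tnth t i|.
Proof. by rewrite lerDl sumr_ge0. Qed.

Lemma le_growth K (c c' : R) (t : K.-tuple R) : c <= c' -> growth c t <= growth c' t.
Proof.
move=> cc'; rewrite ler_expR ler_wpM2r//.
by rewrite (le_trans _ (growth_base_ge1 t)).
Qed.

Lemma growthM K c c' (t : K.-tuple R) : growth c t * growth c' t = growth (c + c') t.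
Proof. by rewrite /growth -expRD mulrDl. Qed.

Lemma growth_ge0 K c (t : K.-tuple R) : 0 <= growth c t.
Proof. exact: expR_ge0. Qed.

Lemma growth1 K c (t : K.-tuple R) : 0 <= c -> c <= growth c t.
Proof.
move=> c0; have := expR_ge1Dx (c * (1 + \sum_i `|tnth t i|)).
apply: le_trans; rewrite -[leLHS]add0r lerD// ler_peMr// growth_base_ge1//.
Qed.

Lemma measurable_growth K c : measurable_fun setT (@growth K c).
Proof.
apply: measurableT_comp => //; apply: measurable_funM => //; apply: measurable_funD => //.
apply: measurable_sum => i; apply: measurableT_comp => //; exact: measurable_tnth.
Qed.

Lemma integral_expR_lin K (v : 'rV[R]_K) :
  (\int[gauss K]_t (expR (lin v t))%:E = (expR (dotp v v / 2))%:E)%E.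
Proof.
have := @cameron_martin R K v (cst 1%E) (@measurable_cst _ _ _ _ _ _) (fun=> lee01).
rewrite /= integral_cst//= probability_setT mule1 => h.
have -> : (\int[gauss K]_t (expR (lin v t))%:E = \int[gauss K]_t
   ((expR (dotp v v / 2))%:E * (1 * (expR (lin v t - dotp v v / 2))%:E)))%E.
  by apply: eq_integral => t _; rewrite mul1e -EFinM -expRD addrC subrK.
rewrite ge0_integralZl// -?h ?mule1//.
- apply: emeasurable_funM => //; apply/measurable_EFinP; apply: measurableT_comp => //.
  by apply: measurable_funB => //; exact: measurable_lin.
Qed.

(** Each factor exp (c |x_i|) is at most exp (c x_i) + exp (- c x_i); expanding the product gives
    one linear exponential for every choice of signs. *)
Lemma growth_le_sum K c (t : K.-tuple R) : growth c t <= expR c *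
  \sum_(s : {ffun 'I_K -> bool}) expR (lin (\row_i (c * (-1) ^+ s i)) t).
Proof.
rewrite /growth mulrDr mulr1 expRD ler_pM2l ?expR_gt0//.
rewrite mulr_sumr expR_sum.
apply: (@le_trans _ _ (\prod_(i < K) \sum_(b : bool) expR (c * (-1) ^+ b * tnth t i))).
  apply: ler_prod => i _; rewrite expR_ge0/= big_bool/= expr0 expr1 mulr1 mulrN1.
  have [x0|x0] := leP 0 (tnth t i).
    by rewrite ger0_norm// lerDr expR_ge0.
  by rewrite ltr0_norm// mulrN mulNr lerDl expR_ge0.
rewrite bigA_distr_bigA/=; apply: ler_sum => s _.
rewrite -expR_sum ler_expR /lin; apply: ler_sum => i _.
by rewrite mxE.
Qed.

Lemma integrable_growth K c : (gauss K).-integrable setT (EFin \o @growth K c).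
Proof.
apply: (@le_integrable _ _ _ _ _ measurableT _ (EFin \o (fun t => expR c *
  \sum_(s : {ffun 'I_K -> bool}) expR (lin (\row_i (c * (-1) ^+ s i)) t)))).
- by apply/measurable_EFinP; exact: measurable_growth.
- move=> t _ /=; rewrite lee_fin (ger0_norm (growth_ge0 _ _)).
  by rewrite (le_trans (growth_le_sum c t))// ler_norm.
have -> : (EFin \o (fun t => expR c *
  \sum_(s : {ffun 'I_K -> bool}) expR (lin (\row_i (c * (-1) ^+ s i)) t))) =
  (fun t => (expR c)%:E * (\sum_(s <- index_enum {ffun 'I_K -> bool})
     (expR (lin (\row_i (c * (-1) ^+ s i)) t))%:E))%E.
  by apply/funext => t /=; rewrite EFinM -sumEFin.
apply: integrableZl => //; apply: integrable_sum => // s _.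
apply/integrableP; split.
  by apply/measurable_EFinP; apply: measurableT_comp => //; exact: measurable_lin.
under eq_integral do rewrite /= ger0_norm ?expR_ge0//.
by rewrite integral_expR_lin ltry.
Qed.

Lemma tame_integrable K (f : K.-tuple R -> R) : tame f ->
  (gauss K).-integrable setT (EFin \o f).
Proof.
move=> [mf [c c0 fc]]; apply: le_integrable (integrable_growth K c) => //.
  exact/measurable_EFinP.
by move=> t _ /=; rewrite lee_fin (ger0_norm (growth_ge0 c t)).
Qed.

Lemma tame_measurable K (f : K.-tuple R -> R) : tame f -> measurable_fun setT f.
Proof. by case. Qed.

Lemma tame_le K (f g : K.-tuple R -> R) : measurable_fun setT f -> tame g ->
  (forall t, `|f t| <= `|g t|) -> tame f.
Proof.
by move=> mf [_ [c c0 gc]] fg; split => //; exists c => // t; exact: le_trans (gc t).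
Qed.

Lemma tame_bounded K (f : K.-tuple R -> R) (M : R) : measurable_fun setT f ->
  (forall t, `|f t| <= M) -> tame f.
Proof.
move=> mf fM; split => //; exists `|M| => // t.
by rewrite (le_trans (fM t))// (le_trans (ler_norm _))// growth1.
Qed.

Lemma tame_cst K (a : R) : tame (fun _ : K.-tuple R => a).
Proof. by apply: (@tame_bounded _ _ `|a|) => //. Qed.

Lemma tame_growth K c : 0 <= c -> tame (@growth K c).
Proof.
move=> c0; split; first exact: measurable_growth.
by exists c => // t; rewrite ger0_norm ?growth_ge0.
Qed.

Lemma tameD K (f g : K.-tuple R -> R) : tame f -> tame g -> tame (fun t => f t + g t).
Proof.
move=> [mf [c c0 fc]] [mg [c' c'0 gc]]; split; first exact: measurable_funD.
exists (1 + (c + c')); first by rewrite !addr_ge0.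
move=> t; rewrite (le_trans (ler_normD _ _))// -growthM.
apply: (@le_trans _ _ (2 * growth (c + c') t)).
  rewrite mulr_natl mulr2n lerD// ?(le_trans (fc t))// ?(le_trans (gc t))//.
    by rewrite le_growth// lerDl.
  by rewrite le_growth// lerDr.
rewrite ler_wpM2r ?growth_ge0// (le_trans (expR_ge1Dx _))// ?expR1 //.
rewrite /growth ler_expR mul1r; exact: growth_base_ge1.
Qed.

Lemma tameM K (f g : K.-tuple R -> R) : tame f -> tame g -> tame (fun t => f t * g t).
Proof.
move=> [mf [c c0 fc]] [mg [c' c'0 gc]]; split; first exact: measurable_funM.
exists (c + c'); first by rewrite addr_ge0.
by move=> t; rewrite normrM -growthM ler_pM.
Qed.

Lemma tameN K (f : K.-tuple R -> R) : tame f -> tame (fun t => - f t).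
Proof.
move=> tf; apply: (tame_le _ tf) => [|t]; last by rewrite normrN.
by apply: measurableT_comp => //; exact: tame_measurable.
Qed.

Lemma tameB K (f g : K.-tuple R -> R) : tame f -> tame g -> tame (fun t => f t - g t).
Proof. by move=> tf tg; apply: tameD => //; exact: tameN. Qed.

Lemma tameZ K a (f : K.-tuple R -> R) : tame f -> tame (fun t => a * f t).
Proof. by move=> tf; apply: tameM => //; exact: tame_cst. Qed.

Lemma tameX K (f : K.-tuple R -> R) n : tame f -> tame (fun t => f t ^+ n).
Proof.
move=> tf; elim: n => [|n IH]; first by apply: tame_cst.
rewrite (_ : (fun _ => _) = (fun t => f t * f t ^+ n)); first exact: tameM.
by apply/funext => t; rewrite exprS.
Qed.

Lemma tame_norm K (f : K.-tuple R -> R) : tame f -> tame (fun t => `|f t|).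
Proof.
move=> tf; apply: (tame_le _ tf) => [|t]; last by rewrite normr_id.
by apply: measurableT_comp => //; exact: tame_measurable.
Qed.

Lemma tame_sum K (I : Type) (s : seq I) (P : pred I) (f : I -> K.-tuple R -> R) :
  (forall i, tame (f i)) -> tame (fun t => \sum_(i <- s | P i) f i t).
Proof.
move=> tf; elim: s => [|i s IH].
  rewrite (_ : (fun _ => _) = (fun=> 0)); first exact: tame_cst.
  by apply/funext => t; rewrite big_nil.
rewrite (_ : (fun _ => _) = (fun t => (if P i then f i t else 0) +
   \sum_(i <- s | P i) f i t)); last first.
  by apply/funext => t; rewrite big_cons; case: ifP => //; rewrite add0r.
by apply: tameD => //; case: (P i) => //; exact: tame_cst.
Qed.

Lemma tame_tnth K (i : 'I_K) : tame (fun t : K.-tuple R => tnth t i).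
Proof.
split; first exact: measurable_tnth.
exists 1 => // t; rewrite /growth mul1r (le_trans _ (expR_ge1Dx _))//.
have : 0 <= \sum_(j < K | j != i) `|tnth t j| by exact: sumr_ge0.
by move=> h; rewrite (bigD1 i)//=; lra.
Qed.

Lemma tame_lin K (v : 'rV[R]_K) : tame (lin v).
Proof. by apply: tame_sum => i; apply: tameZ; exact: tame_tnth. Qed.

Lemma le_lin_sum K (v : 'rV[R]_K) t : `|lin v t| <=
  (\sum_i `|v 0 i|) * (1 + \sum_i `|tnth t i|).
Proof.
rewrite (le_trans (ler_norm_sum _ _ _))// mulr_suml ler_sum// => i _.
rewrite normrM ler_wpM2l// (bigD1 i)//= addrA (addrC _ `|_|) -!addrA lerDl.
by rewrite !addr_ge0 // sumr_ge0.
Qed.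

Lemma tame_expR_lin K (v : 'rV[R]_K) : tame (fun t => expR (lin v t)).
Proof.
split; first by apply: measurableT_comp => //; exact: measurable_lin.
exists (\sum_i `|v 0 i|); first exact: sumr_ge0.
by move=> t; rewrite ger0_norm ?expR_ge0// ler_expR (le_trans (ler_norm _))// le_lin_sum.
Qed.

Lemma growth_shift K c (t : K.-tuple R) (v : 'rV[R]_K) : 0 <= c ->
  growth c (shiftt t v) <= growth (c * (1 + \sum_i `|v 0 i|)) t.
Proof.
move=> c0; rewrite ler_expR -mulrA ler_wpM2l//.
apply: (@le_trans _ _ (1 + \sum_i `|tnth t i| + \sum_i `|v 0 i|)).
  rewrite -addrA lerD2l -big_split/=; apply: ler_sum => i _.
  by rewrite tnth_mktuple ler_normD.
rewrite mulrDl mul1r lerD2l ler_peMr//; last exact: growth_base_ge1.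
exact: sumr_ge0.
Qed.

Lemma tame_shift K (f : K.-tuple R -> R) v : tame f -> tame (fun t => f (shiftt t v)).
Proof.
move=> [mf [c c0 fc]]; split.
  exact: (measurableT_comp mf (@measurable_shiftt _ _ v)).
exists (c * (1 + \sum_i `|v 0 i|)).
  by rewrite mulr_ge0// addr_ge0// sumr_ge0.
by move=> t; exact: le_trans (growth_shift _ _ _).
Qed.

Lemma gED K (f g : K.-tuple R -> R) : tame f -> tame g ->
  gE (fun t => f t + g t) = gE f + gE g.
Proof. by move=> tf tg; rewrite /gE RintegralD//; exact: tame_integrable. Qed.

Lemma gEB K (f g : K.-tuple R -> R) : tame f -> tame g ->
  gE (fun t => f t - g t) = gE f - gE g.
Proof. by move=> tf tg; rewrite /gE RintegralB//; exact: tame_integrable. Qed.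

Lemma gEZ K a (f : K.-tuple R -> R) : tame f -> gE (fun t => a * f t) = a * gE f.
Proof. by move=> tf; rewrite /gE RintegralZl//; exact: tame_integrable. Qed.

Lemma gE_cst K a : gE (fun _ : K.-tuple R => a) = a.
Proof. by rewrite /gE /Rintegral integral_cst//= probability_setT mule1. Qed.

Lemma gE_sum K (I : Type) (s : seq I) (P : pred I) (f : I -> K.-tuple R -> R) :
  (forall i, tame (f i)) ->
  gE (fun t => \sum_(i <- s | P i) f i t) = \sum_(i <- s | P i) gE (f i).
Proof.
move=> tf; elim: s => [|i s IH].
  rewrite big_nil -[RHS](gE_cst K); congr gE; apply/funext => t; exact: big_nil.
rewrite big_cons -IH.
rewrite (_ : (fun t => _) = (fun t => (if P i then f i t else 0) +
   \sum_(i <- s | P i) f i t)); last first.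
  by apply/funext => t; rewrite big_cons; case: ifP => //; rewrite add0r.
rewrite gED; [|by case: (P i) => //; exact: tame_cst|exact: tame_sum].
by case: (P i) => //; rewrite gE_cst add0r.
Qed.

Lemma gE_le K (f g : K.-tuple R -> R) : tame f -> tame g ->
  (forall t, f t <= g t) -> gE f <= gE g.
Proof. by move=> tf tg fg; apply: le_Rintegral => //; exact: tame_integrable. Qed.

Lemma gE_ge0 K (f : K.-tuple R -> R) : (forall t, 0 <= f t) -> 0 <= gE f.
Proof. by move=> f0; apply: Rintegral_ge0. Qed.

Lemma gE_norm K (f : K.-tuple R -> R) : tame f -> `|gE f| <= gE (fun t => `|f t|).
Proof. by move=> tf; apply: le_normr_Rintegral => //; exact: tame_integrable. Qed.

Lemma gE_EFin K (f : K.-tuple R -> R) : tame f ->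
  (\int[gauss K]_t (f t)%:E = (gE f)%:E)%E.
Proof.
move=> tf; rewrite /gE /Rintegral fineK//.
by apply: integrable_fin_num => //; exact: tame_integrable.
Qed.

(** The formula for nonnegative functions is applied to [f + growth c], which is nonnegative, and to
    [growth c]; the difference is the signed case. *)
Lemma gE_CM K (v : 'rV[R]_K) (f : K.-tuple R -> R) : tame f ->
  gE (fun t => f (shiftt t v)) = gE (fun t => f t * expR (lin v t - dotp v v / 2)).
Proof.
move=> tf; have te : tame (fun t => expR (lin v t - dotp v v / 2)).
  rewrite (_ : (fun _ => _) = (fun t => expR (- (dotp v v / 2)) * expR (lin v t))).
    by apply: tameZ; exact: tame_expR_lin.
  by apply/funext => t; rewrite -expRD addrC.
have nn (g : K.-tuple R -> R) : tame g -> (forall t, 0 <= g t) ->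
    gE (fun t => g (shiftt t v)) = gE (fun t => g t * expR (lin v t - dotp v v / 2)).
  move=> tg g0; apply: EFin_inj; rewrite -!gE_EFin; [|exact: tameM|exact: tame_shift].
  rewrite (@cameron_martin _ _ v (EFin \o g))//.
  by apply/measurable_EFinP; exact: tame_measurable.
have [mf [c c0 fc]] := tf; have tG := @tame_growth K _ c0.
have h1 := nn _ (tameD tf tG) (fun t => _).
have {h1}h1 : gE (fun t => f (shiftt t v) + growth c (shiftt t v)) =
    gE (fun t => (f t + growth c t) * expR (lin v t - dotp v v / 2)).
  by apply: h1 => t; have := fc t; rewrite ler_norml => /andP[h _]; lra.
move: h1; rewrite gED; [|exact: tame_shift|exact: (tame_shift _ tG)].
rewrite (nn _ tG (fun=> growth_ge0 _ _)).
rewrite (_ : (fun t => (f t + _) * expR _) = (fun t => f t * expR (lin v t - dotp v v / 2) +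
   growth c t * expR (lin v t - dotp v v / 2))); last first.
  by apply/funext => t; rewrite mulrDl.
by rewrite gED; [move/addIr|exact: tameM|exact: tameM].
Qed.

Lemma gE_derive K (F F' : R -> K.-tuple R -> R) (a b c x : R) :
  0 <= c -> a < x < b ->
  (forall s, a < s < b -> tame (F s)) ->
  (forall s t, a < s < b -> is_derive s 1 (F ^~ t) (F' s t)) ->
  (forall s t, a < s < b -> `|F' s t| <= growth c t) ->
  is_derive x 1 (fun s => gE (F s)) (gE (F' x)).
Proof.
move=> c0 axb tF dF bF'.
have Ix : `]a, b[%classic x by rewrite /= in_itv.
have h1 s : `]a, b[%classic s -> (gauss K).-integrable setT (EFin \o F s).
  by rewrite /= in_itv/= => /tF/tame_integrable.
have h2 s t : `]a, b[%classic s -> setT t -> derivable (F ^~ t) s 1.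
  by rewrite /= in_itv/= => /(dF s t)[].
have h3 s t : `]a, b[%classic s -> setT t -> `|partial1of2 F s t| <= growth c t.
  rewrite /= in_itv/= => sab _; rewrite partial1of2E.
  by have [_ ->] := dF s t sab; exact: bF'.
have E : gE (F' x) = \int[gauss K]_t partial1of2 F x t.
  by apply: eq_Rintegral => t _; rewrite partial1of2E; have [_ ->] := dF x t axb.
split.
  exact: (@derivable_under_integral _ _ _ _ F _ measurableT x a b Ix h1 h2 _
     (growth_ge0 c) (integrable_growth K c) h3).
rewrite -derive1E E.
exact: (@differentiation_under_integral _ _ _ _ F _ measurableT x a b Ix h1 h2 _
     (growth_ge0 c) (integrable_growth K c) h3).
Qed.

Lemma shiftt_add K (t : K.-tuple R) u v : shiftt (shiftt t u) v = shiftt t (u + v).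
Proof. by apply/eq_from_tnth => i; rewrite !tnth_mktuple mxE addrA. Qed.

Lemma shiftt0 K (t : K.-tuple R) : shiftt t 0 = t.
Proof. by apply/eq_from_tnth => i; rewrite tnth_mktuple mxE addr0. Qed.

Lemma linZ K s (v : 'rV[R]_K) t : lin (s *: v) t = s * lin v t.
Proof. by rewrite /lin mulr_sumr; apply: eq_bigr => i _; rewrite mxE mulrA. Qed.

Lemma dotpZ K s (v : 'rV[R]_K) : dotp (s *: v) (s *: v) = s ^+ 2 * dotp v v.
Proof. by rewrite /dotp mulr_sumr; apply: eq_bigr => i _; rewrite !mxE; ring. Qed.

(** The Cameron-Martin formula for the translation by [s *: v] is differentiated at [s = 0]: on one
    side the derivative falls on [f], on the other on the density, where it produces [lin v t]. *)
Lemma gE_ibp K (v : 'rV[R]_K) (f f' : K.-tuple R -> R) : tame f -> tame f' ->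
  (forall t, is_derive (0 : R) 1 (fun s : R => f (shiftt t (s *: v))) (f' t)) ->
  gE (fun t => lin v t * f t) = gE f'.
Proof.
move=> tf tf' df.
have I0 : -1 < (0 : R) < 1 by apply/andP; split; lra.
have [_ [c c0 f'c]] := tf'.
have [_ [c1 c10 fc]] := tf.
set V := \sum_i `|v 0 i|.
have V0 : 0 <= V by exact: sumr_ge0.
have d1 : is_derive (0 : R) 1 (fun s => gE (fun t => f (shiftt t (s *: v))))
    (gE (fun t => f' (shiftt t (0 *: v)))).
  apply: (@gE_derive _ (fun s t => f (shiftt t (s *: v)))
    (fun s t => f' (shiftt t (s *: v))) (-1) 1 (c * (1 + V))) => //.
  - by rewrite mulr_ge0// addr_ge0.
  - by move=> s _; exact: tame_shift.
  - move=> s t _.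
    have := df (shiftt t (s *: v)) => h.
    have -> : (fun s0 => f (shiftt t (s0 *: v))) =
       (fun s0 => f (shiftt (shiftt t (s *: v)) (s0 *: v))) \o (fun x => x - s).
      by apply/funext => y /=; rewrite shiftt_add -scalerDl addrC subrK.
    have e : s - s = 0 by rewrite subrr.
    rewrite -e in h.
    have := @is_derive1_comp _ _ (fun x => x - s) s _ _ h.
    by move=> /(_ 1 _); rewrite mulr1; apply; apply: is_derive_eq; rewrite subr0.
  - move=> s t /andP[s1 s2]; rewrite (le_trans (f'c _))// (le_trans (growth_shift _ _ c0))//.
    apply: le_growth; rewrite ler_wpM2l// lerD2l; apply: ler_sum => i _.
    by rewrite mxE normrM ler_piMl// ler_norml !ltW.
set N := dotp v v / 2.
have N0 : 0 <= N by rewrite divr_ge0// sumr_ge0// => i _; rewrite -expr2 sqr_ge0.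
have NE2 : dotp v v / 2 = N by [].
clearbody N.
have bnd (s : R) t : `|s| <= 1 ->
    `|f t * ((lin v t - 2 * s * N) * expR (s * lin v t - s ^+ 2 * N))| <=
    growth (c1 + ((V + 2 * N) + (V + N))) t.
  move=> s3.
  have B1 := growth_base_ge1 t; have B0 := le_trans ler01 B1.
  rewrite normrM -growthM ler_pM// normrM -growthM ler_pM//.
    rewrite (le_trans _ (expR_ge1Dx _))//.
    have hl := le_lin_sum v t; rewrite -/V in hl.
    have hs : `|2 * s * N| <= 2 * N * (1 + \sum_i `|tnth t i|).
      rewrite !normrM (ger0_norm N0) (ger0_norm (ler0n _ 2)).
      rewrite -mulrA -[leRHS]mulrA ler_wpM2l// mulrC ler_pM//.
      exact: le_trans B1.
    have hn : `|lin v t - 2 * s * N| <=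
      V * (1 + \sum_i `|tnth t i|) + 2 * N * (1 + \sum_i `|tnth t i|).
      by apply: (le_trans (ler_normB _ _)); apply: lerD.
    by rewrite [X in _ <= 1 + X]mulrDl; apply: (le_trans hn); rewrite lerDr.
  rewrite ger0_norm ?expR_ge0// ler_expR (le_trans (ler_norm _))//.
  rewrite (le_trans (ler_normB _ _))// mulrDl lerD// normrM.
    by rewrite (le_trans _ (le_lin_sum v t))// ler_piMl.
  rewrite (ger0_norm N0) normrX (le_trans _ (ler_peMr N0 B1))//.
  by rewrite ler_piMl// exprn_ile1.
have d2 : is_derive (0 : R) 1 (fun s => gE (fun t => f t * expR (s * lin v t - s ^+ 2 * N)))
    (gE (fun t => f t * ((lin v t - 2 * 0 * N) * expR (0 * lin v t - 0 ^+ 2 * N)))).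
  apply: (@gE_derive _ (fun s t => f t * expR (s * lin v t - s ^+ 2 * N))
    (fun s t => f t * ((lin v t - 2 * s * N) * expR (s * lin v t - s ^+ 2 * N))) (-1) 1
    (c1 + ((V + 2 * N) + (V + N)))) => //.
  - by rewrite !addr_ge0 // mulr_ge0.
  - move=> s _; apply: tameM => //.
    rewrite (_ : (fun _ => _) = (fun t => expR (- (s ^+ 2 * N)) * expR (lin (s *: v) t))).
      by apply: tameZ; exact: tame_expR_lin.
    by apply/funext => t; rewrite -expRD addrC linZ.
  - move=> s t _; apply: is_derive_eq.
    by rewrite /GRing.scale/=; ring.
  - by move=> s t /andP[s1 s2]; apply: bnd; rewrite ler_norml !ltW.
have E : (fun s => gE (fun t => f (shiftt t (s *: v)))) =
         (fun s => gE (fun t => f t * expR (s * lin v t - s ^+ 2 * N))).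
  apply/funext => s; rewrite gE_CM//; congr gE; apply/funext => t.
  by rewrite linZ dotpZ -mulrA NE2.
have := d1; rewrite E => d1'.
have [_ e1] := d1'; have [_ e2] := d2.
have -> : (fun t => lin v t * f t) =
  (fun t => f t * ((lin v t - 2 * 0 * N) * expR (0 * lin v t - 0 ^+ 2 * N))).
  apply/funext => t; rewrite mulr0 !mul0r expr0n/= mul0r !subr0 expR0 mulr1.
  by rewrite mulrC.
rewrite -e2 e1; congr gE; apply/funext => t; by rewrite scale0r shiftt0.
Qed.

End tame.

(** * Uniqueness of characteristic functions *)

Section bounded_functions.
Context d (T : measurableType d) (R : realType) (P : probability T R).

Definition bmeas (f : T -> R) := measurable_fun setT f /\ exists M, forall x, `|f x| <= M.

Lemma bmeas_integrable f : bmeas f -> P.-integrable setT (EFin \o f).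
Proof.
move=> [mf [M fM]].
apply: (@le_integrable _ _ _ P _ measurableT _ (EFin \o cst `|M|)).
- exact/measurable_EFinP.
- by move=> x _ /=; rewrite lee_fin normr_id (le_trans (fM x))// ler_norm.
- exact: finite_measure_integrable_cst.
Qed.

Lemma bmeasD f g : bmeas f -> bmeas g -> bmeas (fun x => f x + g x).
Proof.
move=> [mf [M fM]] [mg [N gN]]; split; first exact: measurable_funD.
by exists (M + N) => x; rewrite (le_trans (ler_normD _ _))// lerD.
Qed.

Lemma bmeasM f g : bmeas f -> bmeas g -> bmeas (fun x => f x * g x).
Proof.
move=> [mf [M fM]] [mg [N gN]]; split; first exact: measurable_funM.
by exists (M * N) => x; rewrite normrM ler_pM.
Qed.

Lemma bmeas_cst a : bmeas (fun=> a).
Proof. by split => //; exists `|a|. Qed.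

Lemma bmeas_cvg (f_ : nat -> T -> R) (f : T -> R) (M : R) :
  (forall n, measurable_fun setT (f_ n)) -> (forall n x, `|f_ n x| <= M) ->
  (forall x, f_ ^~ x @ \oo --> f x) ->
  bmeas f /\ (fun n => \int[P]_x f_ n x) @ \oo --> \int[P]_x f x.
Proof.
move=> mf fM ff.
have mlim : measurable_fun setT f.
  apply: (@measurable_fun_cvg _ _ _ _ f_) => //.
have bf : bmeas f.
  split => //; exists M => x.
  have h : (fun n => `|f_ n x|) @ \oo --> `|f x| by apply: cvg_norm; exact: ff.
  rewrite -(cvg_lim _ h)//; apply: limr_le; first by apply/cvg_ex; eexists; exact: h.
  by apply: nearW => n; exact: fM.
split => //.
have h := @dominated_cvg _ _ _ P setT measurableT (fun n => EFin \o f_ n) (EFin \o f)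
   (EFin \o cst M).
have fin g : bmeas g -> (\int[P]_x (g x)%:E \is a fin_num)%E.
  by move=> bg; apply: integrable_fin_num => //; exact: bmeas_integrable.
have {h} : (\int[P]_x (f_ n x)%:E @[n --> \oo] --> \int[P]_x (f x)%:E)%E.
  apply: h => //.
  - by move=> n; exact/measurable_EFinP.
  - by move=> x _; apply: cvg_EFin; [exact: nearW|exact: ff].
  - exact: finite_measure_integrable_cst.
  - by move=> n x _ /=; rewrite lee_fin.
move=> h; rewrite /Rintegral; apply: fine_cvg; rewrite fineK; first exact: h.
exact: fin bf.
Qed.

End bounded_functions.

Section charfun_gauss.
Context {R : realType} (K : nat).
Implicit Types a : 'rV[R]_K.

Lemma linD (u v : 'rV[R]_K) t : lin (u + v) t = lin u t + lin v t.
Proof. by rewrite /lin -big_split; apply: eq_bigr => i _; rewrite mxE mulrDl. Qed.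

Lemma lin_shift (u v : 'rV[R]_K) t : lin u (shiftt t v) = lin u t + dotp u v.
Proof.
rewrite /lin /dotp -big_split; apply: eq_bigr => i _.
by rewrite tnth_mktuple mulrDr.
Qed.

Lemma lin_shiftZ (u v : 'rV[R]_K) s t :
  lin u (shiftt t (s *: v)) = lin u t + s * dotp u v.
Proof.
rewrite lin_shift; congr +%R; rewrite /dotp mulr_sumr.
by apply: eq_bigr => i _; rewrite mxE; ring.
Qed.

Lemma tame_cos_lin a s : tame (fun t => cos (s * lin a t)).
Proof.
apply: (@tame_bounded _ _ _ 1) => [|t]; last exact: cos_max.
apply: measurableT_comp; first exact: measurable_cosR.
by apply: measurable_funM => //; exact: measurable_lin.
Qed.

Lemma tame_sin_lin a s : tame (fun t => sin (s * lin a t)).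
Proof.
apply: (@tame_bounded _ _ _ 1) => [|t]; last exact: sin_max.
apply: measurableT_comp; first exact: measurable_sinR.
by apply: measurable_funM => //; exact: measurable_lin.
Qed.

Lemma ode_gauss (c : R -> R) (N : R) :
  (forall s : R, is_derive s 1 c (- (s * N) * c s)) -> c 1 = c 0 * expR (- (N / 2)).
Proof.
move=> h; pose phi s := c s * expR (s ^+ 2 * (N / 2)).
have h2 (s : R) : is_derive s 1 phi 0.
  have := h s => hs; apply: is_derive_eq.
  by rewrite /GRing.scale/=; field.
have := @is_derive_0_is_cst R phi 1 0 h2; rewrite /phi expr1n mul1r expr0n mul0r expR0 mulr1.
by move=> <-; rewrite -mulrA -expRD subrr expR0 mulr1.
Qed.

Lemma gE_lin_growth a (c : R) (f : R -> R -> R) : (forall s x, `|f s x| <= 1) ->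
  forall s t, `|lin a t * f s (lin a t)| <= growth (\sum_i `|a 0 i|) t.
Proof.
move=> f1 s t; rewrite normrM; apply: (@le_trans _ _ `|lin a t|).
  by rewrite ler_piMr.
rewrite (le_trans (le_lin_sum a t))//; apply: (le_trans _ (expR_ge1Dx _)).
by rewrite lerDr.
Qed.

(** Integration by parts shows that both means, as functions of a scale [s], satisfy c'(s) = - s
    |a|^2 c(s); [ode_gauss] solves this from the values 1 and 0 at [s = 0]. Keeping cosine and sine
    apart avoids complex numbers. *)
Lemma gE_trig a : gE (fun t => cos (lin a t)) = expR (- (dotp a a / 2)) /\
  gE (fun t => sin (lin a t)) = 0.
Proof.
have S0 : 0 <= \sum_i `|a 0 i| by exact: sumr_ge0.
have I01 (s : R) : s - 1 < s < s + 1 by apply/andP; split; lra.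
have dc (s : R) : is_derive s 1 (fun s => gE (fun t => cos (s * lin a t)))
    (- (s * dotp a a) * gE (fun t => cos (s * lin a t))).
  have -> : - (s * dotp a a) * gE (fun t => cos (s * lin a t)) =
     gE (fun t => - (lin a t * sin (s * lin a t))).
    rewrite -(@gEZ _ _ (-(s * dotp a a)))//; last exact: tame_cos_lin.
    transitivity (gE (fun t => lin a t * - sin (s * lin a t))); last first.
      by congr gE; apply/funext => t; rewrite mulrN.
    apply/esym/gE_ibp.
    - by apply: tameN; exact: tame_sin_lin.
    - by apply: tameZ; exact: tame_cos_lin.
    - move=> t; under eq_fun do rewrite lin_shiftZ.
      apply: is_derive_eq; rewrite mul0r addr0 /GRing.scale/=; ring.
  apply: (@gE_derive _ _ (fun s t => cos (s * lin a t))
    (fun s t => - (lin a t * sin (s * lin a t))) (s - 1) (s + 1) (\sum_i `|a 0 i|)) => //.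
  - by move=> x _; exact: tame_cos_lin.
  - move=> x t _; apply: is_derive_eq; rewrite /GRing.scale/=; ring.
  - move=> x t _; rewrite normrN.
    by apply: (@gE_lin_growth a 0 (fun s x => sin (s * x))) => ? ?; exact: sin_max.
have ds (s : R) : is_derive s 1 (fun s => gE (fun t => sin (s * lin a t)))
    (- (s * dotp a a) * gE (fun t => sin (s * lin a t))).
  have -> : - (s * dotp a a) * gE (fun t => sin (s * lin a t)) =
     gE (fun t => lin a t * cos (s * lin a t)).
    rewrite -(@gEZ _ _ (-(s * dotp a a)))//; last exact: tame_sin_lin.
    apply/esym/gE_ibp.
    - exact: tame_cos_lin.
    - by apply: tameZ; exact: tame_sin_lin.
    - move=> t; under eq_fun do rewrite lin_shiftZ.
      apply: is_derive_eq; rewrite mul0r addr0 /GRing.scale/=; ring.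
  apply: (@gE_derive _ _ (fun s t => sin (s * lin a t))
    (fun s t => lin a t * cos (s * lin a t)) (s - 1) (s + 1) (\sum_i `|a 0 i|)) => //.
  - by move=> x _; exact: tame_sin_lin.
  - move=> x t _; apply: is_derive_eq; rewrite /GRing.scale/=; ring.
  - move=> x t _.
    by apply: (@gE_lin_growth a 0 (fun s x => cos (s * x))) => ? ?; exact: cos_max.
have E1 (f : R -> R) : gE (fun t => f (lin a t)) = gE (fun t => f (1 * lin a t)).
  by congr gE; apply/funext => t; rewrite mul1r.
have E0 (f : R -> R) : gE (fun t => f (0 * lin a t)) = f 0.
  by rewrite -[RHS](gE_cst K); congr gE; apply/funext => t; rewrite mul0r.
split.
  by rewrite E1 (ode_gauss dc) E0 cos0 mul1r.
by rewrite E1 (ode_gauss ds) E0 sin0 mul0r.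
Qed.

End charfun_gauss.

Section uniqueness.
Context {R : realType} (k : nat).
Variables P Q : probability (k.-tuple R) R.
Hypothesis PQcos : forall a : 'rV[R]_k,
  \int[P]_t cos (lin a t) = \int[Q]_t cos (lin a t).
Hypothesis PQsin : forall a : 'rV[R]_k,
  \int[P]_t sin (lin a t) = \int[Q]_t sin (lin a t).

Inductive trigpoly : (k.-tuple R -> R) -> Prop :=
| trig_cos a : trigpoly (fun t => cos (lin a t))
| trig_sin a : trigpoly (fun t => sin (lin a t))
| trig_add f g : trigpoly f -> trigpoly g -> trigpoly (fun t => f t + g t)
| trig_scale c f : trigpoly f -> trigpoly (fun t => c * f t).

Lemma bmeas_cos (a : 'rV[R]_k) : bmeas (fun t => cos (lin a t)).
Proof.
split; last by exists 1 => t; exact: cos_max.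
apply: measurableT_comp; first exact: measurable_cosR.
exact: measurable_lin.
Qed.

Lemma bmeas_sin (a : 'rV[R]_k) : bmeas (fun t => sin (lin a t)).
Proof.
split; last by exists 1 => t; exact: sin_max.
apply: measurableT_comp; first exact: measurable_sinR.
exact: measurable_lin.
Qed.

Lemma bmeas_trig f : trigpoly f -> bmeas f.
Proof.
elim => [a|a|g h _ bg _ bh|c g _ bg].
- exact: bmeas_cos.
- exact: bmeas_sin.
- exact: bmeasD.
- by apply: bmeasM => //; exact: bmeas_cst.
Qed.

Lemma linB (u v : 'rV[R]_k) t : lin (u - v) t = lin u t - lin v t.
Proof. by rewrite linD -scaleN1r linZ mulN1r. Qed.

(** Product-to-sum formulas. This closure property lets a [good_fun] weight be multiplied by a
    sine. *)
Lemma trig_mulsin f (b : 'rV[R]_k) : trigpoly f -> trigpoly (fun t => f t * sin (lin b t)).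
Proof.
elim => [a|a|g h _ bg _ bh|c g _ bg].
- rewrite (_ : (fun _ => _) = (fun t => 2^-1 * (sin (lin (a + b) t) +
     (-1) * sin (lin (a - b) t)))).
    by do ?constructor.
  by apply/funext => t; rewrite linB linD sinD sinB; field.
- rewrite (_ : (fun _ => _) = (fun t => 2^-1 * (cos (lin (a - b) t) +
     (-1) * cos (lin (a + b) t)))).
    by do ?constructor.
  by apply/funext => t; rewrite linB linD cosB cosD; field.
- rewrite (_ : (fun _ => _) = (fun t => g t * sin (lin b t) + h t * sin (lin b t))).
    by constructor.
  by apply/funext => t; rewrite mulrDl.
- rewrite (_ : (fun _ => _) = (fun t => c * (g t * sin (lin b t)))).
    by constructor.
  by apply/funext => t; rewrite mulrA.
Qed.

(* Weights against which P and Q cannot be distinguished by trigonometric polynomials. Polynomials in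
   sin (x / A) are such weights, and iterating 3x^2 - 2x^3 on them produces the indicators of boxes. *)
Definition good_fun (chi : k.-tuple R -> R) := bmeas chi /\
  forall f, trigpoly f -> \int[P]_t (chi t * f t) = \int[Q]_t (chi t * f t).

Lemma good_fun1 : good_fun (fun=> 1).
Proof.
split; first exact: bmeas_cst.
move=> f tf.
have -> : (fun t => 1 * f t) = f by apply/funext => t; rewrite mul1r.
elim: tf => [//|//|g h tg eg th eh|c g tg eg].
  rewrite !RintegralD//; [by rewrite eg eh|..]; apply: bmeas_integrable; exact: bmeas_trig.
rewrite !RintegralZl//; [by rewrite eg|..]; apply: bmeas_integrable; exact: bmeas_trig.
Qed.

Lemma goodD f g : good_fun f -> good_fun g -> good_fun (fun t => f t + g t).
Proof.
move=> [bf ef] [bg eg]; split; first exact: bmeasD.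
move=> h th; have bh := bmeas_trig th.
have E : (fun t => (f t + g t) * h t) = (fun t => f t * h t + g t * h t).
  by apply/funext => t; rewrite mulrDl.
rewrite E !RintegralD ?ef ?eg//; apply: bmeas_integrable; exact: bmeasM.
Qed.

Lemma goodZ c f : good_fun f -> good_fun (fun t => f t * c).
Proof.
move=> [bf ef]; split; first by apply: bmeasM => //; exact: bmeas_cst.
move=> h th; have bh := bmeas_trig th.
have E : (fun t => f t * c * h t) = (fun t => c * (f t * h t)).
  by apply/funext => t; ring.
rewrite E !RintegralZl ?ef//; apply: bmeas_integrable; exact: bmeasM.
Qed.

Lemma good_lim (f_ : nat -> k.-tuple R -> R) f M :
  (forall n, good_fun (f_ n)) -> (forall n x, `|f_ n x| <= M) ->
  (forall x, f_ ^~ x @ \oo --> f x) -> good_fun f.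
Proof.
move=> gf fM ff.
have mf n : measurable_fun setT (f_ n) by have [[]] := gf n.
have [bf _] := bmeas_cvg P mf fM ff.
split => // h th; have [mh [N hN]] := bmeas_trig th.
have m2 n : measurable_fun setT (fun t => f_ n t * h t) by exact: measurable_funM.
have b2 n x : `|f_ n x * h x| <= M * N by rewrite normrM ler_pM.
have c2 x : (fun n => f_ n x * h x) @ \oo --> f x * h x.
  by apply: cvgMr_tmp; exact: ff.
have [_ cP] := bmeas_cvg P m2 b2 c2.
have [_ cQ] := bmeas_cvg Q m2 b2 c2.
rewrite -(cvg_lim _ cP)// -(cvg_lim _ cQ)//; congr (limn _); apply/funext => n.
by have [_ ->] := gf n.
Qed.

(** The bound 1 makes the class stable under pointwise limits, by dominated convergence. *)
Definition goodmul (j : 'I_k) (h : R -> R) := (forall x, `|h x| <= 1) /\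
  forall chi, good_fun chi -> good_fun (fun t => chi t * h (tnth t j)).

Lemma lin_delta (j : 'I_k) (s : R) t : lin (s *: delta_mx 0 j) t = s * tnth t j.
Proof.
rewrite linZ /lin (bigD1 j)//= !mxE !eqxx mul1r big1 ?addr0// => i ij.
by rewrite mxE eqxx (negbTE ij) mul0r.
Qed.

Definition smoothstep (m : nat) (x : R) := iter m (fun y : R => 3 * y ^+ 2 - 2 * y ^+ 3) x.

Lemma smoothstep_itv m x : 0 <= x <= 1 -> 0 <= smoothstep m x <= 1.
Proof.
move=> x01; elim: m => //= m; rewrite /smoothstep/=; set y := iter _ _ _.
move: y => y /andP[y0 y1].
have -> : 3 * y ^+ 2 - 2 * y ^+ 3 = y ^+ 2 * (3 - 2 * y) by ring.
apply/andP; split; first by rewrite mulr_ge0 ?sqr_ge0//; lra.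
rewrite -subr_ge0.
have -> : 1 - y ^+ 2 * (3 - 2 * y) = (1 - y) ^+ 2 * (1 + 2 * y) by ring.
by rewrite mulr_ge0 ?sqr_ge0//; lra.
Qed.

(** The starting value lies in [0, 1] because |sin - c| <= 2, and each further step is a cubic
    polynomial in the previous function, so multiplying by that function two and three times
    suffices. *)
Lemma goodmul_smoothstep j (A c : R) (m : nat) : `|c| <= 1 ->
  goodmul j (fun x => smoothstep m (2^-1 + (sin (A * x) - c) * 4^-1)).
Proof.
move=> c1; split => [x|].
  have := @smoothstep_itv m (2^-1 + (sin (A * x) - c) * 4^-1).
  have := sin_max (A * x); move: c1; rewrite !ler_norml /= => /andP[? ?] /andP[? ?].
  by move=> /(_ _)/andP[]; [apply/andP; split; lra|move=> h1 h2; apply/andP; split; lra].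
elim: m => [|m IH2] chi gchi.
  rewrite (_ : (fun _ => _) = (fun t => chi t * (2^-1 - c / 4) +
    chi t * sin (lin (A *: delta_mx 0 j) t) * 4^-1)); last first.
    by apply/funext => t; rewrite lin_delta/=; ring.
  apply: goodD; first exact: goodZ.
  apply: goodZ; case: gchi => bchi echi; split.
    by apply: bmeasM => //; exact: bmeas_sin.
  move=> f tf; have := echi _ (trig_mulsin (A *: delta_mx 0 j) tf).
  have -> // : (fun t => chi t * sin (lin (A *: delta_mx 0 j) t) * f t) =
    (fun t => chi t * (f t * sin (lin (A *: delta_mx 0 j) t))).
  by apply/funext => t; ring.
set h := fun x => smoothstep m (2^-1 + (sin (A * x) - c) * 4^-1).
rewrite (_ : (fun _ => _) = (fun t => chi t * h (tnth t j) * h (tnth t j) * 3 +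
  chi t * h (tnth t j) * h (tnth t j) * h (tnth t j) * (-2))); last first.
  by apply/funext => t; rewrite /smoothstep/= -/(smoothstep m _) -/(h _); ring.
have g1 := IH2 _ gchi; have g2 := IH2 _ g1; have g3 := IH2 _ g2.
by apply: goodD; exact: goodZ.
Qed.

Lemma goodmul_lim j (h_ : nat -> R -> R) h :
  (forall n, goodmul j (h_ n)) -> (forall x, h_ ^~ x @ \oo --> h x) -> goodmul j h.
Proof.
move=> gh hh; split => [x|chi gchi].
  have hc : (fun n => `|h_ n x|) @ \oo --> `|h x| by apply: cvg_norm; exact: hh.
  rewrite -(cvg_lim _ hc)//; apply: limr_le; first by apply/cvg_ex; eexists; exact: hc.
  by apply: nearW => n; have [] := gh n.
have [[_ [M chiM]] _] := gchi.
apply: (@good_lim (fun n t => chi t * h_ n (tnth t j)) _ M).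
- by move=> n; have [_] := gh n; apply.
- move=> n t; rewrite normrM (le_trans _ (chiM t))// ler_piMr//.
  by have [] := gh n.
- by move=> t; apply: cvgMl_tmp; exact: hh.
Qed.

(** The value at 0 is forced: 1/2 is a fixed point of the iteration and separates the basins of 0
    and 1. *)
Definition heavi (x : R) : R := if x < 0 then 0 else if x == 0 then 2^-1 else 1.

(** One step multiplies [y] by [3 * y - 2 * y ^+ 2], which is increasing and smaller than 1 below
    1/2; the decay is therefore geometric with the ratio [r] of the first step. *)
Lemma smoothstep_cvg0 (x : R) : 0 <= x < 2^-1 -> smoothstep^~ x @ \oo --> 0.
Proof.
move=> /andP[x0 x2]; set r := 3 * x - 2 * x ^+ 2.
have r0 : 0 <= r by rewrite /r; nra.
have r1 : r < 1 by rewrite /r; nra.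
have H m : 0 <= smoothstep m x <= r ^+ m * x.
  elim: m => [|m]; first by rewrite /smoothstep/= expr0 mul1r x0 lexx.
  rewrite /smoothstep/=; set y := iter _ _ _ => /andP[y0 yr].
  have yx : y <= x by rewrite (le_trans yr)// ler_piMl// exprn_ile1// ltW.
  have ry : 3 * y - 2 * y ^+ 2 <= r by rewrite /r; nra.
  have ry0 : 0 <= 3 * y - 2 * y ^+ 2 by nra.
  have -> : 3 * y ^+ 2 - 2 * y ^+ 3 = (3 * y - 2 * y ^+ 2) * y by ring.
  apply/andP; split; first exact: mulr_ge0.
  by rewrite [r ^+ _]exprS -(mulrA r) ler_pM.
apply: (@squeeze_cvgr _ _ _ _ (fun=> 0) (fun m => r ^+ m * x)).
- by apply: nearW => m; exact: H.
- exact: cvg_cst.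
- rewrite -[X in _ --> X](mul0r x); apply: cvgMr_tmp.
  by apply: cvg_expr; rewrite ger0_norm.
Qed.

Lemma smoothstepC m x : smoothstep m (1 - x) = 1 - smoothstep m x.
Proof.
by elim: m => //= m; rewrite /smoothstep/= => ->; ring.
Qed.

Lemma smoothstep_cvg (x : R) : 0 <= 2^-1 + x <= 1 ->
  (fun m => smoothstep m (2^-1 + x)) @ \oo --> heavi x.
Proof.
move=> /andP[h1 h2]; rewrite /heavi; case: ltrP => [x0|x0].
  by apply: smoothstep_cvg0; apply/andP; split; lra.
case: eqP => [->|/eqP xn0].
  rewrite (_ : (fun _ => _) = (fun=> 2^-1)); first exact: cvg_cst.
  apply/funext => m; rewrite addr0; elim: m => //= m; rewrite /smoothstep/= => ->.
  by field.
have {}x0 : 0 < x by rewrite lt_neqAle eq_sym xn0.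
rewrite (_ : (fun _ => _) = (fun m => 1 - smoothstep m (1 - (2^-1 + x)))); last first.
  by apply/funext => m; rewrite smoothstepC; ring.
rewrite -[X in _ --> X]subr0; apply: cvgB; first exact: cvg_cst.
by apply: smoothstep_cvg0; apply/andP; split; lra.
Qed.

Lemma sin_lt_halfpi (x y : R) : - (pi / 2) < y -> y < x -> x < pi / 2 -> sin y < sin x.
Proof.
move=> hy yx hx; rewrite -subr_gt0.
have -> : x = (x + y) / 2 + (x - y) / 2 by field.
have E : y = (x + y) / 2 - (x - y) / 2 by field.
rewrite {3}E sinD sinB.
have -> : forall a b : R, a + b - (a - b) = 2 * b by move=> a b; ring.
rewrite !mulr_gt0//.
  by apply: cos_gt0_pihalf; apply/andP; split; lra.
by apply: sin_gt0_pihalf; apply/andP; split; lra.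
Qed.

Lemma heavi_sin (x c : R) : `|x| < pi / 2 -> `|c| < pi / 2 ->
  heavi (sin x - sin c) = heavi (x - c).
Proof.
rewrite !ltr_norml => /andP[x1 x2] /andP[c1 c2]; rewrite /heavi.
case: (ltgtP x c) => [xc|cx|->]; last by rewrite !subrr.
- by rewrite !subr_lt0 xc sin_lt_halfpi.
- have := sin_lt_halfpi c1 cx x2 => h.
  by rewrite !subr_lt0 !subr_eq0 (lt_gtF cx) (lt_gtF h) (gt_eqF cx) (gt_eqF h).
Qed.

Lemma near_small (x e : R) : 0 < e -> \forall n \near \oo, `|n.+1%:R^-1 * x| < e.
Proof.
move=> e0.
have h : (fun n : nat => n.+1%:R^-1 * x) @ \oo --> (0 : R).
  rewrite -[X in _ --> X](mul0r x); apply: cvgMr_tmp; exact: cvg_harmonic.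
by move/cvgr0_norm_lt: h => /(_ _ e0).
Qed.

Lemma goodmul_heavi_sin j (A c : R) : `|c| <= 1 ->
  goodmul j (fun x => heavi (sin (A * x) - c)).
Proof.
move=> c1.
apply: (@goodmul_lim j (fun m x => smoothstep m (2^-1 + (sin (A * x) - c) * 4^-1))).
  by move=> m; exact: goodmul_smoothstep.
move=> x.
have -> : heavi (sin (A * x) - c) = heavi ((sin (A * x) - c) * 4^-1).
  by rewrite /heavi pmulr_llt0// mulf_eq0 (negbTE (invr_neq0 _)) ?orbF.
apply: smoothstep_cvg; have := sin_max (A * x); move: c1.
by rewrite !ler_norml /= => /andP[? ?] /andP[? ?]; apply/andP; split; lra.
Qed.

Lemma goodmul_heavi j (c : R) : goodmul j (fun x => heavi (x - c)).
Proof.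
apply: (@goodmul_lim j (fun n x => heavi (sin (n.+1%:R^-1 * x) - sin (n.+1%:R^-1 * c)))).
  by move=> n; apply: goodmul_heavi_sin; exact: sin_max.
move=> x; have p0 : 0 < pi / 2 :> R by rewrite divr_gt0 ?pi_gt0.
apply: (cvg_near_cst); near=> n.
rewrite heavi_sin; last 2 first.
- near: n; exact: near_small.
- near: n; exact: near_small.
rewrite -mulrBr /heavi pmulr_rlt0 ?invr_gt0// mulf_eq0 (negbTE (invr_neq0 _))//.
Unshelve. all: by end_near.
Qed.

(** The thresholds increase to [c] from strictly below, which sends the value 1/2 at [x = c] to
    1. *)
Lemma goodmul_ge j (c : R) : goodmul j (fun x => (c <= x)%R%:R).
Proof.
apply: (@goodmul_lim j (fun n x => heavi (x - (c - n.+1%:R^-1)))).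
  by move=> n; exact: goodmul_heavi.
move=> x; apply: cvg_near_cst; have [cx|xc] := leP c x.
  apply: nearW => n; rewrite /heavi.
  have h : 0 < x - (c - n.+1%:R^-1).
    by rewrite subr_gt0 ltrBlDr (le_lt_trans cx)// ltrDl invr_gt0.
  by rewrite (lt_gtF h) (gt_eqF h).
have e0 : 0 < c - x by rewrite subr_gt0.
near=> n; rewrite /heavi.
have h : `|n.+1%:R^-1 * 1| < c - x :> R by near: n; exact: near_small.
rewrite mulr1 ger0_norm in h; last by rewrite invr_ge0.
by rewrite subr_lt0 ltrBrDr addrC -ltrBrDr h.
Unshelve. all: by end_near.
Qed.

Definition box (c : 'I_k -> R) : set (k.-tuple R) := [set t | forall i, c i <= tnth t i].

Lemma measurable_box c : measurable (box c).
Proof.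
rewrite (_ : box c = \bigcap_(i in [set: 'I_k]) ((fun t => tnth t i) @^-1` `[c i, +oo[)).
  apply: fin_bigcap_measurable => // i _; rewrite -[X in measurable X]setTI.
  exact: measurable_tnth.
apply/seteqP; split => t /= h i; last by have := h i I; rewrite /= in_itv/= andbT.
by move=> _; rewrite /= in_itv/= andbT.
Qed.

Lemma PQ_box c : P (box c) = Q (box c).
Proof.
have g (s : seq 'I_k) : good_fun (fun t => \prod_(i <- s) (c i <= tnth t i)%R%:R).
  elim: s => [|i s IH].
    rewrite (_ : (fun _ => _) = fun=> 1); first exact: good_fun1.
    by apply/funext => t; rewrite big_nil.
  rewrite (_ : (fun _ => _) = (fun t => (\prod_(i <- s) (c i <= tnth t i)%R%:R) *
     (c i <= tnth t i)%R%:R)); first by have [_] := goodmul_ge i (c i); apply.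
  by apply/funext => t; rewrite big_cons mulrC.
(* Frequency 0 gives the test function 1, so the weight itself is integrated. *)
have [[mg _] /(_ _ (trig_cos 0))] := g (index_enum 'I_k).
have E : (fun t : k.-tuple R => (\prod_(i <- index_enum 'I_k) (c i <= tnth t i)%R%:R) *
    cos (lin 0 t)) = \1_(box c) :> (k.-tuple R -> R).
  apply/funext => t; rewrite -(scale0r (0 : 'rV[R]_k)) linZ mul0r cos0 mulr1 indicE.
  have [h|/existsNP[i /negP h]] := pselect (box c t).
    by rewrite (mem_set h) big1// => i _; rewrite h.
  rewrite (bigD1 i)//= (negbTE h) mul0r memNset// => /(_ i).
  exact: (negP h).
rewrite E => {}E.
have mb := measurable_box c.
move: E; rewrite /Rintegral !integral_indic// !setIT => h.
by rewrite -[LHS]fineK ?fin_num_measure// -[RHS]fineK ?fin_num_measure// h.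
Qed.

(** Boxes are stable under intersection and exhaust the space; by [cover] they generate the
    coordinate half-spaces, hence the whole sigma-algebra. *)
Lemma PQ_eq A : measurable A -> P A = Q A.
Proof.
pose G : set (set (k.-tuple R)) := range box.
have cover (i : 'I_k) (c0 : R) : \bigcup_n box (fun j => if j == i then c0 else - n%:R) =
    (fun t => tnth t i) @^-1` `[c0, +oo[%classic.
  apply/seteqP; split => t /=; rewrite in_itv/= andbT.
    by move=> [n _ /(_ i)]; rewrite eqxx.
  move=> h; have [n hn] : exists n : nat, forall j, `|tnth t j| <= n%:R.
    exists (Num.truncn (\sum_j `|tnth t j|)).+1 => j.
    rewrite (le_trans _ (ltW (truncnS_gt _)))// (bigD1 j)//= lerDl; exact: sumr_ge0.
  exists n => // j; case: ifP => [/eqP -> //|_].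
  by have := hn j; rewrite ler_norml => /andP[].
move=> mA; apply: (@g_sigma_algebra_measure_unique _ _ _ G _ (fun n => box (fun=> - n%:R)) _ _ P Q).
- by move=> _ [c _ <-]; exact: measurable_box.
- by move=> n; exists (fun=> - n%:R).
- rewrite -subTset => t _.
  exists (Num.truncn (\sum_j `|tnth t j|)).+1 => // j.
  have : `|tnth t j| <= (Num.truncn (\sum_j `|tnth t j|)).+1%:R.
    rewrite (le_trans _ (ltW (truncnS_gt _)))// (bigD1 j)//= lerDl; exact: sumr_ge0.
  by rewrite ler_norml => /andP[].
- move=> _ _ [c _ <-] [c' _ <-]; exists (fun i => Num.max (c i) (c' i)) => //.
  apply/seteqP; split => t /=.
    by move=> h; split => i; have := h i; rewrite ge_max => /andP[].
  by move=> [h1 h2] i; rewrite ge_max h1 h2.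
- by move=> _ [c _ <-]; exact: PQ_box.
- by move=> n; rewrite (le_lt_trans (probability_le1 _ (measurable_box _)))// ltry.
have mid : measurable_fun setT (fun t : g_sigma_algebraType G => (t : k.-tuple R)).
  apply/measurable_fun_tnthP => i.
  apply: (measurability (@RGenCInfty.G R)) => [|/= _ [_] [r] -> <-].
    exact: RGenCInfty.measurableE.
  rewrite setTI/= -cover; apply: bigcupT_measurable => n.
  by apply: sub_sigma_algebra; eexists.
by have := mid measurableT _ mA; rewrite setTI.
Qed.

End uniqueness.

Lemma law_unique (R : realType) k d d' (T : measurableType d) (T' : measurableType d')
    (P : probability T R) (P' : probability T' R)
    (V : T -> k.-tuple R) (W : T' -> k.-tuple R) :
  measurable_fun setT V -> measurable_fun setT W ->
  (forall a : 'rV[R]_k, \int[P]_x cos (lin a (V x)) = \int[P']_x cos (lin a (W x))) ->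
  (forall a : 'rV[R]_k, \int[P]_x sin (lin a (V x)) = \int[P']_x sin (lin a (W x))) ->
  forall F : k.-tuple R -> \bar R, measurable_fun setT F -> (forall t, 0 <= F t)%E ->
  (\int[P]_x F (V x) = \int[P']_x F (W x))%E.
Proof.
move=> mV mW hc hs F mF F0.
pose V' : {mfun T >-> k.-tuple R} := mfun_Sub (mem_set mV).
pose W' : {mfun T' >-> k.-tuple R} := mfun_Sub (mem_set mW).
have tr (f : k.-tuple R -> R) : bmeas f ->
    \int[distribution P V']_t f t = \int[P]_x f (V x) /\
    \int[distribution P' W']_t f t = \int[P']_x f (W x).
  move=> [mf [M fM]]; split; rewrite /Rintegral integral_distribution//.
  - exact/measurable_EFinP.
  - apply: bmeas_integrable; split; last by exists M => x; exact: fM.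
    exact: measurableT_comp mf mV.
  - exact/measurable_EFinP.
  - apply: bmeas_integrable; split; last by exists M => x; exact: fM.
    exact: measurableT_comp mf mW.
have E := @PQ_eq R k (distribution P V') (distribution P' W').
rewrite -(@ge0_integral_distribution _ _ _ _ _ P V')//.
rewrite -(@ge0_integral_distribution _ _ _ _ _ P' W')//.
apply: eq_measure_integral => A mA _; apply: E => // a.
- by have [-> ->] := tr _ (bmeas_cos a).
- by have [-> ->] := tr _ (bmeas_sin a).
Qed.

Section same_law.
Context {R : realType} {d d' d0} {T : measurableType d} {T' : measurableType d'}
  {S : measurableType d0}.
Variables (P : probability T R) (P' : probability T' R) (V : T -> S) (W : T' -> S).

(** Testing with nonnegative measurable functions needs no integrability; integrability, signed
    integrals and probabilities of events are recovered from it below. *)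
Definition same_law := forall F : S -> \bar R, measurable_fun setT F ->
  (forall t, 0 <= F t)%E -> (\int[P]_x F (V x) = \int[P']_x F (W x))%E.

Hypotheses (mV : measurable_fun setT V) (mW : measurable_fun setT W).
Hypothesis VW : same_law.

Lemma same_law_integrable (f : S -> R) : measurable_fun setT f ->
  P'.-integrable setT (EFin \o (f \o W)) -> P.-integrable setT (EFin \o (f \o V)).
Proof.
move=> mf /integrableP[_ h]; apply/integrableP; split.
  by apply/measurable_EFinP; exact: measurableT_comp.
have := VW (F := fun s => (`|f s|)%:E) _ (fun s => _); move=> -> //.
by apply/measurable_EFinP; exact: measurableT_comp.
Qed.

Lemma same_law_Rintegral (f : S -> R) : measurable_fun setT f ->
  \int[P]_x f (V x) = \int[P']_x f (W x).
Proof.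
move=> mf.
have mp : measurable_fun setT (EFin \o f)^\+%E.
  by apply: measurable_funepos; exact/measurable_EFinP.
have mn : measurable_fun setT (EFin \o f)^\-%E.
  by apply: measurable_funeneg; exact/measurable_EFinP.
have e1 := VW mp (fun t => funepos_ge0 _ t).
have e2 := VW mn (fun t => funeneg_ge0 _ t).
rewrite /Rintegral [in LHS]integralE [in RHS]integralE.
have e1' : (\int[P]_x ((fun x0 => (f (V x0))%:E)^\+ x) =
    \int[P']_x ((fun x0 => (f (W x0))%:E)^\+ x))%E.
  have fp : (fun x0 => (f (V x0))%:E)^\+%E = (EFin \o f)^\+%E \o V by rewrite -funepos_comp.
  have fp' : (fun x0 => (f (W x0))%:E)^\+%E = (EFin \o f)^\+%E \o W by rewrite -funepos_comp.
  by rewrite fp fp'; exact: e1.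
have e2' : (\int[P]_x ((fun x0 => (f (V x0))%:E)^\- x) =
    \int[P']_x ((fun x0 => (f (W x0))%:E)^\- x))%E.
  have fp : (fun x0 => (f (V x0))%:E)^\-%E = (EFin \o f)^\-%E \o V by rewrite -funeneg_comp.
  have fp' : (fun x0 => (f (W x0))%:E)^\-%E = (EFin \o f)^\-%E \o W by rewrite -funeneg_comp.
  by rewrite fp fp'; exact: e2.
by rewrite e1' e2'.
Qed.

Lemma same_law_prob (A : set S) : measurable A -> P (V @^-1` A) = P' (W @^-1` A).
Proof.
move=> mA; have := VW (F := fun s => (\1_A s)%:E).
have mpre : measurable (V @^-1` A) by rewrite -[X in measurable X]setTI; exact: mV.
have mpre' : measurable (W @^-1` A) by rewrite -[X in measurable X]setTI; exact: mW.
move=> h; have {}h := h _ _.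
have := h _ (fun t => _); rewrite (_ : (fun x => _) = (fun x => (\1_(V @^-1` A) x)%:E))//.
rewrite (_ : (fun x => (\1_A (W x))%:E) = (fun x => (\1_(W @^-1` A) x)%:E))//.
rewrite !integral_indic// !setIT; apply.
- exact/measurable_EFinP/measurable_indic.
- by move=> t; rewrite lee_fin.
Qed.

End same_law.

(** * Moments and characteristic functions of Gaussian vectors *)

Section gaussian_vectors.
Context {R : realType} {d} {T : measurableType d}.
Variables (P : probability T R) (k : nat) (Y : T -> 'cV[R]_k).
Hypotheses (mY : measurable_mx Y) (gY : gaussian_vector P Y).

Let lc (u : 'cV[R]_k) w := (u^T *m Y w) 0 0.

Lemma lcE u w : lc u w = \sum_i u i 0 * Y w i 0.
Proof. by rewrite /lc mxE; apply: eq_bigr => i _; rewrite mxE. Qed.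

Lemma measurable_lc u : measurable_fun setT (lc u).
Proof.
rewrite (_ : lc u = fun w => \sum_i u i 0 * Y w i 0); last exact/funext/lcE.
by apply: measurable_sum => i; apply: measurable_funM.
Qed.

(** Both cases of [gaussian_law] are affine images of one standard normal variable, the point mass
    with scale 0. Moments can then be computed on [gauss 1], where polynomials are tame. *)
Lemma gaussian_vector_law u : exists m s : R,
  same_law P (gauss 1) (lc u) (fun t => m + s * tnth t ord0).
Proof.
have [m [s h]] := gY u; exists m, `|s|.
have mu := measurable_lc u.
pose lc' : T -> measurableTypeR R := lc u.
have mu' : measurable_fun setT lc' := mu.
pose X : {mfun T >-> measurableTypeR R} := mfun_Sub (mem_set mu').
move=> F mF F0.
have E A : measurable A -> distribution P X A = gaussian_law m s A by exact: h.
have g1 (G : R -> \bar R) : measurable_fun setT G -> (forall x, 0 <= G x)%E ->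
    (\int[gauss 1]_t G (tnth t ord0) = \int[normal_prob 0 1]_x G x)%E.
  move=> mG G0; rewrite ge0_integral_gaussS//; last first.
    by apply: (measurableT_comp mG); exact: measurable_tnth.
  apply: eq_integral => x _ /=.
  have cE : (fun t : 0.-tuple R => G (tnth (cons_tup (x, t)) ord0)) = cst (G x).
    by apply/funext => t; rewrite tnth0.
  by rewrite cE integral_cst//= diracT mule1.
have mA : measurable_fun setT (fun x : R => m + `|s| * x).
  by apply: measurable_funD => //; apply: measurable_funM.
rewrite (g1 (fun x => F (m + `|s| * x)))//; last exact: measurableT_comp mF mA.
rewrite -[LHS](@ge0_integral_distribution _ _ _ _ _ P X F mF F0).
have [s0|s0] := eqVneq s 0.
  rewrite (eq_measure_integral (@dirac _ (measurableTypeR R) m R)); last first.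
    by move=> A mA' _; apply: etrans (E _ mA') _; rewrite /gaussian_law s0 eqxx.
  rewrite integral_dirac// s0 normr0.
  under [RHS]eq_integral do rewrite mul0r addr0.
  by rewrite diracT mul1e integral_cst//= probability_setT mule1.
rewrite (eq_measure_integral (normal_prob m s)); last first.
  by move=> A mA' _; apply: etrans (E _ mA') _; rewrite /gaussian_law (negbTE s0).
exact: (ge0_integral_normal_std m s0 mF F0).
Qed.

Lemma tame_affine (m s : R) : tame (fun t : 1.-tuple R => m + s * tnth t ord0).
Proof. by apply: tameD; [exact: tame_cst|apply: tameZ; exact: tame_tnth]. Qed.

Lemma integrable_lcX u n : P.-integrable setT (EFin \o (fun w => lc u w ^+ n)).
Proof.
have [m [s h]] := gaussian_vector_law u.
apply: (same_law_integrable (measurable_lc u) h (f := fun x => x ^+ n)) => //.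
by apply: tame_integrable; apply: tameX; exact: tame_affine.
Qed.

Lemma delta_lc i w : lc (delta_mx i 0) w = Y w i 0.
Proof.
rewrite lcE (bigD1 i)//= mxE !eqxx mul1r big1 ?addr0// => j ji.
by rewrite mxE (negbTE ji) mul0r.
Qed.

Lemma integrable_gvec i : P.-integrable setT (EFin \o (fun w => Y w i 0)).
Proof.
have := integrable_lcX (delta_mx i 0) 1; apply: eq_integrable => // w _ /=.
by rewrite expr1 delta_lc.
Qed.

Lemma integrable_gvecM i j : P.-integrable setT (EFin \o (fun w => Y w i 0 * Y w j 0)).
Proof.
have h u : P.-integrable setT (EFin \o (fun w => lc u w ^+ 2)) by exact: integrable_lcX.
apply: (@le_integrable _ _ _ P _ measurableT _ (EFin \o (fun w =>
   lc (delta_mx i 0) w ^+ 2 + lc (delta_mx j 0) w ^+ 2))).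
- by apply/measurable_EFinP; apply: measurable_funM.
- move=> w _ /=; rewrite lee_fin !delta_lc [leRHS]ger0_norm; last by rewrite addr_ge0 ?sqr_ge0.
  rewrite ler_norml; apply/andP; split; nra.
have := integrableD measurableT (h (delta_mx i 0)) (h (delta_mx j 0)).
by apply: eq_integrable.
Qed.

Hypothesis Y0 : mean_mx P Y = 0.

Lemma gvec_mean0 i : \int[P]_w Y w i 0 = 0.
Proof.
by move/matrixP: Y0 => /(_ i 0); rewrite !mxE unlock.
Qed.

Lemma gvec_cov i j : cov_mx P Y i j = \int[P]_w (Y w i 0 * Y w j 0).
Proof.
rewrite mxE covarianceE.
- have e l : ('E_P[fun w => Y w l 0%R] = 0)%E.
    rewrite unlock -[LHS]fineK; last first.
      by apply: integrable_fin_num => //; exact: integrable_gvec.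
    by congr EFin; exact: gvec_mean0.
  by rewrite !e mule0 sube0 unlock.
- by apply/Lfun1_integrable; exact: integrable_gvec.
- by apply/Lfun1_integrable; exact: integrable_gvec.
- by apply/Lfun1_integrable; exact: integrable_gvecM.
Qed.

Lemma gvec_lin0 u : \int[P]_w lc u w = 0.
Proof.
have -> : lc u = (fun w => \sum_i u i 0 * Y w i 0) by exact/funext/lcE.
rewrite /Rintegral.
under eq_integral do rewrite -sumEFin.
rewrite integral_sum//; last first.
  move=> i; apply: eq_integrable (integrableZl measurableT (u i 0) (integrable_gvec i)) => //.
rewrite big1//= => i _.
under eq_integral do rewrite EFinM.
rewrite integralZl//; last exact: integrable_gvec.
rewrite -[X in (_ * X)%E]fineK; last first.
  by apply: integrable_fin_num => //; exact: integrable_gvec.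
by rewrite [fine _]gvec_mean0 mule0.
Qed.

Lemma gvec_lin2 u : \int[P]_w (lc u w ^+ 2) = (u^T *m cov_mx P Y *m u) 0 0.
Proof.
have -> : (fun w => lc u w ^+ 2) =
    (fun w => \sum_i \sum_j (u i 0 * u j 0) * (Y w i 0 * Y w j 0)).
  apply/funext => w; rewrite lcE expr2 mulr_suml; apply: eq_bigr => i _.
  by rewrite mulr_sumr; apply: eq_bigr => j _; ring.
rewrite /Rintegral.
have I i j : P.-integrable setT
    (fun w => ((u i 0 * u j 0) * (Y w i 0 * Y w j 0))%:E).
  exact: eq_integrable (integrableZl measurableT (u i 0 * u j 0) (integrable_gvecM i j)).
under eq_integral do rewrite -sumEFin.
rewrite integral_sum//; last first.
  move=> i; under [X in integrable _ _ X]eq_fun do rewrite -sumEFin.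
  by apply: integrable_sum => // j _.
rewrite (_ : (\sum_(i < k) _)%E = (\sum_i \sum_j (u i 0 * u j 0 * cov_mx P Y i j))%:E).
  rewrite /= mxE exchange_big/=; apply: eq_bigr => j _; rewrite mxE mulr_suml.
  by apply: eq_bigr => i _; rewrite [u^T _ _]mxE; ring.
rewrite -sumEFin; apply: eq_bigr => i _.
under eq_integral do rewrite -sumEFin.
rewrite integral_sum// -sumEFin; apply: eq_bigr => j _.
under eq_integral do rewrite EFinM.
rewrite integralZl//; last exact: integrable_gvecM.
have <- : (cov_mx P Y i j)%:E = (\int[P]_x (Y x i 0%R * Y x j 0%R)%:E)%E.
  rewrite gvec_cov /Rintegral fineK//.
  by apply: integrable_fin_num => //; exact: integrable_gvecM.
by rewrite EFinM.
Qed.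

(** The affine realisation has mean [m] and variance [s ^+ 2]; comparison with the first two moments
    of the linear combination identifies them as 0 and the quadratic form of the covariance
    matrix. *)
Lemma gvec_charfun u :
  \int[P]_w cos (lc u w) = expR (- ((u^T *m cov_mx P Y *m u) 0 0 / 2)) /\
  \int[P]_w sin (lc u w) = 0.
Proof.
have [m [s h]] := gaussian_vector_law u.
have msqr : measurable_fun setT (fun x : R => x ^+ 2) by exact: measurable_funX.
have mid : measurable_fun setT (fun x : R => x) by [].
have T1 : tame (fun t : 1.-tuple R => tnth t ord0) by exact: tame_tnth.
have L v : lin (v *: (1 : 'rV[R]_1)) = fun t => v * tnth t ord0.
  by apply/funext => t; rewrite linZ /lin big_ord1 mxE mul1r.
have D v : dotp (v *: (1 : 'rV[R]_1)) (v *: 1) = v ^+ 2.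
  by rewrite dotpZ /dotp big_ord1 mxE mul1r mulr1.
have L1 (t : 1.-tuple R) : lin 1 t = tnth t ord0 by have := L 1; rewrite scale1r => ->; rewrite mul1r.
have Eg : gE (fun t : 1.-tuple R => tnth t ord0) = 0.
  have := @gE_ibp R 1 1 (fun=> 1) (fun=> 0) (tame_cst _ _) (tame_cst _ _)
    (fun t => is_derive_cst _ _ _).
  rewrite gE_cst => <-; congr gE; apply/funext => t.
  by rewrite L1 mulr1.
have Eg2 : gE (fun t : 1.-tuple R => tnth t ord0 ^+ 2) = 1.
  have h2 : gE (fun t : 1.-tuple R => lin 1 t * tnth t ord0) = gE (fun _ : 1.-tuple R => 1).
    apply: gE_ibp => //; first exact: tame_cst.
    move=> t; have -> : (fun x : R => tnth (shiftt t (x *: (1 : 'rV[R]_1))) ord0) =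
        (fun x : R => tnth t ord0 + x).
      by apply/funext => x; rewrite tnth_mktuple !mxE mulr1.
    have := is_deriveD (is_derive_cst (tnth t ord0) (0 : R) (1 : R)) (is_derive_id (0 : R) (1 : R)).
    by rewrite add0r.
  rewrite -[RHS](gE_cst 1) -h2; congr gE; apply/funext => t; by rewrite L1 expr2.
have mE : m = 0.
  have := gvec_lin0 u; rewrite (same_law_Rintegral h mid) => <-.
  rewrite -/(gE (fun t : 1.-tuple R => m + s * tnth t ord0)).
  by rewrite gED ?gEZ ?gE_cst ?Eg ?mulr0 ?addr0//; [exact: tame_cst|exact: tameZ].
have sE : s ^+ 2 = (u^T *m cov_mx P Y *m u) 0 0.
  have := gvec_lin2 u; rewrite (same_law_Rintegral h msqr).
  move=> <-; rewrite -/(gE (fun t : 1.-tuple R => (m + s * tnth t ord0) ^+ 2)) mE.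
  rewrite (_ : (fun t => _) = (fun t : 1.-tuple R => s ^+ 2 * (tnth t ord0 ^+ 2))).
    by rewrite gEZ ?Eg2 ?mulr1//; exact: tameX.
  by apply/funext => t; rewrite add0r exprMn.
have [h1 h2] := gE_trig (s *: (1 : 'rV[R]_1)).
rewrite D in h1.
split.
  rewrite (same_law_Rintegral h (@measurable_cosR R)).
  rewrite -sE -h1; congr (Rintegral _ _ _); apply/funext => t.
  by rewrite mE add0r L.
rewrite (same_law_Rintegral h (@measurable_sinR R)).
rewrite -h2; congr (Rintegral _ _ _); apply/funext => t.
by rewrite mE add0r L.
Qed.

End gaussian_vectors.

Section psd.
Context {R : realType}.

Definition psd k (C : 'M[R]_k) := C^T = C /\ forall u : 'rV[R]_k, 0 <= (u *m C *m u^T) 0 0.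

(** Induction by Schur complements. With corner [c] and first row [b], either [c > 0] and the
    complement of [c] is again positive semidefinite, or [c = 0], which forces [b = 0]. *)
Lemma psd_factor k (C : 'M[R]_k) : psd C -> exists S : 'M[R]_k, C = S *m S^T.
Proof.
elim: k C => [|k IH] C; first by exists 0; apply/matrixP => -[].
rewrite -[k.+1]/(1 + k)%N in C * => -[symC posC].
set c := C 0 0; pose b : 'rV[R]_k := ursubmx C; pose D := drsubmx C.
have CE : C = block_mx (c%:M) b b^T D.
  rewrite -[LHS]submxK; congr block_mx; first by rewrite [LHS]mx11_scalar; congr _%:M; rewrite !mxE; congr (C _ _); apply/val_inj.
  by rewrite /b trmx_ursub symC.
have symD : D^T = D by rewrite /D trmx_drsub symC.
have q (x : R) (v : 'rV[R]_k) : (row_mx x%:M v *m C *m (row_mx x%:M v)^T) 0 0 =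
    c * x ^+ 2 + 2 * x * (b *m v^T) 0 0 + (v *m D *m v^T) 0 0.
  rewrite CE tr_row_mx mul_row_block mul_row_col tr_scalar_mx.
  rewrite !mulmxDl mxE [X in X + _ = _]mxE [X in _ + X = _]mxE.
  have -> : ((v *m b^T) *m x%:M) 0 0 = x * (b *m v^T) 0 0.
    by rewrite mul_mx_scalar mxE -[v *m b^T]trmxK trmx_mul trmxK mxE.
  have -> : ((x%:M *m b) *m v^T) 0 0 = x * (b *m v^T) 0 0.
    by rewrite -mulmxA mul_scalar_mx mxE.
  have -> : ((x%:M *m c%:M) *m x%:M : 'M[R]_1) 0 0 = c * x ^+ 2.
    by rewrite -!scalar_mxM mxE eqxx mulr1n; ring.
  by ring.
have c0 : 0 <= c.
  by have := posC (row_mx 1%:M 0); rewrite q trmx0 mulmx0 mulmx0 !mxE; lra.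
have [c00|cn0] := eqVneq c 0.
  have bv (v : 'rV[R]_k) : (b *m v^T) 0 0 = 0.
    set B := (b *m v^T) 0 0; set E := (v *m D *m v^T) 0 0.
    have H x : 0 <= 2 * x * B + E by have := posC (row_mx x%:M v); rewrite q c00 mul0r add0r.
    have [//|B0] := eqVneq B 0.
    (* An affine function of [x] that stays nonnegative has slope 0: at this [x] it would take the
       value -1. *)
    have := H (- (E + 1) / (2 * B)).
    rewrite (_ : 2 * (- (E + 1) / (2 * B)) * B = - (E + 1)); last by field.
    by rewrite (_ : - (E + 1) + E = -1); [rewrite oppr_ge0 ler10|ring].
  have b0 : b = 0.
    apply/rowP => j; have := bv (delta_mx 0 j).
    by rewrite trmx_delta -colE !mxE.
  have [S HS] : exists S : 'M[R]_k, D = S *m S^T.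
    apply: IH; split => // v; have := posC (row_mx 0%:M v).
    by rewrite q bv; lra.
  exists (block_mx 0 0 0 S).
  have z : (0 : R)%:M = 0 :> 'M[R]_1 by apply/matrixP => i j; rewrite !mxE mul0rn.
  by rewrite tr_block_mx mulmx_block CE c00 b0 !trmx0 !mulmx0 !mul0mx !add0r HS z.
have cp : 0 < c by rewrite lt_neqAle eq_sym cn0.
have [S HS] : exists S : 'M[R]_k, D - c^-1 *: (b^T *m b) = S *m S^T.
  apply: IH; split.
    by rewrite linearB linearZ/= trmx_mul trmxK symD.
  (* This first coordinate minimises the form among the vectors ending in [v]; the minimum is the
     form of the Schur complement. *)
  move=> v; have := posC (row_mx (- ((b *m v^T) 0 0 / c))%:M v).
  rewrite q mulmxBr mulmxBl -scalemxAr -scalemxAl mulmxA.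
  rewrite [X in _ -> 0 <= X]mxE [X in _ -> 0 <= _ + X]mxE [X in _ -> 0 <= _ - X]mxE.
  have -> : (v *m b^T *m b *m v^T) 0 0 = (b *m v^T) 0 0 ^+ 2.
    rewrite -mulmxA [LHS]mxE big_ord1 expr2; congr (_ * _).
    by rewrite -[v *m b^T]trmxK trmx_mul trmxK mxE.
  set B := (b *m v^T) 0 0; set E := (v *m D *m v^T) 0 0.
  by rewrite (_ : c * _ ^+ 2 + 2 * _ * B + E = E - c^-1 * B ^+ 2)//; field.
set r := Num.sqrt c.
have rr : r * r = c by rewrite -expr2 sqr_sqrtr.
have r0 : r != 0 by rewrite gt_eqF// sqrtr_gt0.
exists (block_mx r%:M 0 (r^-1 *: b^T) S).
rewrite tr_block_mx mulmx_block CE !trmx0 !mulmx0 !mul0mx !addr0 -HS tr_scalar_mx.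
rewrite -scalar_mxM rr linearZ/= trmxK mul_scalar_mx scalerA divff// scale1r.
rewrite mul_mx_scalar scalerA divff// scale1r -scalemxAl -scalemxAr scalerA.
by rewrite -invfM rr addrC subrK.
Qed.

End psd.

(** * From independent events to products of cosines *)

Section indep.
Context {R : realType} {d} {T : measurableType d} (P : probability T R).
Context {I : choiceType} (X : I -> T -> R).
Hypothesis mX : forall i, measurable_fun setT (X i).
Hypothesis indX : forall (J : seq I) (B : I -> set R), uniq J ->
  (forall i, measurable (B i)) ->
  P (\bigcap_(i in [set` J]) (X i @^-1` B i)) = (\prod_(i <- J) P (X i @^-1` B i))%E.

Lemma mXpre i B : measurable B -> measurable (X i @^-1` B).
Proof. by move=> mB; rewrite -[X in measurable X]setTI; exact: mX. Qed.

Lemma bmeas_prod (J : seq I) (f : I -> T -> R) : (forall i, measurable_fun setT (f i)) ->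
  (forall i x, `|f i x| <= 1) ->
  bmeas (fun w => \prod_(i <- J) f i w) /\ forall w, `|\prod_(i <- J) f i w| <= 1.
Proof.
move=> mf f1; have b w : `|\prod_(i <- J) f i w| <= 1.
  elim: J => [|i J IH]; first by rewrite big_nil normr1.
  by rewrite big_cons normrM mulr_ile1.
split => //; split; last by exists 1.
elim: J {b} => [|i J IH].
  by rewrite (_ : (fun _ => _) = fun=> 1)//; apply/funext => w; rewrite big_nil.
rewrite (_ : (fun _ => _) = (fun w => f i w * \prod_(j <- J) f j w)).
  exact: measurable_funM.
by apply/funext => w; rewrite big_cons.
Qed.

(** Discretisation of a function with values in [-1, 1] with mesh [1 / m.+1]. The number of levels
    is [(2 * m.+1).+1] because [h + 1] may reach 2. *)
Definition stepf (h : R -> R) (m : nat) (x : R) : R :=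
  \sum_(k < (2 * m.+1).+1) ((k%:R - m.+1%:R) / m.+1%:R) *
    \1_((fun y => m.+1%:R * (h y + 1)) @^-1` `[k%:R, k.+1%:R[%classic) x.

Lemma stepf_near h m x : `|h x| <= 1 -> `|stepf h m x - h x| <= m.+1%:R^-1.
Proof.
move=> h1; set y := m.+1%:R * (h x + 1).
have y0 : 0 <= y by rewrite mulr_ge0// -lerBlDr sub0r; move: h1; rewrite ler_norml => /andP[].
have y2 : y <= (2 * m.+1)%:R.
  rewrite mulnC natrM ler_pM2l//; move: h1; rewrite ler_norml => /andP[_]; lra.
have /andP[k1 k2] := truncn_itv y0.
have kl : (Num.truncn y < (2 * m.+1).+1)%N.
  by rewrite ltnS -(ler_nat R) (le_trans k1).
rewrite /stepf (bigD1 (Ordinal kl))//= [X in _ + X - _]big1 ?addr0; last first.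
  move=> k /eqP kn; rewrite indicE memNset ?mulr0//= in_itv/= -/y => /andP[a1 a2].
  apply: kn; apply/val_inj => /=; apply/eqP; rewrite eqn_leq; apply/andP; split.
    by rewrite -ltnS -(ltr_nat R) (le_lt_trans a1).
  by rewrite -ltnS -(ltr_nat R) (le_lt_trans k1).
rewrite indicE mem_set ?mulr1/=; last by rewrite in_itv/= -/y k1 k2.
have -> : h x = (y - m.+1%:R) / m.+1%:R.
  by rewrite /y mulrDr mulr1 addrK mulrC mulKf// gt_eqF.
rewrite -mulrBl (_ : _ - _ - _ = (Num.truncn y)%:R - y); last by ring.
rewrite normrM (gtr0_norm (x := _^-1)) ?invr_gt0// ler_piMl ?invr_ge0//.
rewrite ler_norml; apply/andP; split; last by rewrite lerBlDr (le_trans k1)// lerDr.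
by rewrite lerBrDl lerBlDr (le_trans (ltW k2))// -natr1 addrC.
Qed.

Lemma measurable_stepset (h : R -> R) m (k : nat) : measurable_fun setT h ->
  measurable ((fun y => m.+1%:R * (h y + 1)) @^-1` `[k%:R, k.+1%:R[%classic : set R).
Proof.
move=> mh; rewrite -[X in measurable X]setTI.
have : measurable_fun setT (fun y : R => m.+1%:R * (h y + 1)).
  by apply: measurable_funM => //; apply: measurable_funD.
by apply.
Qed.

(** Functions on [J1] and events on [J2] are mixed so that the induction can move one index: the
    function at [t] is approximated by step functions, whose pieces are events at [t], and the
    statement with [t] in [J2] applies to each piece. *)
Lemma indep_prod (J1 J2 : seq I) (h : I -> R -> R) (B : I -> set R) :
  uniq (J1 ++ J2) -> (forall i, measurable_fun setT (h i)) ->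
  (forall i x, `|h i x| <= 1) -> (forall i, measurable (B i)) ->
  \int[P]_w (\prod_(i <- J1) h i (X i w) * \prod_(i <- J2) \1_(B i) (X i w)) =
  \prod_(i <- J1) (\int[P]_w h i (X i w)) * \prod_(i <- J2) fine (P (X i @^-1` B i)).
Proof.
move=> + mh h1; elim: J1 J2 B => [|t J1 IH] J2 B.
  rewrite cat0s big_nil mul1r => uJ mB.
  have E : (fun w => \prod_(i <- [::]) h i (X i w) * \prod_(i <- J2) \1_(B i) (X i w)) =
      \1_(\bigcap_(i in [set` J2]) (X i @^-1` B i)) :> (T -> R).
    apply/funext => w; rewrite big_nil mul1r indicE.
    elim: J2 {uJ} => [|i J IH]; first by rewrite big_nil mem_set// => i.
    rewrite big_cons IH indicE.
    have [wi|wi] := boolP (X i w \in B i); last first.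
      rewrite mul0r memNset// => /(_ i) /=; rewrite mem_head => /(_ isT).
      by move: wi; rewrite notin_setE.
    rewrite mul1r; congr (nat_of_bool _)%:R; apply/idP/idP; rewrite !inE.
      move=> H j; rewrite /= inE => /orP[/eqP ->|]; last exact: H.
      by move: wi; rewrite inE.
    by move=> H j jJ; apply: H; rewrite /= inE jJ orbT.
  rewrite E /Rintegral integral_indic//; last first.
    by apply: fin_bigcap_measurable => // i _; exact: mXpre.
  transitivity (fine (\prod_(i <- J2) P (X i @^-1` B i))%E).
    by rewrite -indX// setIT.
  elim: J2 {uJ E} => [|i J IH2]; first by rewrite !big_nil.
  have fP j : P (X j @^-1` B j) \is a fin_num by apply: fin_num_measure; exact: mXpre.
  rewrite !big_cons fineM ?IH2//.
  elim: {IH2} J => [|j J IH2]; first by rewrite big_nil.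
  by rewrite big_cons fin_numM.
rewrite cat_cons cons_uniq mem_cat negb_or => /andP[/andP[tJ1 tJ2] uJ] mB.
have [b1 b1'] := bmeas_prod J1 (f := fun i w => h i (X i w))
  (fun i => measurableT_comp (mh i) (mX i)) (fun i w => h1 i _).
have ind1 i w : `|\1_(B i) (X i w) : R| <= 1.
  by rewrite indicE; case: (_ \in _); rewrite ?normr1 ?normr0.
have mind i : measurable_fun setT (fun w => \1_(B i) (X i w) : R).
  exact: measurableT_comp (measurable_indic (mB i)) (mX i).
have [b2 b2'] := bmeas_prod J2 (f := fun i w => \1_(B i) (X i w)) mind ind1.
pose c := \prod_(i <- J1) (\int[P]_w h i (X i w)) *
  \prod_(i <- J2) fine (P (X i @^-1` B i)).
pose G w := \prod_(i <- J1) h i (X i w) * \prod_(i <- J2) \1_(B i) (X i w).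
have bG : bmeas G by exact: bmeasM.
have G1 w : `|G w| <= 1 by rewrite normrM mulr_ile1.
have mst m : measurable_fun setT (fun w => stepf (h t) m (X t w)).
  apply: (measurableT_comp _ (mX t)); apply: measurable_sum => k.
  by apply: measurable_funM => //; apply: measurable_indic; exact: measurable_stepset.
have st2 m w : `|stepf (h t) m (X t w)| <= 2.
  have := stepf_near m (h1 t (X t w)); have := h1 t (X t w).
  have mi : m.+1%:R^-1 <= 1 :> R by rewrite invf_le1// ler1n.
  move=> a b; rewrite -[X in `|X|](subrK (h t (X t w))).
  by rewrite (le_trans (ler_normD _ _))// (le_trans (lerD (le_trans b mi) a))// -natrD.
have stc w : (fun m => stepf (h t) m (X t w)) @ \oo --> h t (X t w).
  apply/cvgrPdist_le => e e0; near=> m.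
  rewrite distrC (le_trans (stepf_near m (h1 t _)))//.
  have : `|m.+1%:R^-1 * 1| < e by near: m; exact: near_small.
  by rewrite mulr1 => hh; rewrite (le_trans (ler_norm _))// ltW.
have [_ lim2] := bmeas_cvg P mst st2 stc.
have mst' m : measurable_fun setT (fun w => stepf (h t) m (X t w) * G w).
  by apply: measurable_funM => //; case: bG.
have st2' m w : `|stepf (h t) m (X t w) * G w| <= 2.
  by rewrite normrM -[2]mulr1 ler_pM.
have stc' w : (fun m => stepf (h t) m (X t w) * G w) @ \oo --> h t (X t w) * G w.
  by apply: cvgMr_tmp; exact: stc.
have [_ lim1] := bmeas_cvg P mst' st2' stc'.
have key m : \int[P]_w (stepf (h t) m (X t w) * G w) =
    (\int[P]_w stepf (h t) m (X t w)) * c.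
  have bI k : bmeas (fun w : T => \1_((fun y => m.+1%:R * (h t y + 1)) @^-1`
      `[k%:R, k.+1%:R[%classic) (X t w) : R).
    split; last by exists 1 => w; rewrite indicE; case: (_ \in _); rewrite ?normr1 ?normr0.
    exact: measurableT_comp (measurable_indic (measurable_stepset m k (mh t))) (mX t).
  have sumE (f : nat -> T -> R) (a : nat -> R) N : (forall k, bmeas (f k)) ->
      \int[P]_w (\sum_(k < N) a k * f k w) = \sum_(k < N) a k * \int[P]_w f k w.
    move=> bf; elim: N => [|N IHN].
      by under [LHS]eq_Rintegral do rewrite big_ord0; rewrite big_ord0 Rintegral_cst// mul0r.
    rewrite big_ord_recr -IHN.
    under [LHS]eq_Rintegral do rewrite big_ord_recr.
    have bs : bmeas (fun w => \sum_(k < N) a k * f k w).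
      elim: N {IHN} => [|N' IH'].
        by rewrite (_ : (fun _ => _) = fun=> 0); [exact: bmeas_cst|apply/funext => w; rewrite big_ord0].
      rewrite (_ : (fun _ => _) = (fun w => \sum_(k < N') a k * f k w + a N' * f N' w)).
        by apply: bmeasD => //; apply: bmeasM => //; exact: bmeas_cst.
      by apply/funext => w; rewrite big_ord_recr.
    rewrite RintegralD//.
    - by rewrite RintegralZl//; exact: bmeas_integrable.
    - exact: bmeas_integrable.
    - by apply: bmeas_integrable; apply: bmeasM => //; exact: bmeas_cst.
  transitivity (\sum_(k < (2 * m.+1).+1) ((k%:R - m.+1%:R) / m.+1%:R) *
     \int[P]_w (\1_((fun y => m.+1%:R * (h t y + 1)) @^-1` `[k%:R, k.+1%:R[%classic)
       (X t w) * G w)).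
    rewrite -(sumE (fun k w => \1_((fun y => m.+1%:R * (h t y + 1)) @^-1`
       `[k%:R, k.+1%:R[%classic) (X t w) * G w) (fun k => (k%:R - m.+1%:R) / m.+1%:R)).
      apply: eq_Rintegral => w _; rewrite /stepf mulr_suml.
      by apply: eq_bigr => k _; rewrite -[LHS]mulrA.
    by move=> k; exact: bmeasM.
  rewrite /stepf (sumE (fun k w => \1_((fun y => m.+1%:R * (h t y + 1)) @^-1`
       `[k%:R, k.+1%:R[%classic) (X t w)) (fun k => (k%:R - m.+1%:R) / m.+1%:R))//.
  rewrite mulr_suml; apply: eq_bigr => k _; rewrite -[RHS]mulrA; congr (_ * _).
  set E := (fun y => _) @^-1` _.
  have mE : measurable E := measurable_stepset m k (mh t).
  pose B' i := if i == t then E else B i.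
  have mB' i : measurable (B' i) by rewrite /B'; case: ifP.
  have eB i : i \in J2 -> B' i = B i.
    by move=> iJ; rewrite /B'; case: eqP => // it; move: tJ2; rewrite -it iJ.
  have B't : B' t = E by rewrite /B' eqxx.
  have := IH (t :: J2) B' _ mB'.
  rewrite -cat1s uniq_catCA /= mem_cat negb_or tJ1 tJ2 uJ.
  move=> /(_ isT).
  rewrite big_cons B't.
  have -> : \prod_(i <- J2) fine (P (X i @^-1` B' i)) = \prod_(i <- J2) fine (P (X i @^-1` B i)).
    by rewrite !big_seq; apply: eq_bigr => i iJ; rewrite eB.
  have PE : fine (P (X t @^-1` E)) = \int[P]_w \1_E (X t w).
    rewrite /Rintegral (_ : (fun w => (\1_E (X t w))%:E) = (fun w => (\1_(X t @^-1` E) w)%:E))//.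
    by rewrite integral_indic ?setIT//; exact: mXpre.
  rewrite PE mulrCA -/c => <-; apply: eq_Rintegral => w _; rewrite big_cons /G B't.
  have -> : \prod_(i <- J2) \1_(B' i) (X i w) = \prod_(i <- J2) \1_(B i) (X i w) :> R.
    by rewrite !big_seq; apply: eq_bigr => i iJ; rewrite eB.
  by ring.
have e1 : (fun m => \int[P]_w (stepf (h t) m (X t w) * G w)) =
   (fun m => (\int[P]_w stepf (h t) m (X t w)) * c) by apply/funext.
rewrite e1 in lim1.
have lim3 : (fun m => (\int[P]_w stepf (h t) m (X t w)) * c) @ \oo -->
   (\int[P]_w h t (X t w)) * c by apply: cvgMr_tmp.
have := cvg_unique _ lim1 lim3 => e.
rewrite big_cons -mulrA -/c -e.
by apply: eq_Rintegral => w _; rewrite big_cons /G mulrA.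
Unshelve. all: by end_near.
Qed.

(** The addition formulas turn one summand of the argument into a factor [cos] or [sin] at [t],
    which joins the product over [J2]; carrying arbitrary factors there closes the induction. Sines
    have mean 0, so only products of cosines survive. *)
Lemma indep_cos (J1 J2 : seq I) (h : I -> R -> R) (e : I -> R) :
  uniq (J1 ++ J2) -> (forall i, measurable_fun setT (h i)) ->
  (forall i x, `|h i x| <= 1) ->
  (forall i, \int[P]_w cos (X i w) = e i) -> (forall i, \int[P]_w sin (X i w) = 0) ->
  \int[P]_w (cos (\sum_(i <- J1) X i w) * \prod_(i <- J2) h i (X i w)) =
    \prod_(i <- J1) e i * \prod_(i <- J2) (\int[P]_w h i (X i w)) /\
  \int[P]_w (sin (\sum_(i <- J1) X i w) * \prod_(i <- J2) h i (X i w)) = 0.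
Proof.
move=> + + + hc hs; elim: J1 J2 h => [|t J1 IH] J2 h.
  rewrite cat0s => uJ mh h1; split.
    have := @indep_prod J2 [::] h (fun=> setT); rewrite cats0 => /(_ uJ mh h1 (fun=> measurableT)).
    rewrite big_nil mulr1 big_nil mul1r => <-; apply: eq_Rintegral => w _.
    by rewrite !big_nil cos0 mul1r mulr1.
  under eq_Rintegral do rewrite big_nil sin0 mul0r.
  by rewrite Rintegral_cst// mul0r.
rewrite cat_cons cons_uniq mem_cat negb_or => /andP[/andP[tJ1 tJ2] uJ] mh h1.
have uJ' : uniq (J1 ++ t :: J2).
  by rewrite -cat1s uniq_catCA /= mem_cat negb_or tJ1 tJ2.
pose hh (f : R -> R) i := if i == t then f else h i.
have mhh f i : measurable_fun setT f -> measurable_fun setT (hh f i).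
  by move=> mf; rewrite /hh; case: ifP.
have hh1 f i x : (forall y, `|f y| <= 1) -> `|hh f i x| <= 1.
  by move=> f1; rewrite /hh; case: ifP.
have [c1 s1] := IH (t :: J2) (hh cos) uJ' (fun i => mhh _ i (@measurable_cosR R)) (fun i x => hh1 _ i x (@cos_max R)).
have [c2 s2] := IH (t :: J2) (hh sin) uJ' (fun i => mhh _ i (@measurable_sinR R)) (fun i x => hh1 _ i x (@sin_max R)).
have E f w : \prod_(i <- t :: J2) hh f i (X i w) = f (X t w) * \prod_(i <- J2) h i (X i w).
  rewrite big_cons /hh eqxx; congr (_ * _); rewrite !big_seq; apply: eq_bigr => i iJ.
  by case: eqP => // it; move: tJ2; rewrite -it iJ.
have EI f : \prod_(i <- t :: J2) (\int[P]_w hh f i (X i w)) =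
    (\int[P]_w f (X t w)) * \prod_(i <- J2) (\int[P]_w h i (X i w)).
  rewrite big_cons /hh eqxx; congr (_ * _); rewrite !big_seq; apply: eq_bigr => i iJ.
  by case: eqP => // it; move: tJ2; rewrite -it iJ.
have bp f g : (f = @cos R \/ f = @sin R) -> (g = @cos R \/ g = @sin R) ->
    bmeas (fun w => f (\sum_(i <- J1) X i w) * \prod_(i <- t :: J2) hh g i (X i w)).
  have q k : (k = @cos R \/ k = @sin R) -> measurable_fun setT k /\ forall y, `|k y| <= 1.
    by move=> [->|->]; split; [exact: measurable_cosR|exact: cos_max|exact: measurable_sinR|exact: sin_max].
  move=> /q[mf f1] /q[mg g1]; apply: bmeasM.
    split; last by exists 1.
    apply: (measurableT_comp mf).
    elim: (J1) => [|i J IHJ].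
      by rewrite (_ : (fun _ => _) = fun=> 0)//; apply/funext => w; rewrite big_nil.
    rewrite (_ : (fun _ => _) = (fun w => X i w + \sum_(j <- J) X j w)).
      exact: measurable_funD.
    by apply/funext => w; rewrite big_cons.
  have [] := bmeas_prod (t :: J2) (f := fun i w => hh g i (X i w)) _ _ => //.
  - by move=> i; apply: (measurableT_comp _ (mX i)); exact: mhh.
  - by move=> i w; exact: hh1.
have bpi f g hf hg := bmeas_integrable P (bp f g hf hg).
split.
- transitivity (\int[P]_w (cos (\sum_(i <- J1) X i w) * \prod_(i <- t :: J2) hh cos i (X i w)) -
    \int[P]_w (sin (\sum_(i <- J1) X i w) * \prod_(i <- t :: J2) hh sin i (X i w))).
    rewrite -RintegralB//; [|exact: bpi (or_introl erefl) (or_introl erefl)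
      |exact: bpi (or_intror erefl) (or_intror erefl)].
    apply: eq_Rintegral => w _; rewrite !E big_cons cosD; ring.
  by rewrite c1 s2 subr0 EI hc big_cons; ring.
- transitivity (\int[P]_w (cos (\sum_(i <- J1) X i w) * \prod_(i <- t :: J2) hh sin i (X i w)) +
    \int[P]_w (sin (\sum_(i <- J1) X i w) * \prod_(i <- t :: J2) hh cos i (X i w))).
    rewrite -RintegralD//; [|exact: bpi (or_introl erefl) (or_intror erefl)
      |exact: bpi (or_intror erefl) (or_introl erefl)].
    apply: eq_Rintegral => w _; rewrite !E big_cons sinD; ring.
  by rewrite c2 s1 addr0 EI hs mul0r mulr0.
Qed.

End indep.

(** * The data as a finite Gaussian vector *)

Section weights.
Context {R : realType}.

Definition wt (b : R) (k : nat) : R := (maxn 1 k)%:R `^ (- b).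

Lemma wt_gt0 b k : 0 < wt b k.
Proof. by rewrite /wt powR_gt0// ltr0n leq_max. Qed.

Lemma wt_ge0 b k : 0 <= wt b k. Proof. exact/ltW/wt_gt0. Qed.

Lemma wtD b c k : wt (b + c) k = wt b k * wt c k.
Proof.
have h : (maxn 1 k)%:R != 0 :> R by rewrite pnatr_eq0; lia.
by rewrite /wt opprD powRD// h implybT.
Qed.

Lemma maxn1_ge1 k : 1 <= (maxn 1 k)%:R :> R.
Proof. by rewrite ler1n leq_max. Qed.

Lemma wt_le_exp b c k : b <= c -> wt c k <= wt b k.
Proof. by move=> bc; rewrite /wt ler_powR ?maxn1_ge1// lerN2. Qed.

Lemma wt_le1 b k : 0 <= b -> wt b k <= 1.
Proof. by move=> b0; rewrite (le_trans (wt_le_exp k b0))// /wt oppr0 powRr0. Qed.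

Lemma wt_le b j k : 0 <= b -> (j <= k)%N -> wt b k <= wt b j.
Proof.
move=> b0 jk; rewrite /wt !powRN lef_pV2 ?posrE ?powR_gt0 ?ltr0n ?leq_max//.
by rewrite ge0_ler_powR// ?nnegrE// ler_nat; lia.
Qed.

(** Integral comparison in telescoping form: [e] times a term is at most the decrement of [wt e], by
    (1 - x)^(-e) >= 1 + e x. The first two terms account for the 2. *)
Lemma sum_wt_le (e : R) N : 0 < e -> \sum_(k < N) wt (1 + e) k <= 2 + e^-1.
Proof.
move=> e0.
have step (k : nat) : e * wt (1 + e) k.+2 <= wt e k.+1 - wt e k.+2.
  have x01 : 0 < 1 - k.+2%:R^-1 :> R by rewrite subr_gt0 invf_lt1// ltr1n.
  have E : wt e k.+1 = wt e k.+2 * (1 - k.+2%:R^-1) `^ (- e).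
    rewrite /wt -powRM//; last exact: ltW.
    have -> : maxn 1 k.+1 = k.+1 by lia.
    have -> : maxn 1 k.+2 = k.+2 by lia.
    by congr (_ `^ _); rewrite mulrBr mulr1 divff// -[in RHS]natr1 addrK.
  have L : 1 + e * k.+2%:R^-1 <= (1 - k.+2%:R^-1) `^ (- e).
    rewrite /powR gt_eqF// (le_trans _ (expR_ge1Dx _))// lerD2l mulNr -mulrN ler_pM2l//.
    rewrite lerNr.
    have := expR_ge1Dx (- k.+2%:R^-1 : R); rewrite -[X in X <= _](lnK x01) ler_expR.
    done.
  have -> : wt (1 + e) k.+2 = wt e k.+2 * k.+2%:R^-1.
    by rewrite wtD mulrC; congr (_ * _); rewrite /wt powRN powRr1.
  rewrite E -{3}[wt e k.+2]mulr1 -mulrBr mulrCA ler_wpM2l ?wt_ge0//.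
  by rewrite lerBrDl.
have S n : \sum_(k < n) wt (1 + e) k.+2 <= e^-1.
  have T : e * \sum_(k < n) wt (1 + e) k.+2 <= wt e 1 - wt e n.+1.
    elim: n => [|n IH]; first by rewrite big_ord0 mulr0 subrr.
    rewrite big_ord_recr/= mulrDr (le_trans (lerD IH (step n)))//.
    by rewrite addrA subrK.
  rewrite -[leRHS]mul1r ler_pdivlMr// mulrC (le_trans T)//.
  by rewrite lerBlDr (le_trans (wt_le1 1 (ltW e0)))// lerDl wt_ge0.
have w1 k : wt (1 + e) k <= 1 by apply: wt_le1; rewrite addr_ge0// ltW.
have e10 : 0 < e^-1 by rewrite invr_gt0.
case: N => [|[|N]].
- by rewrite big_ord0; lra.
- by rewrite big_ord1; have := w1 0%N; rewrite /=; lra.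
rewrite 2!big_ord_recl /=; have := S N; have := w1 0%N; have := w1 1%N.
rewrite /bump /= => *.
by under eq_bigr do rewrite !add1n; lra.
Qed.

(** Up to [n], the factor n^x pays for raising the decay exponent from [c] to [c + x], after which
    the sum converges. *)
Lemma sum_wt_pow (c x e : R) N (n : nat) : 0 < e -> 0 <= x -> 1 + e <= c + x ->
  (N <= n)%N -> (0 < n)%N ->
  \sum_(k < N) wt c k <= n%:R `^ x * (2 + e^-1).
Proof.
move=> e0 x0 cx Nn n0.
apply: (le_trans _ (ler_wpM2l (powR_ge0 _ _) (sum_wt_le N e0))).
rewrite mulr_sumr; apply: ler_sum => k _.
have -> : wt c k = wt (c + x) k * (maxn 1 k)%:R `^ x.
  have h : wt x k * (maxn 1 k)%:R `^ x = 1.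
    by rewrite /wt powRN mulVf// gt_eqF// powR_gt0// ltr0n leq_max.
  by rewrite wtD -mulrA h mulr1.
rewrite mulrC ler_pM ?powR_ge0 ?wt_ge0//; last exact: wt_le_exp.
rewrite ge0_ler_powR// ?nnegrE// ler_nat; have := ltn_ord k; lia.
Qed.

(** A part of the second factor's decay, of exponent [1 - b + e], is transferred from [t + k] to [t]
    to make the sum converge; the rest, of exponent [2 * b - 1 - e], is evaluated at [k]. The two
    inequalities on [b] make both exponents nonnegative. *)
Lemma sum_wt_conv (b e : R) (k N : nat) : 0 < e -> b <= 1 -> 1 + e <= 2 * b ->
  \sum_(t < N) wt b t * wt b (t + k) <= (2 + e^-1) * wt (2 * b - 1 - e) k.
Proof.
move=> e0 b1 be.
apply: (le_trans _ (ler_wpM2r (wt_ge0 _ _) (sum_wt_le N e0))).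
rewrite mulr_suml; apply: ler_sum => t _.
have -> : wt b (t + k) = wt (1 - b + e) (t + k) * wt (2 * b - 1 - e) (t + k).
  by rewrite -wtD; congr wt; ring.
rewrite mulrA; apply: ler_pM; rewrite ?mulr_ge0 ?wt_ge0//; last first.
  by apply: wt_le; [lra|rewrite leq_addl].
have -> : 1 + e = b + (1 - b + e) by ring.
rewrite wtD ler_wpM2l ?wt_ge0//; apply: wt_le; first lra.
by rewrite leq_addr.
Qed.

Lemma cauchy_schwarz_sum (I : finType) (f g : I -> R) :
  (\sum_i f i * g i) ^+ 2 <= (\sum_i f i ^+ 2) * (\sum_i g i ^+ 2).
Proof.
set a := \sum_i f i ^+ 2; set b := \sum_i g i ^+ 2; set c := \sum_i f i * g i.
have a0 : 0 <= a by apply: sumr_ge0 => i _; exact: sqr_ge0.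
have q (s t : R) : 0 <= s ^+ 2 * a + 2 * s * t * c + t ^+ 2 * b.
  rewrite /a /b /c !mulr_sumr -!big_split/=; apply: sumr_ge0 => i _.
  by rewrite (_ : _ + _ = (s * f i + t * g i) ^+ 2); [exact: sqr_ge0|ring].
have [a00|an0] := eqVneq a 0.
  have f0 i : f i = 0.
    apply/eqP; rewrite -sqrf_eq0; apply/eqP/le_anti; rewrite sqr_ge0 andbT.
    rewrite -a00 /a (bigD1 i)//= lerDl; apply: sumr_ge0 => j _; exact: sqr_ge0.
  by rewrite /c big1 ?expr0n ?a00 ?mul0r// => i _; rewrite f0 mul0r.
have ap : 0 < a by rewrite lt_neqAle eq_sym an0.
have := q (- c) a; rewrite -(pmulr_rge0 _ ap) => h.
rewrite -subr_ge0; have : 0 <= a * (a * b - c ^+ 2).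
  have := q (- c) a; congr (0 <= _); ring.
by rewrite pmulr_rge0.
Qed.

End weights.

Section linear_process.
Context {R : realType} (p : nat) (M : linear_process R p) (beta C0 : R).
Hypotheses (hA : condition_A M beta C0) (C00 : 0 < C0) (hb : 3 / 4 < beta).
Local Notation P := (lp_prob M).
Local Notation A := (lp_coef M).
Local Notation eps := (@lp_eps R p M).

Definition lagcoef (k t : nat) : 'M[R]_p := A (t + k)%N *m (A t)^T.

(** An entry of Cov (X_(i + k), X_i): the two sums share innovations, with coefficients A_(t + k)
    and A_t. *)
Definition acov (k : nat) (a b : 'I_p) : R :=
  limn (series (fun t => lagcoef k t a b)).

Lemma coef_row t j : \sum_l (A t j l) ^+ 2 <= (C0 * wt beta t) ^+ 2.
Proof.
have h : Num.sqrt (\sum_(l < lp_dim M) (A t j l) ^+ 2) <= C0 * wt beta t.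
  by rewrite (le_trans _ (hA t))//; apply: (le_bigmax _ _ j).
rewrite -(sqr_sqrtr (_ : 0 <= \sum_l _)); last by apply: sumr_ge0 => l _; exact: sqr_ge0.
by rewrite ler_pXn2r// nnegrE ?sqrtr_ge0// mulr_ge0 ?wt_ge0// ltW.
Qed.

Lemma coef_prod t t' a b : `|(A t *m (A t')^T) a b| <= C0 ^+ 2 * (wt beta t * wt beta t').
Proof.
have w0 := wt_ge0 beta; have C0' := ltW C00.
rewrite -(@ler_pXn2r _ 2)// ?nnegrE ?mulr_ge0// real_normK ?num_real// mxE.
under eq_bigr do rewrite mxE.
apply: (le_trans (cauchy_schwarz_sum _ _)).
apply: (le_trans (ler_pM _ _ (coef_row t a) (coef_row t' b))).
- by apply: sumr_ge0 => l _; exact: sqr_ge0.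
- by apply: sumr_ge0 => l _; exact: sqr_ge0.
- by apply: eq_leW; ring.
Qed.

Variables (b1 e : R).
Hypotheses (e0 : 0 < e) (b11 : b1 <= 1) (b1b : b1 <= beta) (be : 1 + e <= 2 * b1).

(** [b1] is the decay exponent cut off at 1, as the convolution estimate requires; [e] is the part
    of the exponent spent on summability. *)
Definition acov_const := C0 ^+ 2 * (2 + e^-1).

Lemma sum_lagcoef k N a b : \sum_(t < N) `|lagcoef k t a b| <=
  acov_const * wt (2 * b1 - 1 - e) k.
Proof.
apply: (@le_trans _ _ (\sum_(t < N) C0 ^+ 2 * (wt b1 t * wt b1 (t + k)))).
  apply: ler_sum => t _; rewrite (le_trans (coef_prod _ _ _ _))// ler_wpM2l ?sqr_ge0//.
  by rewrite mulrC ler_pM ?wt_ge0// wt_le_exp.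
rewrite -mulr_sumr /acov_const -mulrA ler_wpM2l ?sqr_ge0//; exact: sum_wt_conv.
Qed.

Lemma cvg_acov k a b : series (fun t => lagcoef k t a b) @ \oo --> acov k a b.
Proof.
have h : cvgn [normed series (fun t => lagcoef k t a b)].
  apply: nondecreasing_is_cvgn.
    apply/nondecreasing_seqP => n; rewrite /= /series/= !big_mkord big_ord_recr/=.
    by rewrite lerDl.
  exists (acov_const * wt (2 * b1 - 1 - e) k) => _ [n _ <-].
  by rewrite /= /series/= big_mkord; exact: sum_lagcoef.
exact: (@normed_cvg _ R^o _ h).
Qed.

Lemma acov_le k a b : `|acov k a b| <= acov_const * wt (2 * b1 - 1 - e) k.
Proof.
have h : (fun n => `|series (fun t => lagcoef k t a b) n|) @ \oo --> `|acov k a b|.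
  by apply: cvg_norm; exact: cvg_acov.
rewrite -(cvg_lim _ h)//; apply: limr_le; first by apply/cvg_ex; eexists; exact: h.
apply: nearW => n; rewrite /series/= big_mkord (le_trans (ler_norm_sum _ _ _))//.
exact: sum_lagcoef.
Qed.

(** Covariance of the sums truncated at [N]: the innovations at times [i - t] and [j - t'] coincide
    exactly when [i + t' = j + t], which avoids subtraction. *)
Definition covN N (i j : nat) (a b : 'I_p) : R :=
  \sum_(t < N) \sum_(t' < N) ((i + t' == j + t)%N)%:R * (A t *m (A t')^T) a b.

Definition covlim (i j : nat) (a b : 'I_p) : R :=
  if (j <= i)%N then acov (i - j) a b else acov (j - i) b a.

Lemma covNC N i j a b : covN N i j a b = covN N j i b a.
Proof.
rewrite /covN exchange_big/=; apply: eq_bigr => t _; apply: eq_bigr => t' _.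
rewrite eq_sym; congr (_ * _).
by rewrite -[A t' *m _]trmxK trmx_mul trmxK mxE.
Qed.

Lemma cvg_covN i j a b : (fun N => covN N i j a b) @ \oo --> covlim i j a b.
Proof.
wlog ji : i j a b / (j <= i)%N.
  move=> H; case: (leqP j i) => ij; first exact: H.
  have := H j i b a (ltnW ij); rewrite /covlim (ltnW ij) leqNgt ij/=.
  by under [in X in X -> _]eq_fun do rewrite covNC.
rewrite /covlim ji; set k := (i - j)%N.
(* The coincidence condition forces [t = t' + k], and [t < N] leaves the first [N - k] terms of the
   series. *)
rewrite (_ : (fun N => _) = (fun N => series (fun t => lagcoef k t a b) (N - k)%N)).
  rewrite -(@cvg_shiftn k _ (fun N => series (fun t => lagcoef k t a b) (N - k)%N)).
  by rewrite (_ : (fun n => _) = series (fun t => lagcoef k t a b))//;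
    [exact: cvg_acov|apply/funext => n; rewrite addnK].
apply/funext => N; rewrite /covN exchange_big/= /series/= big_mkord.
transitivity (\sum_(t' < N) (t' + k < N)%:R * lagcoef k t' a b).
  apply: eq_bigr => t' _.
  have E t : (i + t' == j + t)%N = (t == t' + k)%N by rewrite /k; lia.
  under eq_bigr do rewrite E.
  case: (ltnP (t' + k) N) => h.
    rewrite (bigD1 (Ordinal h))//= eqxx !mulr1n !mul1r big1 ?addr0// => t tn.
    rewrite (_ : (t == t' + k :> nat)%N = false) ?mul0r//.
    by apply/negbTE; apply: contra tn => /eqP tE; apply/eqP/val_inj.
  rewrite mulr0n mul0r big1// => t _; rewrite (_ : (t == t' + k :> nat)%N = false) ?mul0r//.
  by have := ltn_ord t; lia.
rewrite (big_ord_widen_cond N xpredT (fun t => lagcoef k t a b)) ?leq_subr//.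
rewrite big_mkcond/= [RHS]big_mkcond/=; apply: eq_bigr => t _.
by rewrite ltn_subRL addnC; case: ifP; rewrite ?mulr1n ?mulr0n ?mul1r ?mul0r.
Qed.

Lemma covlim_le i j a b : `|covlim i j a b| <=
  acov_const * wt (2 * b1 - 1 - e) (i - j + (j - i))%N.
Proof.
rewrite /covlim; case: leqP => ij.
  by rewrite (le_trans (acov_le _ _ _))// (_ : (_ + _ = i - j)%N)//; lia.
by rewrite (le_trans (acov_le _ _ _))// (_ : (_ + _ = j - i)%N)//; lia.
Qed.

Lemma covlim_diag i a b : covlim i i a b = acov 0 a b.
Proof. by rewrite /covlim leqnn subnn. Qed.

(** A linear form of an innovation is measurable for the sigma-algebra generated by its coordinates,
    so independence of the vectors applies. *)
Lemma indep_lc (c : int -> 'cV[R]_(lp_dim M)) (J : seq int) (B : int -> set R) :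
  uniq J -> (forall i, measurable (B i)) ->
  P (\bigcap_(i in [set` J]) ((fun w => ((c i)^T *m eps i w) 0%R 0%R) @^-1` B i)) =
  (\prod_(i <- J) P ((fun w => ((c i)^T *m eps i w) 0%R 0%R) @^-1` B i))%E.
Proof.
move=> uJ mB; apply: (@lp_eps_independent R p M J _ uJ) => i _.
pose V := fun w => [tuple eps i w l 0 | l < lp_dim M].
rewrite /sigma_vector (_ : (fun (l : 'I_(lp_dim M)) w => eps i w l 0) =
    (fun l => (fun t : (lp_dim M).-tuple R => tnth t l) \o V)); last first.
  by apply/funext => l; apply/funext => w /=; rewrite tnth_mktuple.
rewrite g_sigma_preimage_comp.
exists (lin (c i)^T @^-1` B i).
  by rewrite -[X in _ X]setTI; exact: (@measurable_lin _ _ (c i)^T).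
rewrite setTI; apply/seteqP; split => w /=; rewrite /lin mxE.
  by under eq_bigr do rewrite tnth_mktuple.
by under [in X in _ -> B i X]eq_bigr do rewrite tnth_mktuple.
Qed.

Lemma eps_charfun (s : int) (c : 'cV[R]_(lp_dim M)) :
  \int[P]_w cos ((c^T *m eps s w) 0 0) = expR (- ((\sum_l c l 0 ^+ 2) / 2)) /\
  \int[P]_w sin ((c^T *m eps s w) 0 0) = 0.
Proof.
have [g m0 c1] := @lp_eps_gaussian R p M s.
have := gvec_charfun (@lp_eps_measurable R p M s) g m0 c.
rewrite c1 mulmx1 mxE.
by under eq_bigr do rewrite mxE -expr2.
Qed.

Lemma eps_sum_charfun (c : int -> 'cV[R]_(lp_dim M)) (J : seq int) : uniq J ->
  \int[P]_w cos (\sum_(s <- J) ((c s)^T *m eps s w) 0 0) =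
    expR (- ((\sum_(s <- J) \sum_l c s l 0 ^+ 2) / 2)) /\
  \int[P]_w sin (\sum_(s <- J) ((c s)^T *m eps s w) 0 0) = 0.
Proof.
move=> uJ; have uJ0 : uniq (J ++ [::]) by rewrite cats0.
have mX s : measurable_fun setT (fun w => ((c s)^T *m eps s w) 0 0).
  exact: (measurable_lc (@lp_eps_measurable R p M s) (c s)).
have := @indep_cos _ _ _ P _ (fun s w => ((c s)^T *m eps s w) 0 0) mX (indep_lc c) J [::]
  (fun _ _ => 0) (fun s => expR (- ((\sum_l c s l 0 ^+ 2) / 2))) uJ0 (fun=> @measurable_cst _ _ _ _ _ _).
move=> /(_ _ (fun s => (eps_charfun s (c s)).1) (fun s => (eps_charfun s (c s)).2)).
case=> [_ _|]; first by rewrite normr0.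
under eq_Rintegral do rewrite big_nil mulr1.
move=> -> ; under eq_Rintegral do rewrite big_nil mulr1.
move=> ->; split => //; rewrite big_nil mulr1 -expR_sum; congr expR.
by rewrite mulr_suml -sumrN.
Qed.

End linear_process.

Lemma sum_delta_seq (R : pzRingType) (I : eqType) (J : seq I) (y : I) (g : I -> R) :
  uniq J -> y \in J -> \sum_(s <- J) (y == s)%:R * g s = g y.
Proof.
move=> uJ yJ; rewrite (bigD1_seq y)//= eqxx mulr1n mul1r big1 ?addr0// => s sy.
by rewrite eq_sym (negbTE sy) mulr0n mul0r.
Qed.

Lemma sum_enum_val (V : nmodType) (I : finType) (f : I -> V) :
  \sum_x f x = \sum_(i < #|{: I}|) f (enum_val i).
Proof. by rewrite -big_enum_val. Qed.

Section bounded_convergence.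
Context {R : realType} d (T : measurableType d) (P : probability T R).

Lemma bounded_ae_cvg (f_ : nat -> T -> R) (f : T -> R) (c : R) :
  (forall n, measurable_fun setT (f_ n)) -> measurable_fun setT f ->
  (forall n x, `|f_ n x| <= c) ->
  {ae P, forall x, f_ ^~ x @ \oo --> f x} ->
  (fun n => \int[P]_x f_ n x) @ \oo --> \int[P]_x f x.
Proof.
move=> mf_ mf fc ff.
have [i _ h] := @dominated_convergence _ T R P setT measurableT
  (fun n x => (f_ n x)%:E) (fun x => (f x)%:E) (EFin \o cst c)
  (fun n => measurableT_comp (@EFin_measurable _ _) (mf_ n))
  (measurableT_comp (@EFin_measurable _ _) mf)
  ltac:(by apply: filterS ff => x h _; apply: cvg_EFin; [exact: nearW|exact: h])
  (@finite_measure_integrable_cst _ _ _ P setT c measurableT)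
  ltac:(by apply: aeW => x n _; rewrite lee_fin).
have If : (\int[P]_x (f x)%:E)%E \is a fin_num by exact: integrable_fin_num.
apply: (@fine_cvg R nat \oo _ (fun n => (\int[P]_x (f_ n x)%:E)%E)).
by rewrite fineK.
Qed.

Lemma ae_forall_fin (I : finType) (Q : I -> T -> Prop) :
  (forall x, {ae P, forall w, Q x w}) -> {ae P, forall w x, Q x w}.
Proof.
move=> h; have H (s : seq I) : {ae P, forall w x, x \in s -> Q x w}.
  elim: s => [|y s IH]; first exact: aeW.
  apply: filterS2 IH (h y) => w IH hy x; rewrite in_cons => /orP[/eqP->//|]; exact: IH.
apply: filterS (H (enum I)) => w hw x; apply: hw; exact: mem_enum.
Qed.

End bounded_convergence.

Lemma cvg_sumr (R : realType) (I : finType) (f : I -> nat -> R) (l : I -> R) :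
  (forall x, f x @ \oo --> l x) -> (fun N => \sum_x f x N) @ \oo --> \sum_x l x.
Proof.
move=> h; rewrite (_ : (fun N => _) = \sum_x f x); last by apply/funext => N; rewrite fct_sumE.
elim/big_ind2: _ => [|f1 l1 f2 l2|x _]; [exact: cvg_cst|exact: cvgD|exact: h].
Qed.

(** * Characteristic function and law of a finite stretch of the process *)

Section process_law.
Context {R : realType} (p : nat) (M : linear_process R p) (beta C0 b1 e : R).
Hypotheses (hA : condition_A M beta C0) (C00 : 0 < C0) (hb : 3 / 4 < beta).
Hypotheses (e0 : 0 < e) (b11 : b1 <= 1) (b1b : b1 <= beta) (be : 1 + e <= 2 * b1).
Local Notation P := (lp_prob M).
Local Notation A := (lp_coef M).
Local Notation eps := (@lp_eps R p M).
Variable n : nat.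
Local Notation I := ('I_n * 'I_p)%type.

Definition partX N (x : I) w : R :=
  (\sum_(0 <= t < N) A t *m eps ((x.1 : nat)%:Z - t%:Z) w) x.2 0.

Definition datX (x : I) w : R := @lp_X R p M (x.1 : nat)%:Z w x.2 0.

(** The linear combination is regrouped by innovation: [c s] collects all coefficients of [eps s],
    and [J] lists the finitely many times involved. Independence then multiplies the characteristic
    functions. *)
Lemma partX_charfun N (u : I -> R) :
  let v := \sum_x \sum_y u x * u y * covN M N x.1 y.1 x.2 y.2 in
  \int[P]_w cos (\sum_x u x * partX N x w) = expR (- (v / 2)) /\
  \int[P]_w sin (\sum_x u x * partX N x w) = 0.
Proof.
move=> v.
pose c (s : int) : 'cV[R]_(lp_dim M) := \col_l \sum_(x : I) \sum_(t < N)
  ((x.1 : nat)%:Z - (t : nat)%:Z == s)%:R * (u x * A t x.2 l).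
pose J := undup [seq (x.1 : nat)%:Z - (t : nat)%:Z | x : I <- enum {: I}, t : 'I_N <- enum 'I_N].
have uJ : uniq J by exact: undup_uniq.
have xJ (x : I) (t : 'I_N) : (x.1 : nat)%:Z - (t : nat)%:Z \in J.
  by rewrite mem_undup; apply/allpairsP; exists (x, t); rewrite !mem_enum.
have E1 w : \sum_(s <- J) ((c s)^T *m eps s w) 0 0 = \sum_x u x * partX N x w.
  transitivity (\sum_(s <- J) \sum_(x : I) \sum_(t < N)
      ((x.1 : nat)%:Z - (t : nat)%:Z == s)%:R * (u x * (A t *m eps s w) x.2 0)).
    apply: eq_bigr => s _; rewrite mxE.
    under eq_bigr do rewrite !mxE mulr_suml.
    rewrite exchange_big/=; apply: eq_bigr => x _.
    under eq_bigr do rewrite mulr_suml.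
    rewrite exchange_big/=; apply: eq_bigr => t _.
    rewrite mxE !mulr_sumr; apply: eq_bigr => l _; ring.
  rewrite exchange_big/=; apply: eq_bigr => x _; rewrite exchange_big/=.
  rewrite /partX summxE mulr_sumr big_mkord; apply: eq_bigr => t _.
  exact: (sum_delta_seq (fun s => u x * (A t *m eps s w) x.2 0) uJ (xJ x t)).
have E2 : \sum_(s <- J) \sum_l c s l 0 ^+ 2 = v.
  transitivity (\sum_(s <- J) \sum_(x : I) \sum_(t < N) ((x.1 : nat)%:Z - (t : nat)%:Z == s)%:R *
     (\sum_(y : I) \sum_(t' < N) ((y.1 : nat)%:Z - (t' : nat)%:Z == s)%:R *
       (u x * u y * (A t *m (A t')^T) x.2 y.2))).
    apply: eq_bigr => s _.
    transitivity (\sum_l \sum_(x : I) \sum_(t < N) ((x.1 : nat)%:Z - (t : nat)%:Z == s)%:R *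
        (u x * A t x.2 l) * c s l 0).
      apply: eq_bigr => l _; rewrite expr2 {1}mxE mulr_suml; apply: eq_bigr => x _.
      by rewrite mulr_suml.
    rewrite exchange_big/=; apply: eq_bigr => x _.
    rewrite exchange_big/=; apply: eq_bigr => t _.
    under eq_bigr do rewrite mxE -mulrA mulr_sumr mulr_sumr.
    rewrite exchange_big/= mulr_sumr; apply: eq_bigr => y _.
    under eq_bigr do rewrite mulr_sumr mulr_sumr.
    rewrite exchange_big/= mulr_sumr; apply: eq_bigr => t' _.
    rewrite mxE !mulr_sumr; apply: eq_bigr => l _; rewrite mxE; ring.
  rewrite exchange_big/=; apply: eq_bigr => x _; rewrite exchange_big/=.
  transitivity (\sum_(t < N) \sum_(y : I) \sum_(t' < N) ((y.1 : nat)%:Z - (t' : nat)%:Z == (x.1 : nat)%:Z - (t : nat)%:Z)%:R *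
       (u x * u y * (A t *m (A t')^T) x.2 y.2)).
    apply: eq_bigr => t _.
    exact: (sum_delta_seq (fun s => \sum_(y : I) \sum_(t' < N) ((y.1 : nat)%:Z - (t' : nat)%:Z == s)%:R *
       (u x * u y * (A t *m (A t')^T) x.2 y.2)) uJ (xJ x t)).
  rewrite exchange_big/=; apply: eq_bigr => y _; rewrite /covN mulr_sumr.
  apply: eq_bigr => t _; rewrite mulr_sumr; apply: eq_bigr => t' _.
  rewrite (_ : (_ - _ == _ - _) = (x.1 + t' == y.1 + t)%N); first by rewrite mulrCA.
  by apply/eqP/eqP; lia.
have [h1 h2] := eps_sum_charfun c uJ.
rewrite E2 in h1; split.
  by rewrite -h1; apply: eq_Rintegral => w _; rewrite E1.
by rewrite -[RHS]h2; apply: eq_Rintegral => w _; rewrite E1.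
Qed.

Lemma measurable_datX x : measurable_fun setT (datX x).
Proof. exact: (@lp_X_measurable R p M). Qed.

Lemma measurable_partX N x : measurable_fun setT (partX N x).
Proof.
rewrite (_ : partX N x = fun w => \sum_(t < N) \sum_l A t x.2 l * eps ((x.1 : nat)%:Z - (t : nat)%:Z) w l 0).
  apply: measurable_sum => t; apply: measurable_sum => l.
  by apply: measurable_funM => //; exact: (@lp_eps_measurable R p M).
apply/funext => w; rewrite /partX summxE big_mkord; apply: eq_bigr => t _.
by rewrite mxE.
Qed.

Lemma partX_cvg (u : I -> R) : {ae P, forall w,
  (fun N => \sum_x u x * partX N x w) @ \oo --> \sum_x u x * datX x w}.
Proof.
have h : {ae P, forall w (x : I), (fun N => partX N x w) @ \oo --> datX x w}.
  apply: ae_forall_fin => x; apply: filterS (@lp_X_series R p M (x.1 : nat)%:Z) => w h.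
  apply: (@continuous_cvg _ _ _ \oo _ _ (fun V : 'cV[R]_p => V x.2 0)) h.
  exact: coord_continuous.
apply: filterS h => w hw.
apply: cvg_sumr => x; apply: cvgM; [exact: cvg_cst|exact: hw].
Qed.

Definition datcov (x y : I) : R := covlim M x.1 y.1 x.2 y.2.

(** Bounded convergence along the almost sure limit of the truncated sums on one side, [cvg_covN] on
    the other. *)
Lemma datX_charfun (u : I -> R) :
  \int[P]_w cos (\sum_x u x * datX x w) =
     expR (- ((\sum_x \sum_y u x * u y * datcov x y) / 2)) /\
  \int[P]_w sin (\sum_x u x * datX x w) = 0.
Proof.
have mp N : measurable_fun setT (fun w => \sum_x u x * partX N x w).
  by apply: measurable_sum => x; apply: measurable_funM => //; exact: measurable_partX.
have md : measurable_fun setT (fun w => \sum_x u x * datX x w).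
  by apply: measurable_sum => x; apply: measurable_funM => //; exact: measurable_datX.
have v_cvg : (fun N => expR (- ((\sum_x \sum_y u x * u y * covN M N x.1 y.1 x.2 y.2) / 2))) @ \oo -->
    expR (- ((\sum_x \sum_y u x * u y * datcov x y) / 2)).
  apply: (@continuous_cvg _ _ _ \oo _ _ expR); first exact: continuous_expR.
  apply: cvgN; apply: cvgM; last exact: cvg_cst. apply: cvg_sumr => x; apply: cvg_sumr => y.
  apply: cvgM; [exact: cvg_cst|exact: (cvg_covN hA C00 hb e0 b11 b1b be)].
split.
- have h := @bounded_ae_cvg _ _ _ P (fun N w => cos (\sum_x u x * partX N x w)) (fun w => cos (\sum_x u x * datX x w)) 1.
  have {}h : (fun N => \int[P]_w cos (\sum_x u x * partX N x w)) @ \oo --> \int[P]_w cos (\sum_x u x * datX x w).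
    apply: h.
    + by move=> N; apply: measurableT_comp => //; exact: measurable_cosR.
    + by apply: measurableT_comp => //; exact: measurable_cosR.
    + by move=> N x; rewrite ler_norml cos_le1 cos_geN1.
    + by apply: filterS (partX_cvg u) => w; apply: (@continuous_cvg _ _ _ \oo _ _ cos); exact: continuous_cos.
  have E N := (partX_charfun N u).1.
  apply: (cvg_unique _ h) => //.
  by rewrite (_ : (fun N => _) = (fun N => expR (- ((\sum_x \sum_y u x * u y * covN M N x.1 y.1 x.2 y.2) / 2))))//; apply/funext => N; exact: E.
- have h := @bounded_ae_cvg _ _ _ P (fun N w => sin (\sum_x u x * partX N x w)) (fun w => sin (\sum_x u x * datX x w)) 1.
  have {}h : (fun N => \int[P]_w sin (\sum_x u x * partX N x w)) @ \oo --> \int[P]_w sin (\sum_x u x * datX x w).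
    apply: h.
    + by move=> N; apply: measurableT_comp => //; exact: measurable_sinR.
    + by apply: measurableT_comp => //; exact: measurable_sinR.
    + by move=> N x; rewrite ler_norml sin_le1 sin_geN1.
    + by apply: filterS (partX_cvg u) => w; apply: (@continuous_cvg _ _ _ \oo _ _ sin); exact: continuous_sin.
  have E N := (partX_charfun N u).2.
  apply: (cvg_unique _ h) => //.
  by rewrite (_ : (fun N => _) = cst 0)//; [exact: cvg_cst|apply/funext => N; exact: E].
Qed.

Definition covX : 'M[R]_#|{: I}| := \matrix_(i, j) datcov (enum_val i) (enum_val j).

(** Positivity is read off the characteristic function: [expR (- (v / 2))] is the mean of a cosine,
    hence at most 1. *)
Lemma covX_form (u : I -> R) : 0 <= \sum_x \sum_y u x * u y * datcov x y.
Proof.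
set v := \sum_x _.
have h : expR (- (v / 2)) <= 1.
  rewrite -(datX_charfun u).1.
  have m1 : measurable_fun setT (fun w => cos (\sum_x u x * datX x w)).
    apply: measurableT_comp; first exact: measurable_cosR.
    by apply: measurable_sum => x; apply: measurable_funM => //; exact: measurable_datX.
  have E : 1 = \int[P]_w (cst 1 w : R).
    rewrite /Rintegral (_ : (fun w => _) = cst 1%:E)//.
    by rewrite integral_cst//= probability_setT mul1e.
  rewrite E; apply: le_Rintegral => //.
  - by apply: bmeas_integrable; split => //; exists 1 => w; rewrite ler_norml cos_le1 cos_geN1.
  - exact: finite_measure_integrable_cst.
  - by move=> w _; exact: cos_le1.
rewrite -[X in _ <= X]expR0 ler_expR in h; move: v h => v h; lra.
Qed.

Lemma covX_psd : psd covX.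
Proof.
split.
  apply/matrixP => i j; rewrite !mxE /datcov /covlim.
  case: ltngtP => // h; rewrite h subnn.
  have E t a b : lagcoef M 0 t a b = lagcoef M 0 t b a.
    rewrite /lagcoef addn0 -[in LHS](trmxK (A t)) -trmx_mul [LHS]mxE.
    by rewrite trmxK.
  by rewrite /acov; congr (limn (series _)); apply/funext => t; rewrite E.
move=> u; rewrite mxE.
have := covX_form (fun x => u 0 (enum_rank x)).
congr (0 <= _); rewrite sum_enum_val.
under [RHS]eq_bigr do rewrite !mxE mulr_suml.
rewrite [RHS]exchange_big; apply: eq_bigr => i _.
rewrite sum_enum_val.
apply: eq_bigr => j _; rewrite !mxE !enum_valK; ring.
Qed.

Definition datT w : #|{: I}|.-tuple R := [tuple datX (enum_val i) w | i < #|{: I}|].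

Lemma datX_same_law K (S : 'M[R]_(#|{: I}|, K)) : S *m S^T = covX ->
  same_law P (gauss K) datT (fun t => [tuple lin (row i S) t | i < #|{: I}|]).
Proof.
move=> SS F mF F0.
pose L (t : K.-tuple R) := [tuple lin (row i S) t | i < #|{: I}|].
have Ed (a : 'rV_#|{: I}|) w : lin a (datT w) = \sum_x a 0 (enum_rank x) * datX x w.
  rewrite [RHS]sum_enum_val.
  by apply: eq_bigr => i _; rewrite tnth_mktuple enum_valK.
have EL (a : 'rV_#|{: I}|) t : lin a (L t) = lin (a *m S) t.
  rewrite /lin; under eq_bigr do rewrite tnth_mktuple mulr_sumr.
  rewrite exchange_big/=; apply: eq_bigr => k _.
  rewrite mxE mulr_suml; apply: eq_bigr => i _; rewrite mxE; ring.
have Eq (a : 'rV_#|{: I}|) : dotp (a *m S) (a *m S) =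
    \sum_x \sum_y a 0 (enum_rank x) * a 0 (enum_rank y) * datcov x y.
  transitivity ((a *m S *m (a *m S)^T) 0 0).
    by rewrite [RHS]mxE; apply: eq_bigr => i _; rewrite [(_^T) _ _]mxE.
  rewrite trmx_mul mulmxA -[a *m S *m S^T]mulmxA SS mxE.
  rewrite [RHS]sum_enum_val.
  under eq_bigr do rewrite !mxE mulr_suml.
  rewrite exchange_big; apply: eq_bigr => i _.
  rewrite [RHS]sum_enum_val.
  apply: eq_bigr => j _; rewrite !mxE !enum_valK; ring.
apply: law_unique => //.
- apply/measurable_fun_tnthP => i; rewrite (_ : _ \o _ = datX (enum_val i)); first exact: measurable_datX.
  by apply/funext => w /=; rewrite tnth_mktuple.
- apply/measurable_fun_tnthP => i; rewrite (_ : _ \o _ = lin (row i S)); first exact: measurable_lin.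
  by apply/funext => w /=; rewrite tnth_mktuple.
- move=> a; under eq_Rintegral do rewrite Ed; under [RHS]eq_Rintegral do rewrite EL.
  rewrite (datX_charfun _).1 -Eq; exact/esym/(gE_trig _).1.
- move=> a; under eq_Rintegral do rewrite Ed; under [RHS]eq_Rintegral do rewrite EL.
  rewrite (datX_charfun _).2; exact/esym/(gE_trig _).2.
Qed.

End process_law.

(** * Quadratic forms in Gaussian variables *)

Section dotp.
Context {R : realType} (K : nat).
Implicit Types (u v w : 'rV[R]_K) (M N : 'M[R]_K).

Lemma dotpE u v : dotp u v = (u *m v^T) 0 0.
Proof. by rewrite mxE; apply: eq_bigr => i _; rewrite mxE. Qed.

Lemma dotpC u v : dotp u v = dotp v u.
Proof. by apply: eq_bigr => i _; rewrite mulrC. Qed.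

Lemma dotpDl u v w : dotp (u + v) w = dotp u w + dotp v w.
Proof. by rewrite /dotp -big_split; apply: eq_bigr => i _; rewrite mxE mulrDl. Qed.

Lemma dotpDr u v w : dotp w (u + v) = dotp w u + dotp w v.
Proof. by rewrite !(dotpC w) dotpDl. Qed.

Lemma dotpZl a u v : dotp (a *: u) v = a * dotp u v.
Proof. by rewrite /dotp mulr_sumr; apply: eq_bigr => i _; rewrite mxE mulrA. Qed.

Lemma dotpZr a u v : dotp u (a *: v) = a * dotp u v.
Proof. by rewrite dotpC dotpZl dotpC. Qed.

Lemma dotp0l u : dotp 0 u = 0.
Proof. by rewrite /dotp big1// => i _; rewrite mxE mul0r. Qed.

Lemma dotp0r u : dotp u 0 = 0.
Proof. by rewrite dotpC dotp0l. Qed.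

Lemma dotpBl u v w : dotp (u - v) w = dotp u w - dotp v w.
Proof. by rewrite -scaleN1r dotpDl dotpZl mulN1r. Qed.

Lemma dotp_suml (I : finType) (u : I -> 'rV[R]_K) v :
  dotp (\sum_i u i) v = \sum_i dotp (u i) v.
Proof.
by elim/big_rec2: _ => [|i a b _ <-]; rewrite ?dotp0l ?dotpDl.
Qed.

Lemma dotp_sumr (I : finType) (u : I -> 'rV[R]_K) v :
  dotp v (\sum_i u i) = \sum_i dotp v (u i).
Proof. by rewrite dotpC dotp_suml; apply: eq_bigr => i _; rewrite dotpC. Qed.

Lemma dotp_ge0 u : 0 <= dotp u u.
Proof. by apply: sumr_ge0 => i _; rewrite -expr2 sqr_ge0. Qed.

Lemma dotp_CS u v : dotp u v ^+ 2 <= dotp u u * dotp v v.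
Proof. exact: (cauchy_schwarz_sum (fun i => u 0 i) (fun i => v 0 i)). Qed.

Lemma dotp_deltar u a : dotp u (delta_mx 0 a) = u 0 a.
Proof.
rewrite /dotp (bigD1 a)//= mxE !eqxx mulr1 big1 ?addr0// => i ia.
by rewrite mxE eqxx (negbTE ia) mulr0.
Qed.

Lemma dotpMl u v M : dotp (u *m M) v = dotp u (v *m M^T).
Proof. by rewrite !dotpE trmx_mul trmxK mulmxA. Qed.

(** The squared Frobenius norm. *)
Definition fro m (M : 'M[R]_(m, K)) : R := \sum_i \sum_j M i j ^+ 2.

Lemma fro_ge0 m (M : 'M[R]_(m, K)) : 0 <= fro M.
Proof. by apply: sumr_ge0 => i _; apply: sumr_ge0 => j _; exact: sqr_ge0. Qed.

Lemma fro_le u M : dotp (u *m M) (u *m M) <= fro M * dotp u u.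
Proof.
rewrite /fro exchange_big mulr_suml; apply: ler_sum => j _.
rewrite -expr2 mxE (le_trans (cauchy_schwarz_sum _ _))// mulrC.
by rewrite ler_wpM2l ?sumr_ge0// => i _; exact: sqr_ge0.
Qed.

End dotp.

Lemma fro_tr (R : realType) m K (M : 'M[R]_(m, K)) : fro M^T = fro M.
Proof.
rewrite /fro exchange_big; apply: eq_bigr => i _; apply: eq_bigr => j _.
by rewrite mxE.
Qed.

Lemma fro_trace (R : realType) m K (M : 'M[R]_(m, K)) : fro M = \tr (M *m M^T).
Proof.
apply: eq_bigr => i _; rewrite mxE; apply: eq_bigr => j _.
by rewrite mxE expr2.
Qed.

Lemma exprD_le2 (R : realFieldType) (a b : R) q : 0 <= a -> 0 <= b ->
  (a + b) ^+ q <= 2 ^+ q * (a ^+ q + b ^+ q).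
Proof.
wlog ba : a b / b <= a.
  move=> H a0 b0; have [h|/ltW h] := lerP b a; first exact: H.
  by rewrite addrC [X in _ * X]addrC; exact: H.
move=> a0 b0; apply: (@le_trans _ _ ((2 * a) ^+ q)).
  by apply: lerXn2r; rewrite ?nnegrE ?mulr_ge0 ?addr_ge0//; lra.
by rewrite exprMn ler_wpM2l ?exprn_ge0// lerDl exprn_ge0.
Qed.

(** * Integration by parts against linear and quadratic forms; moments *)

Section gradients.
Context {R : realType} (K : nat).
Local Notation T := (K.-tuple R).

Definition xr (t : T) : 'rV[R]_K := \row_a tnth t a.

Lemma lin_dotp (v : 'rV[R]_K) t : lin v t = dotp v (xr t).
Proof. by apply: eq_bigr => i _; rewrite mxE. Qed.

Lemma xr_shift t v : xr (shiftt t v) = xr t + v.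
Proof. by apply/rowP => a; rewrite !mxE tnth_mktuple. Qed.

Lemma xr_mul m (M : 'M[R]_(K, m)) t a : (xr t *m M) 0 a = lin (col a M)^T t.
Proof. by rewrite mxE; apply: eq_bigr => i _; rewrite !mxE mulrC. Qed.

(** Derivatives at parameter 0 are enough because the base point is arbitrary. Tameness of the
    function and of the gradient is included since integration by parts consumes both. *)
Definition hasgrad (f : T -> R) (g : T -> 'rV[R]_K) : Prop :=
  [/\ tame f, forall a, tame (fun t => g t 0 a) & forall v t,
    is_derive (0 : R) 1 (fun s : R => f (shiftt t (s *: v))) (dotp (g t) v)].

Lemma tame_ext (f g : T -> R) : f =1 g -> tame f -> tame g.
Proof. by move=> /funext->. Qed.

Lemma tame_xr_mul m (M : 'M[R]_(K, m)) a : tame (fun t => (xr t *m M) 0 a).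
Proof. by apply: tame_ext (tame_lin (col a M)^T) => t; rewrite xr_mul. Qed.

Lemma tame_dotp (f g : T -> 'rV[R]_K) : (forall a, tame (fun t => f t 0 a)) ->
  (forall a, tame (fun t => g t 0 a)) -> tame (fun t => dotp (f t) (g t)).
Proof. by move=> tf tg; apply: tame_sum => i; exact: tameM (tf i) (tg i). Qed.

Lemma hasgrad_ext f f' g g' : f =1 f' -> g =1 g' -> hasgrad f g -> hasgrad f' g'.
Proof. by move=> /funext-> /funext->. Qed.

Lemma hasgrad_cst a : hasgrad (fun=> a) (fun=> 0).
Proof.
split; [exact: tame_cst|move=> b|].
  by rewrite (_ : (fun=> _) = (fun=> 0)); [exact: tame_cst|apply/funext => t; rewrite mxE].
by move=> v t; rewrite dotp0l; exact: is_derive_cst.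
Qed.

Lemma hasgrad_lin v : hasgrad (lin v) (fun=> v).
Proof.
split; [exact: tame_lin|move=> b; exact: tame_cst|].
move=> u t; rewrite (_ : (fun s => _) = (fun s => lin v t + s * dotp v u)).
  by apply: is_derive_eq; rewrite /GRing.scale/=; ring.
by apply/funext => s; rewrite lin_shift dotpZr.
Qed.

Lemma hasgradD f1 f2 g1 g2 : hasgrad f1 g1 -> hasgrad f2 g2 ->
  hasgrad (fun t => f1 t + f2 t) (fun t => g1 t + g2 t).
Proof.
move=> [t1 g1t d1] [t2 g2t d2]; split; [exact: tameD| |].
  by move=> a; apply: tame_ext (tameD (g1t a) (g2t a)) => t; rewrite mxE.
by move=> v t; rewrite dotpDl; apply: is_deriveD.
Qed.

Lemma hasgradM f1 f2 g1 g2 : hasgrad f1 g1 -> hasgrad f2 g2 ->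
  hasgrad (fun t => f1 t * f2 t) (fun t => f1 t *: g2 t + f2 t *: g1 t).
Proof.
move=> [t1 g1t d1] [t2 g2t d2]; split; [exact: tameM| |].
  move=> a; apply: tame_ext (tameD (tameM t1 (g2t a)) (tameM t2 (g1t a))) => t.
  by rewrite !mxE.
move=> v t; rewrite dotpDl !dotpZl.
have := @is_deriveM _ _ _ _ _ _ _ _ (d1 v t) (d2 v t).
by rewrite scale0r shiftt0.
Qed.

Lemma hasgradZ c f g : hasgrad f g -> hasgrad (fun t => c * f t) (fun t => c *: g t).
Proof.
move=> h; apply: hasgrad_ext (hasgradM (hasgrad_cst c) h) => // t.
by rewrite scaler0 addr0.
Qed.

Lemma hasgrad_sum (I : Type) (s : seq I) (f : I -> T -> R) g : (forall i, hasgrad (f i) (g i)) ->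
  hasgrad (fun t => \sum_(i <- s) f i t) (fun t => \sum_(i <- s) g i t).
Proof.
move=> h; elim: s => [|i s IH].
  by apply: hasgrad_ext (hasgrad_cst 0) => t; rewrite big_nil.
by apply: hasgrad_ext (hasgradD (h i) IH) => t; rewrite big_cons.
Qed.

Lemma hasgradX f g n : hasgrad f g ->
  hasgrad (fun t => f t ^+ n) (fun t => (n%:R * f t ^+ n.-1) *: g t).
Proof.
move=> h; elim: n => [|n IH].
  by apply: hasgrad_ext (hasgrad_cst 1) => t; rewrite ?expr0 // mul0r scale0r.
apply: hasgrad_ext (hasgradM h IH) => t; first by rewrite exprS.
rewrite /= scalerA -scalerDl; congr (_ *: _); case: n {IH} => [|n] /=.
  by rewrite mul0r mulr0 add0r expr0 mulr1.
by rewrite mulrCA -exprS -[n.+2%:R]natr1 mulrDl mul1r.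
Qed.

Lemma hasgrad_xr (a : 'I_K) : hasgrad (fun t => xr t 0 a) (fun=> delta_mx 0 a).
Proof.
apply: hasgrad_ext (hasgrad_lin (delta_mx 0 a)) => // t.
by rewrite lin_dotp dotpC dotp_deltar.
Qed.

Lemma hasgrad_xr_mul (M : 'M[R]_K) a :
  hasgrad (fun t => (xr t *m M) 0 a) (fun=> (col a M)^T).
Proof. by apply: hasgrad_ext (hasgrad_lin _) => // t; rewrite xr_mul. Qed.

Lemma gE_ibp_xr (a : 'I_K) f g : hasgrad f g ->
  gE (fun t => xr t 0 a * f t) = gE (fun t => g t 0 a).
Proof.
move=> [tf tg df]; transitivity (gE (fun t => lin (delta_mx 0 a) t * f t)).
  by congr gE; apply/funext => t; rewrite lin_dotp [dotp (delta_mx _ _) _]dotpC dotp_deltar.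
apply: gE_ibp => // t; have := df (delta_mx 0 a) t; rewrite dotp_deltar; exact.
Qed.

Lemma gE_ibp_lin v f g : hasgrad f g ->
  gE (fun t => lin v t * f t) = gE (fun t => dotp v (g t)).
Proof.
move=> [tf tg df]; apply: gE_ibp => //.
  by apply: tame_dotp => // a; exact: tame_cst.
by move=> t; rewrite dotpC; exact: df.
Qed.

Definition qf (M : 'M[R]_K) (t : T) : R := dotp (xr t *m M) (xr t) - \tr M.

(** Integration by parts of x_a (x M)_a f in each coordinate: the derivative of (x M)_a contributes
    [M a a], and these terms add up to the trace subtracted in [qf]. *)
Lemma gE_ibp_qf M f g : hasgrad f g ->
  gE (fun t => qf M t * f t) = gE (fun t => dotp (xr t *m M) (g t)).
Proof.
move=> h; have [tf tg df] := h.
have tx a : tame (fun t => xr t 0 a) by case: (hasgrad_xr a).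
have tM := @tame_xr_mul K M.
have E a : gE (fun t => xr t 0 a * ((xr t *m M) 0 a * f t)) =
    gE (fun t => (xr t *m M) 0 a * g t 0 a) + M a a * gE f.
  rewrite (gE_ibp_xr a (hasgradM (hasgrad_xr_mul M a) h)) -gEZ// -gED//.
  - congr gE; apply/funext => t; rewrite mxE [in X in X + _]mxE; congr (_ + _).
    by rewrite mxE mulrC !mxE.
  - exact: tameM.
  - exact: tameZ.
transitivity (\sum_a gE (fun t => xr t 0 a * ((xr t *m M) 0 a * f t)) - \tr M * gE f).
  rewrite -gE_sum; last by move=> a; exact: tameM (tx a) (tameM (tM a) tf).
  rewrite -gEZ// -gEB//.
  - congr gE; apply/funext => t; rewrite /qf mulrBl; congr (_ - _).
    by rewrite /dotp mulr_suml; apply: eq_bigr => a _; ring.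
  - by apply: tame_sum => a; exact: tameM (tx a) (tameM (tM a) tf).
  - exact: tameZ.
under eq_bigr do rewrite E.
rewrite big_split/= -mulr_suml addrK -gE_sum//.
by move=> a; exact: tameM (tM a) (tg a).
Qed.

Lemma hasgrad_qf M : hasgrad (qf M) (fun t => xr t *m (M + M^T)).
Proof.
have h := hasgradD (hasgrad_sum (index_enum 'I_K) (fun a => hasgradM (hasgrad_xr_mul M a) (hasgrad_xr a)))
  (hasgrad_cst (- \tr M)).
apply: hasgrad_ext h => // t; rewrite addr0.
apply/rowP => b; rewrite summxE mulmxDr mxE.
rewrite (eq_bigr (fun a => (xr t *m M) 0 a * (a == b)%:R + xr t 0 a * M b a)).
  rewrite big_split/=; congr (_ + _).
    rewrite (bigD1 b)//= eqxx mulr1 big1 ?addr0// => i /negbTE->; exact: mulr0.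
  by rewrite mxE; apply: eq_bigr => a _; rewrite [_^T _ _]mxE.
move=> a _; rewrite mxE; congr (_ + _); rewrite !mxE//.
by rewrite eqxx [b == a]eq_sym.
Qed.

Lemma tame_qf M : tame (qf M). Proof. by case: (hasgrad_qf M). Qed.

Lemma gE_qf M : gE (qf M) = 0.
Proof.
have := gE_ibp_qf M (hasgrad_cst 1).
rewrite (_ : (fun t => qf M t * 1) = qf M); last by apply/funext => t; rewrite mulr1.
move=> ->; rewrite (_ : (fun t => _) = (fun=> 0)) ?gE_cst//.
by apply/funext => t; rewrite dotp0r.
Qed.

Lemma dotp_xr M t : dotp (xr t *m M) (xr t) = qf M t + \tr M.
Proof. by rewrite /qf subrK. Qed.

Lemma gE_dotp_xr M : gE (fun t => dotp (xr t *m M) (xr t)) = \tr M.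
Proof.
under eq_fun do rewrite dotp_xr.
rewrite gED ?gE_qf ?gE_cst ?add0r//; [exact: tame_qf|exact: tame_cst].
Qed.

Lemma gE_qf2 M N : gE (fun t => qf M t * qf N t) = \tr (M *m (N + N^T)).
Proof.
rewrite (gE_ibp_qf M (hasgrad_qf N)) -gE_dotp_xr; congr gE; apply/funext => t.
rewrite mulmxA [RHS]dotpMl; congr (dotp _ (_ *m _)).
by apply/matrixP => i j; rewrite !mxE addrC.
Qed.

(** Integration by parts removes one factor. The gradients produce quadratic forms plus constants,
    so only covariances, known from [gE_qf2], and vanishing means remain. *)
Lemma gE_qf3 M1 M2 M3 : M1^T = M1 -> M2^T = M2 -> M3^T = M3 ->
  gE (fun t => qf M1 t * qf M2 t * qf M3 t) = 8 * \tr (M1 *m M2 *m M3).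
Proof.
move=> s1 s2 s3.
pose N1 := M3 *m M1; pose N2 := M3 *m M2.
transitivity (gE (fun t => qf M3 t * (qf M1 t * qf M2 t))).
  by congr gE; apply/funext => t; ring.
rewrite (gE_ibp_qf M3 (hasgradM (hasgrad_qf M1) (hasgrad_qf M2))).
transitivity (gE (fun t => 2 * (qf M1 t * qf N2 t + \tr N2 * qf M1 t) +
   2 * (qf M2 t * qf N1 t + \tr N1 * qf M2 t))).
  congr gE; apply/funext => t; rewrite s1 s2.
  have E (A : 'M[R]_K) : A^T = A -> dotp (xr t *m M3) (xr t *m (A + A)) =
      2 * (qf (M3 *m A) t + \tr (M3 *m A)).
    move=> sA; rewrite -dotp_xr mulmxDr dotpDr mulmxA [in RHS]dotpMl sA; ring.
  rewrite dotpDr !dotpZr (E M1 s1) (E M2 s2) -/N1 -/N2.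
  move: (qf M1 t) (qf M2 t) (qf N1 t) (qf N2 t) (\tr N1) (\tr N2) => *; ring.
have tq := tame_qf.
rewrite gED; last 2 first.
- by apply: tameZ; apply: tameD; [exact: tameM|exact: tameZ].
- by apply: tameZ; apply: tameD; [exact: tameM|exact: tameZ].
have E A B c : gE (fun t => 2 * (qf A t * qf B t + c * qf A t)) = 2 * \tr (A *m (B + B^T)).
  rewrite gEZ; last by apply: tameD; [exact: tameM|exact: tameZ].
  rewrite gED; [|exact: tameM|exact: tameZ].
  by rewrite gEZ// gE_qf mulr0 addr0 gE_qf2.
rewrite !E /N1 /N2 !trmx_mul s1 s2 s3 !mulmxDr !mxtraceD.
have t1 : \tr (M1 *m (M3 *m M2)) = \tr (M1 *m M2 *m M3).
  by rewrite -[LHS]mxtrace_tr !trmx_mul s1 s2 s3 mxtrace_mulC mulmxA.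
have t2 : \tr (M1 *m (M2 *m M3)) = \tr (M1 *m M2 *m M3) by rewrite mulmxA.
have t3 : \tr (M2 *m (M3 *m M1)) = \tr (M1 *m M2 *m M3) by rewrite mulmxA mxtrace_mulC mulmxA.
have t4 : \tr (M2 *m (M1 *m M3)) = \tr (M1 *m M2 *m M3).
  by rewrite -t1 mxtrace_mulC mulmxA.
rewrite t1 t2 t3 t4; ring.
Qed.

(** With U = |x M|^2, integration by parts gives E U^(k+1) <= (2k + 1) |M|_F^2 E U^k, the gradient
    term being controlled by |x M M^T|^2 <= |M|_F^2 U. *)
Lemma gE_moment_sq (M : 'M[R]_K) q :
  gE (fun t => dotp (xr t *m M) (xr t *m M) ^+ q) <= ((2 * q)%N%:R * fro M) ^+ q.
Proof.
pose U t := dotp (xr t *m M) (xr t *m M).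
have UE t : U t = qf (M *m M^T) t + fro M by rewrite fro_trace -dotp_xr mulmxA [RHS]dotpMl trmxK.
have U0 t : 0 <= U t by exact: dotp_ge0.
have gU : hasgrad U (fun t => 2 *: (xr t *m (M *m M^T))).
  apply: hasgrad_ext (hasgradD (hasgrad_qf (M *m M^T)) (hasgrad_cst (fro M))) => t; first by rewrite UE.
  by rewrite addr0 trmx_mul trmxK mulmxDr -mulr2n -scaler_nat.
have tU : tame U by case: gU.
have step k : gE (fun t => U t ^+ k.+1) <= (2 * k + 1)%N%:R * fro M * gE (fun t => U t ^+ k).
  have -> : gE (fun t => U t ^+ k.+1) = gE (fun t => qf (M *m M^T) t * U t ^+ k) + fro M * gE (fun t => U t ^+ k).
    rewrite -gEZ; last exact: tameX.
    rewrite -gED; [|apply: tameM; [exact: tame_qf|exact: tameX]|apply: tameZ; exact: tameX].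
    by congr gE; apply/funext => t; rewrite exprS {1}UE mulrDl.
  rewrite (gE_ibp_qf _ (hasgradX k gU)).
  rewrite (_ : (2 * k + 1)%N%:R = 2 * k%:R + 1 :> R); last by rewrite natrD natrM.
  set G := gE (fun t => U t ^+ k).
  rewrite (_ : _ * _ * G = 2 * k%:R * fro M * G + fro M * G); last by ring.
  rewrite lerD2r /G -gEZ; last exact: tameX.
  have tx := @tame_xr_mul K.
  apply: gE_le.
  - apply: tame_dotp => a; first exact: tx.
    rewrite (_ : (fun t => _) = (fun t => k%:R * U t ^+ k.-1 * (2 * (xr t *m (M *m M^T)) 0 a))).
      by apply: tameM; apply: tameZ; [exact: tameX|exact: tx].
    by apply/funext => t; rewrite !mxE.
  - by apply: tameZ; exact: tameX.
  move=> t; rewrite !dotpZr mulmxA; clear G; case: k => [|k]; first by rewrite !mul0r mulr0 !mul0r.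
  have h : dotp (xr t *m M *m M^T) (xr t *m M *m M^T) <= fro M * U t.
    by rewrite -(fro_tr M); exact: fro_le.
  rewrite /= exprS.
  rewrite (_ : _ * _ = (2 * k.+1%:R * U t ^+ k) * dotp (xr t *m M *m M^T) (xr t *m M *m M^T)); last by ring.
  rewrite [leRHS](_ : _ = (2 * k.+1%:R * U t ^+ k) * (fro M * U t)); last by ring.
  by rewrite ler_wpM2l// !mulr_ge0// exprn_ge0.
have f0 := fro_ge0 M.
suff H k : (k <= q)%N -> gE (fun t => U t ^+ k) <= ((2 * q)%N%:R * fro M) ^+ k by exact: H.
elim: k => [|k IH] kq; first by under eq_fun do rewrite expr0; rewrite gE_cst expr0.
rewrite (le_trans (step k))// exprS ler_pM ?mulr_ge0//.
- by apply: gE_ge0 => t; exact: exprn_ge0.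
- by rewrite ler_wpM2r// ler_nat; lia.
- exact: IH (ltnW kq).
Qed.

(** The leading 2 absorbs the half moment moved to the left side, the power of [4 * q] comes from
    the pointwise splitting, and the rest bounds the moment of the gradient term. *)
Definition momC (q : nat) : R := 2 * ((4 * q)%N%:R ^+ q * (4 ^+ q * (2 * (2 * q)%N%:R ^+ q))).

Lemma momC_ge0 q : 0 <= momC q.
Proof. by rewrite !mulr_ge0// exprn_ge0. Qed.

(* E Q^(2q) = (2q-1) E (Q^(2q-2) T) with T the squared gradient; pointwise this integrand is at most
   Q^(2q)/2 + C_q T^q. *)
Lemma gE_moment_qf (M : 'M[R]_K) q : (0 < q)%N ->
  gE (fun t => qf M t ^+ (2 * q)) <= momC q * fro M ^+ q.
Proof.
move=> q0.
pose U t := dotp (xr t *m M) (xr t *m M).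
pose V t := dotp (xr t *m M^T) (xr t *m M^T).
pose T2 t := dotp (xr t *m M) (xr t *m (M + M^T)).
have U0 t : 0 <= U t by exact: dotp_ge0.
have V0 t : 0 <= V t by exact: dotp_ge0.
have tx := @tame_xr_mul K.
have tU : tame U by apply: tame_dotp => a; exact: tx.
have tV : tame V by apply: tame_dotp => a; exact: tx.
have tT : tame T2 by apply: tame_dotp => a; exact: tx.
have tq := tame_qf M.
have T2le t : `|T2 t| <= 2 * (U t + V t).
  rewrite /T2 mulmxDr dotpDr (le_trans (ler_normD _ _))// -/(U t) (ger0_norm (U0 t)).
  have h : `|dotp (xr t *m M) (xr t *m M^T)| <= U t + V t.
    rewrite -(@ler_pXn2r _ 2)// ?nnegrE ?addr_ge0// real_normK ?num_real//.
    rewrite (le_trans (dotp_CS _ _))// -/(U t) -/(V t).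
    have := U0 t; have := V0 t; move: (U t) (V t) => a b b0 a0; nra.
  by have := V0 t; lra.
set m := (2 * q).-1.
have E1 : gE (fun t => qf M t ^+ (2 * q)) = gE (fun t => m%:R * qf M t ^+ (2 * q).-2 * T2 t).
  transitivity (gE (fun t => qf M t * qf M t ^+ m)).
    by congr gE; apply/funext => t; rewrite -exprS /m prednK//; lia.
  rewrite (gE_ibp_qf _ (hasgradX m (hasgrad_qf M))); congr gE; apply/funext => t.
  by rewrite dotpZr.
pose cq : R := (4 * q)%N%:R ^+ q.
have pw t : m%:R * qf M t ^+ (2 * q).-2 * T2 t <= 2^-1 * qf M t ^+ (2 * q) +
    cq * (2 * (U t + V t)) ^+ q.
  set S := 2 * (U t + V t); have S0 : 0 <= S by rewrite mulr_ge0// addr_ge0.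
  set Q := qf M t ^+ 2; have Q0 : 0 <= Q by exact: sqr_ge0.
  have -> : qf M t ^+ (2 * q).-2 = Q ^+ q.-1 by rewrite /Q -exprM; congr (_ ^+ _); lia.
  have -> : qf M t ^+ (2 * q) = Q * Q ^+ q.-1 by rewrite -exprS prednK// /Q -exprM.
  have h1 : m%:R * Q ^+ q.-1 * T2 t <= m%:R * Q ^+ q.-1 * S.
    apply: ler_wpM2l; first by rewrite mulr_ge0// exprn_ge0.
    exact: le_trans (ler_norm _) (T2le t).
  apply: (le_trans h1); clear h1; clearbody Q S.
  have mq : m%:R <= 2^-1 * (4 * q)%N%:R :> R.
    rewrite natrM mulrA (_ : 2^-1 * 4 = 2%:R) -?natrM ?ler_nat /m; [lia|by field].
  have c0 : 0 <= (4 * q)%N%:R :> R by [].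
  have [h|h] := lerP ((4 * q)%N%:R * S) Q.
    apply: (@le_trans _ _ (2^-1 * (Q * Q ^+ q.-1))); last by rewrite lerDl mulr_ge0// exprn_ge0.
    rewrite [leLHS]mulrAC [leRHS]mulrA ler_wpM2r ?exprn_ge0//.
    apply: (@le_trans _ _ (2^-1 * (4 * q)%N%:R * S)); first by rewrite ler_wpM2r.
    by rewrite -mulrA ler_wpM2l.
  apply: (@le_trans _ _ (cq * S ^+ q)); last by rewrite lerDr mulr_ge0// mulr_ge0// exprn_ge0.
  have -> : cq * S ^+ q = ((4 * q)%N%:R * S) * ((4 * q)%N%:R * S) ^+ q.-1.
    by rewrite -exprS prednK// exprMn.
  move: mq c0 h; set c := (4 * q)%N%:R => mq c0 h; clearbody c.
  rewrite mulrAC ler_pM ?mulr_ge0 ?exprn_ge0//.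
    by rewrite ler_wpM2r//; lra.
  by apply: lerXn2r; rewrite ?nnegrE ?mulr_ge0// ltW.
have tS : tame (fun t => (2 * (U t + V t)) ^+ q).
  by apply: tameX; apply: tameZ; exact: tameD.
have tQ := tameX (2 * q) tq.
have E2 : gE (fun t => qf M t ^+ (2 * q)) <= 2^-1 * gE (fun t => qf M t ^+ (2 * q)) +
    cq * gE (fun t => (2 * (U t + V t)) ^+ q).
  rewrite -!gEZ// -gED; [|exact: tameZ|exact: tameZ].
  rewrite {1}E1; apply: gE_le => //.
    by apply: tameM => //; apply: tameZ; exact: tameX.
  by apply: tameD; exact: tameZ.
have E3 : gE (fun t => (2 * (U t + V t)) ^+ q) <= 4 ^+ q * (2 * (2 * q)%N%:R ^+ q * fro M ^+ q).
  apply: (@le_trans _ _ (gE (fun t => 4 ^+ q * (U t ^+ q + V t ^+ q)))).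
    apply: gE_le => //; first by apply: tameZ; apply: tameD; exact: tameX.
    move=> t; have -> : 4 = 2 * 2 :> R by ring.
    rewrite !exprMn -mulrA ler_wpM2l ?exprn_ge0//; exact: exprD_le2.
  rewrite gEZ; last by apply: tameD; exact: tameX.
  rewrite gED; [|exact: tameX|exact: tameX].
  rewrite ler_wpM2l ?exprn_ge0// -mulrA mulr2n mulrDl !mul1r lerD// -exprMn.
    exact: gE_moment_sq.
  by rewrite -(fro_tr M); exact: gE_moment_sq.
have cq0 : 0 <= cq by exact: exprn_ge0.
have := ler_wpM2l cq0 E3; rewrite /momC -/cq.
set x := gE _ in E2 *; set y := gE _ in E2 *; move: E2.
have -> : cq * (4 ^+ q * (2 * (2 * q)%:R ^+ q * fro M ^+ q)) =
   cq * (4 ^+ q * (2 * (2 * q)%:R ^+ q)) * fro M ^+ q by rewrite !mulrA.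
move: (cq * (4 ^+ q * _)) => z; rewrite -mulrA; move: (z * _) (cq * y) => a b; lra.
Qed.

End gradients.

(** * Anti-concentration *)

Section gaussian_events.
Context {R : realType} (K : nat).
Local Notation T := (K.-tuple R).
Implicit Types b c : T -> bool.

Definition mb b := measurable_fun setT b.
Definition gP b : R := gE (fun t => (b t)%:R).

Lemma tame_bool b : mb b -> tame (fun t => (b t)%:R : R).
Proof.
move=> mb; apply: (@tame_bounded _ _ _ 1); last by move=> t; case: (b t); rewrite ?normr1 ?normr0.
rewrite (_ : (fun t => _) = (fun t => if b t then 1 else 0)); last by apply/funext => t; case: (b t).
by apply: measurable_fun_ifT.
Qed.

Lemma mb_le (f g : T -> R) : tame f -> tame g -> mb (fun t => f t <= g t).
Proof. by move=> [mf _] [mg _]; exact: measurable_fun_ler. Qed.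

Lemma mb_lt (f g : T -> R) : tame f -> tame g -> mb (fun t => f t < g t).
Proof. by move=> [mf _] [mg _]; exact: measurable_fun_ltr. Qed.

Lemma mb_and b c : mb b -> mb c -> mb (fun t => b t && c t).
Proof. exact: measurable_and. Qed.

Lemma mb_or b c : mb b -> mb c -> mb (fun t => b t || c t).
Proof. exact: measurable_or. Qed.

Lemma mb_cst (x : bool) : mb (fun=> x).
Proof. exact: measurable_cst. Qed.

Lemma mb_imply (x : bool) c : mb c -> mb (fun t => x ==> c t).
Proof. by case: x => //= _; exact: mb_cst. Qed.

Lemma mb_exists (J : finType) (b : J -> T -> bool) : (forall j, mb (b j)) ->
  mb (fun t => [exists j, b j t]).
Proof.
move=> h; rewrite (_ : (fun t => _) = (fun t => has (fun j => b j t) (enum J))).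
  elim: (enum J) => [|j s IH]; first exact: mb_cst.
  exact: mb_or.
apply/funext => t; apply/existsP/hasP => [[j bj]|[j _ bj]]; exists j => //.
exact: mem_enum.
Qed.

Lemma mb_forall (J : finType) (b : J -> T -> bool) : (forall j, mb (b j)) ->
  mb (fun t => [forall j, b j t]).
Proof.
move=> h; rewrite (_ : (fun t => _) = (fun t => all (fun j => b j t) (enum J))).
  elim: (enum J) => [|j s IH]; first exact: mb_cst.
  exact: mb_and.
apply/funext => t; apply/forallP/allP => [bj j _|bj j]; first exact: bj.
by apply: bj; exact: mem_enum.
Qed.

Lemma gP_ge0 b : 0 <= gP b.
Proof. by apply: gE_ge0 => t; exact: ler0n. Qed.

Lemma gP_le b c : mb b -> mb c -> (forall t, b t -> c t) -> gP b <= gP c.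
Proof.
move=> mb mc bc; apply: gE_le; [exact: tame_bool|exact: tame_bool|move=> t].
by rewrite ler_nat; case: (b t) (bc t) => // /(_ isT) ->.
Qed.

Lemma gP_le1 b : mb b -> gP b <= 1.
Proof.
move=> mb; rewrite -[leRHS](@gE_cst R K); apply: gE_le; [exact: tame_bool|exact: tame_cst|move=> t].
by case: (b t).
Qed.

Lemma gP_or b c : mb b -> mb c -> gP (fun t => b t || c t) <= gP b + gP c.
Proof.
move=> mb mc; rewrite -gED; [|exact: tame_bool|exact: tame_bool].
apply: gE_le; [by apply: tame_bool; exact: mb_or|by apply: tameD; exact: tame_bool|move=> t].
by rewrite -natrD ler_nat; case: (b t); case: (c t).
Qed.

Lemma gP_exists (J : finType) (b : J -> T -> bool) : (forall j, mb (b j)) ->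
  gP (fun t => [exists j, b j t]) <= \sum_j gP (b j).
Proof.
move=> h; rewrite -gE_sum; last by move=> j; exact: tame_bool.
apply: gE_le; [by apply: tame_bool; exact: mb_exists|by apply: tame_sum => j; exact: tame_bool|move=> t].
case: existsP => [[j bj]|_]; last by rewrite sumr_ge0.
by rewrite (bigD1 j)//= bj lerDl sumr_ge0.
Qed.

Lemma gP_not b : mb b -> gP (fun t => ~~ b t) = 1 - gP b.
Proof.
move=> mb; apply/eqP; rewrite -subr_eq opprK -gED; last 2 first.
- by apply: tame_bool; exact: measurable_neg.
- exact: tame_bool.
rewrite (_ : (fun t => _) = (fun=> 1)) ?gE_cst//.
by apply/funext => t; case: (b t); rewrite ?add0r ?addr0.
Qed.

Lemma gP_markov (f : T -> R) a q : tame f -> 0 < a ->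
  gP (fun t => a <= `|f t|) <= gE (fun t => f t ^+ (2 * q)) / a ^+ (2 * q).
Proof.
move=> tf a0; rewrite mulrC -gEZ; last exact: tameX.
apply: gE_le.
- by apply: tame_bool; apply: mb_le; [exact: tame_cst|exact: tame_norm].
- by apply: tameZ; exact: tameX.
move=> t; have a2 : 0 < a ^+ (2 * q) by exact: exprn_gt0.
have E : f t ^+ (2 * q) = `|f t| ^+ (2 * q) by rewrite !exprM -normrX ger0_norm// sqr_ge0.
rewrite E; case: (lerP a `|f t|) => h; last by rewrite mulr_ge0 ?invr_ge0 ?exprn_ge0// ltW.
rewrite ler_pdivlMl// mulr1; apply: lerXn2r => //; rewrite nnegrE//; exact: ltW.
Qed.

(** A linear form has the absolute value of [x M] for the rank-one matrix M = v^T e_0. Dimension 0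
    is separate because e_0 must exist. *)
Lemma gE_moment_lin (v : 'rV[R]_K) q :
  gE (fun t => lin v t ^+ (2 * q)) <= ((2 * q)%N%:R * dotp v v) ^+ q.
Proof.
case: K v => [|k] v.
  have -> : (fun t => lin v t ^+ (2 * q)) = (fun=> 0 ^+ (2 * q)).
    by apply/funext => t; rewrite /lin big_ord0.
  rewrite gE_cst /dotp big_ord0 mulr0 exprM expr0n//=.
pose M : 'M[R]_k.+1 := v^T *m delta_mx 0 0.
have E a j : M a j = v 0 a * (j == 0)%:R.
  by rewrite mxE big_ord1 !mxE eqxx.
have EM : fro M = dotp v v.
  apply: eq_bigr => a _; rewrite (bigD1 0)//= big1 ?addr0 ?E ?mulr1 ?expr2//.
  by move=> j j0; rewrite E (negbTE j0) mulr0 expr0n.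
have Ex t : dotp (xr t *m M) (xr t *m M) = lin v t ^+ 2.
  have F j : (xr t *m M) 0 j = lin v t * (j == 0)%:R.
    by rewrite mxE lin_dotp dotpC mulr_suml; apply: eq_bigr => a _; rewrite E mulrA.
  rewrite /dotp (bigD1 0)//= big1 ?addr0 ?F ?mulr1//.
  by move=> j j0; rewrite !F (negbTE j0) !mulr0.
rewrite -EM; have := gE_moment_sq M q.
by under eq_fun do rewrite Ex -exprM.
Qed.

Lemma sum_bool_le1 (I : finType) (p : I -> bool) (c : bool) :
  (forall x y, p x -> p y -> x = y) -> (forall x, p x -> c) ->
  \sum_x (p x)%:R <= c%:R :> R.
Proof.
move=> u pc; have [/existsP[x px]|/existsPn h] := boolP [exists x, p x].
  rewrite (pc x px) (bigD1 x)//= px big1 ?addr0// => y yx.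
  by case: (boolP (p y)) => // py; move: yx; rewrite (u _ _ py px) eqxx.
by rewrite big1 => [|x _]; [exact: ler0n|rewrite (negbTE (h x))].
Qed.

(* Moving the points where j is the maximiser, in the band, and lin (e j) <= Lam along l * (2 eps) e j,
   l < m, gives disjoint sets; by Cameron-Martin each has probability at least e^-4 times the original one. *)
Lemma nazarov (J : finType) (P : pred J) (V : J -> T -> R) (e : J -> 'rV[R]_K) b (Lam eps : R) :
  (forall j, tame (V j)) -> mb b ->
  (forall j, P j -> dotp (e j) (e j) = 1) ->
  (forall j t s, P j -> V j (shiftt t (s *: e j)) = V j t + s) ->
  (forall i j t s, P i -> P j -> 0 <= s -> V i (shiftt t (s *: e j)) <= V i t + s) ->
  (forall j t s, P j -> b (shiftt t (s *: e j)) = b t) ->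
  1 <= Lam -> 0 < eps ->
  gP (fun t => [&& b t, [exists j, P j && (0 <= V j t)], [forall j, P j ==> (V j t <= eps)] &
     [forall j, P j ==> (lin (e j) t <= Lam)]]) <= 2 * expR 4 * Lam * eps * gP b.
Proof.
move=> tV mb_ e1 Vj Vi be L1 eps0.
set X := (fun t => [&& _, _, _ & _]).
have mX : mb X.
  apply: mb_and => //; apply: mb_and; first by apply: mb_exists => j; apply: mb_and; [exact: mb_cst|apply: mb_le => //; exact: tame_cst].
  by apply: mb_and; apply: mb_forall => j; apply: mb_imply; apply: mb_le => //; [exact: tame_cst|exact: tame_lin|exact: tame_cst].
have L0 : 0 < Lam by lra.
have Xb : gP X <= gP b by apply: gP_le => // t /andP[].
have e4 : 1 <= expR 4 :> R by rewrite -[leLHS]expR0 ler_expR.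
(* If [Lam * eps >= 1], the right side already dominates [gP b]. *)
have [big|small] := lerP 1 (Lam * eps).
  apply: (le_trans Xb); rewrite ler_peMl ?gP_ge0// -!mulrA mulrA.
  by rewrite (le_trans big)// ler_peMl ?mulr_ge0 ?ltW//; lra.
have Le0 : 0 < Lam * eps by exact: mulr_gt0.
(* As many translates as possible while the total displacement, at most 2 m eps, stays below
   [2 / Lam], so that the Cameron-Martin densities remain bounded below. *)
pose m := Num.truncn (Lam * eps)^-1.
have [m1 m2] : m%:R <= (Lam * eps)^-1 /\ (Lam * eps)^-1 < m.+1%:R.
  have := truncn_itv (_ : 0 <= (Lam * eps)^-1); rewrite invr_ge0 => /(_ (ltW Le0)) /andP[]//.
have mle : m%:R * (Lam * eps) <= 1 by rewrite -ler_pdivlMr// mul1r.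
have m0 : (0 < m)%N.
  rewrite lt0n; apply/eqP => mE; move: m2; rewrite mE invf_lt1//; lra.
have mge : 1 <= 2 * m%:R * (Lam * eps).
  have : 1 < m.+1%:R * (Lam * eps) by rewrite -ltr_pdivrMr// mul1r.
  have : m.+1%:R <= 2 * m%:R :> R by rewrite -natrM ler_nat mul2n -addnn -addn1 leq_add2l.
  move=> h1 h2; rewrite (le_trans (ltW h2))// ler_wpM2r//; exact: ltW.
(* Ties for the maximum go to the smallest rank, so that the maximiser is unique. *)
pose dom j i t := P i ==> ((V i t <= V j t) && ((enum_rank i < enum_rank j)%N ==> (V i t < V j t))).
pose A j t := [&& b t, P j, (0 <= V j t), (V j t <= eps), [forall i, dom j i t] & (lin (e j) t <= Lam)].
have mA j : mb (A j).
  apply: mb_and => //; apply: mb_and; first exact: mb_cst.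
  apply: mb_and; first by apply: mb_le => //; exact: tame_cst.
  apply: mb_and; first by apply: mb_le => //; exact: tame_cst.
  apply: mb_and; last by apply: mb_le => //; [exact: tame_lin|exact: tame_cst].
  apply: mb_forall => i; apply: mb_imply; apply: mb_and; first exact: mb_le.
  by apply: mb_imply; exact: mb_lt.
have XA t : X t -> exists j, A j t.
  move=> /and4P[bt /existsP[j0 /andP[Pj0 Vj0]] /forallP Ve /forallP Vl].
  have [j1 Pj1 max1] : exists2 j1, P j1 & forall i, P i -> V i t <= V j1 t.
    by case: (arg_maxP (fun j => V j t) Pj0) => j1 Pj1 h; exists j1.
  pose Q j := P j && (V j t == V j1 t).
  have Qj1 : Q j1 by rewrite /Q Pj1 eqxx.
  case: (arg_minnP (fun j => enum_rank j : nat) Qj1) => j /andP[Pj /eqP Ej] hj.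
  exists j; rewrite /A bt Pj Ej (le_trans Vj0 (max1 _ Pj0)) -Ej (implyP (Ve j) Pj) (implyP (Vl j) Pj) /= andbT.
  apply/forallP => i; apply/implyP => Pi; rewrite Ej max1//=; apply/implyP => ij.
  rewrite lt_neqAle max1// andbT; apply/negP => /eqP E.
  have := hj i; rewrite /Q Pi E eqxx => /(_ isT); by rewrite leqNgt ij.
have tsh (b0 : T -> bool) v : mb b0 -> tame (fun t => (b0 (shiftt t v))%:R : R).
  by move=> mb0; apply: (tame_shift v (tame_bool mb0)).
(* More than the width of the band, so that translates along one direction are disjoint. Along [e j]
   no component grows faster than [V j], so the maximiser is preserved and translates along
   different directions are disjoint too. *)
pose h := 2 * eps.
have key : \sum_(x : J * 'I_m) gE (fun t => (A x.1 (shiftt t (- (x.2%:R * h) *: e x.1)))%:R) <= gP b.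
  rewrite -gE_sum; last by move=> x; exact: tsh.
  apply: gE_le; [by apply: tame_sum => x; exact: tsh|exact: tame_bool|move=> t].
  have back (x : J * 'I_m) : let t' := shiftt t (- (x.2%:R * h) *: e x.1) in
      t = shiftt t' ((x.2%:R * h) *: e x.1).
    by rewrite /= shiftt_add -scalerDl addNr scale0r shiftt0.
  have h0 (x : J * 'I_m) : 0 <= x.2%:R * h by rewrite mulr_ge0// /h; lra.
  have uniq_j (x y : J * 'I_m) : A x.1 (shiftt t (- (x.2%:R * h) *: e x.1)) ->
      A y.1 (shiftt t (- (y.2%:R * h) *: e y.1)) -> (enum_rank x.1 < enum_rank y.1)%N -> False.
    move=> /and5P[_ Px _ _ /andP[/forallP dx _]] /and5P[_ Py _ _ /andP[/forallP dy _]] xy.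
    have := implyP (dy x.1) Px => /andP[_ /implyP/(_ xy) l1].
    have := implyP (dx y.1) Py => /andP[l2 _].
    have := Vi x.1 y.1 (shiftt t (- (y.2%:R * h) *: e y.1)) _ Px Py (h0 y); rewrite -back.
    have := Vj y.1 (shiftt t (- (y.2%:R * h) *: e y.1)) (y.2%:R * h) Py; rewrite -back.
    have := Vi y.1 x.1 (shiftt t (- (x.2%:R * h) *: e x.1)) _ Py Px (h0 x); rewrite -back.
    have := Vj x.1 (shiftt t (- (x.2%:R * h) *: e x.1)) (x.2%:R * h) Px; rewrite -back.
    move: l1 l2; lra.
  apply: sum_bool_le1 => [x y Ax Ay|x /andP[bx /andP[Px _]]]; last first.
    by rewrite (back x) be.
  have E1 : x.1 = y.1.
    have rk (a c : J) : enum_rank a = enum_rank c :> nat -> a = c.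
      by move=> /val_inj/enum_rank_inj.
    have [l|l|/rk//] := ltngtP (enum_rank x.1) (enum_rank y.1).
    - by case: (uniq_j x y Ax Ay l).
    - by case: (uniq_j y x Ay Ax l).
  have E2 : x.2 = y.2.
    move: Ax Ay; rewrite /A -E1 => /and5P[_ Px V1 V2 _] /and5P[_ _ V3 V4 _].
    have := Vj x.1 (shiftt t (- (x.2%:R * h) *: e x.1)) (x.2%:R * h) Px; rewrite -back.
    have := Vj x.1 (shiftt t (- (y.2%:R * h) *: e x.1)) (y.2%:R * h) Px; rewrite [in V _ (shiftt _ _)]E1 -back.
    rewrite -[in V y.1 t]E1 => H1 H2.
    have hpos : 0 < h by rewrite /h; lra.
    have he : eps < h by rewrite /h; lra.
    have sep (a c : R) (n1 n2 : nat) : 0 <= a <= eps -> 0 <= c <= eps -> (n1 < n2)%N ->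
        a + n2%:R * h = c + n1%:R * h -> False.
      move=> /andP[a0 a1] /andP[c0 c1] l H.
      have l' : n1%:R + 1 <= n2%:R :> R by rewrite natr1 ler_nat.
      have := ler_wpM2r (ltW hpos) l'; rewrite mulrDl mul1r; lra.
    have [l|l|/val_inj//] := ltngtP x.2 y.2.
    - by case: (sep _ _ _ _ _ _ l (etrans (esym H1) H2)); rewrite ?V1 ?V2 ?V3 ?V4.
    - by case: (sep _ _ _ _ _ _ l (etrans (esym H2) H1)); rewrite ?V1 ?V2 ?V3 ?V4.
  by case: x y E1 E2 {Ax Ay} => [x1 x2] [y1 y2] /= -> ->.
have low (x : J * 'I_m) : expR (- 4) * gP (A x.1) <=
    gE (fun t => (A x.1 (shiftt t (- (x.2%:R * h) *: e x.1)))%:R).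
  rewrite (gE_CM _ (tame_bool (mA x.1))) -gEZ; last exact: tame_bool.
  apply: gE_le.
  - by apply: tameZ; exact: tame_bool.
  - apply: tameM; first exact: tame_bool.
    apply: tame_ext (tameZ (expR (- (dotp (- (x.2%:R * h) *: e x.1) (- (x.2%:R * h) *: e x.1) / 2))) (tame_expR_lin (- (x.2%:R * h) *: e x.1))) => t.
    by rewrite -expRD addrC.
  move=> t; case: (boolP (A x.1 t)) => [/and5P[_ Px _ _ /andP[_ lL]]|_]; last by rewrite mulr0 mul0r.
  (* The exponent is - s lin - s^2 / 2, where [s * Lam <= 2] and [Lam >= 1]; hence it is at least
     -4. *)
  rewrite mulr1 mul1r ler_expR linZ dotpZ e1// mulr1.
  set s := x.2%:R * h.
  have s0 : 0 <= s by rewrite mulr_ge0// /h; lra.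
  have sL : s * Lam <= 2.
    apply: (@le_trans _ _ (2 * (m%:R * (Lam * eps)))); last by lra.
    have xm : x.2%:R <= m%:R :> R by rewrite ler_nat ltnW.
    have := ler_wpM2r (ltW Le0) xm; rewrite /s /h; move: x.2%:R m%:R => a c; nra.
  by clearbody s; nra.
have S1 : m%:R * expR (- 4) * \sum_j gP (A j) <= gP b.
  apply: le_trans key; apply: (@le_trans _ _ (\sum_(x : J * 'I_m) expR (- 4) * gP (A x.1))).
    rewrite -(pair_bigA _ (fun j _ => expR (- 4) * gP (A j)))/= mulr_sumr ler_sum// => j _.
    by rewrite sumr_const card_ord -[leRHS]mulr_natl mulrA.
  by apply: ler_sum => x _; exact: low.
have S2 : gP X <= \sum_j gP (A j).
  apply: le_trans (gP_exists mA); apply: gP_le => //; first exact: mb_exists.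
  by move=> t /XA Ax; exact/existsP.
have S0 : 0 <= \sum_j gP (A j) by apply: sumr_ge0 => j _; exact: gP_ge0.
apply: (le_trans S2); move: S1; rewrite expRN; set S := \sum_j _ => S1.
have {}S1 : m%:R * S <= expR 4 * gP b by rewrite mulrC -ler_pdivrMl// mulrA [_ * m%:R]mulrC mulrA.
have : S <= 2 * m%:R * (Lam * eps) * S by rewrite ler_peMl.
move=> /le_trans; apply.
rewrite (_ : _ * S = (2 * (Lam * eps)) * (m%:R * S)); last by ring.
rewrite (_ : _ * gP b = (2 * (Lam * eps)) * (expR 4 * gP b)); last by ring.
by rewrite ler_wpM2l// mulr_ge0// ltW.
Qed.

End gaussian_events.

(** What Markov's inequality of order 2q gives for the event |Q| >= a when |M|_F^2 N^2 <= 32 a^2.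
    The room left by 32 pays for splitting levels into thirds. *)
Definition tail_small (R : realType) (q : nat) (N eta : R) : Prop :=
  momC q * 32 ^+ q / N ^+ (2 * q) <= eta.

Section arith.
Context {R : realFieldType}.
Implicit Types x y z : R.

Lemma ar_eighth x y : 8 * x < y -> x <= 1 / 8 * y. Proof. lra. Qed.
Lemma ar_sq_le1 x : 0 < x -> x <= 1 -> x * x <= 1. Proof. nra. Qed.
Lemma ar_sq_le1' x : 0 <= x -> x <= 1 -> x * x <= 1. Proof. nra. Qed.
Lemma ar_third x : 0 <= x -> x <= 16 * (x / 3 ^+ 2). Proof. lra. Qed.
Lemma ar_sq64 x : - (1 / 8) <= x -> x <= 1 / 8 -> x ^+ 2 <= 1 / 64. Proof. nra. Qed.
Lemma ar_tail (f d m u x : R) : 0 <= u -> d * m <= u -> x * m <= u -> 2 * f * m <= (d + 2 * x) * m ->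
  f * m <= 32 * (u / 3 ^+ 2).
Proof. lra. Qed.
Lemma ar_abs (x u k : R) : k <= u -> - x <= u + k -> x <= u + k -> (x <= 2 * u) && (- (2 * u) <= x).
Proof. lra. Qed.
Lemma ar_quarter (x y z u : R) : 0 < u -> u <= x + (y + z) -> x <= u / 4 -> y < u / 3 -> u / 3 <= z.
Proof. lra. Qed.

Lemma ar_total (a b p q e Je : R) : p <= q -> a <= e -> p + Je + (b + a + Je) + (Je + Je) <= q + b + (4 * Je + e).
Proof. lra. Qed.

Lemma ar_var (x t1 t2 t3 d1 d2 d3 D : R) : 0 <= D -> - (1 / 8 * D) <= x * (2 * t2 - d2) ->
  x ^+ 2 * (2 * t3 - d3) <= 1 / 64 * D -> 2 * t1 - d1 <= D ->
  2 * t1 - 2 * x * (2 * t2) + x ^+ 2 * (2 * t3) <= d1 - 2 * x * d2 + x ^+ 2 * d3 + 2 * D.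
Proof. lra. Qed.

End arith.

Section tails.
Context {R : realType} (K : nat) (q : nat) (N eta : R).
Hypotheses (q0 : (0 < q)%N) (N1 : 1 <= N) (heta : tail_small q N eta).
Local Notation T := (K.-tuple R).

Lemma eta_ge0 : 0 <= eta.
Proof.
apply: le_trans heta; rewrite divr_ge0// ?exprn_ge0 ?mulr_ge0 ?momC_ge0 ?exprn_ge0//; exact: le_trans ler01 N1.
Qed.

Lemma momC_ge : (2 * q)%N%:R ^+ q <= momC q :> R.
Proof.
rewrite /momC; set x := (2 * q)%N%:R ^+ q; have x0 : 0 <= x by exact: exprn_ge0.
have a1 : 1 <= (4 * q)%N%:R ^+ q :> R by rewrite exprn_ege1// ler1n muln_gt0.
have b1 : 1 <= 4 ^+ q :> R by rewrite exprn_ege1//; lra.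
move: ((4 * q)%:R ^+ q) (4 ^+ q) a1 b1 => a b a1 b1.
rewrite (_ : 2 * _ = (4 * a * b) * x); last by ring.
by rewrite ler_peMl//; nra.
Qed.

Lemma tail_lin (w : 'rV[R]_K) (a : R) : 0 < a -> dotp w w * N ^+ 2 <= 16 * a ^+ 2 ->
  gP (fun t => a <= `|lin w t|) <= eta.
Proof.
move=> a0 h; apply: le_trans heta; have N0 := lt_le_trans ltr01 N1.
apply: (le_trans (gP_markov q (tame_lin w) a0)).
rewrite ler_pdivrMr ?exprn_gt0// mulrAC ler_pdivlMr ?exprn_gt0//.
apply: (le_trans (ler_wpM2r _ (gE_moment_lin w q))); first by rewrite exprn_ge0// ltW.
rewrite !exprM -!exprMn.
have : ((2 * q)%N%:R * dotp w w * N ^+ 2) ^+ q <= ((2 * q)%N%:R * (32 * a ^+ 2)) ^+ q.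
  apply: lerXn2r; rewrite ?nnegrE ?mulr_ge0 ?dotp_ge0 ?(ltW N0) ?(ltW a0)//.
  by rewrite -mulrA ler_wpM2l// (le_trans h)// ler_wpM2r ?sqr_ge0//; lra.
move=> /le_trans; apply.
apply: (@le_trans _ _ (momC q * (32 * a ^+ 2) ^+ q)); last first.
  by rewrite [X in _ * X <= _]exprMn mulrA.
rewrite exprMn; apply: ler_wpM2r; last exact: momC_ge.
by rewrite exprn_ge0// mulr_ge0// sqr_ge0.
Qed.

Lemma tail_qf (M : 'M[R]_K) (a : R) : 0 < a -> fro M * N ^+ 2 <= 32 * a ^+ 2 ->
  gP (fun t => a <= `|qf M t|) <= eta.
Proof.
move=> a0 h; apply: le_trans heta; have N0 := lt_le_trans ltr01 N1.
apply: (le_trans (gP_markov q (tame_qf M) a0)).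
rewrite ler_pdivrMr ?exprn_gt0// mulrAC ler_pdivlMr ?exprn_gt0//.
apply: (le_trans (ler_wpM2r _ (gE_moment_qf M q0))); first by rewrite exprn_ge0// ltW.
move: (momC q) (momC_ge0 (R := R) q) => C C0.
rewrite !exprM -!mulrA ler_wpM2l// -!exprMn.
by apply: lerXn2r; rewrite ?nnegrE ?mulr_ge0 ?fro_ge0 ?(ltW N0) ?(ltW a0).
Qed.

End tails.

Lemma froZ (R : realType) m K (a : R) (A : 'M[R]_(m, K)) : fro (a *: A) = a ^+ 2 * fro A.
Proof.
rewrite /fro mulr_sumr; apply: eq_bigr => i _; rewrite mulr_sumr; apply: eq_bigr => j _.
by rewrite mxE exprMn.
Qed.

Lemma fro_sub (R : realType) K (a : R) (A B : 'M[R]_K) : A^T = A -> B^T = B ->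
  fro (A - a *: B) = \tr (A *m A) - 2 * a * \tr (A *m B) + a ^+ 2 * \tr (B *m B).
Proof.
move=> sA sB; rewrite fro_trace (_ : (A - a *: B)^T = A - a *: B); last first.
  by apply/matrixP => i j; rewrite -{2}sA -{2}sB !mxE.
rewrite mulmxBl !mulmxBr -!scalemxAl -!scalemxAr !raddfB/= !mxtraceZ (mxtrace_mulC B A).
ring.
Qed.

(** * Probability that the maximum along the path falls into a thin band *)

Section band.
Context {R : realType} (K : nat) (J : finType) (Mj : J -> 'M[R]_K) (v : J -> 'rV[R]_K).
Context (j1 j1' : J) (N D s0 eta : R) (q : nat).
Hypotheses (Msym : forall j, (Mj j)^T = Mj j) (vM : forall i j, v i *m Mj j = 0).
Hypotheses (Mneg : Mj j1' = - Mj j1) (vneg : v j1' = - v j1).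
Hypotheses (s00 : 0 < s0) (hs0 : s0 ^+ 2 <= dotp (v j1) (v j1)).
Hypothesis (DC : forall i j, `|2 * \tr (Mj i *m Mj j) - dotp (v i) (v j)| <= D).
Hypotheses (q0 : (0 < q)%N) (N1 : 1 <= N) (heta : tail_small q N eta).
Local Notation T := (K.-tuple R).

(** [s] and [c] play the roles of sine and cosine. By [vM], translations along the [v j] leave the
    quadratic parts fixed. [j1] is a component with standard deviation at least [s0]; since [j1'] is
    its opposite, an upper bound on all components bounds |W j1|. *)
Definition W (s c : R) j (t : T) := s * qf (Mj j) t + c * lin (v j) t.

Lemma tame_W s c j : tame (W s c j).
Proof. by apply: tameD; apply: tameZ; [exact: tame_qf|exact: tame_lin]. Qed.

Lemma linN (w : 'rV[R]_K) t : lin (- w) t = - lin w t.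
Proof. by rewrite -scaleN1r linZ mulN1r. Qed.

Lemma qfN (M : 'M[R]_K) t : qf (- M) t = - qf M t.
Proof.
rewrite /qf mulmxN -scaleN1r dotpZl mulN1r raddfN/=.
by rewrite opprD.
Qed.

Lemma qf_shift (M : 'M[R]_K) w t : M^T = M -> w *m M = 0 -> qf M (shiftt t w) = qf M t.
Proof.
move=> sM wM; rewrite /qf xr_shift mulmxDl wM addr0; congr (_ - _).
by rewrite dotpDr [X in _ + X]dotpMl sM wM dotp0r addr0.
Qed.

Lemma W_shift s c j w t : (forall i, w *m Mj i = 0) ->
  W s c j (shiftt t w) = W s c j t + c * dotp (v j) w.
Proof. by move=> wM; rewrite /W qf_shift// lin_shift; ring. Qed.

Lemma W_neg s c t : W s c j1' t = - W s c j1 t.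
Proof.
by rewrite /W Mneg vneg linN qfN; ring.
Qed.

(** The first summand treats the components comparable to [j1]. The second is the product of the
    band estimate inside the event |W j1| <= 2u with the probability of that event, a product in
    which [u] cancels. *)
Definition bandC : R := 2 * expR 4 * 8 / s0 + (2 * expR 4) ^+ 2 * 4 / s0.

Variables (s c u k : R).
Hypotheses (s01 : 0 <= s <= 1) (c0 : 0 < c) (c1 : c <= 1) (u0 : 0 < u) (k0 : 0 < k).
Hypotheses (Nku : N * k <= u) (Dk : D <= k ^+ 2).
Local Notation Wj := (W s c).

Let sig j := Num.sqrt (dotp (v j) (v j)).
Let sig1 := sig j1.
(** The threshold 8 makes the regression coefficient [a j] of the other components at most 1/8 by
    Cauchy-Schwarz; on |W j1| <= 2u the part of [W j] explained by [W j1] is then at most u / 4. *)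
Let big j := sig1 <= 8 * sig j.
Let a j := dotp (v j) (v j1) / sig1 ^+ 2.
Let v' j := v j - a j *: v j1.
Let sig' j := Num.sqrt (dotp (v' j) (v' j)).
Let mid j := ~~ big j && (u <= N * sig' j).

Let sigE j : sig j ^+ 2 = dotp (v j) (v j). Proof. by rewrite sqr_sqrtr// dotp_ge0. Qed.
Let sig'E j : sig' j ^+ 2 = dotp (v' j) (v' j). Proof. by rewrite sqr_sqrtr// dotp_ge0. Qed.
Let sig_ge0 j : 0 <= sig j. Proof. exact: sqrtr_ge0. Qed.
Let sig'_ge0 j : 0 <= sig' j. Proof. exact: sqrtr_ge0. Qed.

Let sig1_ge : s0 <= sig1.
Proof. rewrite -(@ler_pXn2r _ 2)// ?nnegrE ?(ltW s00) ?sqrtr_ge0//.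
by have := sigE j1; rewrite -/sig1 => ->. Qed.

Let sig1_gt0 : 0 < sig1. Proof. exact: lt_le_trans sig1_ge. Qed.
Let N0 : 0 < N. Proof. exact: lt_le_trans ltr01 N1. Qed.
Let eta0 : 0 <= eta. Proof. exact: eta_ge0 heta. Qed.
Let ku : k <= u. Proof. by apply: le_trans Nku; rewrite ler_peMl// ltW. Qed.

Let CSn (x y : 'rV[R]_K) (sx sy : R) : 0 <= sx -> 0 <= sy -> dotp x x = sx ^+ 2 -> dotp y y = sy ^+ 2 ->
  `|dotp x y| <= sx * sy.
Proof.
move=> sx0 sy0 Ex Ey.
rewrite -(@ler_pXn2r _ 2)// ?nnegrE ?mulr_ge0// real_normK ?num_real//.
by rewrite (le_trans (dotp_CS _ _))// Ex Ey exprMn.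
Qed.

Let CS (x y : 'rV[R]_K) (sx sy : R) : 0 <= sx -> 0 <= sy -> dotp x x = sx ^+ 2 -> dotp y y = sy ^+ 2 ->
  dotp x y <= sx * sy.
Proof. by move=> sx0 sy0 Ex Ey; apply: (le_trans (ler_norm _)); exact: CSn. Qed.

Let v'1 j : dotp (v' j) (v j1) = 0.
Proof.
rewrite /v' dotpBl dotpZl -[dotp (v j1) _]sigE /a divfK ?subrr//.
by rewrite expf_neq0// gt_eqF.
Qed.

Let spanM w : (exists x y j, w = x *: (v j - y *: v j1)) -> forall i, w *m Mj i = 0.
Proof.
by move=> [x [y [j ->]]] i; rewrite -scalemxAl mulmxBl -scalemxAl !vM scaler0 subr0 scaler0.
Qed.

Lemma unit_tail (w : 'rV[R]_K) : dotp w w = 1 -> gP (fun t => ~~ (lin w t <= N)) <= eta.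
Proof.
move=> w1; apply: le_trans (tail_lin q0 N1 heta N0 (_ : dotp w w * N ^+ 2 <= 16 * N ^+ 2)).
  apply: gP_le.
  - by apply: measurable_neg; apply: mb_le; [exact: tame_lin|exact: tame_cst].
  - by apply: mb_le; [exact: tame_cst|apply: tame_norm; exact: tame_lin].
  - by move=> t; rewrite -ltNge => /ltW h; rewrite (le_trans h)// ler_norm.
by rewrite w1 ler_wpM2r ?sqr_ge0//; lra.
Qed.

(** [nazarov] after normalisation: dividing by [c * sg j] and taking unit directions makes each
    [V j] move at unit speed, and the others at most at that speed by Cauchy-Schwarz. The event that
    a unit direction exceeds [N] costs [eta] per component. *)
Lemma nazarov_W (P : pred J) (d : J -> 'rV[R]_K) (sg : J -> R) b (lo wd ep : R) :
  mb b -> (forall j, P j -> 0 < sg j) -> (forall j, P j -> dotp (d j) (d j) = sg j ^+ 2) ->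
  (forall i j, P i -> P j -> dotp (v i) (d j) = dotp (d i) (d j)) ->
  (forall j, P j -> forall i, d j *m Mj i = 0) ->
  (forall j t x, P j -> b (shiftt t (x *: d j)) = b t) ->
  0 < ep -> (forall j, P j -> wd <= ep * (c * sg j)) ->
  gP (fun t => b t && ([exists j, P j && (lo <= Wj j t)] && [forall j, P j ==> (Wj j t <= lo + wd)]))
    <= 2 * expR 4 * N * ep * gP b + #|J|%:R * eta.
Proof.
move=> mb_ sg0 dd vd dM bd ep0 wdep.
pose e j := (sg j)^-1 *: d j.
pose V j t := (c * sg j)^-1 * (Wj j t - lo).
have e1 j : P j -> dotp (e j) (e j) = 1.
  move=> Pj; rewrite dotpZl dotpZr dd// mulrA -expr2 exprVn mulVf//.
  by rewrite expf_neq0// gt_eqF// sg0.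
have eM j : P j -> forall i, e j *m Mj i = 0 by move=> Pj i; rewrite -scalemxAl dM// scaler0.
have tV j : tame (V j) by apply: tameZ; apply: tameB; [exact: tame_W|exact: tame_cst].
have Vsh i j t x : P i -> P j -> V i (shiftt t (x *: e j)) = V i t + x * (dotp (d i) (d j) / (sg i * sg j)).
  move=> Pi Pj; rewrite /V W_shift; last by move=> l; rewrite -scalemxAl eM// scaler0.
  rewrite dotpZr dotpZr vd//; field.
  by rewrite !gt_eqF//= ?sg0.
have mX : mb (fun t => [&& b t, [exists j, P j && (0 <= V j t)], [forall j, P j ==> (V j t <= ep)] &
     [forall j, P j ==> (lin (e j) t <= N)]]).
  apply: mb_and => //; apply: mb_and; first by apply: mb_exists => j; apply: mb_and; [exact: mb_cst|apply: mb_le => //; exact: tame_cst].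
  by apply: mb_and; apply: mb_forall => j; apply: mb_imply; apply: mb_le => //; [exact: tame_cst|exact: tame_lin|exact: tame_cst].
have mY j : mb (fun t => P j && ~~ (lin (e j) t <= N)).
  apply: mb_and; first exact: mb_cst.
  by apply: measurable_neg; apply: mb_le; [exact: tame_lin|exact: tame_cst].
apply: (@le_trans _ _ (gP (fun t => [&& b t, [exists j, P j && (0 <= V j t)], [forall j, P j ==> (V j t <= ep)] &
     [forall j, P j ==> (lin (e j) t <= N)]] || [exists j, P j && ~~ (lin (e j) t <= N)]))).
  apply: gP_le.
  - apply: mb_and => //; apply: mb_and; [apply: mb_exists => j; apply: mb_and; first exact: mb_cst|apply: mb_forall => j; apply: mb_imply].
      by apply: mb_le; [exact: tame_cst|exact: tame_W].
    by apply: mb_le; [exact: tame_W|exact: tame_cst].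
  - by apply: mb_or => //; exact: mb_exists.
  move=> t /andP[-> /andP[/existsP[j /andP[Pj lj]] /forallP hj]] /=.
  have [E|/existsPn nE] := boolP [exists j, P j && ~~ (lin (e j) t <= N)]; first by rewrite orbT.
  rewrite orbF; apply/and3P; split.
  - apply/existsP; exists j; rewrite Pj /V mulr_ge0 ?subr_ge0// invr_ge0 mulr_ge0 ?ltW// sg0//.
  - apply/forallP => i; apply/implyP => Pi; rewrite /V ler_pdivrMl ?mulr_gt0 ?sg0//.
    have := implyP (hj i) Pi; have := wdep i Pi; rewrite mulrC; lra.
  - apply/forallP => i; apply/implyP => Pi; have := nE i; rewrite Pi/= negbK//.
apply: (le_trans (gP_or mX (mb_exists mY))); apply: lerD.
  apply: nazarov => //.
  - move=> j t x Pj; rewrite Vsh// dd// -expr2 divff ?mulr1//.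
    by rewrite expf_neq0// gt_eqF// sg0.
  - move=> i j t x Pi Pj x0; rewrite Vsh// lerD2l ler_piMr// ler_pdivrMr ?mulr_gt0 ?sg0// mul1r.
    by apply: CS; rewrite ?dd// ltW// sg0.
  - by move=> j t x Pj; rewrite scalerA bd.
apply: (le_trans (gP_exists mY)).
apply: (@le_trans _ _ (\sum_(j : J) eta)); last by rewrite sumr_const mulr_natl.
apply: ler_sum => j _; have [Pj|nPj] := boolP (P j).
  exact: unit_tail (e1 j Pj).
rewrite (_ : (fun t => _) = (fun=> false)) ?/gP ?gE_cst//.
Qed.

Lemma level_tail : gP (fun t => (Wj j1 t <= 2 * u) && (- (2 * u) <= Wj j1 t)) <=
  2 * expR 4 * N * (4 * u / (c * s0)) + #|J|%:R * eta.
Proof.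
have ep0 : 0 < 4 * u / (c * s0) by rewrite divr_gt0 ?mulr_gt0//.
have := @nazarov_W (pred1 j1) v sig (fun=> true) (- (2 * u)) (4 * u) (4 * u / (c * s0)) (mb_cst true).
move=> h; apply: le_trans (le_trans (h _ _ _ _ _ ep0 _) _).
- apply: gP_le.
  + by apply: mb_and; apply: mb_le; [exact: tame_W|exact: tame_cst|exact: tame_cst|exact: tame_W].
  + apply: mb_and; first exact: mb_cst.
    apply: mb_and; [apply: mb_exists => j; apply: mb_and; first exact: mb_cst|apply: mb_forall => j; apply: mb_imply].
      by apply: mb_le; [exact: tame_cst|exact: tame_W].
    by apply: mb_le; [exact: tame_W|exact: tame_cst].
  + move=> t /andP[h1 h2] /=; apply/andP; split; first by apply/existsP; exists j1; rewrite eqxx.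
    by apply/forallP => i; apply/implyP => /eqP ->; lra.
- by move=> j /eqP->.
- by move=> j _; rewrite sigE.
- by move=> i j _ /eqP->.
- by move=> j _ i; exact: vM.
- by [].
- move=> j /eqP ->; rewrite -/sig1 -mulrA ler_peMr//; first by rewrite mulr_ge0// ltW.
  by rewrite mulrC ler_pdivlMr ?mulr_gt0// mul1r ler_wpM2l// ltW.
- by rewrite lerD2r /gP gE_cst mulr1.
Qed.

(* Components whose standard deviation is comparable to that of component j1 are moved along v j. The others
   are decomposed as a j * W j1 + (residual), and moved along the residual direction, which leaves W j1, hence
   the event |W j1| <= 2u of probability O(u), unchanged; if the residual is tiny, it cannot reach level u. *)
Lemma band_prob :
  gP (fun t => [exists j, u <= Wj j t] && [forall j, Wj j t <= u + k]) <=
  bandC * N ^+ 3 * k / c ^+ 2 + (4 + 2 * expR 4 * (N / c)) * (#|J|%:R * eta).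
Proof.
pose b t := (Wj j1 t <= 2 * u) && (- (2 * u) <= Wj j1 t).
have mbb : mb b.
  by apply: mb_and; apply: mb_le; [exact: tame_W|exact: tame_cst|exact: tame_cst|exact: tame_W].
pose ev (P : pred J) (b0 : T -> bool) t := b0 t && ([exists j, P j && (u <= Wj j t)] && [forall j, P j ==> (Wj j t <= u + k)]).
have mev P b0 : mb b0 -> mb (ev P b0).
  move=> mb0; apply: mb_and => //; apply: mb_and; [apply: mb_exists => j; apply: mb_and; first exact: mb_cst|apply: mb_forall => j; apply: mb_imply].
    by apply: mb_le; [exact: tame_cst|exact: tame_W].
  by apply: mb_le; [exact: tame_W|exact: tame_cst].
have sigb j : big j -> s0 / 8 <= sig j.
  by rewrite /big ler_pdivrMr// mulrC; apply: le_trans.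
have sigb0 j : big j -> 0 < sig j by move=> /sigb; apply: lt_le_trans; rewrite divr_gt0.
have sigm j : mid j -> u / N <= sig' j by move=> /andP[_ h]; rewrite ler_pdivrMr// mulrC.
have sigm0 j : mid j -> 0 < sig' j by move=> /sigm; apply: lt_le_trans; rewrite divr_gt0.
have P1 : gP (ev big (fun=> true)) <= 2 * expR 4 * N * (8 * k / (c * s0)) + #|J|%:R * eta.
  have ep0 : 0 < 8 * k / (c * s0) by rewrite divr_gt0 ?mulr_gt0.
  have h := @nazarov_W big v sig (fun=> true) u k (8 * k / (c * s0)) (mb_cst true).
  apply: le_trans (h _ _ _ _ _ ep0 _) _ => //.
  - move=> j /sigb bj.
    have -> : 8 * k / (c * s0) * (c * sig j) = k * (8 * sig j / s0) by field; rewrite !gt_eqF.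
    by rewrite ler_peMr ?(ltW k0)// ler_pdivlMr// mul1r -ler_pdivrMl// mulrC.
  - by rewrite lerD2r /gP gE_cst mulr1.
have P2 : gP (ev mid b) <= 2 * expR 4 * N * (k * N / (c * u)) * gP b + #|J|%:R * eta.
  have ep0 : 0 < k * N / (c * u) by rewrite divr_gt0 ?mulr_gt0.
  have dv i j : dotp (v i) (v' j) = dotp (v' i) (v' j).
    by rewrite {2}/v' dotpBl dotpZl [dotp (v j1) _]dotpC v'1 mulr0 subr0.
  have v'M j i : v' j *m Mj i = 0 by apply: spanM; exists 1, (a j), j; rewrite scale1r.
  apply: (@nazarov_W mid v' sig' b u k (k * N / (c * u)) mbb) => //.
  - by move=> j t x _; rewrite /b W_shift ?dotpZr ?[dotp (v j1) _]dotpC ?v'1 ?mulr0 ?addr0// => i; rewrite -scalemxAl v'M scaler0.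
  - move=> j /sigm bj.
    have -> : k * N / (c * u) * (c * sig' j) = k * (sig' j * N / u) by field; rewrite !gt_eqF.
    by rewrite ler_peMr ?(ltW k0)// ler_pdivlMr// mul1r -ler_pdivrMr.
pose M' j := s *: (Mj j - a j *: Mj j1).
pose z' j := c *: v' j.
pose rest j := ~~ big j && ~~ mid j.
pose r1 j t := rest j && (u / 3 <= `|qf (M' j) t|).
pose r2 j t := rest j && (u / 3 <= `|lin (z' j) t|).
have u3 : 0 < u / 3 by rewrite divr_gt0.
have m1 j : mb (r1 j) by apply: mb_and; [exact: mb_cst|apply: mb_le; [exact: tame_cst|apply: tame_norm; exact: tame_qf]].
have m2 j : mb (r2 j) by apply: mb_and; [exact: mb_cst|apply: mb_le; [exact: tame_cst|apply: tame_norm; exact: tame_lin]].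
have tiny j : rest j -> `|a j| <= 1 / 8 /\ dotp (v' j) (v' j) * N ^+ 2 <= u ^+ 2.
  move=> /andP[nb nm]; split; last first.
    move: nm; rewrite /mid nb/= -ltNge => h; rewrite -sig'E -exprMn mulrC.
    by apply: lerXn2r; rewrite ?nnegrE ?mulr_ge0 ?(ltW u0) ?(ltW N0)// ltW.
  rewrite /a normrM normfV [`|sig1 ^+ 2|]ger0_norm ?sqr_ge0// ler_pdivrMr ?exprn_gt0//.
  have n1 : `|dotp (v j) (v j1)| <= sig j * sig1.
    exact: (CSn (sig_ge0 j) (sig_ge0 j1) (esym (sigE j)) (esym (sigE j1))).
  apply: (le_trans n1); move: nb; rewrite /big -ltNge expr2 mulrA => h.
  by rewrite ler_wpM2r ?(ltW sig1_gt0)//; exact: ar_eighth.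
have T2 j : gP (r2 j) <= eta.
  rewrite /r2; case: (boolP (rest j)) => rj; last first.
    by rewrite (_ : (fun t => _) = (fun=> false)) ?/gP ?gE_cst.
  apply: (tail_lin q0 N1 heta u3); rewrite /z' dotpZl dotpZr.
  have [_ h] := tiny j rj; have d0 := dotp_ge0 (v' j).
  have : c * (c * dotp (v' j) (v' j)) * N ^+ 2 <= dotp (v' j) (v' j) * N ^+ 2.
    by rewrite ler_wpM2r ?sqr_ge0// mulrA ler_piMl//; exact: ar_sq_le1.
  by move=> /le_trans; apply; apply: (le_trans h); rewrite expr_div_n; exact: ar_third (sqr_ge0 u).
have T1 j : gP (r1 j) <= eta.
  rewrite /r1; case: (boolP (rest j)) => rj; last first.
    by rewrite (_ : (fun t => _) = (fun=> false)) ?/gP ?gE_cst.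
  apply: (tail_qf q0 N1 heta u3).
  have [aj h] := tiny j rj.
  (* The left side is the variance of the quadratic residual. Quadratic and linear parts have the
     same covariances up to [D], so it inherits the smallness of |v' j|^2; [a j] at most 1/8 keeps
     the error below 2D. *)
  have F : 2 * fro (Mj j - a j *: Mj j1) <= dotp (v' j) (v' j) + 2 * D.
    have E : 2 * fro (Mj j - a j *: Mj j1) = 2 * \tr (Mj j *m Mj j) - 2 * a j * (2 * \tr (Mj j *m Mj j1)) +
        a j ^+ 2 * (2 * \tr (Mj j1 *m Mj j1)).
      by rewrite fro_sub// !mulrDr; ring.
    have E' : dotp (v' j) (v' j) = dotp (v j) (v j) - 2 * a j * dotp (v j) (v j1) + a j ^+ 2 * dotp (v j1) (v j1).
      rewrite /v' !dotpBl [dotp (v j) (_ - _)]dotpC [dotp (_ *: _) (_ - _)]dotpC !dotpBl.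
      by rewrite !dotpZl !dotpZr [dotp (v j1) (v j)]dotpC; ring.
    rewrite E E'; have := DC j j; have := DC j j1; have := DC j1 j1.
    rewrite !ler_norml => /andP[_ h1] /andP[h2 h3] /andP[_ h4]; move: aj; rewrite ler_norml => /andP[a1 a2].
    have D0 : 0 <= D by apply: le_trans (DC j j).
    have g1 : `|a j * (2 * \tr (Mj j *m Mj j1) - dotp (v j) (v j1))| <= 1 / 8 * D.
      by rewrite normrM ler_pM// ler_norml; apply/andP.
    have g2 : a j ^+ 2 * (2 * \tr (Mj j1 *m Mj j1) - dotp (v j1) (v j1)) <= 1 / 64 * D.
      by apply: (le_trans (ler_wpM2l (sqr_ge0 _) h1)); rewrite ler_wpM2r//; exact: ar_sq64.
    by move: g1; rewrite ler_norml => /andP[g1 _]; exact: (ar_var D0 g1 g2 h4).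
  have F2 : fro (M' j) <= fro (Mj j - a j *: Mj j1).
    rewrite /M' froZ ler_piMl ?fro_ge0// expr2.
    by move: s01 => /andP[]; exact: ar_sq_le1'.
  have kN : k ^+ 2 * N ^+ 2 <= u ^+ 2.
    by rewrite -exprMn [k * N]mulrC; apply: lerXn2r; rewrite ?nnegrE ?mulr_ge0 ?(ltW u0) ?(ltW N0) ?(ltW k0).
  have DN : D * N ^+ 2 <= u ^+ 2 by rewrite (le_trans _ kN)// ler_wpM2r ?sqr_ge0.
  apply: (le_trans (ler_wpM2r (sqr_ge0 _) F2)).
  rewrite expr_div_n; apply: (ar_tail (sqr_ge0 u) h DN).
  by rewrite ler_wpM2r// sqr_ge0.
have cover t : [exists j, u <= Wj j t] && [forall j, Wj j t <= u + k] ->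
    (ev big (fun=> true) t || ev mid b t) || ([exists j, r1 j t] || [exists j, r2 j t]).
  move=> /andP[/existsP[j uj] /forallP all_].
  have fa P : [forall i, P i ==> (Wj i t <= u + k)] by apply/forallP => i; rewrite all_ implybT.
  have bt : b t.
    by rewrite /b; have := all_ j1; have := all_ j1'; rewrite W_neg; exact: ar_abs ku.
  have [bj|nbj] := boolP (big j).
    by rewrite {1}/ev fa andbT /= (_ : [exists _, _]) //; apply/existsP; exists j; rewrite bj.
  have [mj|nmj] := boolP (mid j).
    have -> : ev mid b t by rewrite /ev bt fa andbT; apply/existsP; exists j; rewrite mj.
    by rewrite orbT.
  have rj : rest j by rewrite /rest nbj nmj.
  have [aj _] := tiny j rj.
  have E : Wj j t = a j * Wj j1 t + (qf (M' j) t + lin (z' j) t).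
    rewrite /W /z' /v' linZ linB linZ /M' /qf -scalemxAr dotpZl mxtraceZ mulmxBr -scalemxAr dotpBl dotpZl.
    by rewrite raddfB/= mxtraceZ; ring.
  have aW : a j * Wj j1 t <= u / 4.
    rewrite (le_trans (ler_norm _))// normrM (_ : u / 4 = 1 / 8 * (2 * u)); last by field.
    by rewrite ler_pM// ler_norml andbC.
  have [h1|h1] := lerP (u / 3) `|qf (M' j) t|.
    have -> : [exists j, r1 j t] by apply/existsP; exists j; rewrite /r1 rj h1.
    by rewrite orbT.
  have -> : [exists j, r2 j t].
    apply/existsP; exists j; rewrite /r2 rj/=; apply: le_trans (ler_norm _).
    move: h1; rewrite ltr_norml => /andP[_ h1]; move: uj; rewrite E => uj; exact: ar_quarter u0 uj aW h1.
  by rewrite !orbT.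
have mE1 : mb (fun t => [exists j, r1 j t]) by exact: mb_exists.
have mE2 : mb (fun t => [exists j, r2 j t]) by exact: mb_exists.
have me1 : mb (ev big (fun=> true)) by apply: mev; exact: mb_cst.
have me2 : mb (ev mid b) by exact: mev.
have tot : gP (fun t => [exists j, u <= Wj j t] && [forall j, Wj j t <= u + k]) <=
   (gP (ev big (fun=> true)) + gP (ev mid b)) + (#|J|%:R * eta + #|J|%:R * eta).
  apply: (@le_trans _ _ (gP (fun t => (ev big (fun=> true) t || ev mid b t) || ([exists j, r1 j t] || [exists j, r2 j t])))).
    apply: gP_le => //.
    - by apply: mb_and; [apply: mb_exists|apply: mb_forall] => j; apply: mb_le; [exact: tame_cst|exact: tame_W|exact: tame_W|exact: tame_cst].
    - by apply: mb_or; exact: mb_or.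
  apply: (le_trans (gP_or (mb_or me1 me2) (mb_or mE1 mE2))); apply: lerD; first exact: gP_or.
  apply: (le_trans (gP_or mE1 mE2)); apply: lerD.
    by apply: (le_trans (gP_exists m1)); rewrite mulr_natl -sumr_const ler_sum.
  by apply: (le_trans (gP_exists m2)); rewrite mulr_natl -sumr_const ler_sum.
apply: (le_trans tot).
have B1 : gP b <= 2 * expR 4 * N * (4 * u / (c * s0)) + #|J|%:R * eta := level_tail.
have x0 : 0 <= 2 * expR 4 * N * (k * N / (c * u)).
  by rewrite !mulr_ge0 ?invr_ge0 ?mulr_ge0 ?expR_ge0 ?(ltW N0) ?(ltW k0) ?(ltW c0) ?(ltW u0).
have P2' := le_trans P2 (lerD (ler_wpM2l x0 B1) (lexx _)).
have Je0 : 0 <= #|J|%:R * eta by rewrite mulr_ge0.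
move: P1 P2' => /le_trans P1 /le_trans P2'.
set Je := #|J|%:R * eta in Je0 *; set C := 2 * expR 4 in x0 P1 P2' *.
have C0 : 0 <= C by rewrite mulr_ge0 ?expR_ge0.
have Q1 : C * N * (8 * k / (c * s0)) <= C * 8 / s0 * N ^+ 3 * k / c ^+ 2.
  have -> : C * 8 / s0 * N ^+ 3 * k / c ^+ 2 = C * N * (8 * k / (c * s0)) * (N ^+ 2 / c) by field; rewrite !gt_eqF.
  rewrite ler_peMr ?mulr_ge0 ?invr_ge0 ?mulr_ge0 ?(ltW N0) ?(ltW k0) ?(ltW c0) ?(ltW s00)//.
  by rewrite ler_pdivlMr// mul1r (le_trans c1)// exprn_ege1.
have Q2 : C * N * (k * N / (c * u)) * (C * N * (4 * u / (c * s0))) = C ^+ 2 * 4 / s0 * N ^+ 3 * k / c ^+ 2.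
  by field; rewrite !gt_eqF.
have Q3 : C * N * (k * N / (c * u)) * Je <= C * (N / c) * Je.
  rewrite ler_wpM2r//.
  have -> : C * N * (k * N / (c * u)) = C * (N / c) * (N * k / u) by field; rewrite !gt_eqF.
  rewrite ler_piMr//; last by rewrite ler_pdivrMr// mul1r.
  by rewrite mulr_ge0// divr_ge0// ltW.
apply: le_trans (_ : (C * N * (8 * k / (c * s0)) + Je + (C * N * (k * N / (c * u)) *
   (C * N * (4 * u / (c * s0)) + Je) + Je)) + (Je + Je) <= _).
  by rewrite lerD2r; apply: lerD; [apply: P1|apply: P2'].
rewrite [_ * (_ + Je)]mulrDr Q2.
have -> : bandC * N ^+ 3 * k / c ^+ 2 = C * 8 / s0 * N ^+ 3 * k / c ^+ 2 + C ^+ 2 * 4 / s0 * N ^+ 3 * k / c ^+ 2.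
  by rewrite /bandC -/C; ring.
have -> : (4 + C * (N / c)) * Je = 4 * Je + C * (N / c) * Je by ring.
exact: (ar_total _ _ Q1 Q3).
Qed.

End band.

(** * Interpolation of a smooth maximum *)

Section calculus.
Context {R : realType}.

Lemma is_derive_addR (f g : R -> R) (x df dg : R) : is_derive x 1 f df -> is_derive x 1 g dg ->
  is_derive x 1 (fun y => f y + g y) (df + dg).
Proof. by move=> h1 h2; apply: is_deriveD. Qed.

Lemma is_derive_cstR (a x : R) : is_derive x 1 (fun=> a) 0.
Proof. exact: is_derive_cst. Qed.

Lemma derive_nonpos_le (h dh : R -> R) (a b : R) : a <= b ->
  (forall x : R, is_derive x 1 h (dh x)) -> (forall x, a < x < b -> dh x <= 0) -> h b <= h a.
Proof.
move=> ab d1 d0; apply: (@ler0_derive1_nincr R h a b) => //.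
- by move=> x; rewrite in_itv/= => xab; rewrite derive1E derive_val; exact: d0.
- apply: continuous_subspaceT => x; apply: differentiable_continuous.
  by apply/derivable1_diffP; case: (d1 x).
Qed.

Lemma derive_comparison (h dh psi dpsi : R -> R) (a b : R) : a <= b ->
  (forall x : R, is_derive x 1 h (dh x)) -> (forall x : R, is_derive x 1 psi (dpsi x)) ->
  (forall x, a < x < b -> `|dh x| <= dpsi x) -> `|h b - h a| <= psi b - psi a.
Proof.
move=> ab d1 d2 le.
have h1 : h b - psi b <= h a - psi a.
  apply: (@derive_nonpos_le (fun x => h x - psi x) (fun x => dh x - dpsi x) a b ab).
  by move=> x /le; rewrite ler_norml => /andP[_]; rewrite subr_le0.
have h2 : - h b - psi b <= - h a - psi a.
  apply: (@derive_nonpos_le (fun x => - h x - psi x) (fun x => - dh x - dpsi x) a b ab).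
  by move=> x /le; rewrite ler_norml => /andP[+ _]; rewrite subr_le0 lerNl.
by rewrite ler_norml; move: (h a) (h b) (psi a) (psi b) h1 h2 => *; lra.
Qed.

Lemma is_derive_sum_fin (J : finType) (f : J -> R -> R) (df : J -> R) (x : R) :
  (forall j, is_derive x 1 (f j) (df j)) -> is_derive x 1 (fun s => \sum_j f j s) (\sum_j df j).
Proof.
move=> h; rewrite (_ : (fun s => _) = \sum_j f j); last by apply/funext => s; rewrite fct_sumE.
elim/big_rec2: _ => [|j y1 y2 _ d]; first exact: is_derive_cst.
exact: is_deriveD.
Qed.

End calculus.

Section softmax.
Context {R : realType} (J : finType) (B u : R).
Implicit Types y : J -> R.

Definition sme y j := expR (B * (y j - u)).
Definition smS y := \sum_j sme y j.
(* A smooth version of the indicator of [forall j, y j < u]. *)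
Definition sm y := (1 + smS y)^-1.
(** [sm1] and [sm2] are the first and second partial derivatives of [sm]. *)
Definition sm1 j y := - (B * sme y j * sm y ^+ 2).
Definition sm2 j k y := - ((j == k)%:R * (B ^+ 2 * sme y j * sm y ^+ 2)) +
  2 * B ^+ 2 * (sme y j * sme y k * sm y ^+ 3).

Lemma sme_ge0 y j : 0 <= sme y j. Proof. exact: expR_ge0. Qed.
Lemma smS_ge0 y : 0 <= smS y. Proof. by apply: sumr_ge0 => j _; exact: sme_ge0. Qed.
Lemma sm_pos y : 0 < 1 + smS y. Proof. by rewrite ltr_wpDr// smS_ge0. Qed.
Lemma sm_gt0 y : 0 < sm y. Proof. by rewrite invr_gt0 sm_pos. Qed.
Lemma sm_ge0 y : 0 <= sm y. Proof. exact/ltW/sm_gt0. Qed.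
Lemma sm_le1 y : sm y <= 1. Proof. by rewrite invf_le1 ?sm_pos// lerDl smS_ge0. Qed.
Lemma sme_le_S y j : sme y j <= smS y.
Proof. by rewrite /smS (bigD1 j)//= lerDl; apply: sumr_ge0 => i _; exact: sme_ge0. Qed.
Lemma sm_S_le1 y : smS y * sm y <= 1.
Proof. by rewrite ler_pdivrMr ?sm_pos// mul1r lerDr. Qed.
Lemma sme_sm_le1 y j : sme y j * sm y <= 1.
Proof. by apply: le_trans (sm_S_le1 y); rewrite ler_wpM2r ?sm_ge0// sme_le_S. Qed.

Lemma is_derive_sme (y : J -> R -> R) (dy : J -> R) (x : R) j :
  (forall k, is_derive x 1 (y k) (dy k)) ->
  is_derive x 1 (fun s => sme (fun k => y k s) j) (B * dy j * sme (fun k => y k x) j).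
Proof.
move=> h; have hj := h j.
have d1 : is_derive x 1 (fun s => B * (y j s - u)) (B * dy j).
  by apply: is_derive_eq; rewrite /GRing.scale/=; ring.
have := @is_derive1_comp R expR (fun s => B * (y j s - u)) x _ _ (is_derive_expR _) d1.
by rewrite mulrC.
Qed.

Lemma is_derive_sm (y : J -> R -> R) (dy : J -> R) (x : R) :
  (forall k, is_derive x 1 (y k) (dy k)) ->
  is_derive x 1 (fun s => sm (fun k => y k s)) (\sum_j sm1 j (fun k => y k x) * dy j).
Proof.
move=> h; have d1 : is_derive x 1 (fun s => 1 + smS (fun k => y k s))
    (\sum_j B * dy j * sme (fun k => y k x) j).
  have dS : is_derive x 1 (fun s => smS (fun k => y k s)) (\sum_j B * dy j * sme (fun k => y k x) j).
    by apply: is_derive_sum_fin => j; exact: is_derive_sme.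
  have := is_derive_addR (is_derive_cstR 1 x) dS.
  by rewrite add0r.
have n0 : 1 + smS (fun k => y k x) != 0 by rewrite gt_eqF// sm_pos.
have := @is_deriveV R (fun s => 1 + smS (fun k => y k s)) x _ 1 n0 d1.
rewrite /GRing.scale/= mulr_sumr; congr is_derive; apply: eq_bigr => j _.
rewrite /sm1 /sm -exprVn; ring.
Qed.

Lemma is_derive_sm1 (y : J -> R -> R) (dy : J -> R) (x : R) j :
  (forall k, is_derive x 1 (y k) (dy k)) ->
  is_derive x 1 (fun s => sm1 j (fun k => y k s)) (\sum_k sm2 j k (fun k => y k x) * dy k).
Proof.
move=> h; have d1 := is_derive_sme j h; have d2 := is_derive_sm h.
have d3 : is_derive x 1 (fun s => sm1 j (fun k => y k s))
   (- (B * (B * dy j * sme (fun k => y k x) j) * sm (fun k => y k x) ^+ 2 +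
      B * sme (fun k => y k x) j * (2 * sm (fun k => y k x) * (\sum_j sm1 j (fun k => y k x) * dy j)))).
  by apply: is_derive_eq; rewrite /GRing.scale/=; ring.
apply: is_derive_eq; rewrite /sm2.
transitivity (\sum_k (- ((j == k)%:R * (B ^+ 2 * sme (fun k => y k x) j * sm (fun k => y k x) ^+ 2)) * dy k +
   (- (2 * B * sme (fun k => y k x) j * sm (fun k => y k x))) * (sm1 k (fun k => y k x) * dy k))).
  rewrite big_split/= -mulr_sumr; set S1 := \sum_j0 sm1 _ _ * _.
  have -> : \sum_i - ((j == i)%:R * (B ^+ 2 * sme (y^~ x) j * sm (y^~ x) ^+ 2)) * dy i =
      - (B ^+ 2 * sme (y^~ x) j * sm (y^~ x) ^+ 2) * dy j.
    rewrite (bigD1 j)//= eqxx mulr1n mul1r big1 ?addr0// => k kj.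
    by rewrite eq_sym (negbTE kj) mulr0n mul0r oppr0 mul0r.
  by move: (sme _ _) (sm _) S1 => *; ring.
by apply: eq_bigr => k _; rewrite /sm1; ring.
Qed.

Hypothesis B0 : 0 < B.

Lemma sm1_le y j : `|sm1 j y| <= B.
Proof.
rewrite normrN ger0_norm; last by rewrite mulr_ge0 ?sqr_ge0// mulr_ge0 ?sme_ge0// ltW.
rewrite expr2 -mulrA mulrA -[leRHS]mulr1 -[in leLHS]mulrA ler_wpM2l ?(ltW B0)//.
rewrite mulrA mulr_ile1 ?sm_le1 ?sm_ge0 ?sme_sm_le1// mulr_ge0 ?sme_ge0 ?sm_ge0//.
Qed.

(** No factor |J| arises: the weights [sme y j] add up to [smS y], and [smS y * sm y <= 1]. *)
Lemma sm2_sum_le y : \sum_j \sum_k `|sm2 j k y| <= 3 * B ^+ 2 * (smS y * sm y ^+ 2).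
Proof.
have s0 := sm_ge0 y; have e0 := sme_ge0 y; have S0 := smS_ge0 y; have B20 : 0 <= B ^+ 2 by exact: sqr_ge0.
apply: (@le_trans _ _ (\sum_j \sum_k ((j == k)%:R * (B ^+ 2 * sme y j * sm y ^+ 2) +
    2 * B ^+ 2 * (sme y j * sme y k * sm y ^+ 3)))).
  apply: ler_sum => j _; apply: ler_sum => k _; apply: (le_trans (ler_normD _ _)).
  rewrite normrN !ger0_norm//.
    by apply: mulr_ge0; [exact: mulr_ge0|apply: mulr_ge0; [exact: mulr_ge0|exact: exprn_ge0]].
  by apply: mulr_ge0 => //; apply: mulr_ge0; [exact: mulr_ge0|exact: exprn_ge0].
have -> : \sum_j \sum_k ((j == k)%:R * (B ^+ 2 * sme y j * sm y ^+ 2) +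
    2 * B ^+ 2 * (sme y j * sme y k * sm y ^+ 3)) =
    B ^+ 2 * smS y * sm y ^+ 2 + 2 * B ^+ 2 * (smS y * smS y * sm y ^+ 3).
  under eq_bigr do rewrite big_split/=.
  rewrite big_split/=; congr (_ + _).
    rewrite /smS mulr_sumr mulr_suml; apply: eq_bigr => j _.
    rewrite (bigD1 j)//= eqxx mulr1n mul1r big1 ?addr0// => k kj.
    by rewrite eq_sym (negbTE kj) mulr0n mul0r.
  rewrite /smS [X in _ = _ * (X * _)]mulr_suml mulr_suml mulr_sumr; apply: eq_bigr => j _.
  by rewrite mulr_sumr mulr_suml mulr_sumr.
have h : smS y * smS y * sm y ^+ 3 <= smS y * sm y ^+ 2.
  rewrite (_ : _ * _ ^+ 3 = (smS y * sm y ^+ 2) * (smS y * sm y)); last by ring.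
  by rewrite ler_piMr ?mulr_ge0 ?exprn_ge0// sm_S_le1.
have := ler_wpM2l B20 h; move: (smS y) (sm y) (B ^+ 2) => S s b; lra.
Qed.

Lemma sm2_le y j k : `|sm2 j k y| <= 3 * B ^+ 2.
Proof.
apply: (@le_trans _ _ (\sum_j \sum_k `|sm2 j k y|)).
  rewrite (bigD1 j)//= (bigD1 k)//= -addrA lerDl addr_ge0// sumr_ge0// => i _.
  by rewrite sumr_ge0.
apply: (le_trans (sm2_sum_le y)); have B20 : 0 <= B ^+ 2 by exact: sqr_ge0.
rewrite ler_piMr//; first exact: mulr_ge0.
by rewrite expr2 mulrA mulr_ile1 ?mulr_ge0 ?smS_ge0 ?sm_ge0 ?sm_S_le1 ?sm_le1.
Qed.

Variable r : R.

Lemma smS_small y : (forall j, y j < u - r) -> smS y <= #|J|%:R * expR (- (B * r)).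
Proof.
move=> h; apply: (@le_trans _ _ (\sum_(j : J) expR (- (B * r)))); last by rewrite sumr_const mulr_natl.
apply: ler_sum => j _.
by rewrite ler_expR -mulrN ler_wpM2l ?(ltW B0)// lerBlDr addrC ltW.
Qed.

Lemma sm_small y j : u + r <= y j -> sm y <= expR (- (B * r)).
Proof.
move=> h; rewrite expRN lef_pV2 ?posrE ?sm_pos ?expR_gt0//.
apply: (@le_trans _ _ (sme y j)); last by rewrite (le_trans (sme_le_S y j))// lerDr.
by rewrite ler_expR ler_wpM2l ?(ltW B0)// lerBrDl.
Qed.

Lemma sm_ge_ind y : [forall j, y j < u - r]%:R <= sm y + #|J|%:R * expR (- (B * r)).
Proof.
case: forallP => [/smS_small h|_]; last by rewrite addr_ge0 ?sm_ge0// mulr_ge0// expR_ge0.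
rewrite -lerBlDr; apply: (@le_trans _ _ (1 - smS y)); first by rewrite lerD2l lerN2.
rewrite /sm -[leRHS]mul1r ler_pdivlMr ?sm_pos//; have := smS_ge0 y; move: (smS y) => S S0; nra.
Qed.

Lemma sm_le_ind y : sm y <= [forall j, y j < u + r]%:R + expR (- (B * r)).
Proof.
case: (boolP [forall j, y j < u + r]) => [_|]; first by rewrite (le_trans (sm_le1 y))// lerDl expR_ge0.
by move=> /forallPn[j]; rewrite -leNgt => /sm_small; rewrite add0r.
Qed.

(** [smS * sm ^+ 2] is at most [smS], which is tiny if all components are below [u - r], and at most
    [sm], which is tiny if some component exceeds [u + r]; only the band remains. *)
Lemma sm2_sum_loc y : \sum_j \sum_k `|sm2 j k y| <= 3 * B ^+ 2 *
  (([exists j, u - r <= y j] && [forall j, y j <= u + r])%:R + (1 + #|J|%:R) * expR (- (B * r))).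
Proof.
apply: (le_trans (sm2_sum_le y)); have B20 : 0 <= B ^+ 2 by exact: sqr_ge0.
rewrite ler_wpM2l//; first exact: mulr_ge0.
have e0 := expR_ge0 (- (B * r)); set e := expR _ in e0 *.
have b1 : smS y * sm y ^+ 2 <= 1.
  by rewrite expr2 mulrA mulr_ile1 ?mulr_ge0 ?smS_ge0 ?sm_ge0 ?sm_S_le1 ?sm_le1.
have b2 : smS y * sm y ^+ 2 <= smS y.
  by rewrite ler_piMr ?smS_ge0// exprn_ile1 ?sm_ge0 ?sm_le1.
have b3 : smS y * sm y ^+ 2 <= sm y.
  by rewrite expr2 mulrA ler_piMl ?sm_ge0 ?sm_S_le1.
have [E1|/existsPn nE1] := boolP [exists j, u - r <= y j]; last first.
  rewrite /= add0r (le_trans b2)//; apply: (le_trans (smS_small _)).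
    by move=> j; rewrite ltNge; exact: nE1.
  by rewrite mulrDl mul1r lerDr.
have [E2|/forallPn[j]] := boolP [forall j, y j <= u + r].
  by rewrite (le_trans b1)// lerDl mulr_ge0// addr_ge0.
rewrite -ltNge => /ltW /sm_small h; rewrite /= add0r (le_trans b3)// (le_trans h)//.
by rewrite mulrDl mul1r lerDl mulr_ge0.
Qed.

End softmax.

Section interpolation.
Context {R : realType} (K : nat) (J : finType) (Mj : J -> 'M[R]_K) (v : J -> 'rV[R]_K).
Context (N D s0 eta kap x : R) (q : nat).
Hypotheses (Msym : forall j, (Mj j)^T = Mj j) (vM : forall i j, v i *m Mj j = 0).
Hypotheses (DC : forall i j, `|2 * \tr (Mj i *m Mj j) - dotp (v i) (v j)| <= D).
Hypotheses (DF : forall i j, fro (Mj i *m Mj j) <= D ^+ 2) (D0 : 0 < D).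
Hypotheses (q0 : (0 < q)%N) (N1 : 1 <= N) (heta : tail_small q N eta).
Hypothesis kap0 : 0 < kap.
Local Notation T := (K.-tuple R).
Local Notation B := (kap^-1).
Local Notation Wv s c t := (fun j => W Mj v s c j t).

Let B0 : 0 < B. Proof. by rewrite invr_gt0. Qed.
Let N0 : 0 < N. Proof. exact: lt_le_trans ltr01 N1. Qed.

Lemma hasgrad_W s c j : hasgrad (W Mj v s c j)
  (fun t => (2 * s) *: (xr t *m Mj j) + c *: v j).
Proof.
apply: hasgrad_ext (hasgradD (hasgradZ s (hasgrad_qf (Mj j))) (hasgradZ c (hasgrad_lin (v j)))) => // t.
by rewrite Msym mulmxDr scalerDr -scalerDl (_ : s + s = 2 * s)//; ring.
Qed.

Lemma measurable_sme s c j : measurable_fun setT (fun t => sme B x (Wv s c t) j).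
Proof.
apply: measurableT_comp => //; apply: measurable_funM => //; apply: measurable_funB => //.
exact: tame_measurable (tame_W Mj v s c j).
Qed.

Lemma measurable_sm s c : measurable_fun setT (fun t => sm B x (Wv s c t)).
Proof.
have mS : measurable_fun setT (fun t => 1 + smS B x (Wv s c t)).
  by apply: measurable_funD => //; apply: measurable_sum => j; exact: measurable_sme.
apply: (measurable_comp (F := [set z : R | z != 0]) _ _ _ mS).
- by apply: open_measurable; exact: open_neq.
- by move=> _ [t _ <-] /=; rewrite gt_eqF// sm_pos.
- apply: open_continuous_measurable_fun; first exact: open_neq.
  by move=> z; rewrite inE/= => z0; exact: inv_continuous.
Qed.

Lemma tame_sm s c : tame (fun t => sm B x (Wv s c t)).
Proof.
apply: (@tame_bounded _ _ _ 1); first exact: measurable_sm.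
by move=> t; rewrite ger0_norm ?sm_ge0// sm_le1.
Qed.

Lemma tame_sm1 s c j : tame (fun t => sm1 B x j (Wv s c t)).
Proof.
apply: (@tame_bounded _ _ _ B); last by move=> t; exact: sm1_le.
apply: measurableT_comp => //; apply: measurable_funM.
  by apply: measurable_funM => //; exact: measurable_sme.
by apply: measurable_funX; exact: measurable_sm.
Qed.

Lemma tame_sm2 s c j k : tame (fun t => sm2 B x j k (Wv s c t)).
Proof.
apply: (@tame_bounded _ _ _ (3 * B ^+ 2)); last by move=> t; exact: sm2_le.
apply: measurable_funD.
  apply: measurableT_comp => //; apply: measurable_funM => //; apply: measurable_funM.
    by apply: measurable_funM => //; exact: measurable_sme.
  by apply: measurable_funX; exact: measurable_sm.
apply: measurable_funM => //; apply: measurable_funM.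
  by apply: measurable_funM; exact: measurable_sme.
by apply: measurable_funX; exact: measurable_sm.
Qed.

Lemma hasgrad_sm1 s c j : hasgrad (fun t => sm1 B x j (Wv s c t))
  (fun t => \sum_k sm2 B x j k (Wv s c t) *: ((2 * s) *: (xr t *m Mj k) + c *: v k)).
Proof.
split; first exact: tame_sm1.
  move=> a; apply: (@tame_ext _ _ (fun t => \sum_k sm2 B x j k (Wv s c t) * ((2 * s) *: (xr t *m Mj k) + c *: v k) 0 a)).
    by move=> t; rewrite summxE; apply: eq_bigr => k _; rewrite [in RHS]mxE.
  by apply: tame_sum => k; apply: tameM; [exact: tame_sm2|case: (hasgrad_W s c k) => _ /(_ a)].
move=> w t.
have h k : is_derive (0 : R) 1 (fun z : R => W Mj v s c k (shiftt t (z *: w)))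
   (dotp ((2 * s) *: (xr t *m Mj k) + c *: v k) w) by case: (hasgrad_W s c k).
have := is_derive_sm1 B x j h.
rewrite scale0r shiftt0 dotp_suml.
by under [in X in _ -> X]eq_bigr do rewrite dotpZl.
Qed.

(* Rotates the Gaussian vector (th = 0) into the vector of quadratic forms (th = pi / 2). *)
Definition hth (th : R) := gE (fun t => sm B x (Wv (sin th) (cos th) t)).

(** 2 <M_j x, M_k x> - <v_j, v_k>, split into its centred part and its mean, the mismatch of the
    covariances. *)
Definition dcov j k t := 2 * qf (Mj j *m Mj k) t + (2 * \tr (Mj j *m Mj k) - dotp (v j) (v k)).

Definition dhth (th : R) := sin th * cos th *
  \sum_j \sum_k gE (fun t => sm2 B x j k (Wv (sin th) (cos th) t) * dcov j k t).

(** Integration by parts against both forms. Cross terms between quadratic and linear parts vanish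
    by [vM], and each surviving term carries the factor [s * c]. *)
Lemma ibp_term s c j : c * gE (fun t => qf (Mj j) t * sm1 B x j (Wv s c t)) -
   s * gE (fun t => lin (v j) t * sm1 B x j (Wv s c t)) =
   s * c * \sum_k gE (fun t => sm2 B x j k (Wv s c t) * dcov j k t).
Proof.
have g := hasgrad_sm1 s c j.
have tg k : tame (fun t => sm2 B x j k (Wv s c t)) := tame_sm2 s c j k.
rewrite (gE_ibp_qf _ g) (gE_ibp_lin _ g).
have tx := @tame_xr_mul R K.
have tE : tame (fun t => \sum_k sm2 B x j k (Wv s c t) * (2 * s * dotp (xr t *m (Mj j *m Mj k)) (xr t))).
  apply: tame_sum => k; apply: tameM => //; apply: tameZ.
  apply: (tame_dotp (f := fun t => xr t *m (Mj j *m Mj k)) (g := @xr R K)) => a; first exact: tx.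
  by case: (hasgrad_xr (R := R) a).
have tF : tame (fun t => \sum_k sm2 B x j k (Wv s c t) * (c * dotp (v j) (v k))).
  by apply: tame_sum => k; apply: tameM => //; exact: tame_cst.
have -> : gE (fun t => dotp (xr t *m Mj j) (\sum_k sm2 B x j k (Wv s c t) *: ((2 * s) *: (xr t *m Mj k) + c *: v k))) =
   gE (fun t => \sum_k sm2 B x j k (Wv s c t) * (2 * s * dotp (xr t *m (Mj j *m Mj k)) (xr t))).
  congr gE; apply/funext => t; rewrite dotp_sumr; apply: eq_bigr => k _.
  rewrite dotpZr dotpDr !dotpZr [dotp (xr t *m Mj j) (v k)]dotpMl Msym vM dotp0r mulr0 addr0.
  by rewrite mulmxA [in RHS]dotpMl Msym.
have -> : gE (fun t => dotp (v j) (\sum_k sm2 B x j k (Wv s c t) *: ((2 * s) *: (xr t *m Mj k) + c *: v k))) =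
   gE (fun t => \sum_k sm2 B x j k (Wv s c t) * (c * dotp (v j) (v k))).
  congr gE; apply/funext => t; rewrite dotp_sumr; apply: eq_bigr => k _.
  by rewrite dotpZr dotpDr !dotpZr [dotp (v j) (_ *m _)]dotpC dotpMl Msym vM dotp0r mulr0 add0r.
rewrite -!gEZ// -gEB//; [|exact: tameZ|exact: tameZ].
rewrite -gE_sum; last first.
  move=> k; apply: tameM => //; apply: tameD; [by apply: tameZ; exact: tame_qf|exact: tame_cst].
rewrite -gEZ; last first.
  apply: tame_sum => k; apply: tameM => //; apply: tameD; [by apply: tameZ; exact: tame_qf|exact: tame_cst].
congr gE; apply/funext => t; rewrite !mulr_sumr -sumrB; apply: eq_bigr => k _.
by rewrite /dcov dotp_xr; ring.
Qed.

Lemma is_derive_hth (th : R) : is_derive th 1 hth (dhth th).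
Proof.
pose dF (z : R) t := \sum_j sm1 B x j (Wv (sin z) (cos z) t) * (cos z * qf (Mj j) t - sin z * lin (v j) t).
pose G t := \sum_j B * (`|qf (Mj j) t| + `|lin (v j) t|).
have tG : tame G.
  by apply: tame_sum => j; apply: tameZ; apply: tameD; apply: tame_norm; [exact: tame_qf|exact: tame_lin].
have [_ [c c0 Gc]] := tG.
have I0 : th - 1 < th < th + 1 by apply/andP; split; lra.
have h := @gE_derive R K (fun z t => sm B x (Wv (sin z) (cos z) t)) dF (th - 1) (th + 1) c th c0 I0.
have -> : dhth th = gE (dF th).
  rewrite /dF gE_sum; last first.
    move=> j; apply: tameM; first exact: tame_sm1.
    by apply: tameB; apply: tameZ; [exact: tame_qf|exact: tame_lin].
  rewrite /dhth mulr_sumr; apply: eq_bigr => j _; rewrite -ibp_term.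
  have t1 := tame_sm1 (sin th) (cos th) j.
  rewrite -!gEZ; [|by apply: tameM => //; exact: tame_lin|by apply: tameM => //; exact: tame_qf].
  rewrite -gEB; [|by apply: tameZ; apply: tameM => //; exact: tame_qf|by apply: tameZ; apply: tameM => //; exact: tame_lin].
  by congr gE; apply/funext => t; ring.
apply: h.
- by move=> z _; exact: tame_sm.
- move=> z t _; apply: is_derive_sm => j.
  by rewrite /W; apply: is_derive_eq; rewrite /GRing.scale/=; ring.
- move=> z t _; apply: le_trans (Gc t); apply: (le_trans (ler_norm_sum _ _ _)); apply: le_trans (ler_norm _).
  apply: ler_sum => j _; rewrite normrM ler_pM//; first exact: sm1_le.
  apply: (le_trans (ler_normB _ _)); rewrite !normrM lerD// ler_piMl//.
  + by rewrite ler_norml cos_geN1 cos_le1.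
  + by rewrite ler_norml sin_geN1 sin_le1.
Qed.

(** In units of [N * D], the inequality |z| <= 1 + z^(2q) replaces a large-deviation event by a
    moment that [tail_small] controls. *)
Lemma dcov_le j k t : `|dcov j k t| <= 3 * (N * D) * (1 + (qf (Mj j *m Mj k) t / (N * D)) ^+ (2 * q)).
Proof.
have ND0 : 0 < N * D by exact: mulr_gt0.
set z := qf _ t / (N * D).
have E : qf (Mj j *m Mj k) t = z * (N * D) by rewrite /z divfK// gt_eqF.
have z2 : 0 <= z ^+ (2 * q) by rewrite exprM exprn_ge0// sqr_ge0.
have zz : `|z| <= 1 + z ^+ (2 * q).
  have [h|h] := lerP `|z| 1; first by rewrite (le_trans h)// lerDl.
  rewrite (_ : z ^+ (2 * q) = `|z| ^+ (2 * q)); last by rewrite !exprM -normrX ger0_norm// sqr_ge0.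
  apply: le_trans (_ : `|z| ^+ (2 * q) <= _); last by rewrite lerDr.
  by rewrite -[leLHS]expr1 ler_weXn2l// ?muln_gt0// ltW.
rewrite /dcov; apply: (le_trans (ler_normD _ _)).
rewrite normrM E normrM (gtr0_norm ND0) (ger0_norm (_ : 0 <= 2)) //.
have h1 := ler_wpM2r (ltW ND0) zz.
have h2 : D <= N * D * (1 + z ^+ (2 * q)).
  apply: (@le_trans _ _ (N * D)); first by rewrite ler_peMl// ltW.
  by rewrite ler_peMr ?(ltW ND0)// lerDl.
have := DC j k; move: h1 h2; move: (2 * \tr _ - _) (z ^+ _) `|z| => a b c; rewrite mulrC; lra.
Qed.

(** The constant part of [dcov_le] meets the sum of the |sm2|, which is localised in the band; the
    moment part meets the uniform bound 3 B^2 on each |sm2| and costs |J|^2. *)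
Lemma dhth_le th : 0 <= sin th -> 0 <= cos th -> `|dhth th| <= sin th * cos th * (9 * (N * D) * B ^+ 2 *
  (gP (fun t => [exists j, x - N * kap <= W Mj v (sin th) (cos th) j t] &&
               [forall j, W Mj v (sin th) (cos th) j t <= x + N * kap])
   + (1 + #|J|%:R) * expR (- N) + #|J|%:R ^+ 2 * eta)).
Proof.
move=> sn cs; have ND0 : 0 < N * D by exact: mulr_gt0.
have B20 : 0 <= B ^+ 2 by exact: sqr_ge0.
set s := sin th in sn *; set c := cos th in cs *.
rewrite /dhth normrM ger0_norm ?mulr_ge0// ler_wpM2l ?mulr_ge0//.
pose z j k t := (qf (Mj j *m Mj k) t / (N * D)) ^+ (2 * q).
have tz j k : tame (z j k).
  by apply: tameX; apply: (tame_ext (f := fun t => (N * D)^-1 * qf (Mj j *m Mj k) t)) (tameZ _ (tame_qf _)) => t; rewrite mulrC.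
have z0 j k t : 0 <= z j k t by rewrite /z exprM exprn_ge0// sqr_ge0.
have Ez j k : gE (z j k) <= eta.
  apply: le_trans heta.
  apply: (@le_trans _ _ (((N * D) ^+ (2 * q))^-1 * gE (fun t => qf (Mj j *m Mj k) t ^+ (2 * q)))).
    by rewrite -gEZ; [apply: eq_leW; congr gE; apply/funext => t; rewrite /z exprMn exprVn mulrC|apply: tameX; exact: tame_qf].
  rewrite ler_pdivrMl ?exprn_gt0//.
  apply: (le_trans (gE_moment_qf _ q0)).
  rewrite (_ : (N * D) ^+ (2 * q) * _ = momC q * (32 ^+ q * (D ^+ 2) ^+ q)); last first.
    by rewrite exprMn [D ^+ (2 * q)]exprM; field; rewrite expf_neq0// gt_eqF.
  apply: ler_wpM2l; first exact: momC_ge0.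
  apply: (@le_trans _ _ ((D ^+ 2) ^+ q)).
    by apply: lerXn2r; rewrite ?nnegrE ?fro_ge0 ?sqr_ge0.
  by apply: ler_peMl; [rewrite exprn_ge0// sqr_ge0|rewrite exprn_ege1//; lra].
have tsm2 j k := tame_sm2 s c j k.
have td j k : tame (dcov j k) by apply: tameD; [apply: tameZ; exact: tame_qf|exact: tame_cst].
pose bd t := [exists j, x - N * kap <= W Mj v s c j t] && [forall j, W Mj v s c j t <= x + N * kap].
have mbd : mb bd.
  by apply: mb_and; [apply: mb_exists|apply: mb_forall] => j; apply: mb_le; [exact: tame_cst|exact: tame_W|exact: tame_W|exact: tame_cst].
have tn j k : tame (fun t => `|sm2 B x j k (Wv s c t)|) by exact: tame_norm.
have tS : tame (fun t => \sum_j \sum_k `|sm2 B x j k (Wv s c t)|) by do 2 apply: tame_sum => ?; exact: tn.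
have tZ : tame (fun t => \sum_j \sum_k z j k t) by do 2 apply: tame_sum => ?; exact: tz.
apply: (@le_trans _ _ (3 * (N * D) * (gE (fun t => \sum_j \sum_k `|sm2 B x j k (Wv s c t)|) +
    3 * B ^+ 2 * gE (fun t => \sum_j \sum_k z j k t)))).
  rewrite -[3 * B ^+ 2 * _]gEZ// -gED//; last exact: tameZ.
  rewrite -[_ * gE _]gEZ; last by apply: tameD => //; exact: tameZ.
  rewrite (_ : \sum_j _ = gE (fun t => \sum_j \sum_k sm2 B x j k (Wv s c t) * dcov j k t)); last first.
    rewrite gE_sum; last by move=> j; apply: tame_sum => k; exact: tameM.
    by apply: eq_bigr => j _; rewrite gE_sum// => k; exact: tameM.
  apply: (le_trans (gE_norm _)); first by do 2 apply: tame_sum => ?; exact: tameM.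
  apply: gE_le.
  - by apply: tame_norm; do 2 apply: tame_sum => ?; exact: tameM.
  - by apply: tameZ; apply: tameD => //; exact: tameZ.
  move=> t; rewrite mulr_sumr -big_split mulr_sumr; apply: (le_trans (ler_norm_sum _ _ _)).
  apply: ler_sum => j _; rewrite mulr_sumr -big_split mulr_sumr; apply: (le_trans (ler_norm_sum _ _ _)).
  apply: ler_sum => k _; rewrite normrM.
  apply: (le_trans (ler_wpM2l (normr_ge0 _) (dcov_le j k t))); rewrite -/(z j k t).
  rewrite mulrCA ler_wpM2l//; first by rewrite mulr_ge0// ltW.
  rewrite mulrDr mulr1 lerD2l ler_wpM2r//; exact: sm2_le.
have E1 : gE (fun t => \sum_j \sum_k z j k t) <= #|J|%:R ^+ 2 * eta.
  rewrite gE_sum; last by move=> j; apply: tame_sum => k.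
  apply: (@le_trans _ _ (\sum_(j : J) \sum_(k : J) eta)).
    by apply: ler_sum => j _; rewrite gE_sum//; apply: ler_sum => k _.
  by rewrite sumr_const sumr_const -mulrnA -[leLHS]mulr_natl natrM expr2.
have E2 : gE (fun t => \sum_j \sum_k `|sm2 B x j k (Wv s c t)|) <=
    3 * B ^+ 2 * (gP bd + (1 + #|J|%:R) * expR (- N)).
  have tb := tame_bool mbd.
  rewrite -[(1 + _) * expR _](@gE_cst R K) -gED//; last exact: tame_cst.
  rewrite -gEZ; last by apply: tameD => //; exact: tame_cst.
  apply: gE_le => //; first by apply: tameZ; apply: tameD => //; exact: tame_cst.
  move=> t; have := sm2_sum_loc x B0 (N * kap) (Wv s c t).
  by rewrite (_ : B * (N * kap) = N)//; field; rewrite gt_eqF.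
rewrite -/(bd) in E2 *; move: (gE (fun t => \sum_j \sum_k `| _ |)) E2 => y1 E2.
move: (gE (fun t => \sum_j \sum_k z j k t)) E1 => y2 E1.
have -> : 9 * (N * D) * B ^+ 2 * (gP bd + (1 + #|J|%:R) * expR (- N) + #|J|%:R ^+ 2 * eta) =
  3 * (N * D) * (3 * B ^+ 2 * (gP bd + (1 + #|J|%:R) * expR (- N)) + 3 * B ^+ 2 * (#|J|%:R ^+ 2 * eta)) by ring.
rewrite ler_wpM2l//; first by rewrite mulr_ge0// ltW.
by rewrite lerD// ler_wpM2l// mulr_ge0.
Qed.

End interpolation.

Section arith2.
Context {R : realFieldType}.

(** Merges the trivial bound 1 with [X / c2] into an expression that stays bounded as [c2] tends to
    0. *)
Lemma min_quot (P X c2 e : R) : 0 < X -> 0 < c2 -> P <= 1 -> 0 <= e -> (X < c2 -> P <= X / c2 + e) ->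
  P <= 2 * X / (c2 + X) + e.
Proof.
move=> X0 c0 P1 e0 h; have s0 : 0 < c2 + X by rewrite addr_gt0.
have [l|l] := lerP c2 X.
  rewrite (le_trans P1)// (le_trans _ (_ : 2 * X / (c2 + X) <= _)) ?lerDl//.
  by rewrite ler_pdivlMr// mul1r; lra.
rewrite (le_trans (h l))// lerD2r ler_pdivrMr// mulrAC ler_pdivlMr//.
by rewrite -mulrA [2 * _]mulrC -mulrA ler_wpM2l ?(ltW X0)//; lra.
Qed.

End arith2.

(** * Comparison of the distribution functions of the two maxima *)

Section comparison.
Context {R : realType} (K : nat) (J : finType) (Mj : J -> 'M[R]_K) (v : J -> 'rV[R]_K).
Context (j1 j1' : J) (N D s0 eta kap : R) (q : nat).
Hypotheses (Msym : forall j, (Mj j)^T = Mj j) (vM : forall i j, v i *m Mj j = 0).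
Hypotheses (Mneg : Mj j1' = - Mj j1) (vneg : v j1' = - v j1).
Hypotheses (s00 : 0 < s0) (hs0 : s0 ^+ 2 <= dotp (v j1) (v j1)).
Hypotheses (DC : forall i j, `|2 * \tr (Mj i *m Mj j) - dotp (v i) (v j)| <= D).
Hypotheses (DF : forall i j, fro (Mj i *m Mj j) <= D ^+ 2) (D0 : 0 < D).
Hypotheses (q0 : (0 < q)%N) (N1 : 1 <= N) (heta : tail_small q N eta).
Hypotheses (eN : expR (- N) <= eta) (kap0 : 0 < kap) (kap1 : kap <= 1) (Dkap : D <= kap ^+ 2).
Hypothesis lnk : ln (2 / kap) <= N.
Local Notation T := (K.-tuple R).
Local Notation Jn := (#|J|%:R : R).
Local Notation cn := (expR 4 : R).
Local Notation Cb := (bandC s0).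

Let N0 : 0 < N. Proof. exact: lt_le_trans ltr01 N1. Qed.
Let eta0 : 0 <= eta. Proof. exact: eta_ge0 heta. Qed.
Let J1 : 1 <= Jn. Proof. by rewrite ler1n; apply/card_gt0P; exists j1. Qed.
Let Cb0 : 0 <= Cb.
Proof. by rewrite /bandC addr_ge0// divr_ge0 ?mulr_ge0 ?exprn_ge0 ?mulr_ge0 ?expR_ge0 ?(ltW s00). Qed.

(** Up to tails, the band probability at angle [th] is at most this over cos^2 th. The summand 1
    guarantees [kap <= cmpX]. *)
Definition cmpX : R := (2 * Cb + 1) * N ^+ 4 * kap.
Definition cmpE : R := 9 * N * ((3 + (4 + 2 * cn * N)) * (Jn ^+ 2 * eta)).

Let X0 : 0 < cmpX.
Proof. by rewrite /cmpX !mulr_gt0// ?exprn_gt0// ltr_wpDl// mulr_ge0. Qed.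

Let Xkap : kap <= cmpX.
Proof.
rewrite /cmpX ler_peMl ?(ltW kap0)// -[leLHS]mulr1 ler_pM//; last exact: exprn_ege1.
by rewrite lerDr mulr_ge0.
Qed.

(** The second derivatives cost kap^-2, which [D <= kap ^+ 2] compensates. The factor cos th cancels
    the 1 / cos th in the tail terms of [band_prob]. *)
Lemma dhth_bound (x th : R) : N * (2 * (N * kap)) <= x - N * kap -> 0 < th < pi / 2 ->
  `|dhth Mj v kap x th| <= 9 * N * cmpX * (2 * (sin th * cos th) / (cos th ^+ 2 + cmpX)) + cmpE.
Proof.
move=> hx /andP[th0 th1].
have sp : 0 < sin th by apply: sin_gt0_pi; rewrite th0/= (lt_trans th1)// ltr_pdivrMr// ltr_pMr ?pi_gt0// ltr1n.
have cp : 0 < cos th by apply: cos_gt0_pihalf; rewrite th1 andbT (lt_trans _ th0)// oppr_lt0 divr_gt0// pi_gt0.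
have c1 := cos_le1 th; have s1 := sin_le1 th.
have hd := dhth_le x DC DF D0 q0 N1 heta kap0 (ltW sp) (ltW cp).
apply: le_trans hd _.
set Pb := gP _; set s := sin th in sp s1 *; set c := cos th in cp c1 *.
have Nk0 : 0 < N * kap by exact: mulr_gt0.
have u0 : 0 < x - N * kap by apply: lt_le_trans hx; rewrite !mulr_gt0.
have Pb1 : Pb <= 1.
  by apply: gP_le1; apply: mb_and; [apply: mb_exists|apply: mb_forall] => j; apply: mb_le; [exact: tame_cst|exact: tame_W|exact: tame_W|exact: tame_cst].
have k20 : 0 < 2 * (N * kap) by rewrite mulr_gt0.
have Dk2 : D <= (2 * (N * kap)) ^+ 2.
  apply: (le_trans Dkap); apply: lerXn2r; rewrite ?nnegrE ?(ltW kap0) ?(ltW k20)//.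
  apply: (@le_trans _ _ (N * kap)); first by rewrite ler_peMl// ltW.
  by rewrite ler_peMl ?(ltW Nk0)// ler1n.
have s01 : 0 <= s <= 1 by rewrite (ltW sp).
have h := band_prob Msym vM Mneg vneg s00 hs0 DC q0 N1 heta s01 cp c1 u0 k20 hx Dk2.
have xE : x - N * kap + 2 * (N * kap) = x + N * kap by ring.
rewrite xE -/Pb in h.
have Je0 : 0 <= Jn * eta by rewrite mulr_ge0.
have J2e : Jn * eta <= Jn ^+ 2 * eta by rewrite ler_wpM2r// expr2 ler_peMl.
have c20 : 0 < c ^+ 2 by rewrite exprn_gt0.
pose e := (4 + 2 * cn * (N / c)) * (Jn * eta).
have Nc0 : 0 <= N / c by rewrite divr_ge0// ltW.
have e0 : 0 <= e by apply: mulr_ge0 => //; apply: addr_ge0 => //; apply: mulr_ge0 => //; rewrite mulr_ge0 ?expR_ge0.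
have h2 : Pb <= 2 * cmpX / (c ^+ 2 + cmpX) + e.
  apply: min_quot => // _; apply: (le_trans h); rewrite lerD2r ler_wpM2r ?invr_ge0 ?(ltW c20)//.
  rewrite (_ : Cb * N ^+ 3 * (2 * (N * kap)) = 2 * Cb * N ^+ 4 * kap); last by ring.
  by rewrite /cmpX ler_wpM2r ?(ltW kap0)// ler_wpM2r ?exprn_ge0 ?(ltW N0)// lerDl.
have DB : D * kap^-1 ^+ 2 <= 1 by rewrite exprVn ler_pdivrMr ?exprn_gt0// mul1r.
have r0 : 0 <= Pb + (1 + Jn) * expR (- N) + Jn ^+ 2 * eta.
  by rewrite !addr_ge0 ?gP_ge0// ?mulr_ge0 ?expR_ge0 ?exprn_ge0.
have r1 : (1 + Jn) * expR (- N) <= 2 * (Jn ^+ 2 * eta).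
  rewrite mulrA ler_pM ?expR_ge0//.
  by have : 1 <= Jn ^+ 2; [exact: exprn_ege1|have : Jn <= Jn ^+ 2; [rewrite expr2 ler_peMl|move: (Jn ^+ 2) Jn => a b; lra]].
have sc0 : 0 <= s * c by rewrite mulr_ge0 ?(ltW sp) ?(ltW cp).
have sc1 : s * c <= 1 by rewrite mulr_ile1 ?(ltW sp) ?(ltW cp).
have step1 : 9 * (N * D) * kap^-1 ^+ 2 * (Pb + (1 + Jn) * expR (- N) + Jn ^+ 2 * eta) <=
   9 * N * (2 * cmpX / (c ^+ 2 + cmpX) + e + 3 * (Jn ^+ 2 * eta)).
  rewrite (_ : 9 * (N * D) * _ = 9 * N * (D * kap^-1 ^+ 2)); last by ring.
  apply: (@le_trans _ _ (9 * N * (Pb + (1 + Jn) * expR (- N) + Jn ^+ 2 * eta))).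
    by rewrite ler_wpM2r// ler_piMr// mulr_ge0// ltW.
  rewrite ler_wpM2l ?mulr_ge0 ?(ltW N0)//; move: h2 r1; move: (_ * expR _) (Jn ^+ 2 * eta) (_ / _) => a b d; lra.
apply: (le_trans (ler_wpM2l sc0 step1)).
have see : s * c * e <= (4 + 2 * cn * N) * (Jn ^+ 2 * eta).
  have -> : s * c * e = (s * (c * 4 + 2 * cn * N)) * (Jn * eta) by rewrite /e; field; rewrite gt_eqF.
  have w0 : 0 <= c * 4 + 2 * cn * N by rewrite addr_ge0 ?mulr_ge0 ?expR_ge0 ?(ltW cp) ?(ltW N0).
  apply: ler_pM => //; first by rewrite mulr_ge0// ltW.
  apply: (@le_trans _ _ (c * 4 + 2 * cn * N)); first by rewrite ler_piMl.
  by rewrite lerD2r; lra.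
have -> : s * c * (9 * N * (2 * cmpX / (c ^+ 2 + cmpX) + e + 3 * (Jn ^+ 2 * eta))) =
  9 * N * cmpX * (2 * (s * c) / (c ^+ 2 + cmpX)) + 9 * N * (s * c * e + s * c * (3 * (Jn ^+ 2 * eta))) by ring.
rewrite lerD2l /cmpE ler_wpM2l ?mulr_ge0 ?(ltW N0)//.
have : s * c * (3 * (Jn ^+ 2 * eta)) <= 3 * (Jn ^+ 2 * eta).
  by rewrite ler_piMl// mulr_ge0// mulr_ge0// exprn_ge0.
move=> h3; apply: le_trans (lerD see h3) _.
by apply: eq_leW; ring.
Qed.

Let cmpE0 : 0 <= cmpE.
Proof.
by rewrite /cmpE !mulr_ge0 ?(ltW N0)// ?addr_ge0 ?mulr_ge0 ?expR_ge0 ?(ltW N0)// ?exprn_ge0.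
Qed.

(** - ln (cos^2 + cmpX) is a primitive of the nearly singular part. Over the path it grows by ln ((1
    + cmpX) / cmpX), at most ln (2 / kap) and hence at most [N]. *)
Lemma hth_diff x : N * (2 * (N * kap)) <= x - N * kap ->
  `|hth Mj v kap x (pi / 2) - hth Mj v kap x 0| <= 9 * N ^+ 2 * cmpX + 2 * cmpE.
Proof.
move=> hx.
have cX (z : R) : 0 < cos z ^+ 2 + cmpX by rewrite ltr_wpDl ?sqr_ge0.
pose psi (z : R) := - (9 * N * cmpX) * ln (cos z ^+ 2 + cmpX) + cmpE * z.
pose dpsi (z : R) := 9 * N * cmpX * (2 * (sin z * cos z) / (cos z ^+ 2 + cmpX)) + cmpE.
have dp (z : R) : is_derive z 1 psi (dpsi z).
  have d1 : is_derive z 1 (fun y : R => cos y ^+ 2 + cmpX) (- (2 * sin z * cos z)).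
    by apply: is_derive_eq; rewrite /GRing.scale/=; ring.
  have d2 := @is_derive1_comp R (@ln R) (fun y => cos y ^+ 2 + cmpX) z _ _ (is_derive1_ln (cX z)) d1.
  rewrite /psi; apply: is_derive_eq; rewrite /dpsi /GRing.scale/=; ring.
have pi20 : 0 <= pi / 2 :> R by rewrite divr_ge0// pi_ge0.
have h := @derive_comparison R _ _ psi dpsi 0 (pi / 2) pi20
  (fun z => is_derive_hth x Msym vM kap0 z) dp (fun z hz => dhth_bound hx hz).
apply: (le_trans h); rewrite /psi cos_pihalf cos0 expr1n expr0n/= add0r mulr0 addr0.
have E0 := cmpE0.
have p4 : pi / 2 <= 2 :> R by have := pihalf_lt2 R; move=> /ltW.
have l1 : ln (1 + cmpX) - ln cmpX <= N.
  rewrite -ln_div ?posrE ?addr_gt0//; apply: le_trans lnk.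
  rewrite ler_ln ?posrE ?divr_gt0 ?addr_gt0//.
  rewrite ler_pdivrMr// mulrAC ler_pdivlMr//.
  by move: Xkap kap1 kap0 X0; move: cmpX => X; nra.
have X9 : 0 <= 9 * N * cmpX by apply: mulr_ge0; [apply: mulr_ge0 => //; exact: ltW|exact: ltW].
have := ler_wpM2l X9 l1.
have := ler_wpM2l E0 p4.
rewrite expr2; move: (pi / 2) cmpE cmpX (ln _) (ln _) => a b d f g; lra.
Qed.

Definition pL (u : R) := gP (fun t => [forall j, qf (Mj j) t < u]).
Definition pZ (u : R) := gP (fun t => [forall j, lin (v j) t < u]).

Lemma mb_pL u : mb (fun t => [forall j, qf (Mj j) t < u]).
Proof. by apply: mb_forall => j; apply: mb_lt; [exact: tame_qf|exact: tame_cst]. Qed.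

Lemma mb_pZ u : mb (fun t => [forall j, lin (v j) t < u]).
Proof. by apply: mb_forall => j; apply: mb_lt; [exact: tame_lin|exact: tame_cst]. Qed.

Definition cmpI : R := 9 * N ^+ 2 * cmpX + 2 * cmpE + 2 * (Jn * eta).

Lemma W10 j t : W Mj v 1 0 j t = qf (Mj j) t. Proof. by rewrite /W mul1r mul0r addr0. Qed.
Lemma W01 j t : W Mj v 0 1 j t = lin (v j) t. Proof. by rewrite /W mul1r mul0r add0r. Qed.

Let Bk : kap^-1 * (N * kap) = N. Proof. by field; rewrite gt_eqF. Qed.
Let B0 : 0 < kap^-1. Proof. by rewrite invr_gt0. Qed.

Let pW s c u := gP (fun t => [forall j, W Mj v s c j t < u]).

Let mb_pW s c u : mb (fun t => [forall j, W Mj v s c j t < u]).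
Proof. by apply: mb_forall => j; apply: mb_lt; [exact: tame_W|exact: tame_cst]. Qed.

Let pLE u : pL u = pW (sin (pi / 2)) (cos (pi / 2)) u.
Proof.
by rewrite sin_pihalf cos_pihalf; congr gP; apply/funext => t; under [RHS]eq_forallb do rewrite W10.
Qed.

Let pZE u : pZ u = pW (sin 0) (cos 0) u.
Proof. by rewrite sin0 cos0; congr gP; apply/funext => t; under [RHS]eq_forallb do rewrite W01. Qed.

Lemma hth_ge x th : pW (sin th) (cos th) (x - N * kap) <= hth Mj v kap x th + Jn * eta.
Proof.
have tS := tame_sm Mj v kap x (sin th) (cos th).
rewrite -[Jn * eta](@gE_cst R K) -gED//; last exact: tame_cst.
apply: gE_le; [by apply: tame_bool; exact: mb_pW|by apply: tameD => //; exact: tame_cst|move=> t].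
apply: le_trans (_ : sm kap^-1 x (fun j => W Mj v (sin th) (cos th) j t) + Jn * expR (- N) <= _); last by rewrite lerD2l ler_wpM2l.
by have := sm_ge_ind x B0 (N * kap) (fun j => W Mj v (sin th) (cos th) j t); rewrite Bk.
Qed.

Lemma hth_le x th : hth Mj v kap x th <= pW (sin th) (cos th) (x + N * kap) + Jn * eta.
Proof.
have tS := tame_sm Mj v kap x (sin th) (cos th).
have tb := tame_bool (mb_pW (sin th) (cos th) (x + N * kap)).
rewrite -[Jn * eta](@gE_cst R K) -gED//; last exact: tame_cst.
apply: gE_le => //; [by apply: tameD => //; exact: tame_cst|move=> t].
have := sm_le_ind x B0 (N * kap) (fun j => W Mj v (sin th) (cos th) j t); rewrite Bk => /le_trans; apply.
by rewrite lerD2l; apply: (le_trans eN); rewrite ler_peMl.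
Qed.

Lemma pL_le_pZ a : N * (2 * (N * kap)) <= a -> pL a <= pZ (a + 2 * (N * kap)) + cmpI.
Proof.
move=> ha; have h : N * (2 * (N * kap)) <= a + N * kap - N * kap by rewrite addrK.
have := hth_diff h; have := hth_ge (a + N * kap) (pi / 2); have := hth_le (a + N * kap) 0.
rewrite -pLE -pZE addrK (_ : a + N * kap + N * kap = a + 2 * (N * kap)); last by ring.
rewrite /cmpI ler_norml => h1 h2 /andP[_ h3].
move: h1 h2 h3; move: (pL a) (pZ _) (hth _ _ _ _ _) (hth _ _ _ _ _) (9 * _ * _) cmpE (Jn * eta) => *; lra.
Qed.

Lemma pZ_le_pL a : N * (2 * (N * kap)) <= a -> pZ a <= pL (a + 2 * (N * kap)) + cmpI.
Proof.
move=> ha; have h : N * (2 * (N * kap)) <= a + N * kap - N * kap by rewrite addrK.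
have := hth_diff h; have := hth_ge (a + N * kap) 0; have := hth_le (a + N * kap) (pi / 2).
rewrite -pLE -pZE addrK (_ : a + N * kap + N * kap = a + 2 * (N * kap)); last by ring.
rewrite /cmpI ler_norml => h1 h2 /andP[h3 _].
move: h1 h2 h3; move: (pZ a) (pL _) (hth _ _ _ _ _) (hth _ _ _ _ _) (9 * _ * _) cmpE (Jn * eta) => *; lra.
Qed.

Lemma pZ_band a k : 0 < k -> N * k <= a -> D <= k ^+ 2 ->
  pZ (a + k) <= pZ a + (Cb * N ^+ 3 * k + (4 + 2 * cn * N) * (Jn * eta)).
Proof.
move=> k0 Nk Dk; have a0 : 0 < a by apply: lt_le_trans Nk; rewrite mulr_gt0.
have z01 : 0 <= (0 : R) <= 1 by rewrite lexx ler01.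
have h := band_prob Msym vM Mneg vneg s00 hs0 DC q0 N1 heta z01 ltr01 (lexx 1) a0 k0 Nk Dk.
rewrite expr1n !divr1 in h.
have mbd : mb (fun t => [exists j, a <= W Mj v 0 1 j t] && [forall j, W Mj v 0 1 j t <= a + k]).
  by apply: mb_and; [apply: mb_exists|apply: mb_forall] => j; apply: mb_le; [exact: tame_cst|exact: tame_W|exact: tame_W|exact: tame_cst].
apply: le_trans (lerD (lexx _) h); apply: le_trans (gP_or (mb_pZ a) mbd).
apply: gP_le; [exact: mb_pZ|by apply: mb_or => //; exact: mb_pZ|move=> t /forallP h1].
have [//|/forallPn[j]] := boolP [forall j, lin (v j) t < a]; rewrite -leNgt => hj /=.
apply/andP; split; first by apply/existsP; exists j; rewrite W01.
by apply/forallP => i; rewrite W01 ltW.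
Qed.

(** Since [j1'] is the opposite of [j1], the event confines |lin (v j1)|, and the estimate for this
    single component applies. *)
Lemma pZ_low u : 0 < u -> pZ u <= 4 * cn / s0 * N * u + Jn * eta.
Proof.
move=> u0; have u20 : 0 < u / 2 by rewrite divr_gt0.
have h := level_tail Msym vM s00 hs0 q0 N1 heta 0 ltr01 u20.
rewrite (_ : 2 * expR 4 * N * (4 * (u / 2) / (1 * s0)) = 4 * cn / s0 * N * u) in h; last by field; rewrite gt_eqF.
apply: le_trans h; apply: gP_le; first exact: mb_pZ.
  by apply: mb_and; apply: mb_le; [exact: tame_W|exact: tame_cst|exact: tame_cst|exact: tame_W].
move=> t /forallP h; have := h j1; have := h j1'; rewrite vneg linN W01 (_ : 2 * (u / 2) = u); last by field.
by move=> h1 h2; rewrite ltW//= lerNl ltW.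
Qed.

Definition cmpT : R := cmpI + (Cb * N ^+ 3 * (3 * (N * kap)) + (4 + 2 * cn * N) * (Jn * eta)) +
  (4 * cn / s0 * N * (6 * (N ^+ 2 * kap)) + Jn * eta).

Lemma mono_pZ a b : a <= b -> pZ a <= pZ b.
Proof.
move=> ab; apply: gP_le; [exact: mb_pZ|exact: mb_pZ|move=> t /forallP h].
by apply/forallP => j; exact: lt_le_trans (h j) ab.
Qed.

Lemma mono_pL a b : a <= b -> pL a <= pL b.
Proof.
move=> ab; apply: gP_le; [exact: mb_pL|exact: mb_pL|move=> t /forallP h].
by apply/forallP => j; exact: lt_le_trans (h j) ab.
Qed.

Let Nk0 : 0 < N * kap. Proof. exact: mulr_gt0. Qed.
Let kNk : kap <= N * kap. Proof. by rewrite ler_peMl// ltW. Qed.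
Let NkN : N * kap <= N ^+ 2 * kap.
Proof. by rewrite expr2 -mulrA ler_peMl// ltW. Qed.
Let D3 : D <= (kap + 2 * (N * kap)) ^+ 2.
Proof.
apply: (le_trans Dkap); apply: lerXn2r; rewrite ?nnegrE ?addr_ge0 ?mulr_ge0 ?(ltW kap0) ?(ltW N0)//.
by rewrite lerDl mulr_ge0// ltW.
Qed.
Let k30 : 0 < kap + 2 * (N * kap). Proof. by rewrite addr_gt0// mulr_gt0. Qed.
Let k3N : N * (kap + 2 * (N * kap)) <= 3 * (N ^+ 2 * kap).
Proof. by rewrite mulrDr expr2; move: NkN; rewrite expr2 -!mulrA; move: (N * kap) => a; rewrite mulrCA; move: (N * a) => b; lra. Qed.
Let Je0 : 0 <= Jn * eta. Proof. by rewrite mulr_ge0. Qed.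

Let cmpI0 : 0 <= cmpI.
Proof.
rewrite /cmpI; apply: addr_ge0; last by rewrite mulr_ge0.
apply: addr_ge0; last by rewrite mulr_ge0.
by apply: mulr_ge0; [apply: mulr_ge0 => //; apply: exprn_ge0; exact: ltW|exact: ltW].
Qed.

Let band0 k : k <= 3 * (N * kap) -> Cb * N ^+ 3 * k + (4 + 2 * cn * N) * (Jn * eta) <=
   Cb * N ^+ 3 * (3 * (N * kap)) + (4 + 2 * cn * N) * (Jn * eta).
Proof. by move=> h; rewrite lerD2r ler_wpM2l// mulr_ge0 ?exprn_ge0 ?(ltW N0). Qed.

Let band00 : 0 <= Cb * N ^+ 3 * (3 * (N * kap)) + (4 + 2 * cn * N) * (Jn * eta).
Proof.
by rewrite !addr_ge0 ?mulr_ge0 ?exprn_ge0 ?(ltW N0) ?(ltW kap0)// addr_ge0// !mulr_ge0 ?expR_ge0 ?(ltW N0).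
Qed.

Let low0 u : 0 < u -> u <= 6 * (N ^+ 2 * kap) -> pZ u <= 4 * cn / s0 * N * (6 * (N ^+ 2 * kap)) + Jn * eta.
Proof.
move=> u0 h; apply: (le_trans (pZ_low u0)); rewrite lerD2r ler_wpM2l//.
by rewrite mulr_ge0 ?(ltW N0)// divr_ge0 ?mulr_ge0 ?expR_ge0 ?(ltW s00).
Qed.

Let low00 : 0 <= 4 * cn / s0 * N * (6 * (N ^+ 2 * kap)) + Jn * eta.
Proof. by apply: le_trans (low0 _ (lexx _)); [exact: gP_ge0|rewrite !mulr_gt0// exprn_gt0]. Qed.

(** From level 3 N^2 kap on, smoothing at scale [N * kap] and the band estimate for the linear forms
    apply. Below it both distribution functions are small by [pZ_low]. The margin [kap] is reserved
    for the nonlinear remainder of the error. *)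
Theorem comparison_up u : pL (u + kap) <= pZ u + cmpT.
Proof.
have N2k0 : 0 < N ^+ 2 * kap by rewrite mulr_gt0// exprn_gt0.
have E2 : N * (2 * (N * kap)) = 2 * (N ^+ 2 * kap) by rewrite expr2; ring.
have [hu|hu] := lerP (3 * (N ^+ 2 * kap)) u.
  have h1 := @pL_le_pZ (u + kap) _; rewrite E2 in h1.
  have {}h1 := h1 (_ : 2 * (N ^+ 2 * kap) <= u + kap).
  have h2 := @pZ_band u (kap + 2 * (N * kap)) k30 (le_trans k3N hu) D3.
  have h3 : kap + 2 * (N * kap) <= 3 * (N * kap) by move: kNk; move: kap (N * kap) => *; lra.
  have h4 := band0 h3; rewrite addrA in h2.
  have {}h1 : pL (u + kap) <= pZ (u + kap + 2 * (N * kap)) + cmpI.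
    by apply: h1; move: kap0 N2k0 hu; move: kap (N ^+ 2 * kap) => *; lra.
  apply: (le_trans h1); rewrite /cmpT; move: h2 h4 low00.
  move: (pZ _) (pZ _) cmpI (Cb * _ * (kap + _) + _) (Cb * _ * (3 * _) + _) (4 * cn / s0 * N * _ + _) => *; lra.
have h1 : pL (u + kap) <= pL (3 * (N ^+ 2 * kap) + kap) by apply: mono_pL; rewrite lerD2r ltW.
have h2 := @pL_le_pZ (3 * (N ^+ 2 * kap) + kap) _; rewrite E2 in h2.
have {}h2 : pL (3 * (N ^+ 2 * kap) + kap) <= pZ (3 * (N ^+ 2 * kap) + kap + 2 * (N * kap)) + cmpI.
  by apply: h2; move: kap0 N2k0; move: kap (N ^+ 2 * kap) => *; lra.
have h3 : pZ (3 * (N ^+ 2 * kap) + kap + 2 * (N * kap)) <= 4 * cn / s0 * N * (6 * (N ^+ 2 * kap)) + Jn * eta.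
  apply: low0; first by rewrite !addr_gt0 ?mulr_gt0.
  by move: kNk NkN; move: kap (N * kap) (N ^+ 2 * kap) => *; lra.
apply: (le_trans h1); apply: (le_trans h2); rewrite /cmpT; move: h3 band00 (gP_ge0 (fun t => [forall j, lin (v j) t < u])).
rewrite -/(pZ u); move: (pZ _) (pZ _) cmpI (Cb * _ * (3 * _) + _) (4 * cn / s0 * N * _ + _) => *; lra.
Qed.

Theorem comparison_down u : pZ u <= pL (u - kap) + cmpT.
Proof.
have N2k0 : 0 < N ^+ 2 * kap by rewrite mulr_gt0// exprn_gt0.
have E2 : N * (2 * (N * kap)) = 2 * (N ^+ 2 * kap) by rewrite expr2; ring.
set a := u - (kap + 2 * (N * kap)).
have ua : u = a + (kap + 2 * (N * kap)) by rewrite /a subrK.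
have ua2 : u - kap = a + 2 * (N * kap) by rewrite /a; ring.
clearbody a.
have [ha|ha] := lerP (3 * (N ^+ 2 * kap)) a.
  have h1 := @pZ_le_pL a _; rewrite E2 -ua2 in h1.
  have {}h1 : pZ a <= pL (u - kap) + cmpI.
    by apply: h1; move: N2k0 ha; move: (N ^+ 2 * kap) => *; lra.
  have h2 := @pZ_band a (kap + 2 * (N * kap)) k30 (le_trans k3N ha) D3; rewrite -ua in h2.
  have h3 : kap + 2 * (N * kap) <= 3 * (N * kap) by move: kNk; move: kap (N * kap) => *; lra.
  have h4 := band0 h3.
  apply: (le_trans h2); rewrite /cmpT; move: h1 h4 low00.
  move: (pZ _) (pL _) cmpI (Cb * _ * (kap + _) + _) (Cb * _ * (3 * _) + _) (4 * cn / s0 * N * _ + _) => *; lra.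
have h1 : pZ u <= pZ (6 * (N ^+ 2 * kap)).
  apply: mono_pZ; rewrite ua; move: ha kNk NkN; move: (N * kap) (N ^+ 2 * kap) => *; lra.
have h2 : pZ (6 * (N ^+ 2 * kap)) <= 4 * cn / s0 * N * (6 * (N ^+ 2 * kap)) + Jn * eta.
  by apply: low0; rewrite ?mulr_gt0.
apply: (le_trans h1); rewrite /cmpT; move: h2 cmpI0 band00 (gP_ge0 (fun t => [forall j, qf (Mj j) t < u - kap])).
rewrite -/(pL _); move: (pL _) (pZ _) cmpI (Cb * _ * (3 * _) + _) (4 * cn / s0 * N * _ + _) => *; lra.
Qed.

End comparison.

(** * Negative moments of the sample covariance matrix *)

Section laplace.
Context {R : realType} (K n : nat) (A : 'M[R]_(K, n)) (Lam : R) (m : nat).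
Hypotheses (Lam0 : 0 < Lam) (hLam : forall w : 'rV[R]_n, dotp (w *m A^T) (w *m A^T) <= Lam * dotp w w).
Hypothesis hm : m%:R * (2 * Lam) <= fro A.
Local Notation T := (K.-tuple R).

Definition sqn (t : T) := dotp (xr t *m A) (xr t *m A).

Lemma sqn_ge0 t : 0 <= sqn t. Proof. exact: dotp_ge0. Qed.

Lemma sqnE t : sqn t = qf (A *m A^T) t + fro A.
Proof.
rewrite fro_trace -dotp_xr /sqn !dotpE; congr (_ 0 0).
by rewrite !trmx_mul !mulmxA.
Qed.

Lemma tame_sqn : tame sqn.
Proof. by apply: tame_sum => a; apply: tameM; exact: tame_xr_mul. Qed.

Definition lap (s : R) := gE (fun t => expR (- (s / 2) * sqn t)).

Lemma tame_lap (s : R) : 0 <= s -> tame (fun t => expR (- (s / 2) * sqn t)).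
Proof.
move=> s0; apply: (@tame_bounded _ _ _ 1).
  by apply: measurableT_comp => //; apply: measurable_funM => //; exact: tame_measurable tame_sqn.
move=> t; rewrite ger0_norm ?expR_ge0// -[leRHS]expR0 ler_expR mulNr oppr_le0.
by rewrite mulr_ge0 ?sqn_ge0// divr_ge0.
Qed.

Lemma is_derive_lap (s : R) : 0 < s ->
  is_derive s 1 lap (- 2^-1 * gE (fun t => sqn t * expR (- (s / 2) * sqn t))).
Proof.
move=> s0; have [_ [c c0 hc]] := tame_sqn.
rewrite -gEZ; last by apply: tameM; [exact: tame_sqn|exact: tame_lap (ltW s0)].
apply: (@gE_derive R K (fun z t => expR (- (z / 2) * sqn t))
  (fun z t => - 2^-1 * (sqn t * expR (- (z / 2) * sqn t))) 0 (s + 1) c) => //.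
- by rewrite s0/= ltrDl.
- by move=> z /andP[z0 _]; exact: tame_lap (ltW z0).
- move=> z t _; have d : is_derive z 1 (fun y : R => - (y / 2) * sqn t) (- 2^-1 * sqn t).
    by apply: is_derive_eq; rewrite /GRing.scale/=; ring.
  have := @is_derive1_comp R expR (fun y => - (y / 2) * sqn t) z _ _ (is_derive_expR _) d.
  by rewrite mulrC -mulrA.
- move=> z t /andP[z0 _]; apply: le_trans (hc t); rewrite !normrM normrN (gtr0_norm (_ : 0 < 2^-1)) ?invr_gt0// (ger0_norm (expR_ge0 _)).
  have e1 : expR (- (z / 2) * sqn t) <= 1.
    by rewrite -[leRHS]expR0 ler_expR mulNr oppr_le0 mulr_ge0 ?sqn_ge0// divr_ge0// ltW.
  rewrite mulrA mulrAC; apply: le_trans (_ : 2^-1 * 1 * `|sqn t| <= _).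
    by rewrite ler_wpM2r// ler_wpM2l// invr_ge0.
  by rewrite mulr1 ler_piMl// invf_le1// ler1n.
Qed.

(** Integration by parts after writing [sqn] as a centred form plus [fro A]; the gradient term is |x
    A A^T|^2, at most [Lam * sqn]. *)
Lemma lap_ineq (s : R) : 0 < s -> fro A * lap s <= (1 + s * Lam) * gE (fun t => sqn t * expR (- (s / 2) * sqn t)).
Proof.
move=> s0; have te := tame_lap (ltW s0); have tU := tame_sqn.
have tx := @tame_xr_mul R K.
have g : hasgrad (fun t => expR (- (s / 2) * sqn t))
   (fun t => (- s * expR (- (s / 2) * sqn t)) *: (xr t *m (A *m A^T))).
  split; first exact: te.
    move=> a; apply: (tame_ext (f := fun t => - s * expR (- (s / 2) * sqn t) * (xr t *m (A *m A^T)) 0 a)).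
      by move=> t; rewrite [in RHS]mxE.
    by apply: tameM; [exact: tameZ|exact: tx].
  move=> w t; have gU : hasgrad sqn (fun t => 2 *: (xr t *m (A *m A^T))).
    have := hasgradD (hasgrad_qf (A *m A^T)) (hasgrad_cst K (fro A)).
    congr hasgrad; apply/funext => u; first by rewrite sqnE.
    by rewrite addr0 trmx_mul trmxK mulmxDr -mulr2n -scaler_nat.
  have [_ _ d] := hasgradZ (- (s / 2)) gU.
  have := @is_derive1_comp R expR _ 0 _ _ (is_derive_expR _) (d w t).
  rewrite /= scale0r shiftt0 !dotpZl.
  by congr is_derive; field.
have E : gE (fun t => sqn t * expR (- (s / 2) * sqn t)) = fro A * lap s +
    gE (fun t => qf (A *m A^T) t * expR (- (s / 2) * sqn t)).
  rewrite /lap -gEZ// -gED; [|exact: tameZ|by apply: tameM => //; exact: tame_qf].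
  by congr gE; apply/funext => t; rewrite {1}sqnE; ring.
have tN : tame (fun t => expR (- (s / 2) * sqn t) * dotp (xr t *m (A *m A^T)) (xr t *m (A *m A^T))).
  by apply: tameM => //; apply: tame_dotp => a; exact: tx.
have E2 : gE (fun t => qf (A *m A^T) t * expR (- (s / 2) * sqn t)) = - s *
    gE (fun t => expR (- (s / 2) * sqn t) * dotp (xr t *m (A *m A^T)) (xr t *m (A *m A^T))).
  by rewrite (gE_ibp_qf _ g) -gEZ//; congr gE; apply/funext => t; rewrite dotpZr mulrA.
have E3 : gE (fun t => expR (- (s / 2) * sqn t) * dotp (xr t *m (A *m A^T)) (xr t *m (A *m A^T))) <=
    Lam * gE (fun t => sqn t * expR (- (s / 2) * sqn t)).
  rewrite -gEZ; last exact: tameM.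
  apply: gE_le => //; first by apply: tameZ; exact: tameM.
  move=> t; rewrite mulrA mulrC ler_wpM2r ?expR_ge0// mulmxA; exact: hLam.
have := ler_wpM2l (ltW s0) E3; move: E E2.
set x := gE (fun t => sqn t * _); set y := gE (fun t => qf _ t * _); set z := gE (fun t => _ * dotp _ _).
by clearbody x y z; move: (fro A * _) => f *; lra.
Qed.

Lemma lap_ge0 s : 0 <= lap s.
Proof. by apply: gE_ge0 => t; exact: expR_ge0. Qed.

(** By [lap_ineq] the logarithmic derivative of [lap] is at most - fro A / (2 (1 + s Lam)), and
    [fro A >= 2 m Lam]; so [lap] decreases at least as fast as (1 + s Lam)^(-m). *)
Lemma lap_le (s0 s : R) : 0 < s0 -> s0 <= s ->
  lap s * (1 + s * Lam) ^+ m <= lap s0 * (1 + s0 * Lam) ^+ m.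
Proof.
move=> s00 s0s.
have p1 (z : R) : 0 < z -> 0 < 1 + z * Lam by move=> z0; rewrite addr_gt0// mulr_gt0.
pose f (z : R) := lap z * (1 + z * Lam) ^+ m.
pose df (z : R) := lap z * (m%:R * (1 + z * Lam) ^+ m.-1 * Lam) +
   (1 + z * Lam) ^+ m * (- 2^-1 * gE (fun t => sqn t * expR (- (z / 2) * sqn t))).
have d (z : R) : 0 < z -> is_derive z 1 f (df z).
  move=> z0; have d1 := is_derive_lap z0.
  have d2 : is_derive z 1 (fun y : R => 1 + y * Lam) Lam.
    by apply: is_derive_eq; rewrite /GRing.scale/=; ring.
  have d3 : is_derive z 1 (fun y : R => (1 + y * Lam) ^+ m) (m%:R * (1 + z * Lam) ^+ m.-1 * Lam).
    rewrite (_ : (fun y : R => (1 + y * Lam) ^+ m) = (fun y : R => 1 + y * Lam) ^+ m).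
      exact: is_deriveX d2.
    by rewrite exprfctE.
  exact: is_deriveM d1 d3.
apply: (@ler0_derive1_nincr R f s0 s _ _ _ s0 s (lexx _) s0s (lexx _)).
- by move=> z; rewrite in_itv/= => /andP[z0 _]; case: (d z (lt_trans s00 z0)).
- move=> z; rewrite in_itv/= => /andP[z0 _]; have z1 := lt_trans s00 z0.
  have dz := d z z1; rewrite derive1E derive_val /df.
  have := lap_ineq z1; have := p1 z z1; have l0 := lap_ge0 z.
  have := ler_wpM2r l0 hm.
  have g0 : 0 <= gE (fun t => sqn t * expR (- (z / 2) * sqn t)).
    by apply: gE_ge0 => t; rewrite mulr_ge0 ?sqn_ge0 ?expR_ge0.
  case: m => [|k] /=.
    by move=> *; rewrite !mul0r mulr0 add0r expr0 mul1r mulNr oppr_le0 mulr_ge0 ?invr_ge0.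
  move: (lap z) (gE _) l0 g0 => a g a0 g0 h1 h2 h3.
  have hk : 0 <= (1 + z * Lam) ^+ k by rewrite exprn_ge0// ltW.
  rewrite exprS (_ : _ + _ = (1 + z * Lam) ^+ k * (a * k.+1%:R * Lam - 2^-1 * ((1 + z * Lam) * g))); last by ring.
  by rewrite mulr_ge0_le0// ; move: h1 h3; move: (fro A) (k.+1%:R) => F r; lra.
- apply: derivable_within_continuous => z; rewrite in_itv/= => /andP[z0 _].
  by case: (d z (lt_le_trans s00 z0)).
Qed.

(** Markov's inequality for exp (- sqn / del), that is [s = 2 / del], and comparison with
    [s = 1 / Lam], where [lap] is at most 1 and the other factor is 2^m. *)
Lemma small_ball (del : R) : 0 < del -> del <= 2 * Lam ->
  gP (fun t => sqn t <= del) <= expR 1 * (del / Lam) ^+ m.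
Proof.
move=> d0 dL.
have s0 : 0 < Lam^-1 by rewrite invr_gt0.
have s1 : 0 < 2 / del by rewrite divr_gt0.
have s01 : Lam^-1 <= 2 / del by rewrite ler_pdivlMr// mulrC ler_pdivrMr.
have h := lap_le s0 s01.
have l1 : lap Lam^-1 <= 1.
  rewrite -[leRHS](@gE_cst R K); apply: gE_le; [exact: tame_lap (ltW s0)|exact: tame_cst|move=> t].
  by rewrite -[leRHS]expR0 ler_expR mulNr oppr_le0 mulr_ge0 ?sqn_ge0// divr_ge0// ltW.
have h1 : lap (2 / del) * (2 * Lam / del) ^+ m <= 2 ^+ m.
  apply: (@le_trans _ _ (lap (2 / del) * (1 + 2 / del * Lam) ^+ m)).
    rewrite ler_wpM2l ?lap_ge0//; apply: lerXn2r; rewrite ?nnegrE ?addr_ge0 ?divr_ge0 ?mulr_ge0 ?(ltW Lam0) ?(ltW d0) ?invr_ge0 ?(ltW d0)//.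
    by rewrite mulrAC lerDr.
  apply: (le_trans h); rewrite mulVf ?gt_eqF//.
  by apply: le_trans (ler_piMl _ l1) _; rewrite ?exprn_ge0.
have h2 : lap (2 / del) <= (del / Lam) ^+ m.
  have x0 : 0 < (2 * Lam / del) ^+ m by rewrite exprn_gt0// divr_gt0// mulr_gt0.
  rewrite -(ler_pM2r x0) (le_trans h1)// -exprMn.
  by rewrite (_ : del / Lam * (2 * Lam / del) = 2)//; field; rewrite !gt_eqF.
apply: le_trans (ler_wpM2l (expR_ge0 1) h2).
rewrite /lap -gEZ; last exact: tame_lap (ltW s1).
apply: gE_le.
- by apply: tame_bool; apply: mb_le; [exact: tame_sqn|exact: tame_cst].
- by apply: tameZ; exact: tame_lap (ltW s1).
move=> t; case: (lerP (sqn t) del) => hd; last by rewrite mulr_ge0 ?expR_ge0.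
rewrite -expRD -[leLHS]expR0 ler_expR (_ : - (2 / del / 2) * sqn t = - (sqn t / del)); last by field; rewrite gt_eqF.
by rewrite subr_ge0 ler_pdivrMr// mul1r.
Qed.

End laplace.

Lemma lower_unitmx (R : realFieldType) p (H : 'M[R]_p) (e : R) : 0 < e ->
  (forall v : 'rV[R]_p, e * \sum_a v 0 a ^+ 2 <= (v *m H *m v^T) 0 0) -> H \in unitmx.
Proof.
move=> e0 h; rewrite -row_free_unit; apply: inj_row_free => v vH.
apply/rowP => a; rewrite mxE; apply/eqP; rewrite -sqrf_eq0; apply/eqP/le_anti.
rewrite sqr_ge0 andbT; have := h v; rewrite vH mul0mx mxE pmulr_rle0// => /(le_trans _); apply.
by rewrite (bigD1 a)//= lerDl sumr_ge0// => i _; exact: sqr_ge0.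
Qed.

(** For v the j-th row of the inverse, v H v^T = v_j, so e |v|^2 <= v_j. This gives first v_j <= 1 /
    e and then |v| <= 1 / e. *)
Lemma lower_invmx_entry (R : rcfType) p (H : 'M[R]_p) (e : R) : 0 < e ->
  (forall v : 'rV[R]_p, e * \sum_a v 0 a ^+ 2 <= (v *m H *m v^T) 0 0) ->
  forall j k, `|invmx H j k| <= e^-1.
Proof.
move=> e0 h j k; have uH := lower_unitmx e0 h.
set v := row j (invmx H).
have vH : v *m H = delta_mx 0 j by rewrite /v -row_mul mulVmx// row1.
have sq (i : 'I_p) : v 0 i ^+ 2 <= \sum_a v 0 a ^+ 2.
  by rewrite (bigD1 i)//= lerDl sumr_ge0// => a _; exact: sqr_ge0.
have vj : (v *m H *m v^T) 0 0 = v 0 j.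
  rewrite vH mxE (bigD1 j)//= !mxE !eqxx mul1r big1 ?addr0// => i ij.
  by rewrite !mxE (negbTE ij) andbF mul0r.
have hv := h v; rewrite vj in hv.
have vj0 : 0 <= v 0 j by apply: le_trans hv; rewrite mulr_ge0 ?(ltW e0)// sumr_ge0// => a _; exact: sqr_ge0.
have vjle : v 0 j <= e^-1.
  have := sq j; have [->|vjn] := eqVneq (v 0 j) 0; first by move=> _; rewrite invr_ge0 ltW.
  have vjp : 0 < v 0 j by rewrite lt_neqAle eq_sym vjn.
  move=> h2; have := le_trans (ler_wpM2l (ltW e0) h2) hv.
  by rewrite expr2 mulrA ger_pMl// -ler_pdivlMl// mulr1.
have -> : invmx H j k = v 0 k by rewrite mxE.
have ei0 : 0 <= e^-1 by rewrite invr_ge0 ltW.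
rewrite -(@ler_pXn2r _ 2)// real_normK ?num_real//.
apply: (le_trans (sq k)); rewrite -ler_pdivlMl// in hv; apply: (le_trans hv).
by rewrite expr2 ler_wpM2l.
Qed.

(** * Lower bound for the sample covariance matrix through a grid of directions *)

Section good_event.
Context {R : realType} (K n p : nat) (xi : 'I_n -> 'I_p -> 'rV[R]_K) (Sg : 'M[R]_p).
Context (ce Ce Rr : R) (r : 'I_n -> 'I_n -> R).
Hypotheses (n0 : (0 < n)%N) (p0 : (0 < p)%N).
Hypothesis hS : forall i a b, dotp (xi i a) (xi i b) = Sg a b.
Hypotheses (ce0 : 0 < ce) (hce : forall v : 'rV[R]_p, ce * dotp v v <= dotp (v *m Sg) v).
Hypothesis hCe : forall a, Sg a a <= Ce.
Hypothesis hr : forall i l a b, `|dotp (xi i a) (xi l b)| <= r i l.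
Hypotheses (rl : forall i, \sum_l r i l <= Rr) (rr : forall l, \sum_i r i l <= Rr) (Rr1 : 1 <= Rr).
Local Notation T := (K.-tuple R).

Definition Hm (t : T) : 'M[R]_p := \matrix_(a, b) (n%:R^-1 * \sum_i lin (xi i a) t * lin (xi i b) t).

(** The observations projected on [g]; the form of [Hm] at [g] becomes a squared norm, to which
    [small_ball] applies. *)
Definition dirA (g : 'rV[R]_p) : 'M[R]_(K, n) := \matrix_(k, i) \sum_a g 0 a * xi i a 0 k.

Lemma xr_dirA g t i : (xr t *m dirA g) 0 i = \sum_a g 0 a * lin (xi i a) t.
Proof.
rewrite mxE; under eq_bigr do rewrite !mxE mulr_sumr.
rewrite exchange_big/=; apply: eq_bigr => a _; rewrite /lin mulr_sumr.
by apply: eq_bigr => k _; ring.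
Qed.

Lemma Hm_form (g : 'rV[R]_p) t : dotp (g *m Hm t) g = n%:R^-1 * sqn (dirA g) t.
Proof.
rewrite /sqn /dotp; under [in RHS]eq_bigr do rewrite xr_dirA.
transitivity (\sum_b \sum_a n%:R^-1 * \sum_i (g 0 a * lin (xi i a) t) * (g 0 b * lin (xi i b) t)).
  apply: eq_bigr => b _; rewrite mxE mulr_suml; apply: eq_bigr => a _; rewrite mxE.
  by rewrite !mulr_sumr mulr_suml; apply: eq_bigr => i _; ring.
rewrite exchange_big mulr_sumr/=.
under eq_bigr do rewrite -mulr_sumr exchange_big/=.
rewrite -mulr_sumr exchange_big/= -mulr_sumr; congr (_ * _); apply: eq_bigr => i _.
by rewrite mulr_suml; apply: eq_bigr => a _; rewrite [RHS]mulr_sumr; exact: eq_bigr.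
Qed.

Lemma fro_dirA g : fro (dirA g) = n%:R * dotp (g *m Sg) g.
Proof.
rewrite /fro exchange_big/=.
transitivity (\sum_(i < n) dotp (g *m Sg) g); last by rewrite sumr_const card_ord mulr_natl.
apply: eq_bigr => i _.
transitivity (dotp (\sum_a g 0 a *: xi i a) (\sum_a g 0 a *: xi i a)).
  by apply: eq_bigr => k _; rewrite mxE summxE expr2; congr (_ * _); apply: eq_bigr => a _; rewrite mxE.
rewrite dotp_sumr; apply: eq_bigr => b _; rewrite dotpZr mulrC; congr (_ * _).
by rewrite dotp_suml mxE; apply: eq_bigr => a _; rewrite dotpZl hS.
Qed.

(** Schur test with the row and column sums of [r]; the factor [p] comes from bounding the 1-norm of
    [g] by its Euclidean norm. *)
Lemma dirA_op (g : 'rV[R]_p) (w : 'rV[R]_n) :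
  dotp (w *m (dirA g)^T) (w *m (dirA g)^T) <= p%:R * dotp g g * Rr * dotp w w.
Proof.
pose y i := \sum_a g 0 a *: xi i a.
have wE : w *m (dirA g)^T = \sum_i w 0 i *: y i.
  apply/rowP => k; rewrite mxE summxE; apply: eq_bigr => i _; rewrite !mxE; congr (_ * _).
  by rewrite summxE; apply: eq_bigr => a _; rewrite mxE.
pose V := \sum_a `|g 0 a|.
have V2 : V ^+ 2 <= p%:R * dotp g g.
  have := cauchy_schwarz_sum (fun=> 1) (fun a : 'I_p => `|g 0 a|).
  under eq_bigr do rewrite mul1r; under [X in _ <= X * _]eq_bigr do rewrite expr1n.
  rewrite sumr_const card_ord; under [X in _ <= _ * X]eq_bigr do rewrite real_normK ?num_real//.
  by [].
have yy i l : `|dotp (y i) (y l)| <= V ^+ 2 * r i l.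
  rewrite dotp_sumr; apply: (le_trans (ler_norm_sum _ _ _)).
  rewrite expr2 -mulrA mulr_suml; apply: ler_sum => b _; rewrite dotpZr normrM ler_wpM2l//.
  rewrite dotp_suml; apply: (le_trans (ler_norm_sum _ _ _)); rewrite mulr_suml; apply: ler_sum => a _.
  by rewrite dotpZl normrM ler_wpM2l.
have r0 i l : 0 <= r i l.
  have a : 'I_p := Ordinal p0; exact: le_trans (hr i l a a).
have VR : V ^+ 2 * Rr * dotp w w <= p%:R * dotp g g * Rr * dotp w w.
  by rewrite ler_wpM2r ?dotp_ge0// ler_wpM2r// (le_trans ler01 Rr1).
apply: le_trans VR; rewrite wE dotp_sumr.
apply: (@le_trans _ _ (\sum_l \sum_i V ^+ 2 * (r i l * (2^-1 * (w 0 i ^+ 2 + w 0 l ^+ 2))))).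
  apply: ler_sum => l _; rewrite dotpZr dotp_suml mulr_sumr; apply: ler_sum => i _.
  rewrite dotpZl; apply: (le_trans (ler_norm _)); rewrite !normrM mulrA mulrC.
  apply: (le_trans (ler_wpM2r _ (yy i l))); first exact: mulr_ge0.
  rewrite -mulrA ler_wpM2l ?sqr_ge0// ler_wpM2l//.
  rewrite -!normrM ler_norml; apply/andP; split.
    by have := sqr_ge0 (w 0 l + w 0 i); move: (w 0 i) (w 0 l) => x z; lra.
  by have := sqr_ge0 (w 0 l - w 0 i); move: (w 0 i) (w 0 l) => x z; lra.
under eq_bigr do rewrite -mulr_sumr; rewrite -mulr_sumr -mulrA ler_wpM2l ?sqr_ge0//.
have -> : \sum_l \sum_i r i l * (2^-1 * (w 0 i ^+ 2 + w 0 l ^+ 2)) =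
   2^-1 * (\sum_i (\sum_l r i l) * w 0 i ^+ 2 + \sum_l (\sum_i r i l) * w 0 l ^+ 2).
  under [X in _ = _ * (X + _)]eq_bigr do rewrite mulr_suml.
  rewrite [X in _ = _ * (X + _)]exchange_big/= -big_split mulr_sumr; apply: eq_bigr => l _.
  by rewrite mulr_suml -big_split mulr_sumr; apply: eq_bigr => i _ /=; ring.
have S1 : \sum_i (\sum_l r i l) * w 0 i ^+ 2 <= Rr * dotp w w.
  by rewrite /dotp mulr_sumr; apply: ler_sum => i _; rewrite -expr2 ler_wpM2r ?sqr_ge0.
have S2 : \sum_l (\sum_i r i l) * w 0 l ^+ 2 <= Rr * dotp w w.
  by rewrite /dotp mulr_sumr; apply: ler_sum => i _; rewrite -expr2 ler_wpM2r ?sqr_ge0.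
by move: S1 S2; move: (\sum_i _) (\sum_l _) (Rr * _) => a b c; lra.
Qed.

Variable m : nat.
Hypothesis hm : m%:R * (2 * (p%:R * Rr)) <= n%:R * ce.

Let nR0 : 0 < n%:R :> R. Proof. by rewrite ltr0n. Qed.
Let p1 : 1 <= p%:R :> R. Proof. by rewrite ler1n. Qed.

Lemma grid_ball (g : 'rV[R]_p) (del : R) : 4^-1 <= dotp g g -> 0 < del -> 2 * n%:R * del <= 1 ->
  gP (fun t => dotp (g *m Hm t) g <= del) <= expR 1 * (4 * n%:R * del) ^+ m.
Proof.
move=> g4 d0 nd.
have gg0 : 0 < dotp g g by apply: lt_le_trans g4; rewrite invr_gt0.
have pR1 : 1 <= p%:R * Rr by rewrite -[leLHS]mulr1 ler_pM.
pose Lam := p%:R * dotp g g * Rr.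
have L4 : 4^-1 <= Lam by rewrite /Lam mulrAC -[leLHS]mul1r ler_pM.
have L0 : 0 < Lam by apply: lt_le_trans L4; rewrite invr_gt0.
have hL w : dotp (w *m (dirA g)^T) (w *m (dirA g)^T) <= Lam * dotp w w by exact: dirA_op.
have hmL : m%:R * (2 * Lam) <= fro (dirA g).
  rewrite fro_dirA; apply: (@le_trans _ _ (n%:R * (ce * dotp g g))); last by rewrite ler_wpM2l// ltW.
  have -> : m%:R * (2 * Lam) = m%:R * (2 * (p%:R * Rr)) * dotp g g by rewrite /Lam; ring.
  by rewrite [leRHS]mulrA ler_wpM2r// ltW.
have nd0 : 0 < n%:R * del by rewrite mulr_gt0.
have h := small_ball L0 hL hmL nd0 _.
have {}h := h (_ : n%:R * del <= 2 * Lam).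
have ndL : n%:R * del <= 2 * Lam by move: nd L4; rewrite -mulrA; move: (n%:R * del) => x; lra.
apply: (@le_trans _ _ (gP (fun t => sqn (dirA g) t <= n%:R * del))).
  apply: gP_le.
  - apply: mb_le; last exact: tame_cst.
    by apply: (tame_ext (f := fun t => n%:R^-1 * sqn (dirA g) t)) (tameZ _ (tame_sqn _)) => t; rewrite Hm_form.
  - by apply: mb_le; [exact: tame_sqn|exact: tame_cst].
  - by move=> t; rewrite Hm_form ler_pdivrMl.
apply: (le_trans (h ndL)); rewrite ler_wpM2l ?expR_ge0//.
apply: lerXn2r; rewrite ?nnegrE ?divr_ge0 ?(ltW L0) ?(ltW nd0)//; first by rewrite -mulrA mulr_ge0// ltW.
rewrite ler_pdivrMr// -mulrA; have := ler_wpM2l (ltW nd0) L4.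
rewrite (_ : 4 * (n%:R * del) * Lam = 4 * (n%:R * del * Lam)); last by ring.
move: (n%:R * del * Lam) => y; rewrite ler_pdivrMr// => h4.
by rewrite [4 * y]mulrC.
Qed.

Variables (eps : R) (L : nat).
Hypotheses (eps0 : 0 < eps) (L2 : (2 <= L)%N) (Leps : L%:R^-1 <= eps).

Definition gridv (k : {ffun 'I_p -> 'I_(2 * L + 1)}) : 'rV[R]_p := \row_a ((k a)%:R / L%:R - 1).

(** The trace controls how the form changes between a vector and its nearest grid point; the lower
    bound at grid points away from 0 is then transferred to all directions. *)
Definition good (t : T) : bool := (\tr (Hm t) <= eps^-1) &&
  [forall k, (4^-1 <= dotp (gridv k) (gridv k)) ==> ~~ (dotp (gridv k *m Hm t) (gridv k) <= 4 * p%:R * eps)].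

Lemma Hm_qD (u d : 'rV[R]_p) t : dotp ((u + d) *m Hm t) (u + d) <=
  2 * dotp (u *m Hm t) u + 2 * (dotp d d * \tr (Hm t)).
Proof.
have q (g : 'rV[R]_p) : dotp (g *m Hm t) g = n%:R^-1 * \sum_i (\sum_a g 0 a * lin (xi i a) t) ^+ 2.
  by rewrite Hm_form; congr (_ * _); apply: eq_bigr => i _; rewrite xr_dirA expr2.
have trE : \tr (Hm t) = n%:R^-1 * \sum_i \sum_a lin (xi i a) t ^+ 2.
  by rewrite exchange_big mulr_sumr; apply: eq_bigr => a _; rewrite mxE; congr (_ * _); apply: eq_bigr => i _.
rewrite !q trE.
have -> : 2 * (n%:R^-1 * \sum_i (\sum_a u 0 a * lin (xi i a) t) ^+ 2) + 2 * (dotp d d * (n%:R^-1 * \sum_i \sum_a lin (xi i a) t ^+ 2)) =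
  n%:R^-1 * \sum_i (2 * (\sum_a u 0 a * lin (xi i a) t) ^+ 2 + 2 * (dotp d d * \sum_a lin (xi i a) t ^+ 2)).
  by rewrite big_split/= -!mulr_sumr; ring.
rewrite ler_wpM2l ?invr_ge0 ?(ltW nR0)//; apply: ler_sum => i _.
have -> : \sum_a (u + d) 0 a * lin (xi i a) t = \sum_a u 0 a * lin (xi i a) t + \sum_a d 0 a * lin (xi i a) t.
  by rewrite -big_split; apply: eq_bigr => a _; rewrite mxE mulrDl.
have := cauchy_schwarz_sum (fun a => d 0 a) (fun a => lin (xi i a) t).
rewrite (_ : \sum_a d 0 a ^+ 2 = dotp d d); last by apply: eq_bigr => a _; rewrite expr2.
move: (\sum_a u 0 a * _) (\sum_a d 0 a * _) (_ * \sum_a _ ^+ 2) => x y z h.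
by have := sqr_ge0 (x - y); nra.
Qed.

(** Scale [v] to sup norm 1 and round down to the grid: coordinates move by at most 1 / L <= eps,
    and the largest keeps modulus 1/2. If the form were below eps |v|^2, its value at the grid point
    would be at most 2 p eps + 2 p eps^2 / eps, against [good]. *)
Lemma good_lower t : good t -> forall v : 'rV[R]_p, eps * dotp v v <= dotp (v *m Hm t) v.
Proof.
move=> /andP[tr1 /forallP gr] v.
have [->|v0] := eqVneq v 0; first by rewrite mul0mx !dotp0l mulr0.
have [a0 ha0] : exists a0, v 0 a0 != 0.
  apply/existsP; apply: contra_neqT v0 => /existsPn h; apply/rowP => a; rewrite mxE.
  by have := h a; rewrite negbK => /eqP.
have [a1 _ max1] := @arg_maxP _ _ _ a0 xpredT (fun a => `|v 0 a|) isT.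
pose M := `|v 0 a1|; have M0 : 0 < M by apply: lt_le_trans (max1 a0 isT); rewrite normr_gt0.
pose u : 'rV[R]_p := M^-1 *: v.
have u1 a : `|u 0 a| <= 1.
  by rewrite mxE normrM gtr0_norm ?invr_gt0// ler_pdivrMl// mulr1; exact: max1.
have ua1 : `|u 0 a1| = 1 by rewrite mxE normrM gtr0_norm ?invr_gt0// mulVf// gt_eqF.
have vE : v = M *: u by rewrite /u scalerA divff ?scale1r// gt_eqF.
clearbody u.
suff h : eps * dotp u u <= dotp (u *m Hm t) u.
  have : eps * dotp (M *: u) (M *: u) <= dotp ((M *: u) *m Hm t) (M *: u).
    rewrite -scalemxAl !dotpZl !dotpZr mulrCA ler_wpM2l ?(ltW M0)// mulrCA ler_wpM2l ?(ltW M0)//.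
  by rewrite -vE.
rewrite leNgt; apply/negP => lt1.
have L0 : 0 < L%:R :> R by rewrite ltr0n ltnW.
have kp (a : 'I_p) : (Num.truncn ((u 0%R a + 1)%R * L%:R)%R < 2 * L + 1)%N.
  have x0 : 0 <= (u 0 a + 1) * L%:R by rewrite mulr_ge0 ?(ltW L0)//; have := u1 a; rewrite ler_norml => /andP[+ _]; lra.
  have /andP[t1 _] := truncn_itv x0.
  rewrite addn1 ltnS -(@ler_nat R); apply: (le_trans t1).
  by rewrite natrM ler_wpM2r ?(ltW L0)//; have := u1 a; rewrite ler_norml => /andP[_]; lra.
pose k := [ffun a => Ordinal (kp a)].
pose g := gridv k; pose d := g - u.
have dle a : `|d 0 a| <= L%:R^-1.
  have x0 : 0 <= (u 0 a + 1) * L%:R by rewrite mulr_ge0 ?(ltW L0)//; have := u1 a; rewrite ler_norml => /andP[+ _]; lra.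
  have /andP[t1 t2] := truncn_itv x0.
  rewrite /d !mxE ffunE/=; set z := Num.truncn _ in t1 t2 *.
  rewrite (_ : _ - 1 - _ = (z%:R - (u 0 a + 1) * L%:R) / L%:R); last by field; rewrite gt_eqF.
  rewrite normrM (gtr0_norm (_ : 0 < L%:R^-1)) ?invr_gt0// ler_piMl ?invr_ge0 ?(ltW L0)//.
  by move: t1 t2; rewrite -natr1 ler_norml; move: z%:R (_ * _) => x y; lra.
have gE_ : g = u + d by rewrite /d addrC subrK.
have g4 : 4^-1 <= dotp g g.
  have : g 0 a1 ^+ 2 <= dotp g g.
    by rewrite /dotp (bigD1 a1)//= -expr2 lerDl sumr_ge0// => a _; rewrite -expr2 sqr_ge0.
  apply: le_trans; have da := dle a1.
  have L12 : L%:R^-1 <= 2^-1 :> R by rewrite lef_pV2 ?posrE// ler_nat.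
  have h2 : 2^-1 <= `|g 0 a1|.
    rewrite gE_ mxE; have := ler_normB (u 0 a1 + d 0 a1) (d 0 a1); rewrite addrK ua1; lra.
  rewrite -real_normK ?num_real//; have : 0 <= `|g 0 a1| by []. move: `|g 0 a1| h2 => x; nra.
have := implyP (gr k) g4; rewrite -/g => /negP; apply; rewrite gE_.
apply: (le_trans (Hm_qD _ _ _)).
have uu : dotp u u <= p%:R.
  rewrite -[p in leRHS]card_ord -sumr_const; apply: ler_sum => a _.
  by rewrite -expr2 -real_normK ?num_real// exprn_ile1.
have dd : dotp d d <= p%:R * eps ^+ 2.
  rewrite -[p in leRHS]card_ord mulr_natl -sumr_const; apply: ler_sum => a _.
  rewrite -expr2 -real_normK ?num_real//; apply: lerXn2r; rewrite ?nnegrE ?(ltW eps0)//.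
  exact: le_trans (dle a) Leps.
have dt : dotp d d * \tr (Hm t) <= p%:R * eps.
  apply: (@le_trans _ _ (dotp d d * eps^-1)); first by rewrite ler_wpM2l// dotp_ge0.
  by rewrite ler_pdivrMr// -mulrA -expr2.
have eu : eps * dotp u u <= p%:R * eps by rewrite mulrC ler_wpM2r// ltW.
by move: lt1 dt eu; rewrite -mulrA; move: (dotp (u *m _) _) (_ * \tr _) (eps * _) (p%:R * _) => *; lra.
Qed.

Lemma good_invmx t : good t -> forall j k, `|invmx (Hm t) j k| <= eps^-1.
Proof.
move=> gt; apply: lower_invmx_entry => // v.
have -> : \sum_a v 0 a ^+ 2 = dotp v v by apply: eq_bigr => a _; rewrite expr2.
by rewrite -dotpE; exact: good_lower.
Qed.

Lemma tame_Hm a b : tame (fun t => Hm t a b).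
Proof.
apply: (tame_ext (f := fun t => n%:R^-1 * \sum_i lin (xi i a) t * lin (xi i b) t)) => [t|]; first by rewrite mxE.
by apply: tameZ; apply: tame_sum => i; apply: tameM; exact: tame_lin.
Qed.

Lemma tame_Hm_form g : tame (fun t => dotp (g *m Hm t) g).
Proof.
by apply: (tame_ext (f := fun t => n%:R^-1 * sqn (dirA g) t)) (tameZ _ (tame_sqn _)) => t; rewrite Hm_form.
Qed.

Lemma mb_good : mb good.
Proof.
apply: mb_and; first by apply: mb_le; [apply: tame_sum => a; exact: tame_Hm|exact: tame_cst].
apply: mb_forall => k; apply: mb_imply; apply: measurable_neg; apply: mb_le; last exact: tame_cst.
exact: tame_Hm_form.
Qed.

Lemma trace_tail q : gP (fun t => ~~ (\tr (Hm t) <= eps^-1)) <=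
  n%:R * p%:R * ((2 * q)%N%:R * Ce * (p%:R * eps)) ^+ q.
Proof.
pose del := (eps * p%:R)^-1.
have pR0 : 0 < p%:R :> R by rewrite ltr0n.
have del0 : 0 < del by rewrite invr_gt0 mulr_gt0.
have sd0 : 0 < Num.sqrt del by rewrite sqrtr_gt0.
pose b (x : 'I_n * 'I_p) t := Num.sqrt del <= `|lin (xi x.1 x.2) t|.
have mb_b x : mb (b x) by apply: mb_le; [exact: tame_cst|apply: tame_norm; exact: tame_lin].
apply: (@le_trans _ _ (gP (fun t => [exists x, b x t]))).
  apply: gP_le.
  - by apply: measurable_neg; apply: mb_le; [apply: tame_sum => a; exact: tame_Hm|exact: tame_cst].
  - exact: mb_exists.
  move=> t; apply: contraNT => /existsPn nb.
  have hx i a : lin (xi i a) t ^+ 2 <= del.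
    have := nb (i, a); rewrite /b/= -ltNge => h.
    rewrite -real_normK ?num_real// -(sqr_sqrtr (ltW del0)); apply: lerXn2r; rewrite ?nnegrE ?sqrtr_ge0//.
    exact: ltW.
  rewrite (_ : eps^-1 = \sum_(a < p) del); last first.
    by rewrite sumr_const card_ord -mulr_natl /del; field; rewrite !gt_eqF.
  apply: ler_sum => a _; rewrite mxE ler_pdivrMl//.
  apply: (@le_trans _ _ (\sum_(i < n) del)); first by apply: ler_sum => i _; rewrite -expr2.
  by rewrite sumr_const card_ord mulr_natl.
apply: (le_trans (gP_exists mb_b)).
apply: (@le_trans _ _ (\sum_(x : 'I_n * 'I_p) ((2 * q)%N%:R * Ce * (p%:R * eps)) ^+ q)); last first.
  by rewrite sumr_const card_prod !card_ord -natrM -[leLHS]mulr_natl.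
apply: ler_sum => -[i a] _; apply: (le_trans (gP_markov q (tame_lin _) sd0)).
rewrite exprM sqr_sqrtr ?(ltW del0)// ler_pdivrMr ?exprn_gt0// -exprMn.
apply: (le_trans (gE_moment_lin _ q)); rewrite hS /=.
have Saa : 0 <= Sg a a by rewrite -(hS i) dotp_ge0.
rewrite (_ : _ * del = (2 * q)%N%:R * Ce); last by rewrite /del; field; rewrite !gt_eqF.
by apply: lerXn2r; rewrite ?nnegrE ?ler_wpM2l// mulr_ge0// (le_trans Saa).
Qed.

(** Union bound over the grid; the small-ball exponent [m] has to beat the number (2L + 1)^p of
    directions. *)
Lemma good_prob q : 8 * n%:R * p%:R * eps <= 1 -> gP (fun t => ~~ good t) <=
  n%:R * p%:R * ((2 * q)%N%:R * Ce * (p%:R * eps)) ^+ q +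
  (2 * L + 1)%N%:R ^+ p * (expR 1 * (16 * n%:R * p%:R * eps) ^+ m).
Proof.
move=> small.
pose bk (k : {ffun 'I_p -> 'I_(2 * L + 1)}) t := (4^-1 <= dotp (gridv k) (gridv k)) &&
  (dotp (gridv k *m Hm t) (gridv k) <= 4 * p%:R * eps).
have mbk k : mb (bk k).
  by apply: mb_and; [exact: mb_cst|apply: mb_le; [exact: tame_Hm_form|exact: tame_cst]].
have mtr : mb (fun t => ~~ (\tr (Hm t) <= eps^-1)).
  by apply: measurable_neg; apply: mb_le; [apply: tame_sum => a; exact: tame_Hm|exact: tame_cst].
apply: (@le_trans _ _ (gP (fun t => ~~ (\tr (Hm t) <= eps^-1) || [exists k, bk k t]))).
  apply: gP_le.
  - by apply: measurable_neg; exact: mb_good.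
  - by apply: mb_or => //; exact: mb_exists.
  move=> t; rewrite /good negb_and => /orP[->//|/forallPn[k]].
  by rewrite negb_imply negbK => h; apply/orP; right; apply/existsP; exists k.
apply: (le_trans (gP_or mtr (mb_exists mbk))); apply: lerD; first exact: trace_tail.
apply: (le_trans (gP_exists mbk)).
have pR0 : 0 < p%:R :> R by rewrite ltr0n.
apply: (@le_trans _ _ (\sum_(k : {ffun 'I_p -> 'I_(2 * L + 1)}) expR 1 * (16 * n%:R * p%:R * eps) ^+ m)); last first.
  by rewrite sumr_const card_ffun !card_ord -[leLHS]mulr_natl natrX.
apply: ler_sum => k _; have [h|h] := boolP (4^-1 <= dotp (gridv k) (gridv k)).
  apply: (le_trans (_ : _ <= gP (fun t => dotp (gridv k *m Hm t) (gridv k) <= 4 * p%:R * eps))).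
    by rewrite /bk h.
  have d0 : 0 < 4 * p%:R * eps by rewrite !mulr_gt0.
  have nd : 2 * n%:R * (4 * p%:R * eps) <= 1 by rewrite (_ : _ * _ = 8 * n%:R * p%:R * eps)//; ring.
  apply: (le_trans (grid_ball h d0 nd)).
  by rewrite (_ : 4 * n%:R * (4 * p%:R * eps) = 16 * n%:R * p%:R * eps)//; ring.
rewrite /gP (_ : (fun t => _) = (fun=> 0)); last by apply/funext => t; rewrite /bk (negbTE h).
by rewrite gE_cst mulr_ge0 ?expR_ge0// exprn_ge0// !mulr_ge0// ltW.
Qed.

End good_event.

(** * Perturbation of the precision matrix *)

Section cycles.
Context {R : realType} (n : nat) (r : 'I_n -> 'I_n -> R) (S1 S2 : R).
Hypotheses (r0 : forall i l, 0 <= r i l) (rC : forall i l, r i l = r l i).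
Hypotheses (h1 : forall i, \sum_l r i l <= S1) (h2 : forall i, \sum_l r i l ^+ 2 <= S2).
Hypotheses (S10 : 0 <= S1) (S20 : 0 <= S2).

Let sq_mean (x y : R) : x * y <= 2^-1 * (x ^+ 2 + y ^+ 2).
Proof. by have := sqr_ge0 (x - y); lra. Qed.

(** Two adjacent edges are replaced by half the sum of their squares; the squared edge then sums to
    [S2], the third edge to [S1], and one vertex stays free. *)
Lemma cycle3 : \sum_i \sum_l \sum_m r i l * (r l m * r m i) <= n%:R * (S1 * S2).
Proof.
apply: (@le_trans _ _ (\sum_i \sum_l \sum_m (2^-1 * (r i l ^+ 2 * r m i) + 2^-1 * (r l m ^+ 2 * r m i)))).
  apply: ler_sum => i _; apply: ler_sum => l _; apply: ler_sum => m _.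
  have := ler_wpM2r (r0 m i) (sq_mean (r i l) (r l m)); rewrite mulrA; move: (r i l) (r l m) (r m i) => x y z; lra.
have E1 : \sum_i \sum_l \sum_m r i l ^+ 2 * r m i <= n%:R * (S1 * S2).
  rewrite mulr_natl -[n in leRHS]card_ord -sumr_const; apply: ler_sum => i _.
  have sq0 : 0 <= \sum_l r i l ^+ 2 by apply: sumr_ge0 => l _; exact: sqr_ge0.
  have s1 : \sum_m r m i <= S1 by under eq_bigr do rewrite rC.
  rewrite exchange_big/=.
  under eq_bigr do rewrite -mulr_suml mulrC.
  by rewrite -mulr_suml; apply: ler_pM => //; apply: sumr_ge0.
have E2 : \sum_i \sum_l \sum_m r l m ^+ 2 * r m i <= n%:R * (S1 * S2).
  apply: le_trans E1; rewrite exchange_big/=; apply: eq_leW.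
  rewrite exchange_big/=.
  under eq_bigr do rewrite exchange_big/=.
  rewrite exchange_big/=; apply: eq_bigr => m _; rewrite exchange_big/=; apply: eq_bigr => l _; apply: eq_bigr => i _.
  by rewrite rC [r m i]rC.
have -> : \sum_i \sum_l \sum_m (2^-1 * (r i l ^+ 2 * r m i) + 2^-1 * (r l m ^+ 2 * r m i)) =
   2^-1 * (\sum_i \sum_l \sum_m r i l ^+ 2 * r m i) + 2^-1 * (\sum_i \sum_l \sum_m r l m ^+ 2 * r m i).
  rewrite !mulr_sumr -big_split; apply: eq_bigr => i _; rewrite !mulr_sumr -big_split; apply: eq_bigr => l _.
  by rewrite !mulr_sumr -big_split.
by move: E1 E2; move: (\sum_i _) (\sum_i _) (_ * _) => *; lra.
Qed.

(** Here opposite edges are paired, so that each of the other two gives a factor [S1]. *)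
Lemma cycle4 : \sum_i \sum_l \sum_m \sum_k r i l * (r l m * (r m k * r k i)) <= n%:R * (S1 ^+ 2 * S2).
Proof.
have in_sum (i l : 'I_n) : \sum_m \sum_k r i l ^+ 2 * (r l m * r k i) <= r i l ^+ 2 * S1 ^+ 2.
  under eq_bigr do rewrite -mulr_sumr -mulr_sumr.
  rewrite -mulr_sumr -mulr_suml ler_wpM2l ?sqr_ge0// expr2 ler_pM ?sumr_ge0//.
  by under eq_bigr do rewrite rC.
have E1 : \sum_i \sum_l \sum_m \sum_k r i l ^+ 2 * (r l m * r k i) <= n%:R * (S1 ^+ 2 * S2).
  rewrite mulr_natl -[n in leRHS]card_ord -sumr_const; apply: ler_sum => i _.
  apply: (@le_trans _ _ (\sum_l r i l ^+ 2 * S1 ^+ 2)); first by apply: ler_sum => l _.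
  by rewrite -mulr_suml mulrC ler_wpM2l ?sqr_ge0.
have E2 : \sum_i \sum_l \sum_m \sum_k r m k ^+ 2 * (r l m * r k i) <= n%:R * (S1 ^+ 2 * S2).
  have -> : \sum_i \sum_l \sum_m \sum_k r m k ^+ 2 * (r l m * r k i) =
      \sum_m \sum_k (r m k ^+ 2 * (\sum_l r l m * (\sum_i r k i))).
    transitivity (\sum_i \sum_m \sum_l \sum_k r m k ^+ 2 * (r l m * r k i)).
      by apply: eq_bigr => i _; rewrite exchange_big.
    rewrite exchange_big/=; apply: eq_bigr => m _.
    transitivity (\sum_i \sum_k \sum_l r m k ^+ 2 * (r l m * r k i)).
      by apply: eq_bigr => i _; rewrite exchange_big.
    rewrite exchange_big/=; apply: eq_bigr => k _; rewrite exchange_big mulr_sumr; apply: eq_bigr => l _.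
    by rewrite !mulr_sumr.
  rewrite mulr_natl -[n in leRHS]card_ord -sumr_const; apply: ler_sum => m _.
  apply: (@le_trans _ _ (\sum_k r m k ^+ 2 * S1 ^+ 2)); last by rewrite -mulr_suml mulrC ler_wpM2l ?sqr_ge0.
  apply: ler_sum => k _; rewrite ler_wpM2l ?sqr_ge0// -mulr_suml expr2 ler_pM ?sumr_ge0//.
  by under eq_bigr do rewrite rC.
apply: (@le_trans _ _ (2^-1 * (\sum_i \sum_l \sum_m \sum_k r i l ^+ 2 * (r l m * r k i)) +
   2^-1 * (\sum_i \sum_l \sum_m \sum_k r m k ^+ 2 * (r l m * r k i)))); last first.
  by move: E1 E2; move: (\sum_i _) (\sum_i _) (_ * _) => *; lra.
rewrite !mulr_sumr -big_split; apply: ler_sum => i _; rewrite !mulr_sumr -big_split; apply: ler_sum => l _.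
rewrite !mulr_sumr -big_split; apply: ler_sum => m _; rewrite !mulr_sumr -big_split; apply: ler_sum => k _ /=.
have := ler_wpM2r (mulr_ge0 (r0 l m) (r0 k i)) (sq_mean (r i l) (r m k)).
move: (r i l) (r l m) (r m k) (r k i) => x y z t; lra.
Qed.

End cycles.

(** * Sample cross-covariances as quadratic forms; traces of products *)

Section bilinear.
Context {R : realType} (K n : nat).
Hypothesis n0 : (0 < n)%N.
Implicit Types u v : 'I_n -> 'rV[R]_K.

Definition UM u : 'M[R]_(n, K) := \matrix_(i, k) u i 0 k.
Definition PM u v : 'M[R]_K := (UM u)^T *m UM v.
Definition gram u v : 'M[R]_n := UM u *m (UM v)^T.
(** Symmetrised, so that its centred form is the centred sample cross-covariance of [u] and [v]. *)
Definition BM u v : 'M[R]_K := (2 * n%:R)^-1 *: (PM u v + PM v u).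

Lemma gramE u v i l : gram u v i l = dotp (u i) (v l).
Proof. by rewrite mxE; apply: eq_bigr => k _; rewrite !mxE. Qed.

Lemma PMT u v : (PM u v)^T = PM v u.
Proof. by rewrite /PM trmx_mul trmxK. Qed.

Lemma BM_sym u v : (BM u v)^T = BM u v.
Proof. by rewrite /BM linearZ linearD/= !PMT addrC. Qed.

Lemma tr_PM u v : \tr (PM u v) = \sum_i dotp (u i) (v i).
Proof.
by rewrite /PM mxtrace_mulC -[UM v *m _]/(gram v u); apply: eq_bigr => i _; rewrite gramE dotpC.
Qed.

Lemma form_PM u v t : dotp (xr t *m PM u v) (xr t) = \sum_i lin (u i) t * lin (v i) t.
Proof.
have U w i : (xr t *m (UM w)^T) 0 i = lin (w i) t.
  by rewrite mxE lin_dotp; apply: eq_bigr => k _; rewrite !mxE mulrC.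
rewrite /PM mulmxA dotpE -mulmxA -[UM v *m _]trmxK trmx_mul trmxK mxE.
by apply: eq_bigr => i _; rewrite U [(_^T) _ _]mxE U.
Qed.

Lemma qf_BM u v t : qf (BM u v) t =
  n%:R^-1 * \sum_i (lin (u i) t * lin (v i) t - dotp (u i) (v i)).
Proof.
rewrite /qf /BM -scalemxAr dotpZl mulmxDr dotpDl mxtraceZ mxtraceD !form_PM !tr_PM sumrB.
have -> : \sum_i lin (v i) t * lin (u i) t = \sum_i lin (u i) t * lin (v i) t.
  by apply: eq_bigr => i _; rewrite mulrC.
have -> : \sum_i dotp (v i) (u i) = \sum_i dotp (u i) (v i) by apply: eq_bigr => i _; rewrite dotpC.
by field; rewrite pnatr_eq0 -lt0n.
Qed.

Lemma BMC u v : BM u v = BM v u. Proof. by rewrite /BM addrC. Qed.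

Lemma froD m (A B : 'M[R]_(m, K)) : fro (A + B) <= 2 * (fro A + fro B).
Proof.
rewrite /fro -big_split mulr_sumr; apply: ler_sum => i _; rewrite -big_split mulr_sumr.
apply: ler_sum => j _ /=; rewrite mxE; have := sqr_ge0 (A i j - B i j); move: (A i j) (B i j) => x y; lra.
Qed.

Lemma fro_PM u v : fro (PM u v) = \sum_i \sum_l dotp (u i) (u l) * dotp (v i) (v l).
Proof.
have -> : fro (PM u v) = \tr (gram v v *m gram u u).
  rewrite fro_trace PMT /PM /gram mulmxA mxtrace_mulC.
  by rewrite !mulmxA -[X in \tr X = _]mulmxA mxtrace_mulC !mulmxA.
apply: eq_bigr => i _; rewrite mxE; apply: eq_bigr => l _; rewrite !gramE mulrC.
by rewrite dotpC.
Qed.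

(** By cyclicity the trace becomes one of n x n Gram matrices, a sum over closed walks of length 4
    that [cycle4] can bound. *)
Lemma fro_PMPM u v u' v' : fro (PM u v *m PM u' v') =
  \sum_i \sum_l \sum_m \sum_k dotp (v i) (u' l) * (dotp (v' l) (v' m) * (dotp (u' m) (v k) * dotp (u k) (u i))).
Proof.
have -> : fro (PM u v *m PM u' v') = \tr (gram v u' *m (gram v' v' *m (gram u' v *m gram u u))).
  rewrite fro_trace trmx_mul !PMT /PM /gram !mulmxA mxtrace_mulC !mulmxA.
  by rewrite -[LHS]/(\tr (UM u *m (UM u)^T *m UM v *m (UM u')^T *m UM v' *m (UM v')^T *m UM u' *m (UM v)^T)) -4!mulmxA -[X in \tr X]mulmxA mxtrace_mulC !mulmxA.
apply: eq_bigr => i _; rewrite mxE; apply: eq_bigr => l _; rewrite [X in _ * X]mxE mulr_sumr.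
apply: eq_bigr => m _; rewrite [X in _ * (_ * X)]mxE !mulr_sumr; apply: eq_bigr => k _.
by rewrite !gramE.
Qed.

Lemma tr_PM3 u v u' v' u'' v'' : \tr (PM u v *m PM u' v' *m PM u'' v'') =
  \sum_i \sum_l \sum_m dotp (v i) (u' l) * (dotp (v' l) (u'' m) * dotp (v'' m) (u i)).
Proof.
have -> : \tr (PM u v *m PM u' v' *m PM u'' v'') = \tr (gram v u' *m (gram v' u'' *m gram v'' u)).
  rewrite /PM /gram !mulmxA; rewrite -!mulmxA mxtrace_mulC !mulmxA.
  by rewrite -!mulmxA.
apply: eq_bigr => i _; rewrite mxE; apply: eq_bigr => l _; rewrite [X in _ * X]mxE mulr_sumr.
by apply: eq_bigr => m _; rewrite !gramE.
Qed.

Lemma fro_BM_le u v : fro (BM u v) <= n%:R ^- 2 * \sum_i \sum_l `|dotp (u i) (u l)| * `|dotp (v i) (v l)|.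
Proof.
set B := \sum_i _.
have P1 u1 v1 : fro (PM u1 v1) <= \sum_i \sum_l `|dotp (u1 i) (u1 l)| * `|dotp (v1 i) (v1 l)|.
  rewrite fro_PM; apply: ler_sum => i _; apply: ler_sum => l _.
  by rewrite (le_trans (ler_norm _))// normrM.
have P2 : fro (PM v u) <= B.
  by rewrite (le_trans (P1 _ _))// /B; apply: eq_leW; apply: eq_bigr => i _; apply: eq_bigr => l _; rewrite mulrC.
rewrite /BM froZ (le_trans (ler_wpM2l (sqr_ge0 _) (froD _ _)))//.
have := P1 u v; rewrite -/B => P3.
rewrite (_ : (2 * n%:R)^-1 ^+ 2 * (2 * (fro (PM u v) + fro (PM v u))) =
  n%:R ^- 2 * (2^-1 * (fro (PM u v) + fro (PM v u)))); last by field; rewrite pnatr_eq0 -lt0n.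
by rewrite ler_wpM2l//; lra.
Qed.

Variables (r : 'I_n -> 'I_n -> R) (S1 S2 : R).
Hypotheses (r0 : forall i l, 0 <= r i l) (rC : forall i l, r i l = r l i).
Hypotheses (h1 : forall i, \sum_l r i l <= S1) (h2 : forall i, \sum_l r i l ^+ 2 <= S2).

Definition kbound u v (w : R) := forall i l, `|dotp (u i) (v l)| <= w * r i l.

Let S10 : 0 <= S1. Proof. by apply: le_trans (h1 (Ordinal n0)); apply: sumr_ge0. Qed.
Let S20 : 0 <= S2.
Proof. by apply: le_trans (h2 (Ordinal n0)); apply: sumr_ge0 => l _; exact: sqr_ge0. Qed.

Lemma fro_PMPM_le u v u' v' (W : R) : 0 <= W ->
  kbound v u' W -> kbound v' v' W -> kbound u' v W -> kbound u u W ->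
  fro (PM u v *m PM u' v') <= W ^+ 4 * (n%:R * (S1 ^+ 2 * S2)).
Proof.
move=> W0 b1 b2 b3 b4; rewrite fro_PMPM.
apply: (@le_trans _ _ (W ^+ 4 * \sum_i \sum_l \sum_m \sum_k r i l * (r l m * (r m k * r k i)))); last first.
  by rewrite ler_wpM2l ?exprn_ge0//; exact: cycle4.
rewrite mulr_sumr; apply: ler_sum => i _; rewrite mulr_sumr; apply: ler_sum => l _.
rewrite mulr_sumr; apply: ler_sum => m _; rewrite mulr_sumr; apply: ler_sum => k _.
apply: (le_trans (ler_norm _)); rewrite !normrM.
rewrite (_ : W ^+ 4 * _ = (W * r i l) * ((W * r l m) * ((W * r m k) * (W * r k i)))); last by ring.
by rewrite ler_pM ?mulr_ge0// ler_pM ?mulr_ge0// ler_pM.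
Qed.

Lemma fro_BMBM_le u v u' v' (W : R) : 0 <= W ->
  kbound u u W -> kbound u v W -> kbound u u' W -> kbound u v' W ->
  kbound v u W -> kbound v v W -> kbound v u' W -> kbound v v' W ->
  kbound u' u W -> kbound u' v W -> kbound u' u' W -> kbound u' v' W ->
  kbound v' u W -> kbound v' v W -> kbound v' u' W -> kbound v' v' W ->
  fro (BM u v *m BM u' v') <= n%:R ^- 4 * (W ^+ 4 * (n%:R * (S1 ^+ 2 * S2))).
Proof.
move=> W0; set B := W ^+ 4 * _ => ? ? ? ? ? ? ? ? ? ? ? ? ? ? ? ?.
have e1 : fro (PM u v *m PM u' v') <= B by exact: fro_PMPM_le.
have e2 : fro (PM v u *m PM u' v') <= B by exact: fro_PMPM_le.
have e3 : fro (PM u v *m PM v' u') <= B by exact: fro_PMPM_le.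
have e4 : fro (PM v u *m PM v' u') <= B by exact: fro_PMPM_le.
rewrite /BM -scalemxAl -scalemxAr scalerA froZ mulmxDr !mulmxDl.
apply: (le_trans (ler_wpM2l (sqr_ge0 _) (froD _ _))).
have d1 := froD (PM u v *m PM u' v') (PM v u *m PM u' v').
have d2 := froD (PM u v *m PM v' u') (PM v u *m PM v' u').
set x := fro (_ + _) in d1 *; set y := fro (_ + _) in d2 *.
rewrite (_ : _ * (2 * (x + y)) = n%:R ^- 4 * (8^-1 * (x + y))); last by field; rewrite pnatr_eq0 -lt0n.
by rewrite ler_wpM2l//; move: d1 d2 e1 e2 e3 e4; clearbody x y B; move: (fro _) (fro _) (fro _) (fro _) => *; lra.
Qed.

Lemma tr_PM3_le u v u' v' u'' v'' (w1 w2 w3 : R) : 0 <= w1 -> 0 <= w2 -> 0 <= w3 ->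
  kbound v u' w1 -> kbound v' u'' w2 -> kbound v'' u w3 ->
  `|\tr (PM u v *m PM u' v' *m PM u'' v'')| <= w1 * w2 * w3 * (n%:R * (S1 * S2)).
Proof.
move=> w10 w20 w30 b1 b2 b3; rewrite tr_PM3.
apply: (@le_trans _ _ (w1 * w2 * w3 * \sum_i \sum_l \sum_m r i l * (r l m * r m i))); last first.
  by rewrite ler_wpM2l ?mulr_ge0//; exact: cycle3.
apply: (le_trans (ler_norm_sum _ _ _)); rewrite mulr_sumr; apply: ler_sum => i _.
apply: (le_trans (ler_norm_sum _ _ _)); rewrite mulr_sumr; apply: ler_sum => l _.
apply: (le_trans (ler_norm_sum _ _ _)); rewrite mulr_sumr; apply: ler_sum => m _.
rewrite !normrM.
rewrite (_ : w1 * w2 * w3 * _ = (w1 * r i l) * ((w2 * r l m) * (w3 * r m i))); last by ring.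
by rewrite ler_pM ?mulr_ge0// ler_pM.
Qed.

(** Expanding the symmetrisations gives eight traces; each family occurs once in each of them, so
    all weights multiply to the same product. Three factors 1 / (2n) against 8 n leave n^-2. *)
Lemma tr_BM3_le (a b c : 'I_3) (u v : 'I_3 -> 'I_n -> 'rV[R]_K) (wu wv : 'I_3 -> R) :
  (forall i, 0 <= wu i) -> (forall i, 0 <= wv i) ->
  (forall i j, i != j -> [/\ kbound (u i) (u j) (wu i * wu j), kbound (u i) (v j) (wu i * wv j),
     kbound (v i) (u j) (wv i * wu j) & kbound (v i) (v j) (wv i * wv j)]) ->
  a != b -> b != c -> c != a ->
  `|\tr (BM (u a) (v a) *m BM (u b) (v b) *m BM (u c) (v c))| <=
    wu a * wv a * (wu b * wv b) * (wu c * wv c) * (n%:R ^- 2 * (S1 * S2)).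
Proof.
move=> wu0 wv0 hk ab bc ca.
set W := wu a * wv a * _ * _; set B := W * (n%:R * (S1 * S2)).
have [kab1 kab2 kab3 kab4] := hk a b ab; have [kbc1 kbc2 kbc3 kbc4] := hk b c bc.
have [kca1 kca2 kca3 kca4] := hk c a ca.
have P (x1 y1 x2 y2 x3 y3 : 'I_n -> 'rV[R]_K) (s1 t1 s2 t2 s3 t3 : R) :
    0 <= s1 -> 0 <= t1 -> 0 <= s2 -> 0 <= t2 -> 0 <= s3 -> 0 <= t3 ->
    kbound y1 x2 (t1 * s2) -> kbound y2 x3 (t2 * s3) -> kbound y3 x1 (t3 * s1) ->
    s1 * t1 * (s2 * t2) * (s3 * t3) = W ->
    `|\tr (PM x1 y1 *m PM x2 y2 *m PM x3 y3)| <= B.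
  move=> ? ? ? ? ? ? k1 k2 k3 eW; rewrite /B -eW.
  apply: (le_trans (tr_PM3_le _ _ _ k1 k2 k3)); rewrite ?mulr_ge0//.
  by apply: eq_leW; ring.
rewrite /BM -!scalemxAl -!scalemxAr !scalerA linearZ/= -scalemxAl linearZ/= mulrA !mulmxDr !mulmxDl !linearD/=.
rewrite normrM ger0_norm ?mulr_ge0 ?invr_ge0 ?mulr_ge0//.
rewrite (_ : W * _ = (2 * n%:R)^-1 * (2 * n%:R)^-1 * (2 * n%:R)^-1 * (8 * B)); last first.
  by rewrite /B; field; rewrite pnatr_eq0 -lt0n.
rewrite ler_wpM2l ?mulr_ge0 ?invr_ge0 ?mulr_ge0//.
have W1 : wu a * wv a * (wu b * wv b) * (wu c * wv c) = W by [].
have W2 : wv a * wu a * (wu b * wv b) * (wu c * wv c) = W by rewrite /W; ring.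
have W3 : wu a * wv a * (wv b * wu b) * (wu c * wv c) = W by rewrite /W; ring.
have W4 : wv a * wu a * (wv b * wu b) * (wu c * wv c) = W by rewrite /W; ring.
have W5 : wu a * wv a * (wu b * wv b) * (wv c * wu c) = W by rewrite /W; ring.
have W6 : wv a * wu a * (wu b * wv b) * (wv c * wu c) = W by rewrite /W; ring.
have W7 : wu a * wv a * (wv b * wu b) * (wv c * wu c) = W by rewrite /W; ring.
have W8 : wv a * wu a * (wv b * wu b) * (wv c * wu c) = W by rewrite /W; ring.
have p1 := P (u a) (v a) (u b) (v b) (u c) (v c) _ _ _ _ _ _ (wu0 a) (wv0 a) (wu0 b) (wv0 b) (wu0 c) (wv0 c) kab3 kbc3 kca3 W1.
have p2 := P (v a) (u a) (u b) (v b) (u c) (v c) _ _ _ _ _ _ (wv0 a) (wu0 a) (wu0 b) (wv0 b) (wu0 c) (wv0 c) kab1 kbc3 kca4 W2.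
have p3 := P (u a) (v a) (v b) (u b) (u c) (v c) _ _ _ _ _ _ (wu0 a) (wv0 a) (wv0 b) (wu0 b) (wu0 c) (wv0 c) kab4 kbc1 kca3 W3.
have p4 := P (v a) (u a) (v b) (u b) (u c) (v c) _ _ _ _ _ _ (wv0 a) (wu0 a) (wv0 b) (wu0 b) (wu0 c) (wv0 c) kab2 kbc1 kca4 W4.
have p5 := P (u a) (v a) (u b) (v b) (v c) (u c) _ _ _ _ _ _ (wu0 a) (wv0 a) (wu0 b) (wv0 b) (wv0 c) (wu0 c) kab3 kbc4 kca1 W5.
have p6 := P (v a) (u a) (u b) (v b) (v c) (u c) _ _ _ _ _ _ (wv0 a) (wu0 a) (wu0 b) (wv0 b) (wv0 c) (wu0 c) kab1 kbc4 kca2 W6.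
have p7 := P (u a) (v a) (v b) (u b) (v c) (u c) _ _ _ _ _ _ (wu0 a) (wv0 a) (wv0 b) (wu0 b) (wv0 c) (wu0 c) kab4 kbc2 kca1 W7.
have p8 := P (v a) (u a) (v b) (u b) (v c) (u c) _ _ _ _ _ _ (wv0 a) (wu0 a) (wv0 b) (wu0 b) (wv0 c) (wu0 c) kab2 kbc2 kca2 W8.
move: p1 p2 p3 p4 p5 p6 p7 p8.
do 8 move: (\tr _).
move=> z1 z2 z3 z4 z5 z6 z7 z8; rewrite !ler_norml => /andP[? ?] /andP[? ?] /andP[? ?] /andP[? ?] /andP[? ?] /andP[? ?] /andP[? ?] /andP[? ?].
by apply/andP; split; lra.
Qed.

Lemma fro_BM_diag u (x : R) : (forall i, dotp (u i) (u i) = x) -> x ^+ 2 / n%:R <= fro (BM u u).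
Proof.
move=> hx; have -> : BM u u = n%:R^-1 *: PM u u.
  by rewrite /BM -mulr2n -[X in _ *: X]scaler_nat scalerA; congr (_ *: _); field; rewrite pnatr_eq0 -lt0n.
rewrite froZ fro_PM (_ : x ^+ 2 / n%:R = n%:R^-1 ^+ 2 * (x ^+ 2 * n%:R)); last by field; rewrite pnatr_eq0 -lt0n.
rewrite ler_wpM2l ?sqr_ge0// mulr_natr -[n in leLHS]card_ord -sumr_const; apply: ler_sum => i _.
rewrite (bigD1 i)//= hx -expr2 lerDl; apply: sumr_ge0 => l _; rewrite -expr2; exact: sqr_ge0.
Qed.

End bilinear.

(** * Deterministic expansion of the inverse matrix *)

Section perturbation.
Context {R : realType} (p : nat).
Implicit Types (H D Sg Om : 'M[R]_p) (u v : 'rV[R]_p).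

Lemma dotp_sqE v : dotp v v = \sum_a v 0 a ^+ 2.
Proof. by apply: eq_bigr => a _; rewrite expr2. Qed.

Lemma dotp_le_max v (x : R) : (forall a, `|v 0 a| <= x) -> dotp v v <= p%:R * x ^+ 2.
Proof.
move=> h; rewrite dotp_sqE mulr_natl -[p in leRHS]card_ord -sumr_const; apply: ler_sum => a _.
by rewrite -[leLHS]real_normK ?num_real// lerXn2r ?nnegrE// (le_trans _ (h a)).
Qed.

Lemma fro_le_max D (x : R) : 0 <= x -> (forall a b, `|D a b| <= x) -> fro D <= (p%:R * x) ^+ 2.
Proof.
move=> x0 h; have -> : (p%:R * x) ^+ 2 = \sum_(a < p) \sum_(b < p) x ^+ 2.
  rewrite sumr_const card_ord sumr_const card_ord -mulr_natl -[_ *+ p]mulr_natl; ring.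
apply: ler_sum => a _; apply: ler_sum => b _.
by rewrite -[leLHS]real_normK ?num_real// lerXn2r ?nnegrE// (le_trans _ (h a b)).
Qed.

Lemma mulmx_le_max D v (x : R) : 0 <= x -> (forall a b, `|D a b| <= x) ->
  dotp (v *m D) (v *m D) <= (p%:R * x) ^+ 2 * dotp v v.
Proof. by move=> x0 h; rewrite (le_trans (fro_le _ _))// ler_wpM2r ?dotp_ge0// fro_le_max. Qed.

Lemma dotp_abs_le u v (x y : R) : 0 <= x -> 0 <= y ->
  dotp u u <= x ^+ 2 -> dotp v v <= y ^+ 2 -> `|dotp u v| <= x * y.
Proof.
move=> x0 y0 hu hv; rewrite -(@ler_pXn2r _ 2) ?nnegrE ?mulr_ge0// real_normK ?num_real//.
by rewrite (le_trans (dotp_CS _ _))// exprMn ler_pM ?dotp_ge0.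
Qed.

Lemma congr_entry (A B : 'M[R]_p) j k : (A *m B *m A^T) j k = dotp (row j A *m B) (row k A).
Proof.
rewrite mxE; apply: eq_bigr => a _; rewrite -row_mul; congr (_ * _); by rewrite !mxE.
Qed.

Lemma solve_le H (e : R) : 0 < e -> (forall v, e * dotp v v <= dotp (v *m H) v) ->
  forall v, dotp (v *m invmx H) (v *m invmx H) <= e^-1 ^+ 2 * dotp v v.
Proof.
move=> e0 lo v; have uH : H \in unitmx.
  by apply: (lower_unitmx e0) => w; rewrite -dotp_sqE -dotpE.
set u := v *m invmx H; have uHv : u *m H = v by rewrite /u -mulmxA mulVmx// mulmx1.
have := lo u; rewrite uHv => l1; have := dotp_CS v u => cs.
have [u0|u0] := eqVneq (dotp u u) 0; first by rewrite u0 mulr_ge0 ?sqr_ge0 ?dotp_ge0.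
have up : 0 < dotp u u by rewrite lt_neqAle eq_sym u0 dotp_ge0.
have l2 : (e * dotp u u) ^+ 2 <= dotp v v * dotp u u.
  by apply: le_trans cs; rewrite lerXn2r ?nnegrE// ?mulr_ge0 ?(ltW e0) ?(ltW up)// (le_trans _ l1)// mulr_ge0 ?(ltW e0) ?(ltW up).
rewrite exprVn ler_pdivlMl ?exprn_gt0//.
by rewrite -(ler_pM2r up) (le_trans _ l2)//; apply: eq_leW; ring.
Qed.

Variables (Sg Om H : 'M[R]_p) (ce e aG aD : R).
Hypotheses (SO : Sg *m Om = 1%:M) (OT : Om^T = Om) (ST : Sg^T = Sg) (HT : H^T = H).
Hypotheses (ce0 : 0 < ce) (hce : forall v, ce * dotp v v <= dotp (v *m Sg) v).
Hypotheses (hD : forall a b, `|(H - Sg) a b| <= aD) (hG : forall a j, `|((H - Sg) *m Om) a j| <= aG).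
Hypothesis (small : p%:R * aD <= ce / 2).

Hypotheses (aD0 : 0 <= aD) (aG0 : 0 <= aG).

Let uS : Sg \in unitmx. Proof. by have := mulmx1_unit SO => -[]. Qed.

Let OmE : Om = invmx Sg.
Proof. by rewrite -[LHS]mul1mx -(mulVmx uS) -mulmxA SO mulmx1. Qed.

Let lower v : ce / 2 * dotp v v <= dotp (v *m H) v.
Proof.
have E : H = Sg + (H - Sg) by rewrite addrC subrK.
rewrite E mulmxDr dotpDl; have h1 := hce v.
have h2 : `|dotp (v *m (H - Sg)) v| <= ce / 2 * dotp v v.
  apply: (@le_trans _ _ (p%:R * aD * dotp v v)); last by rewrite ler_wpM2r ?dotp_ge0.
  rewrite -(@ler_pXn2r _ 2) ?nnegrE ?mulr_ge0 ?dotp_ge0// real_normK ?num_real//.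
  rewrite (le_trans (dotp_CS _ _))// exprMn [dotp v v ^+ 2]expr2 mulrA ler_wpM2r ?dotp_ge0//.
  exact: mulmx_le_max.
move: h1 h2; rewrite ler_norml; move: (dotp _ _) (dotp v v) (dotp _ _) => x y z h1 /andP[h2 h3]; lra.
Qed.

Let ce2 : 0 < ce / 2. Proof. by rewrite divr_gt0. Qed.

Lemma perturb_unit : H \in unitmx.
Proof. by apply: (lower_unitmx ce2) => w; rewrite -dotp_sqE -dotpE. Qed.

Local Notation A := (Om *m (H - Sg)).

(** An exact second-order expansion: the true inverse sits in the remainder, so no series has to be
    summed. *)
Lemma inv_expand : invmx H - Om = - (A *m Om) + A *m invmx H *m A^T.
Proof.
have uH := perturb_unit.
have -> : A^T = (H - Sg) *m Om by rewrite trmx_mul OT linearB/= HT ST.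
have OS : Om *m Sg = 1%:M by rewrite OmE mulVmx.
have -> : (H - Sg) *m Om = H *m Om - 1%:M by rewrite mulmxBl SO.
have -> : A = Om *m H - 1%:M by rewrite mulmxBr OS.
rewrite [_ *m invmx H]mulmxBl -(mulmxA Om) (mulmxV uH) mulmx1 mul1mx [_ *m (H *m Om - _)]mulmxBr !mulmx1.
rewrite [_ *m (H *m Om)]mulmxBl !mulmxA mulVmx// mul1mx mulmxBl mul1mx.
by move: (Om *m H *m Om) (invmx H) => X Y; apply/matrixP => a b; rewrite !mxE; ring.
Qed.

Let rowA j : dotp (row j A) (row j A) <= p%:R * aG ^+ 2.
Proof.
apply: dotp_le_max => a; rewrite mxE.
have -> : A j a = ((H - Sg) *m Om) a j by rewrite -[A]trmxK [LHS]mxE trmx_mul OT linearB/= HT ST.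
exact: hG.
Qed.

Let sp : R := Num.sqrt p%:R.
Let sp2 : sp ^+ 2 = p%:R. Proof. by rewrite sqr_sqrtr. Qed.
Let rowA' j : dotp (row j A) (row j A) <= (sp * aG) ^+ 2. Proof. by rewrite exprMn sp2. Qed.
Let rowH j : dotp (row j A *m invmx H) (row j A *m invmx H) <= (2 / ce * (sp * aG)) ^+ 2.
Proof.
apply: (le_trans (solve_le ce2 lower _)).
rewrite exprMn (_ : (ce / 2)^-1 = 2 / ce); last by rewrite invfM invrK mulrC.
by rewrite ler_wpM2l ?sqr_ge0.
Qed.

(** Only rows of Om (H - Sg) enter, bounded through [aG], and the inverse in the middle has operator
    norm at most 2 / ce; no norm of [Om] is spent. *)
Lemma perturb_R j k : `|(A *m invmx H *m A^T) j k| <= 2 / ce * p%:R * aG ^+ 2.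
Proof.
rewrite congr_entry; have q0 : 0 <= sp * aG by rewrite mulr_ge0 ?sqrtr_ge0.
have z0 : 0 <= 2 / ce * (sp * aG) by rewrite mulr_ge0// divr_ge0 ?(ltW ce0).
apply: (le_trans (dotp_abs_le z0 q0 (rowH j) (rowA' k))).
by rewrite -sp2; apply: eq_leW; ring.
Qed.

(** The difference of the two inverses is itself a product, invmx H (H - Sg) Om, which gains one
    factor [aD]. *)
Lemma perturb_R3 j k : `|(A *m invmx H *m A^T - A *m Om *m A^T) j k| <=
  2 / ce ^+ 2 * p%:R ^+ 2 * aD * aG ^+ 2.
Proof.
have uH := perturb_unit.
have -> : A *m invmx H *m A^T - A *m Om *m A^T = - (A *m (invmx H *m (H - Sg) *m Om) *m A^T).
  have -> : invmx H *m (H - Sg) *m Om = Om - invmx H.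
    by rewrite mulmxBr (mulVmx uH) mulmxBl mul1mx -mulmxA SO mulmx1.
  by move: (Om *m (H - Sg)) => B; rewrite [in RHS]mulmxBr [in RHS]mulmxBl opprB.
rewrite mxE normrN congr_entry; have q0 : 0 <= sp * aG by rewrite mulr_ge0 ?sqrtr_ge0.
have z0 : 0 <= 2 / ce * (sp * aG) by rewrite mulr_ge0// divr_ge0 ?(ltW ce0).
have y0 : 0 <= ce^-1 * (p%:R * aD * (2 / ce * (sp * aG))) by apply: mulr_ge0; [rewrite invr_ge0 ltW|apply: mulr_ge0 => //; exact: mulr_ge0].
have h : dotp (row j A *m (invmx H *m (H - Sg) *m Om)) (row j A *m (invmx H *m (H - Sg) *m Om)) <=
   (ce^-1 * (p%:R * aD * (2 / ce * (sp * aG)))) ^+ 2.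
  rewrite !mulmxA OmE; apply: (le_trans (solve_le ce0 hce _)).
  rewrite exprMn ler_wpM2l ?sqr_ge0//; apply: (le_trans (mulmx_le_max _ aD0 hD)).
  by rewrite [leRHS]exprMn ler_wpM2l ?sqr_ge0// -OmE; exact: rowH.
apply: (le_trans (dotp_abs_le y0 q0 h (rowA' k))).
by rewrite -[p%:R in leRHS]sp2; apply: eq_leW; rewrite -sp2; field; rewrite gt_eqF.
Qed.

End perturbation.

(** * Covariances computed up to an event of small probability *)

Section truncated_moments.
Context {R : realType} (K : nat).
Local Notation T := (K.-tuple R).
Local Notation P := (gauss K : probability _ R).

Definition L2 (F : T -> R) := measurable_fun setT F /\ P.-integrable setT (EFin \o (fun t => F t ^+ 2)).

Lemma L2M F G : L2 F -> L2 G -> P.-integrable setT (EFin \o (fun t => F t * G t)).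
Proof.
move=> [mF iF] [mG iG]; apply: (@le_integrable _ _ _ P _ measurableT _ (EFin \o (fun t => F t ^+ 2 + G t ^+ 2))).
- by apply/measurable_EFinP; exact: measurable_funM.
- move=> t _ /=; rewrite lee_fin (ger0_norm (addr_ge0 (sqr_ge0 _) (sqr_ge0 _))) ler_norml.
  have := sqr_ge0 (F t + G t); have := sqr_ge0 (F t - G t); have := sqr_ge0 (F t); have := sqr_ge0 (G t).
  by move: (F t) (G t) => x y *; apply/andP; split; lra.
- by have := integrableD measurableT iF iG; apply: eq_integrable => // t _; rewrite /= EFinD.
Qed.

Lemma tame_L2 F : tame F -> L2 F.
Proof. by move=> tF; split; [exact: tame_measurable|apply: tame_integrable; exact: tameX]. Qed.

Lemma L2_bool b F : mb b -> L2 F -> L2 (fun t => (b t)%:R * F t).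
Proof.
move=> mbb [mF iF]; have mB := tame_measurable (tame_bool mbb).
split; first exact: measurable_funM.
apply: (le_integrable _ _ _ iF) => //.
  by apply/measurable_EFinP; apply: measurable_funX; exact: measurable_funM.
move=> t _ /=; rewrite lee_fin; case: (b t); rewrite ?mul1r// mul0r expr0n normr0//.
Qed.

Lemma L2_int F : L2 F -> P.-integrable setT (EFin \o F).
Proof.
move=> lF; have := L2M lF (tame_L2 (@tame_cst R K 1)); apply: eq_integrable => // t _ /=.
by rewrite mulr1.
Qed.

Definition bad_bound (b : T -> bool) (tau : R) (F : T -> R) := gE (fun t => (b t)%:R * F t ^+ 2) <= tau.

Lemma bad_bound_prod b tau F G : mb b -> L2 F -> L2 G -> bad_bound b tau F -> bad_bound b tau G ->
  `|gE (fun t => (b t)%:R * (F t * G t))| <= tau.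
Proof.
move=> mbb lF lG bF bG.
have iF : P.-integrable setT (EFin \o (fun t => (b t)%:R * F t ^+ 2)).
  have := L2M (L2_bool mbb lF) lF; apply: eq_integrable => // t _ /=; congr EFin; ring.
have iG : P.-integrable setT (EFin \o (fun t => (b t)%:R * G t ^+ 2)).
  have := L2M (L2_bool mbb lG) lG; apply: eq_integrable => // t _ /=; congr EFin; ring.
have iFG : P.-integrable setT (EFin \o (fun t => (b t)%:R * (F t * G t))).
  have := L2M (L2_bool mbb lF) lG; apply: eq_integrable => // t _ /=; congr EFin; ring.
apply: (le_trans (le_normr_Rintegral measurableT iFG)).
apply: (@le_trans _ _ (2^-1 * (gE (fun t => (b t)%:R * F t ^+ 2) + gE (fun t => (b t)%:R * G t ^+ 2)))); last first.
  by move: bF bG; rewrite /bad_bound; move: (gE _) (gE _) => *; lra.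
rewrite /gE -RintegralD// -RintegralZl//; last first.
  by have := integrableD measurableT iF iG; apply: eq_integrable => // t _; rewrite /= EFinD.
apply: le_Rintegral => //.
- exact: integrable_norm.
- have := integrableZl measurableT (2^-1) (integrableD measurableT iF iG); apply: eq_integrable => // t _ /=.
move=> t _ /=; case: (b t); rewrite ?mul1r ?mul0r ?addr0 ?mulr0 ?normr0// ler_norml.
have := sqr_ge0 (F t + G t); have := sqr_ge0 (F t - G t).
by move: (F t) (G t) => x y *; apply/andP; split; lra.
Qed.

Section cov_perturb.
Variables (g : T -> bool) (tau eR e3 aL : R).
Hypotheses (mg : mb g) (eR0 : 0 <= eR) (e30 : 0 <= e3) (aL0 : 0 <= aL).
Local Notation b := (fun t => ~~ g t).
Hypothesis bad1 : bad_bound b tau (fun=> 1).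
(** [L] and [R2] are the first two terms of an expansion of [F]. On [g] they approximate it
    pointwise; off [g], where [F] may be huge, only second moments are controlled. *)
Definition approx (F L R2 : T -> R) := [/\ L2 F, tame L, tame R2, gE L = 0 &
  [/\ bad_bound b tau F, bad_bound b tau L, bad_bound b tau R2 &
   forall t, g t -> [/\ `|F t - L t| <= eR, `|F t - L t - R2 t| <= e3 & `|L t| <= aL]]].

Let mbb : mb b. Proof. exact: measurable_neg. Qed.
Let tg : tame (fun t => (g t)%:R : R). Proof. exact: tame_bool. Qed.
Let L21 : L2 (fun=> 1). Proof. exact: tame_L2 (@tame_cst R K 1). Qed.

Let tame_good (F : T -> R) (x : R) : measurable_fun setT F -> 0 <= x ->
  (forall t, g t -> `|F t| <= x) -> tame (fun t => (g t)%:R * F t) /\ forall t, `|(g t)%:R * F t| <= x.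
Proof.
move=> mF x0 h; have B t : `|(g t)%:R * F t| <= x.
  by case: (boolP (g t)) => gt; rewrite ?mul1r ?mul0r ?normr0//; exact: h.
split=> //; apply: tame_bounded B; apply: measurable_funM => //; exact: tame_measurable.
Qed.

Let gE_abs (F : T -> R) (x : R) : tame F -> (forall t, `|F t| <= x) -> `|gE F| <= x.
Proof.
move=> tF h; apply: (le_trans (gE_norm tF)); rewrite -[leRHS](@gE_cst R K).
by apply: gE_le => //; [exact: tame_norm|exact: tame_cst].
Qed.

Let split_int (F G : T -> R) : L2 F -> L2 G -> gE (fun t => F t * G t) =
  gE (fun t => (g t)%:R * (F t * G t)) + gE (fun t => (~~ g t)%:R * (F t * G t)).
Proof.
move=> lF lG; rewrite /gE -RintegralD//.
- by apply: eq_Rintegral => t _; case: (g t); rewrite /= ?mul1r ?mul0r ?addr0 ?add0r.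
- by have := L2M (L2_bool mg lF) lG; apply: eq_integrable => // t _ /=; congr EFin; ring.
- by have := L2M (L2_bool mbb lF) lG; apply: eq_integrable => // t _ /=; congr EFin; ring.
Qed.

Let mean_le F L R2 : approx F L R2 -> `|gE F| <= eR + 2 * tau.
Proof.
move=> [lF tL tR m0 [bF bL bR h]].
have -> : gE F = gE (fun t => F t * 1) by congr gE; apply/funext => t; rewrite mulr1.
rewrite split_int//.
have h1 := bad_bound_prod mbb lF L21 bF bad1.
have h2 := bad_bound_prod mbb (tame_L2 tL) L21 bL bad1.
have [t3 h3] := tame_good (measurable_funB lF.1 (tame_measurable tL)) eR0 (fun t gt => let: And3 x _ _ := h t gt in x).
have h3' := gE_abs t3 h3.
have E1 : gE (fun t => (g t)%:R * (F t * 1)) = gE (fun t => (g t)%:R * (F t - L t)) + gE (fun t => (g t)%:R * (L t * 1)).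
  rewrite -gED//; last by apply: tameM => //; apply: tameM => //; exact: tame_cst.
  by congr gE; apply/funext => t /=; ring.
have E2 := split_int (tame_L2 tL) L21.
rewrite (_ : (fun t => L t * 1) = L) in E2; last by apply/funext => t; rewrite mulr1.
rewrite m0 in E2; move: h1 h2 h3' E1 E2; rewrite !ler_norml.
move: (gE _) (gE _) (gE _) (gE _) (gE _) => x1 x2 x3 x4 x5 /andP[? ?] /andP[? ?] /andP[? ?] ? ?.
by apply/andP; split; lra.
Qed.

(** On [g], F F' - L L' consists of L R2' and R2 L', of L or L' times a third-order remainder, and
    of (F - L)(F' - L'). The first two are completed to full expectations, bounded by [B3]; each
    passage between [g] and the whole space costs [tau]. *)
Lemma cov_perturb F L R2 F' L' R2' (B3 : R) : approx F L R2 -> approx F' L' R2' ->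
  `|gE (fun t => L t * R2' t)| <= B3 -> `|gE (fun t => R2 t * L' t)| <= B3 ->
  `|gE (fun t => F t * F' t) - gE F * gE F' - gE (fun t => L t * L' t)| <=
    2 * B3 + 2 * (aL * e3) + eR ^+ 2 + (eR + 2 * tau) ^+ 2 + 4 * tau.
Proof.
move=> a1 a2 b1 b2.
have mm : `|gE F * gE F'| <= (eR + 2 * tau) ^+ 2.
  by rewrite normrM expr2 ler_pM ?normr_ge0// (mean_le a1, mean_le a2).
move: a1 a2 => [lF tL tR m0 [bF bL bR h]] [lF' tL' tR' m0' [bF' bL' bR' h']].
rewrite (split_int lF lF').
have := bad_bound_prod mbb lF lF' bF bF'.
have c1 := bad_bound_prod mbb (tame_L2 tL) (tame_L2 tL') bL bL'.
have c2 := bad_bound_prod mbb (tame_L2 tL) (tame_L2 tR') bL bR'.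
have c3 := bad_bound_prod mbb (tame_L2 tR) (tame_L2 tL') bR bL'.
have s1 := split_int (tame_L2 tL) (tame_L2 tL').
have s2 := split_int (tame_L2 tL) (tame_L2 tR').
have s3 := split_int (tame_L2 tR) (tame_L2 tL').
have [tr hr] := tame_good (measurable_funB lF.1 (tame_measurable tL)) eR0 (fun t gt => let: And3 x _ _ := h t gt in x).
have [tr' hr'] := tame_good (measurable_funB lF'.1 (tame_measurable tL')) eR0 (fun t gt => let: And3 x _ _ := h' t gt in x).
have mr3 := measurable_funB (measurable_funB lF.1 (tame_measurable tL)) (tame_measurable tR).
have mr3' := measurable_funB (measurable_funB lF'.1 (tame_measurable tL')) (tame_measurable tR').
have [t3 h3] := tame_good mr3 e30 (fun t gt => let: And3 _ x _ := h t gt in x).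
have [t3' h3'] := tame_good mr3' e30 (fun t gt => let: And3 _ x _ := h' t gt in x).
have [tl hl] := tame_good (tame_measurable tL) aL0 (fun t gt => let: And3 _ _ x := h t gt in x).
have [tl' hl'] := tame_good (tame_measurable tL') aL0 (fun t gt => let: And3 _ _ x := h' t gt in x).
have prod (u v : T -> R) (x y : R) : tame u -> tame v -> 0 <= x -> 0 <= y -> (forall t, `|u t| <= x) -> (forall t, `|v t| <= y) ->
    `|gE (fun t => u t * v t)| <= x * y.
  move=> tu tv x0 y0 hu hv; apply: gE_abs; first exact: tameM.
  by move=> t; rewrite normrM ler_pM.
have d1 := prod _ _ _ _ tr tr' eR0 eR0 hr hr'.
have d2 := prod _ _ _ _ tl t3' aL0 e30 hl h3'.
have d3 := prod _ _ _ _ tl' t3 aL0 e30 hl' h3.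
have E : gE (fun t => (g t)%:R * (F t * F' t)) = gE (fun t => (g t)%:R * (L t * L' t)) +
   (gE (fun t => (g t)%:R * L t * ((g t)%:R * (F' t - L' t - R2' t))) + (gE (fun t => (g t)%:R * (L t * R2' t)) +
   (gE (fun t => (g t)%:R * L' t * ((g t)%:R * (F t - L t - R2 t))) + (gE (fun t => (g t)%:R * (R2 t * L' t)) +
    gE (fun t => (g t)%:R * (F t - L t) * ((g t)%:R * (F' t - L' t))))))).
  have q1 := tameM tg (tameM tL tL'). have q2 := tameM tg (tameM tL tR'). have q3 := tameM tg (tameM tR tL').
  have q4 := tameM tl t3'. have q5 := tameM tl' t3. have q6 := tameM tr tr'.
  rewrite -(gED q3 q6) -(gED q5 (tameD q3 q6)) -(gED q2 (tameD q5 (tameD q3 q6))).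
  rewrite -(gED q4 (tameD q2 (tameD q5 (tameD q3 q6)))) -(gED q1 (tameD q4 (tameD q2 (tameD q5 (tameD q3 q6))))).
  by congr gE; apply/funext => t /=; case: (g t); rewrite ?mul1r ?mul0r; ring.
rewrite E => c0; move: c0 mm b1 b2 c1 c2 c3 s1 s2 s3 d1 d2 d3 => {E prod h h' tr hr tr' hr' mr3 mr3' t3 h3 t3' h3' tl hl tl' hl'}.
move: (gE F * gE F') ((eR + 2 * tau) ^+ 2) => z1 z2; rewrite -expr2; move: (eR ^+ 2) (aL * e3) => z3 z4.
do ! (move: (gE _)); move=> *; repeat (match goal with H : is_true (`|_| <= _) |- _ => move: H; rewrite ler_norml => /andP[? ?] end).
by rewrite ler_norml; apply/andP; split; lra.
Qed.

End cov_perturb.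

(** If [m.+1] is the first good scale, then [Y] is at most 4^(m+1) / eps^2 while [good m] fails,
    which has probability of order 16^(-m) eps^4; the resulting series is geometric. Scale 0
    contributes the term with [gP b]. *)
Lemma layer_cake (Y : T -> R) (b : T -> bool) (good : nat -> T -> bool) (eps C : R) :
  measurable_fun setT Y -> (forall t, 0 <= Y t) -> mb b -> (forall l, mb (good l)) -> 0 < eps -> 0 <= C ->
  (forall l t, good l t -> Y t <= 4 ^+ l / eps ^+ 2) ->
  (forall l, gP (fun t => ~~ good l t) <= C * (eps / 2 ^+ l) ^+ 4) ->
  (\int[P]_t ((b t)%:R * Y t)%:E <= (eps ^- 2 * gP b + 8 * C * eps ^+ 2)%:E)%E.
Proof.
move=> mY Y0 mbb mgd e0 C0 hY hP.
pose G (l : nat) t : \bar R := (4 ^+ l.+1 / eps ^+ 2 * (~~ good l t)%:R)%:E.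
have G0 l t : (0 <= G l t)%E by rewrite lee_fin mulr_ge0// divr_ge0 ?exprn_ge0 ?(ltW e0).
have mbg l : mb (fun t => ~~ good l t) by apply: measurable_neg; exact: mgd.
have tG l : tame (fun t => 4 ^+ l.+1 / eps ^+ 2 * (~~ good l t)%:R : R) by apply: tameZ; exact: tame_bool.
have mG l : measurable_fun setT (G l) by apply/measurable_EFinP; exact: tame_measurable.
have point t : (((b t)%:R * Y t)%:E <= (eps ^- 2 * (b t)%:R)%:E + \sum_(0 <= l <oo) G l t)%E.
  have S0 : (0 <= \sum_(0 <= l <oo) G l t)%E by apply: nneseries_ge0 => l _ _.
  have [g0|ng0] := boolP (good 0%N t).
    apply: (@le_trans _ _ (eps ^- 2 * (b t)%:R)%:E); last by rewrite leeDl.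
    by rewrite lee_fin mulrC ler_wpM2r// (le_trans (hY _ _ g0))// expr0 mul1r.
  apply: (@le_trans _ _ (Y t)%:E).
    by rewrite lee_fin; case: (b t); rewrite ?mul1r ?mul0r.
  apply: (@le_trans _ _ (\sum_(0 <= l <oo) G l t)%E); last first.
    by rewrite leeDr// lee_fin mulr_ge0// invr_ge0 exprn_ge0 ?(ltW e0).
  have [[l gl]|ng] := pselect (exists l, good l t).
    have [m gm hm] := ex_minnP (ex_intro (fun l => good l t) l gl).
    case: m gm hm => [|m] gm hm; first by rewrite gm in ng0.
    have nm : ~~ good m t by apply/negP => /hm; rewrite ltnn.
    apply: (@le_trans _ _ (G m t)); first by rewrite /G nm mulr1 lee_fin hY.
    apply: (@le_trans _ _ (\sum_(0 <= l < m.+1) G l t)%E).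
      by rewrite big_nat_recr//= leeDr// sume_ge0.
    exact: nneseries_lim_ge.
  have ngl l : ~~ good l t by apply/negP => gl; apply: ng; exists l.
  (* If no scale is good, every term of the series is at least eps^-2, so [N] of them already exceed
     [Y t]. *)
  pose N := Num.bound (Y t * eps ^+ 2).
  have hN : Y t * eps ^+ 2 < N%:R by have := archi_boundP (mulr_ge0 (Y0 t) (exprn_ge0 2 (ltW e0))).
  apply: (@le_trans _ _ (\sum_(0 <= l < N) G l t)%E); last exact: nneseries_lim_ge.
  rewrite sumEFin lee_fin; apply: (@le_trans _ _ (\sum_(0 <= l < N) eps ^- 2)).
    by rewrite big_const_nat subn0 iter_addr_0 -mulr_natl ler_pdivlMr ?exprn_gt0// ltW.
  apply: ler_sum => l _; rewrite ngl mulr1 ler_peMl ?invr_ge0 ?exprn_ge0 ?(ltW e0)//.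
  by rewrite exprn_ege1// ler1n.
have ma : measurable_fun setT (fun t => ((b t)%:R * Y t)%:E).
  by apply/measurable_EFinP; apply: measurable_funM => //; exact: tame_measurable (tame_bool mbb).
have tb : tame (fun t => eps ^- 2 * (b t)%:R : R) by apply: tameZ; exact: tame_bool.
have mb1 : measurable_fun setT (fun t => (eps ^- 2 * (b t)%:R)%:E) by apply/measurable_EFinP; exact: tame_measurable.
have ms : measurable_fun setT (fun t => \sum_(0 <= l <oo) G l t)%E by apply: ge0_emeasurable_sum.
apply: (@le_trans _ _ (\int[P]_t ((eps ^- 2 * (b t)%:R)%:E + \sum_(0 <= l <oo) G l t))%E).
  apply: ge0_le_integral => //.
  - by move=> t _; rewrite lee_fin mulr_ge0.
  - exact: emeasurable_funD.
rewrite ge0_integralD//; first last.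
- by move=> t _; rewrite nneseries_ge0.
- by move=> t _; rewrite lee_fin mulr_ge0// invr_ge0 exprn_ge0 ?(ltW e0).
rewrite (gE_EFin tb) gEZ; last exact: tame_bool.
rewrite EFinD leeD//.
rewrite integral_nneseries//.
apply: (@le_trans _ _ (\sum_(0 <= l <oo) ((8 * C * eps ^+ 2) / (2 ^ l.+1)%:R)%:E)%E); last first.
  by apply: epsilon_trick0; rewrite !mulr_ge0 ?exprn_ge0 ?(ltW e0).
apply: lee_nneseries => // [l _ _|l _]; first by apply: integral_ge0 => t _.
rewrite (gE_EFin (tG l)) lee_fin gEZ; last by apply: tame_bool.
apply: (@le_trans _ _ (4 ^+ l.+1 / eps ^+ 2 * (C * (eps / 2 ^+ l) ^+ 4))).
  by apply: ler_wpM2l; [apply: divr_ge0; apply: exprn_ge0 => //; exact: ltW|exact: hP].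
rewrite natrX [4 ^+ _](_ : _ = 4 * (2 ^+ l) ^+ 2); last by rewrite exprS -exprM mulnC exprM; congr (_ * _ ^+ l); ring.
rewrite [2 ^+ l.+1]exprS; have l1 : 1 <= 2 ^+ l :> R by rewrite exprn_ege1// ler1n.
have l0 : 0 < 2 ^+ l :> R by rewrite exprn_gt0.
move: (2 ^+ l) l1 l0 => u u1 u0.
rewrite [leLHS](_ : _ = 4 * C * eps ^+ 2 / u * u^-1); last by field; rewrite !gt_eqF.
rewrite [leRHS](_ : _ = 4 * C * eps ^+ 2 / u); last by field; rewrite gt_eqF.
by rewrite ler_piMr ?invf_le1// divr_ge0 ?(ltW u0)// !mulr_ge0 ?exprn_ge0 ?(ltW e0).
Qed.

End truncated_moments.

(** * The entries of the precision matrix: first-order term, remainder, bad event *)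

Section precision.
Context {R : realType} (K n p : nat) (xi : 'I_n -> 'I_p -> 'rV[R]_K) (Sg Om : 'M[R]_p).
Context (ce Ce w S1 S2 : R) (r : 'I_n -> 'I_n -> R).
Hypotheses (n0 : (0 < n)%N) (p0 : (0 < p)%N).
Hypothesis hS : forall i a b, dotp (xi i a) (xi i b) = Sg a b.
Hypotheses (SO : Sg *m Om = 1%:M) (OT : Om^T = Om).
Hypotheses (ce0 : 0 < ce) (hce : forall v : 'rV[R]_p, ce * dotp v v <= dotp (v *m Sg) v).
Hypothesis hCe : forall a, Sg a a <= Ce.
Hypotheses (r0 : forall i l, 0 <= r i l) (rC : forall i l, r i l = r l i).
Hypothesis hr : forall i l a b, `|dotp (xi i a) (xi l b)| <= r i l.
Hypotheses (h1 : forall i, \sum_l r i l <= S1) (h2 : forall i, \sum_l r i l ^+ 2 <= S2).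
Hypotheses (w0 : 0 <= w) (hw : forall j, \sum_a `|Om a j| <= w).
Local Notation T := (K.-tuple R).
Local Notation H := (Hm xi).
Local Notation sn := (Num.sqrt (n%:R : R)).

Lemma sn2 : sn ^+ 2 = n%:R. Proof. by rewrite sqr_sqrtr. Qed.
Lemma sn0 : 0 < sn. Proof. by rewrite sqrtr_gt0 ltr0n. Qed.

Let ST : Sg^T = Sg.
Proof. by apply/matrixP => a b; rewrite mxE -(hS (Ordinal n0)) dotpC hS. Qed.

Let uS : Sg \in unitmx. Proof. by have := mulmx1_unit SO => -[]. Qed.
Let OmE : Om = invmx Sg.
Proof. by rewrite -[LHS]mul1mx -(mulVmx uS) -mulmxA SO mulmx1. Qed.
Let OS : Om *m Sg = 1%:M. Proof. by rewrite OmE mulVmx. Qed.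

Definition xv (a : 'I_p) (i : 'I_n) : 'rV[R]_K := xi i a.
(** The coordinates of Om X_i, a family dual to [xv]: mixed products at equal times are Kronecker
    symbols, and its own covariance matrix is [Om]. *)
Definition yv (j : 'I_p) (i : 'I_n) : 'rV[R]_K := \sum_a Om a j *: xi i a.

Lemma dotp_xy i a j : dotp (xi i a) (yv j i) = (a == j)%:R.
Proof.
rewrite dotp_sumr; under eq_bigr do rewrite dotpZr hS mulrC.
by transitivity ((Sg *m Om) a j); [rewrite mxE|rewrite SO mxE].
Qed.

Lemma dotp_yy i j k : dotp (yv j i) (yv k i) = Om j k.
Proof.
rewrite [yv j i]/yv dotp_suml; under eq_bigr do rewrite dotpZl dotp_xy.
rewrite (bigD1 k)//= eqxx mulr1 big1 ?addr0 => [|a ak]; last by rewrite (negbTE ak) mulr0.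
by rewrite -[in LHS]OT mxE.
Qed.

Lemma Om_entry j k : `|Om j k| <= ce^-1.
Proof. by rewrite OmE; apply: lower_invmx_entry => // v; rewrite -dotp_sqE -dotpE. Qed.

(** Cauchy-Schwarz for dual vectors: 1 = <x_j, y_j>^2 <= Sg j j * Om j j. *)
Lemma Om_diag_ge j : Ce^-1 <= Om j j.
Proof.
have := dotp_CS (xi (Ordinal n0) j) (yv j (Ordinal n0)); rewrite dotp_xy eqxx hS dotp_yy expr1n => h.
have Oj : 0 <= Om j j by rewrite -(dotp_yy (Ordinal n0)) dotp_ge0.
have Ce0 : 0 < Ce.
  rewrite ltNge; apply/negP => Cn; have := le_trans h (ler_wpM2r Oj (hCe j)).
  by move=> /le_trans -/(_ _ (mulr_le0_ge0 Cn Oj)); rewrite ler10.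
by rewrite -div1r ler_pdivrMr// mulrC (le_trans h)// ler_wpM2r.
Qed.

Lemma kb_xx a b : kbound r (xv a) (xv b) 1. Proof. by move=> i l; rewrite mul1r; exact: hr. Qed.

Lemma kb_sumr (u : 'I_n -> 'rV[R]_K) (c : R) j : 0 <= c -> (forall a, kbound r u (xv a) c) -> kbound r u (yv j) (c * w).
Proof.
move=> c0 h i l; rewrite dotp_sumr; apply: (le_trans (ler_norm_sum _ _ _)).
apply: (@le_trans _ _ (\sum_a `|Om a j| * (c * r i l))).
  by apply: ler_sum => a _; rewrite dotpZr normrM ler_wpM2l//; exact: h.
rewrite -mulr_suml [leRHS](_ : _ = w * (c * r i l)); last by ring.
by rewrite ler_wpM2r ?mulr_ge0.
Qed.

Lemma kb_sym (u v : 'I_n -> 'rV[R]_K) (c : R) : kbound r u v c -> kbound r v u c.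
Proof. by move=> h i l; rewrite dotpC rC; exact: h. Qed.

Lemma kb_xy a j : kbound r (xv a) (yv j) w.
Proof. by rewrite -[w]mul1r; apply: kb_sumr => // b; exact: kb_xx. Qed.
Lemma kb_yx j a : kbound r (yv j) (xv a) w. Proof. exact/kb_sym/kb_xy. Qed.
Lemma kb_yy j k : kbound r (yv j) (yv k) (w ^+ 2).
Proof. by rewrite expr2; apply: kb_sumr => // b; exact: kb_yx. Qed.

Lemma yy_le j i l : `|dotp (yv j i) (yv j l)| <= ce^-1.
Proof.
have c0 : 0 <= ce^-1 by rewrite invr_ge0 ltW.
rewrite -(@ler_pXn2r _ 2) ?nnegrE// real_normK ?num_real//.
have e m : dotp (yv j m) (yv j m) <= ce^-1 by rewrite dotp_yy (le_trans (ler_norm _))// Om_entry.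
by rewrite (le_trans (dotp_CS _ _))// expr2 ler_pM ?dotp_ge0.
Qed.

Let nR0 : 0 < n%:R :> R. Proof. by rewrite ltr0n. Qed.

Lemma fro_le_sum (u v : 'I_n -> 'rV[R]_K) (B : R) : (forall i, \sum_l `|dotp (u i) (u l)| * `|dotp (v i) (v l)| <= B) ->
  fro (BM u v) <= B / n%:R.
Proof.
move=> h; apply: (le_trans (fro_BM_le n0 _ _)).
rewrite (_ : B / n%:R = n%:R ^- 2 * (n%:R * B)); last by field; rewrite gt_eqF.
rewrite ler_wpM2l ?invr_ge0 ?exprn_ge0//; rewrite mulr_natl -[n in leRHS]card_ord -sumr_const.
exact: ler_sum.
Qed.

Lemma fro_xx a b : fro (BM (xv a) (xv b)) <= S2 / n%:R.
Proof.
apply: fro_le_sum => i; apply: (le_trans _ (h2 i)); apply: ler_sum => l _.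
by rewrite expr2 ler_pM//; exact: hr.
Qed.

Lemma fro_xy1 a j : fro (BM (xv a) (yv j)) <= w ^+ 2 * S2 / n%:R.
Proof.
apply: fro_le_sum => i; apply: (@le_trans _ _ (\sum_l w ^+ 2 * r i l ^+ 2)); last first.
  by rewrite -mulr_sumr ler_wpM2l ?sqr_ge0.
apply: ler_sum => l _; rewrite [leRHS](_ : _ = r i l * (w ^+ 2 * r i l)); last by ring.
by rewrite ler_pM//; [exact: hr|exact: kb_yy].
Qed.

(** An alternative to [fro_xy1] that spends no power of [w]: products of the [yv] are bounded by
    their variances, and only those of the [xv] are summed. *)
Lemma fro_xy2 a j : fro (BM (xv a) (yv j)) <= S1 / ce / n%:R.
Proof.
apply: fro_le_sum => i; apply: (@le_trans _ _ (\sum_l r i l / ce)); last first.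
  by rewrite -mulr_suml ler_wpM2r ?invr_ge0 ?(ltW ce0).
by apply: ler_sum => l _; rewrite ler_pM//; [exact: hr|exact: yy_le].
Qed.

Lemma fro_yy j k : fro (BM (yv j) (yv k)) <= w ^+ 4 * S2 / n%:R.
Proof.
apply: fro_le_sum => i; apply: (@le_trans _ _ (\sum_l w ^+ 4 * r i l ^+ 2)); last first.
  by rewrite -mulr_sumr ler_wpM2l ?exprn_ge0.
apply: ler_sum => l _; rewrite [leRHS](_ : _ = w ^+ 2 * r i l * (w ^+ 2 * r i l)); last by ring.
by rewrite ler_pM//; exact: kb_yy.
Qed.

Lemma H_entry a b t : (H t - Sg) a b = qf (BM (xv a) (xv b)) t.
Proof.
rewrite !mxE qf_BM// sumrB mulrBr; congr (_ - _).
under eq_bigr do rewrite hS.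
by rewrite sumr_const card_ord -[Sg a b *+ n]mulr_natl mulKf// gt_eqF.
Qed.

Lemma qf_BM_sumr (u : 'I_n -> 'rV[R]_K) j t : qf (BM u (yv j)) t = \sum_a Om a j * qf (BM u (xv a)) t.
Proof.
rewrite qf_BM//; under [RHS]eq_bigr do rewrite qf_BM// mulrCA.
rewrite -mulr_sumr; congr (_ * _); under [RHS]eq_bigr do rewrite mulr_sumr.
rewrite exchange_big/=; apply: eq_bigr => i _.
have -> : lin (yv j i) t = \sum_a Om a j * lin (xv a i) t.
  by rewrite lin_dotp dotp_suml; apply: eq_bigr => a _; rewrite dotpZl -lin_dotp.
rewrite dotp_sumr mulr_sumr -sumrB; apply: eq_bigr => a _; rewrite dotpZr; ring.
Qed.

Definition Gf a j := qf (BM (xv a) (yv j)).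

Lemma G_entry a j t : ((H t - Sg) *m Om) a j = Gf a j t.
Proof.
rewrite /Gf qf_BM_sumr mxE; apply: eq_bigr => b _; rewrite H_entry mulrC //.
Qed.

Lemma ODO_entry j k t : (Om *m (H t - Sg) *m Om) j k = qf (BM (yv j) (yv k)) t.
Proof.
rewrite BMC qf_BM_sumr -mulmxA mxE; apply: eq_bigr => a _; rewrite G_entry BMC /Gf.
by rewrite -[in LHS]OT mxE.
Qed.

(** The sign is that of the first-order term in [inv_expand]. *)
Definition ML (x : 'I_p * 'I_p) := - sn *: BM (yv x.1) (yv x.2).
Definition Lf x := qf (ML x).
(** The second-order term sqrt n Om D Om D Om, as a sum of products of two quadratic forms. *)
Definition R2f (x : 'I_p * 'I_p) t := sn * \sum_a Gf a x.1 t * qf (BM (yv a) (yv x.2)) t.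
Definition Ff (x : 'I_p * 'I_p) t := sn * (invmx (H t) - Om) x.1 x.2.

Lemma qfZ c (M : 'M[R]_K) t : qf (c *: M) t = c * qf M t.
Proof. by rewrite /qf -scalemxAr dotpZl mxtraceZ mulrBr. Qed.

Lemma R2_entry x t : R2f x t = sn * (Om *m (H t - Sg) *m Om *m (Om *m (H t - Sg))^T) x.1 x.2.
Proof.
have HT : (H t)^T = H t by apply/matrixP => a b; rewrite !mxE; congr (_ * _); apply: eq_bigr => i _; rewrite mulrC.
rewrite /R2f; congr (_ * _); rewrite trmx_mul OT [(_ - _)^T]linearB/= HT ST -!mulmxA [in RHS]mulmxA mxE; apply: eq_bigr => a _.
congr (_ * _); last by rewrite -ODO_entry -mulmxA.
rewrite -[Om *m (H t - Sg)]trmxK [RHS]mxE trmx_mul OT linearB/= HT ST; exact/esym/G_entry.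
Qed.

Variables (N : R) (N1 : 1 <= N).
(** Both variance bounds for the entries of D Om are kept, because the square of the remainder is
    controlled by their product. *)
Definition fG := Num.min (w ^+ 2 * S2 / n%:R) (S1 / ce / n%:R).
Definition aG := N * Num.sqrt fG.
Definition aD := N * Num.sqrt (S2 / n%:R).
Definition aL := N * (w ^+ 2 * Num.sqrt S2).

Definition good1 t := [&& [forall a, forall b, ~~ (aD <= `|qf (BM (xv a) (xv b)) t|)],
  [forall a, forall j, ~~ (aG <= `|Gf a j t|)] & [forall x, ~~ (aL <= `|Lf x t|)]].

Lemma mb_good1 : mb good1.
Proof.
have q M (a : R) : mb (fun t => ~~ (a <= `|qf (M : 'M[R]_K) t|)).
  by apply: measurable_neg; apply: mb_le; [exact: tame_cst|apply: tame_norm; exact: tame_qf].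
apply: mb_and; first by apply: mb_forall => a; apply: mb_forall => b.
by apply: mb_and; [apply: mb_forall => a; apply: mb_forall => b; exact: q|apply: mb_forall => x; exact: q].
Qed.

Hypotheses (S20 : 0 < S2) (S10 : 0 < S1) (wp : 0 < w).
Hypothesis small : p%:R * aD <= ce / 2.

Lemma fG_gt0 : 0 < fG. Proof. by rewrite /fG lt_min !divr_gt0// ?mulr_gt0// ?exprn_gt0. Qed.

Lemma good1P t : good1 t -> [/\ forall a b, `|(H t - Sg) a b| <= aD, forall a j, `|((H t - Sg) *m Om) a j| <= aG
  & forall x, `|Lf x t| <= aL].
Proof.
move=> /and3P[/forallP g1 /forallP g2 /forallP g3]; split.
- by move=> a b; rewrite H_entry; have := g1 a => /forallP/(_ b); rewrite -ltNge => /ltW.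
- by move=> a b; rewrite G_entry; have := g2 a => /forallP/(_ b); rewrite -ltNge => /ltW.
- by move=> x; have := g3 x; rewrite -ltNge => /ltW.
Qed.

Definition eR := sn * (2 / ce * p%:R * aG ^+ 2).
Definition e3 := sn * (2 / ce ^+ 2 * p%:R ^+ 2 * aD * aG ^+ 2).

Lemma aD_ge0 : 0 <= aD. Proof. by rewrite mulr_ge0 ?sqrtr_ge0 ?(le_trans ler01 N1). Qed.
Lemma aG_ge0 : 0 <= aG. Proof. by rewrite mulr_ge0 ?sqrtr_ge0 ?(le_trans ler01 N1). Qed.

Let HT t : (H t)^T = H t.
Proof. by apply/matrixP => a b; rewrite !mxE; congr (_ * _); apply: eq_bigr => i _; rewrite mulrC. Qed.

Lemma good1_expand t x : good1 t -> [/\ `|Ff x t - Lf x t| <= eR, `|Ff x t - Lf x t - R2f x t| <= e3 & `|Lf x t| <= aL].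
Proof.
move=> gt; have [g1 g2 g3] := good1P gt; rewrite g3.
have E : Ff x t - Lf x t = sn * (Om *m (H t - Sg) *m invmx (H t) *m (Om *m (H t - Sg))^T) x.1 x.2.
  rewrite /Ff /Lf /ML qfZ -ODO_entry (inv_expand SO OT ST (HT t) ce0 hce g1 small aD_ge0).
  by rewrite mxE [X in _ * (X + _)]mxE; ring.
rewrite R2_entry E -mulrBr !normrM (gtr0_norm sn0) !(ler_pM2l sn0); split => //.
  exact: (perturb_R OT ST (HT t) ce0 hce g1 g2 small aD_ge0 aG_ge0 x.1 x.2).
have := perturb_R3 SO OT ST (HT t) ce0 hce g1 g2 small aD_ge0 aG_ge0 x.1 x.2.
by rewrite mxE [X in _ + X]mxE.
Qed.

Lemma ML_sym x : (ML x)^T = ML x.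
Proof. by rewrite /ML linearZ/= BM_sym. Qed.

Let nE y : n%:R * y = sn * (sn * y). Proof. by rewrite mulrA -expr2 sn2. Qed.

Lemma fro_MLML x x' : fro (ML x *m ML x') <= w ^+ 8 * S1 ^+ 2 * S2 / n%:R.
Proof.
rewrite /ML -scalemxAl -scalemxAr scalerA froZ.
have h := fro_BMBM_le n0 r0 rC h1 h2 (W := w ^+ 2) (u := yv x.1) (v := yv x.2) (u' := yv x'.1) (v' := yv x'.2).
apply: (le_trans (ler_wpM2l (sqr_ge0 _) (h _ _ _ _ _ _ _ _ _ _ _ _ _ _ _ _ _))); rewrite ?sqr_ge0//; try exact: kb_yy.
rewrite mulrNN -expr2 sn2.
by apply: eq_leW; field; rewrite gt_eqF.
Qed.

(** Half the variance of a diagonal entry of the first-order term; this is the nondegenerate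
    component that anti-concentration needs. *)
Lemma fro_ML_diag j : Ce^-1 ^+ 2 <= fro (ML (j, j)).
Proof.
rewrite /ML froZ sqrrN sn2 /=; have h := fro_BM_diag n0 (fun i => dotp_yy i j j).
apply: (le_trans _ (ler_wpM2l (ltW nR0) h)); rewrite mulrC divfK ?gt_eqF//.
have Ce0 : 0 <= Ce^-1.
  rewrite invr_ge0; apply: le_trans (hCe j); rewrite -(hS (Ordinal n0)); exact: dotp_ge0.
by rewrite lerXn2r ?nnegrE// ?Om_diag_ge// (le_trans Ce0)// Om_diag_ge.
Qed.

Lemma kb_gen u v (c d : R) :
  (exists a, u = xv a /\ c = 1) \/ (exists j, u = yv j /\ c = w) ->
  (exists a, v = xv a /\ d = 1) \/ (exists j, v = yv j /\ d = w) -> kbound r u v (c * d).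
Proof.
case=> [[a [-> ->]]|[a [-> ->]]] [[b [-> ->]]|[b [-> ->]]]; rewrite ?mul1r ?mulr1.
- exact: kb_xx.
- exact: kb_xy.
- exact: kb_yx.
- exact: kb_yy.
Qed.

(** 8 from [gE_qf3], [p] from the summation index of [R2f], and one [w] for each of the five vectors
    [yv] in [tr3_le]. *)
Definition B3 := 8 * p%:R * w ^+ 5 * S1 * S2 / n%:R.

Lemma tr3_le j k a j' k' : `|\tr (BM (yv j) (yv k) *m BM (xv a) (yv j') *m BM (yv a) (yv k'))| <=
  w ^+ 5 * (n%:R ^- 2 * (S1 * S2)).
Proof.
pose u (i : 'I_3) := nth (yv j) [:: yv j; xv a; yv a] i.
pose v (i : 'I_3) := nth (yv k) [:: yv k; yv j'; yv k'] i.
pose wu (i : 'I_3) := nth w [:: w; 1; w] i.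
have hu i : (exists a, u i = xv a /\ wu i = 1) \/ (exists j, u i = yv j /\ wu i = w).
  by case: i => [[|[|[|]]]//= h]; rewrite /u /wu /=; [right; exists j|left; exists a|right; exists a].
have hv i : (exists a, v i = xv a /\ w = 1) \/ (exists j, v i = yv j /\ w = w).
  by case: i => [[|[|[|]]]//= h]; rewrite /v /=; right; [exists k|exists j'|exists k'].
have := tr_BM3_le n0 r0 rC h1 h2 (a := 0) (b := 1) (c := 2) (u := u) (v := v) (wu := wu) (wv := fun=> w).
rewrite /u /v /wu /= => h; apply: (le_trans (h _ _ _ isT isT isT)).
- by case=> [[|[|[|]]]//=].
- by [].
- by move=> i l _; split; apply: kb_gen; rewrite ?(hu i) ?(hu l) ?(hv i) ?(hv l); [exact: (hu i)|exact: (hu l)|exact: (hu i)|exact: (hv l)|exact: (hv i)|exact: (hu l)|exact: (hv i)|exact: (hv l)].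
- by apply: eq_leW; ring.
Qed.

Lemma tame_R2 x : tame (R2f x).
Proof. by apply: tameZ; apply: tame_sum => a; apply: tameM; exact: tame_qf. Qed.

Lemma gE_LR2 x x' : `|gE (fun t => Lf x t * R2f x' t)| <= B3.
Proof.
have tt a : tame (fun t => qf (BM (yv x.1) (yv x.2)) t * Gf a x'.1 t * qf (BM (yv a) (yv x'.2)) t).
  by apply: tameM; [apply: tameM|]; exact: tame_qf.
have -> : gE (fun t => Lf x t * R2f x' t) = - (n%:R * \sum_a 8 * \tr (BM (yv x.1) (yv x.2) *m BM (xv a) (yv x'.1) *m BM (yv a) (yv x'.2))).
  under [in RHS]eq_bigr do rewrite -gE_qf3 ?BM_sym//.
  rewrite -gE_sum// -gEZ; last exact: tame_sum.
  rewrite -mulN1r -gEZ; last by apply: tameZ; exact: tame_sum.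
  congr gE; apply/funext => t; rewrite /Lf /R2f /ML qfZ nE mulN1r mulNr mulNr; congr (- _).
  rewrite -!mulrA; congr (_ * _); rewrite mulrCA; congr (_ * _); rewrite mulr_sumr.
  by apply: eq_bigr => a _; rewrite /Gf mulrA.
rewrite normrN normrM gtr0_norm// /B3.
apply: (@le_trans _ _ (n%:R * (p%:R * (8 * (w ^+ 5 * (n%:R ^- 2 * (S1 * S2))))))); last first.
  by apply: eq_leW; field; rewrite gt_eqF.
rewrite ler_pM2l//; apply: (le_trans (ler_norm_sum _ _ _)).
rewrite mulr_natl -[p in leRHS]card_ord -sumr_const; apply: ler_sum => a _.
by rewrite normrM ger0_norm// ler_wpM2l// tr3_le.
Qed.

Section tails.
Variables (eta : R) (q : nat).
Hypotheses (q0 : (0 < q)%N) (heta : tail_small q N eta).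
Local Notation bad := (fun t => ~~ good1 t).

Let Np : 0 < N. Proof. exact: lt_le_trans ltr01 N1. Qed.

Let tail (M : 'M[R]_K) (B : R) : 0 < B -> fro M <= B -> gP (fun t => N * Num.sqrt B <= `|qf M t|) <= eta.
Proof.
move=> B0 h; apply: (tail_qf q0 N1 heta); first by rewrite mulr_gt0 ?sqrtr_gt0.
rewrite exprMn sqr_sqrtr ?(ltW B0)// [leRHS](_ : _ = 32 * B * N ^+ 2); last by ring.
rewrite ler_wpM2r ?sqr_ge0//.
by rewrite (le_trans h)// ler_peMl ?(ltW B0)// ler1n.
Qed.

Lemma fro_ML x : fro (ML x) <= w ^+ 4 * S2.
Proof.
rewrite /ML froZ sqrrN sn2 (le_trans (ler_wpM2l (ltW nR0) (fro_yy _ _)))//.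
by rewrite mulrC divfK// gt_eqF.
Qed.

Lemma gP_bad : gP bad <= 3 * p%:R ^+ 2 * eta.
Proof.
have tq (M : 'M[R]_K) (a : R) : mb (fun t => a <= `|qf M t|).
  by apply: mb_le; [exact: tame_cst|apply: tame_norm; exact: tame_qf].
have m1 : mb (fun t => [exists a, exists b, aD <= `|qf (BM (xv a) (xv b)) t|]).
  by apply: mb_exists => a; apply: mb_exists => b.
have m2 : mb (fun t => [exists a, exists j, aG <= `|Gf a j t|]).
  by apply: mb_exists => a; apply: mb_exists => b; exact: tq.
have m3 : mb (fun t => [exists x, aL <= `|Lf x t|]) by apply: mb_exists => a; exact: tq.
have u (f : 'I_p -> 'I_p -> T -> bool) : (forall a b, mb (f a b)) -> (forall a b, gP (f a b) <= eta) ->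
    gP (fun t => [exists a, exists b, f a b t]) <= p%:R ^+ 2 * eta.
  move=> mf hf; apply: (le_trans (gP_exists (fun a => mb_exists (mf a)))).
  rewrite expr2 -mulrA mulr_natl -[X in _ *+ X]card_ord -sumr_const; apply: ler_sum => a _.
  apply: (le_trans (gP_exists (mf a))).
  by rewrite mulr_natl -[X in _ *+ X]card_ord -sumr_const; apply: ler_sum => b _.
apply: (@le_trans _ _ (gP (fun t => [exists a, exists b, aD <= `|qf (BM (xv a) (xv b)) t|] ||
   ([exists a, exists j, aG <= `|Gf a j t|] || [exists x, aL <= `|Lf x t|])))).
  apply: gP_le; [by apply: measurable_neg; exact: mb_good1|by apply: mb_or => //; exact: mb_or|move=> t].
  rewrite /good1 !negb_and => /or3P[/forallPn[a /forallPn[b]]|/forallPn[a /forallPn[b]]|/forallPn[a]]; rewrite negbK => h; apply/or3P.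
  - by apply: Or31; apply/existsP; exists a; apply/existsP; exists b.
  - by apply: Or32; apply/existsP; exists a; apply/existsP; exists b.
  - by apply: Or33; apply/existsP; exists a.
apply: (le_trans (gP_or m1 (mb_or m2 m3))).
have k1 : gP (fun t => [exists a, exists b, aD <= `|qf (BM (xv a) (xv b)) t|]) <= p%:R ^+ 2 * eta.
  by apply: u => // a b; apply: tail; [exact: divr_gt0|exact: fro_xx].
have k2 : gP (fun t => [exists a, exists j, aG <= `|Gf a j t|]) <= p%:R ^+ 2 * eta.
  apply: u => a b; [exact: tq|apply: tail; first exact: fG_gt0].
  by rewrite /fG le_min fro_xy1 fro_xy2.
have k3 : gP (fun t => [exists x, aL <= `|Lf x t|]) <= p%:R ^+ 2 * eta.
  apply: (le_trans (gP_exists (fun x => tq (ML x) aL))).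
  apply: (@le_trans _ _ (\sum_(x : 'I_p * 'I_p) eta)); last first.
    by rewrite sumr_const card_prod card_ord -[eta *+ _]mulr_natl natrM expr2.
  apply: ler_sum => x _; have -> : aL = N * Num.sqrt (w ^+ 4 * S2).
    have e4 : w ^+ 4 = (w ^+ 2) ^+ 2 by ring.
    by rewrite /aL e4 sqrtrM ?sqr_ge0// sqrtr_sqr ger0_norm// sqr_ge0.
  by apply: tail; [rewrite mulr_gt0// exprn_gt0|exact: fro_ML].
have := gP_or m2 m3; move: k1 k2 k3; rewrite -!mulrA; move: (gP _) (gP _) (gP _) (gP _) (_ * eta) => *; lra.
Qed.

Variables (Bf x : R).
Hypotheses (x0 : 0 < x) (Bf2 : w ^+ 2 * S2 <= Bf) (Bf4 : w ^+ 4 * S2 <= Bf).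
(** Bounds fourth moments on the bad event through y <= x y^2 + 1 / x with y = Q^4. The weight [x]
    is chosen later to balance the eighth moment against the probability. *)
Definition t4 := x * (momC 4 * Bf ^+ 4) + x^-1 * gP bad.

Let mbd : mb bad. Proof. by apply: measurable_neg; exact: mb_good1. Qed.
Let tb : tame (fun t => (bad t)%:R : R). Proof. exact: tame_bool. Qed.

Lemma bad4 (M : 'M[R]_K) : fro M <= Bf -> gE (fun t => (bad t)%:R * qf M t ^+ 4) <= t4.
Proof.
move=> h; apply: (@le_trans _ _ (x * gE (fun t => qf M t ^+ (2 * 4)) + x^-1 * gP bad)); last first.
  rewrite lerD2r ler_wpM2l ?(ltW x0)//; apply: (le_trans (gE_moment_qf M (q := 4) isT)).
  by rewrite ler_wpM2l ?momC_ge0// lerXn2r ?nnegrE ?fro_ge0// (le_trans (fro_ge0 _) h).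
have t8 : tame (fun t => qf M t ^+ (2 * 4)) by apply: tameX; exact: tame_qf.
rewrite -!gEZ// -gED; [|exact: tameZ|exact: tameZ].
apply: gE_le; [by apply: tameM => //; apply: tameX; exact: tame_qf|by apply: tameD; exact: tameZ|move=> t].
have y0 : 0 <= qf M t ^+ 4 by rewrite (exprM _ 2 2) sqr_ge0.
rewrite (exprM _ 4 2); move: (qf M t ^+ 4) y0 => y y0.
have xi0 : 0 < x^-1 by rewrite invr_gt0.
case: (bad t); rewrite ?mul1r ?mul0r ?mulr0 ?mulr1 ?addr0; last by rewrite mulr_ge0 ?sqr_ge0 ?(ltW x0).
have := sqr_ge0 (x * y - 1); rewrite -(pmulr_rge0 _ xi0).
have -> : x^-1 * (x * y - 1) ^+ 2 = x * y ^+ 2 - 2 * y + x^-1 by field; rewrite gt_eqF.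
by move: (x * y ^+ 2) (x^-1) => u v; lra.
Qed.

Let bP (M : 'M[R]_K) : gP bad = gE (fun t => (bad t)%:R). Proof. by []. Qed.

Lemma t4_ge0 : 0 <= t4.
Proof.
rewrite /t4 addr_ge0// mulr_ge0 ?invr_ge0 ?(ltW x0)// ?gP_ge0// mulr_ge0 ?momC_ge0//.
by rewrite (exprM _ 2 2) sqr_ge0.
Qed.

Lemma bad_L y : gE (fun t => (bad t)%:R * Lf y t ^+ 2) <= t4 + gP bad.
Proof.
have hM : fro (ML y) <= Bf by rewrite (le_trans (fro_ML y)).
apply: le_trans (_ : gE (fun t => (bad t)%:R * qf (ML y) t ^+ 4) + gP bad <= _); last by rewrite lerD2r bad4.
have t1 : tame (fun t => (bad t)%:R * qf (ML y) t ^+ 4) by apply: tameM => //; apply: tameX; exact: tame_qf.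
rewrite -gED//; apply: gE_le; [by apply: tameM => //; apply: tameX; exact: tame_qf|exact: tameD|move=> t].
rewrite /Lf; move: (qf _ t) => u; case: (bad t); rewrite ?mul1r ?mul0r ?addr0//.
by rewrite mulr1n (exprM u 2 2); have := sqr_ge0 (u ^+ 2 - 1); have := sqr_ge0 u; move: (u ^+ 2) => v; nra.
Qed.

Lemma bad_R y : gE (fun t => (bad t)%:R * R2f y t ^+ 2) <= 2 * n%:R * p%:R ^+ 2 * t4.
Proof.
have tG a b : tame (fun t => (bad t)%:R * qf (BM (xv a) (yv b)) t ^+ 4) by apply: tameM => //; apply: tameX; exact: tame_qf.
have tY a b : tame (fun t => (bad t)%:R * qf (BM (yv a) (yv b)) t ^+ 4) by apply: tameM => //; apply: tameX; exact: tame_qf.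
have ts : tame (fun t => \sum_a ((bad t)%:R * qf (BM (xv a) (yv y.1)) t ^+ 4 + (bad t)%:R * qf (BM (yv a) (yv y.2)) t ^+ 4)).
  by apply: tame_sum => a; apply: tameD.
have n1 : 1 <= n%:R :> R by rewrite ler1n.
have dn (a B : R) : a <= B / n%:R -> B <= Bf -> a <= Bf.
  move=> ha hb; apply: (le_trans ha); rewrite ler_pdivrMr// (le_trans hb)// ler_peMr//.
  by apply: le_trans Bf2; rewrite mulr_ge0 ?sqr_ge0 ?(ltW S20).
apply: (@le_trans _ _ (gE (fun t => n%:R * p%:R * \sum_a ((bad t)%:R * qf (BM (xv a) (yv y.1)) t ^+ 4 + (bad t)%:R * qf (BM (yv a) (yv y.2)) t ^+ 4)))).
  apply: gE_le; [by apply: tameM => //; apply: tameX; exact: tame_R2|exact: tameZ|move=> t].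
  rewrite /R2f /Gf; case: (bad t); last by rewrite mul0r big1 ?mulr0// => a _; rewrite !mul0r addr0.
  rewrite mul1r exprMn sn2 -mulrA ler_pM2l//.
  have := cauchy_schwarz_sum (fun _ : 'I_p => 1) (fun a => qf (BM (xv a) (yv y.1)) t * qf (BM (yv a) (yv y.2)) t).
  under eq_bigr do rewrite mul1r.
  move=> /le_trans; apply; rewrite expr1n sumr_const card_ord ler_wpM2l//.
  apply: ler_sum => a _; rewrite !mul1r; move: (qf _ t) (qf _ t) => u v.
  have := sqr_ge0 (u ^+ 2 - v ^+ 2); have := sqr_ge0 (u ^+ 2 + v ^+ 2); rewrite exprMn (exprM u 2 2) (exprM v 2 2); move: (u ^+ 2) (v ^+ 2) => a1 b1; nra.
rewrite gEZ// gE_sum; last by move=> a; exact: tameD.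
rewrite [leRHS](_ : _ = n%:R * p%:R * (p%:R * (t4 + t4))); last by ring.
rewrite ler_wpM2l ?mulr_ge0// mulr_natl -[X in _ *+ X]card_ord -sumr_const; apply: ler_sum => a _.
rewrite gED// lerD// bad4//; [exact: dn (fro_xy1 _ _) Bf2|exact: dn (fro_yy _ _) Bf4].
Qed.

Hypotheses (S11 : 1 <= S1) (Ce0 : 0 < Ce).
Hypothesis hm : (24 * p ^ 2)%N%:R * S1 <= n%:R * ce.

(** The first summand comes from [trace_tail] with [q = 10], the second from the constant of
    [small_ball]. *)
Definition Cg := (20 * Ce) ^+ 10 + expR 1.

(** [L] is of order 1 / e, so the grid has at most e^(-2p) points. With small-ball exponent 4p + 8,
    the bound (16 n p e)^2 <= e yields e^(2p + 4), which leaves e^4. In the trace term six factors e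
    absorb the powers of n and p. *)
Lemma good_prob4 (e : R) : 0 < e -> e <= 4^-1 -> (16 * n%:R * p%:R) ^+ 2 * e <= 1 ->
  exists L : nat, [/\ (1 < L)%N, L%:R^-1 <= e & gP (fun t => ~~ good xi e L t) <= Cg * e ^+ 4].
Proof.
move=> e0 e4 hnp; have ei0 : 0 < e^-1 by rewrite invr_gt0.
have ei4 : 4 <= e^-1 by rewrite -[4]invrK lef_pV2 ?posrE// invr_gt0.
have /andP[L1 L2] := truncn_itv (ltW ei0).
exists (Num.truncn e^-1).+1; set L := (Num.truncn e^-1).+1 in L2 *.
have L4 : 4 <= L%:R :> R by exact: le_trans ei4 (ltW L2).
have Lb : L%:R <= e^-1 + 1 by rewrite /L -addn1 natrD lerD2r.
split.
- by rewrite -(ltr_nat R); apply: lt_le_trans L4; rewrite ltr_nat.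
- by rewrite -[e]invrK lef_pV2 ?posrE ?ltr0n// ltW.
have np1 : 1 <= n%:R * p%:R :> R by rewrite -natrM ler1n muln_gt0 n0.
have pe : 8 * n%:R * p%:R * e <= 1.
  apply: le_trans hnp; rewrite ler_wpM2r ?(ltW e0)// -!mulrA; move: (n%:R * p%:R) np1 => u u1; rewrite exprMn expr2; nra.
(* 4p + 8 <= 12p, whence the 24 in [hm]. *)
have m2 : (2 * (2 * p + 4))%N%:R * (2 * (p%:R * S1)) <= n%:R * ce.
  apply: le_trans hm; rewrite [leRHS](_ : _ = (12 * p)%N%:R * (2 * (p%:R * S1))); last by rewrite !natrM; ring.
  by rewrite ler_wpM2r ?mulr_ge0 ?(ltW S10)// ler_nat; move: p0; clear; lia.
have rr l : \sum_i r i l <= S1 by under eq_bigr do rewrite rC.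
have gp := good_prob n0 p0 hS hce hCe hr h1 rr S11 m2 L e0 10 pe.
apply: (le_trans gp).
have hu : (n%:R * p%:R) ^+ 2 * e <= 1.
  apply: le_trans hnp; rewrite ler_wpM2r ?(ltW e0)//; move: (n%:R * p%:R) np1 (mulrA 16 (n%:R : R) p%:R) => u u1 <-; rewrite exprMn; nra.
have pR1 : 1 <= p%:R :> R by rewrite ler1n.
have nR1 : 1 <= n%:R :> R by rewrite ler1n.
rewrite /Cg [leRHS]mulrDl; apply: lerD.
  rewrite [leLHS](_ : _ = (20 * Ce) ^+ 10 * (n%:R * p%:R ^+ 11 * e ^+ 6) * e ^+ 4); last by rewrite (_ : (2 * 10)%N = 20%N)//; ring.
  rewrite ler_wpM2r ?exprn_ge0 ?(ltW e0)// ler_piMr ?exprn_ge0 ?mulr_ge0 ?(ltW Ce0)//.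
  apply: (@le_trans _ _ (((n%:R * p%:R) ^+ 2 * e) ^+ 6)); last by rewrite exprn_ile1// mulr_ge0 ?sqr_ge0 ?(ltW e0).
  rewrite exprMn -exprM ler_wpM2r ?exprn_ge0 ?(ltW e0)// exprMn ler_pM ?exprn_ge0//.
    by rewrite [leRHS]exprS ler_peMr// exprn_ege1.
  by rewrite [leRHS]exprS ler_peMl ?exprn_ge0.
apply: (@le_trans _ _ ((e^-1 ^+ 2) ^+ p * (expR 1 * e ^+ (2 * p + 4)))); last first.
  rewrite -exprM exprD mulrCA [X in _ * X]mulrA exprVn mulVf ?mul1r// expf_neq0// gt_eqF//.
rewrite ler_pM ?exprn_ge0// ?mulr_ge0 ?expR_ge0 ?exprn_ge0 ?mulr_ge0 ?(ltW e0)//.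
  rewrite lerXn2r ?nnegrE ?sqr_ge0// natrD natrM; move: (e^-1) ei4 Lb L4 => y; move: (L%:R) => l; nra.
rewrite ler_wpM2l ?expR_ge0// exprM lerXn2r ?nnegrE ?sqr_ge0 ?(ltW e0)//.
by rewrite exprMn expr2 mulrA ler_piMl ?(ltW e0).
Qed.

Lemma Cg_ge0 : 0 <= Cg.
Proof. by rewrite /Cg addr_ge0 ?expR_ge0// exprn_ge0// mulr_ge0// ltW. Qed.

Variable e : R.
Hypotheses (e0 : 0 < e) (e4 : e <= 4^-1) (he : (16 * n%:R * p%:R) ^+ 2 * e <= 1).
Hypothesis hF : forall y, L2 (Ff y).

Let epow (l : nat) : 0 < e / 2 ^+ l /\ e / 2 ^+ l <= e.
Proof.
by rewrite divr_gt0// ler_pdivrMr// ler_peMr ?(ltW e0)// exprn_ege1// ler1n.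
Qed.

(** [layer_cake] for the events [good] at resolutions e / 2^l, on which entries of the inverse are
    at most 2^l / e. *)
Lemma bad_inv j k : gE (fun t => (bad t)%:R * invmx (H t) j k ^+ 2) <= e ^- 2 * gP bad + 8 * Cg * e ^+ 2.
Proof.
have /choice[Lf hL] : forall l, exists L : nat, [/\ (1 < L)%N, L%:R^-1 <= e / 2 ^+ l & gP (fun t => ~~ good xi (e / 2 ^+ l) L t) <= Cg * (e / 2 ^+ l) ^+ 4].
  move=> l; have [u0 u1] := epow l; apply: good_prob4 => //; first exact: le_trans u1 e4.
  by apply: le_trans he; rewrite ler_wpM2l ?sqr_ge0.
have minv : measurable_fun setT (fun t => invmx (H t) j k).
  rewrite (_ : (fun t => _) = (fun t => sn^-1 * Ff (j, k) t + Om j k)).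
    by apply: measurable_funD => //; apply: measurable_funM => //; have [] := hF (j, k).
  by apply/funext => t; rewrite /Ff !mxE mulKf ?subrK// gt_eqF// sn0.
have := @layer_cake R K (fun t => invmx (H t) j k ^+ 2) bad (fun l => good xi (e / 2 ^+ l) (Lf l)) e Cg.
have tc := @layer_cake R K.
rewrite /gE => h; rewrite /Rintegral -lee_fin.
have {}h := h _ _ mbd _ e0 Cg_ge0 _ _.
have hh : (\int[gauss K]_t ((bad t)%:R * invmx (H t) j k ^+ 2)%:E <= (e ^- 2 * gP bad + 8 * Cg * e ^+ 2)%:E)%E.
  apply: h.
  - exact: measurable_funX.
  - by move=> t; exact: sqr_ge0.
  - by move=> l; exact: mb_good.
  - move=> l t gt; have [L1 L2 _] := hL l; have [u0 _] := epow l.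
    have g := good_invmx n0 u0 L1 L2 gt j k.
    rewrite -[leLHS]real_normK ?num_real//; apply: (@le_trans _ _ ((e / 2 ^+ l)^-1 ^+ 2)).
      by rewrite lerXn2r ?nnegrE// (le_trans _ g).
    by rewrite invfM invrK exprMn -exprM mulnC exprM exprVn mulrC (_ : 2 ^+ 2 = 4)//; ring.
  - by move=> l; have [] := hL l.
rewrite fineK// ge0_fin_numE; first exact: le_lt_trans hh (ltry _).
by apply: integral_ge0 => t _; rewrite lee_fin mulr_ge0 ?sqr_ge0.
Qed.

Lemma bad_F y : gE (fun t => (bad t)%:R * Ff y t ^+ 2) <=
  2 * n%:R * (e ^- 2 * gP bad + 8 * Cg * e ^+ 2 + ce^-1 ^+ 2 * gP bad).
Proof.
have iF : (gauss K).-integrable setT (EFin \o (fun t => (bad t)%:R * Ff y t ^+ 2)).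
  have := L2M (L2_bool mbd (hF y)) (hF y); apply: eq_integrable => // t _ /=; congr EFin; ring.
have lI : L2 (fun t => invmx (H t) y.1 y.2).
  have lc : L2 (fun t : T => sn^-1 * Ff y t + Om y.1 y.2).
    split; first by apply: measurable_funD => //; apply: measurable_funM => //; have [] := hF y.
    have i1 := integrableZl measurableT (sn^-1 ^+ 2) (hF y).2.
    have i2 := integrableZl measurableT (2 * sn^-1 * Om y.1 y.2) (L2_int (hF y)).
    have i3 : (gauss K).-integrable setT (EFin \o (fun t : T => Om y.1 y.2 ^+ 2)).
      by apply: tame_integrable; exact: tame_cst.
    have := integrableD measurableT (integrableD measurableT i1 i2) i3.
    by apply: eq_integrable => // t _ /=; rewrite -!EFinM -!EFinD; congr EFin; ring.
  rewrite (_ : (fun t => _) = (fun t => sn^-1 * Ff y t + Om y.1 y.2))//.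
  by apply/funext => t; rewrite /Ff !mxE mulKf ?subrK// gt_eqF// sn0.
have iI : (gauss K).-integrable setT (EFin \o (fun t => (bad t)%:R * invmx (H t) y.1 y.2 ^+ 2)).
  have := L2M (L2_bool mbd lI) lI; apply: eq_integrable => // t _ /=; congr EFin; ring.
have iB : (gauss K).-integrable setT (EFin \o (fun t => ce^-1 ^+ 2 * (bad t)%:R : R)).
  by apply: tame_integrable; exact: tameZ.
have E : gE (fun t => 2 * n%:R * ((bad t)%:R * invmx (H t) y.1 y.2 ^+ 2 + ce^-1 ^+ 2 * (bad t)%:R)) =
   2 * n%:R * (gE (fun t => (bad t)%:R * invmx (H t) y.1 y.2 ^+ 2) + ce^-1 ^+ 2 * gP bad).
  rewrite /gP -gEZ// /gE -RintegralD// RintegralZl//.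
  by have := integrableD measurableT iI iB; apply: eq_integrable => // t _; rewrite /= EFinD.
apply: (@le_trans _ _ (gE (fun t => 2 * n%:R * ((bad t)%:R * invmx (H t) y.1 y.2 ^+ 2 + ce^-1 ^+ 2 * (bad t)%:R)))).
  rewrite /gE; apply: le_Rintegral => //.
    have := integrableZl measurableT (2 * n%:R) (integrableD measurableT iI iB).
    by apply: eq_integrable => // t _ /=; rewrite -!EFinD -EFinM.
  move=> t _; have -> : Ff y t = sn * (invmx (H t) y.1 y.2 - Om y.1 y.2) by rewrite /Ff !mxE.
  rewrite exprMn sn2.
  have : Om y.1 y.2 ^+ 2 <= ce^-1 ^+ 2.
    by rewrite -[leLHS]real_normK ?num_real// lerXn2r ?nnegrE ?invr_ge0 ?(ltW ce0)// Om_entry.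
  case: (bad t); rewrite ?mul0r ?mulr0 ?addr0 ?mulr0// !mul1r mulr1 (mulrC 2) -mulrA ler_pM2l//.
  move: (invmx _ _ _) (Om _ _) (ce^-1 ^+ 2) => a b c hb; have := sqr_ge0 (a + b); rewrite sqrrD sqrrB; lra.
rewrite E ler_wpM2l ?mulr_ge0// lerD2r; exact: bad_inv.
Qed.

Definition tauE := 2 * n%:R * p%:R ^+ 2 * t4 + (1 + 2 * n%:R * (e ^- 2 + ce^-1 ^+ 2)) * gP bad + 16 * n%:R * Cg * e ^+ 2.

Lemma tau_bounds : [/\ 0 <= tauE, bad_bound bad tauE (fun=> 1), forall y, bad_bound bad tauE (Ff y),
  forall y, bad_bound bad tauE (Lf y) & forall y, bad_bound bad tauE (R2f y)].
Proof.
have a1 : t4 <= 2 * n%:R * p%:R ^+ 2 * t4.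
  have u : 1 <= n%:R * p%:R ^+ 2 :> R by rewrite -natrX -natrM ler1n muln_gt0 n0 expn_gt0 p0.
  rewrite -[2 * _ * _]mulrA; move: (n%:R * p%:R ^+ 2) t4 t4_ge0 u => v y; nra.
have a2 : 0 <= 2 * n%:R * (e ^- 2 + ce^-1 ^+ 2) by rewrite mulr_ge0 ?mulr_ge0// addr_ge0 ?sqr_ge0// invr_ge0 sqr_ge0.
have a3 : 0 <= 16 * n%:R * Cg * e ^+ 2 by rewrite mulr_ge0 ?sqr_ge0// mulr_ge0 ?Cg_ge0// mulr_ge0.
have a4 := gP_ge0 bad; have a5 := t4_ge0.
have a6 : 0 <= 2 * n%:R * (e ^- 2 + ce^-1 ^+ 2) * gP bad by rewrite mulr_ge0.
have tE : tauE = 2 * n%:R * p%:R ^+ 2 * t4 + gP bad + 2 * n%:R * (e ^- 2 + ce^-1 ^+ 2) * gP bad + 16 * n%:R * Cg * e ^+ 2 by rewrite /tauE; ring.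
have ar (A B C G y : R) : y <= A -> 0 <= B -> 0 <= G -> 0 <= y -> 0 <= C ->
    [/\ 0 <= A + G + C + B, G <= A + G + C + B, C + B <= A + G + C + B, y + G <= A + G + C + B & A <= A + G + C + B].
  by move=> *; split; lra.
have [b1 b2 b3 b4 b5] := ar _ _ _ _ _ a1 a3 a4 a5 a6; rewrite -tE in b1 b2 b3 b4 b5.
split=> //; rewrite /bad_bound.
- by apply: le_trans b2; rewrite (_ : (fun t => _) = (fun t => (bad t)%:R))//; apply/funext => t; rewrite expr1n mulr1.
- move=> y; apply: (le_trans (bad_F y)); apply: le_trans b3.
  by apply: eq_leW; ring.
- by move=> y; apply: (le_trans (bad_L y)).
- by move=> y; apply: (le_trans (bad_R y)).
Qed.

End tails.

Section covariance.
Variables (tau : R).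
Local Notation bad := (fun t => ~~ good1 t).
Hypotheses (hF : forall x, L2 (Ff x)) (tau1 : bad_bound bad tau (fun=> 1)) (tauF : forall x, bad_bound bad tau (Ff x))
  (tauL : forall x, bad_bound bad tau (Lf x)) (tauR : forall x, bad_bound bad tau (R2f x)).

Lemma aL_ge0 : 0 <= aL. Proof. by rewrite !mulr_ge0 ?sqrtr_ge0 ?exprn_ge0// (le_trans ler01 N1). Qed.
Lemma eR_ge0 : 0 <= eR.
Proof. by rewrite /eR; apply: mulr_ge0; [exact: ltW sn0|apply: mulr_ge0 (sqr_ge0 _); rewrite mulr_ge0// divr_ge0// ltW]. Qed.
Lemma e3_ge0 : 0 <= e3.
Proof. by rewrite /e3; apply: mulr_ge0; [exact: ltW sn0|apply: mulr_ge0 (sqr_ge0 _); apply: mulr_ge0 aD_ge0; apply: mulr_ge0 (sqr_ge0 _); rewrite divr_ge0// sqr_ge0]. Qed.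

Definition covE := 2 * B3 + 2 * (aL * e3) + eR ^+ 2 + (eR + 2 * tau) ^+ 2 + 4 * tau.

Lemma cov_close x x' : `|gE (fun t => Ff x t * Ff x' t) - gE (Ff x) * gE (Ff x') - 2 * \tr (ML x *m ML x')| <= covE.
Proof.
have -> : 2 * \tr (ML x *m ML x') = gE (fun t => Lf x t * Lf x' t).
  by rewrite gE_qf2 ML_sym mulmxDr mxtraceD -mulr2n mulr_natl.
have ap y : approx good1 tau eR e3 aL (Ff y) (Lf y) (R2f y).
  split; [exact: hF|exact: tame_qf|exact: tame_R2|exact: gE_qf|split => // t gt].
  exact: good1_expand.
apply: (cov_perturb mb_good1 eR_ge0 e3_ge0 aL_ge0 tau1 (ap x) (ap x')); first exact: gE_LR2.
by under eq_fun do rewrite mulrC; exact: gE_LR2.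
Qed.

Variables (z : 'I_p * 'I_p -> 'rV[R]_K) (kap eta : R) (q : nat).
Hypothesis hz : forall x x', dotp (z x) (z x') = gE (fun t => Ff x t * Ff x' t) - gE (Ff x) * gE (Ff x').
Hypothesis zx : forall x i a, dotp (z x) (xi i a) = 0.
Hypotheses (q0 : (0 < q)%N) (heta : tail_small q N eta) (eN : expR (- N) <= eta).
Hypotheses (kap0 : 0 < kap) (kap1 : kap <= 1) (lnk : ln (2 / kap) <= N).
Hypotheses (hk1 : w ^+ 8 * S1 ^+ 2 * S2 / n%:R <= kap ^+ 4) (hk2 : covE <= kap ^+ 2).
Hypotheses (kCe : kap ^+ 2 <= Ce^-1 ^+ 2) (Ce0 : 0 < Ce) (tau0 : 0 <= tau).
Local Notation J := (('I_p * 'I_p) * bool)%type.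

(** The index carries a sign, so that a maximum of absolute values is a maximum of components and
    every component has its opposite. *)
Definition Mj (j : J) := (-1) ^+ j.2 *: ML j.1.
Definition vj (j : J) := (-1) ^+ j.2 *: z j.1.

Let zBM x (u v : 'I_n -> 'rV[R]_K) : (forall i, dotp (z x) (u i) = 0) -> (forall i, dotp (z x) (v i) = 0) -> z x *m BM u v = 0.
Proof.
have U (c : 'I_n -> 'rV[R]_K) : (forall i, dotp (z x) (c i) = 0) -> z x *m (UM c)^T = 0.
  move=> h; apply/rowP => i; rewrite [RHS]mxE -[RHS](h i) mxE; apply: eq_bigr => a _; by rewrite !mxE.
by move=> hu hv; rewrite /BM -scalemxAr mulmxDr /PM !mulmxA !U// !mul0mx addr0 scaler0.
Qed.

Let vM i j : vj i *m Mj j = 0.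
Proof.
have zy x k l : dotp (z x) (yv k l) = 0.
  by rewrite dotp_sumr big1// => a _; rewrite dotpZr zx mulr0.
by rewrite /vj /Mj -scalemxAl -scalemxAr /ML -scalemxAr zBM// !scaler0.
Qed.

Let eR_kap : eR <= kap.
Proof.
rewrite -(@ler_pXn2r _ 2) ?nnegrE ?eR_ge0 ?(ltW kap0)//; apply: le_trans hk2; rewrite /covE.
have b30 : 0 <= B3 by rewrite /B3 !mulr_ge0 ?invr_ge0 ?exprn_ge0 ?(ltW S10) ?(ltW S20).
have := mulr_ge0 aL_ge0 e3_ge0; have := sqr_ge0 (eR + 2 * tau); have := tau0.
by move: b30; move: (aL * e3) ((_ + _) ^+ 2) (eR ^+ 2) => x y u; lra.
Qed.

Let DC i j : `|2 * \tr (Mj i *m Mj j) - dotp (vj i) (vj j)| <= kap ^+ 2.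
Proof.
apply: le_trans hk2; rewrite /vj /Mj dotpZl dotpZr hz -scalemxAl -scalemxAr !mxtraceZ.
apply: le_trans (cov_close i.1 j.1).
rewrite distrC [leLHS](_ : _ = `|(-1) ^+ i.2 * ((-1) ^+ j.2 *
  (gE (fun t => Ff i.1 t * Ff j.1 t) - gE (Ff i.1) * gE (Ff j.1) - 2 * \tr (ML i.1 *m ML j.1)))|).
  by rewrite !normrM !normrX !normrN1 !expr1n !mul1r.
by congr `|_|; ring.
Qed.

Let DF i j : fro (Mj i *m Mj j) <= (kap ^+ 2) ^+ 2.
Proof.
rewrite -exprM; apply: le_trans hk1; apply: le_trans (fro_MLML i.1 j.1).
by rewrite /Mj -scalemxAl -scalemxAr !froZ -!exprM ![(_ * 2)%N]mulnC !exprM !sqrrN !expr1n !mul1r.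
Qed.

Let a0 : 'I_p := Ordinal p0.
Let j1 : J := ((a0, a0), false).
Let j1' : J := ((a0, a0), true).

Let hs0 : Ce^-1 ^+ 2 <= dotp (vj j1) (vj j1).
Proof.
have := DC j1 j1; rewrite /Mj /= expr0 scale1r -[X in \tr (_ *m X)]ML_sym -fro_trace.
have := fro_ML_diag a0; have := kCe; rewrite ler_norml => k1 k2 /andP[_ k3].
by move: k1 k2 k3; move: (dotp _ _) (fro _) (_ ^+ 2) (_ ^+ 2) => x y u v; lra.
Qed.

Definition pF u := gP (fun t => [forall x, `|Ff x t| < u]).
Definition pzA u := gP (fun t => [forall x, `|lin (z x) t| < u]).

Let mF u : mb (fun t => [forall x, `|Ff x t| < u]).
Proof.
apply: mb_forall => x; apply: measurable_fun_ltr; last exact: measurable_cst.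
by apply: measurableT_comp => //; have [] := hF x.
Qed.

Let forall_sign (f : 'I_p * 'I_p -> R) u : [forall x, `|f x| < u] = [forall j : J, (-1) ^+ j.2 * f j.1 < u].
Proof.
apply/forallP/forallP => [h [x b] /=|h x].
  by apply: le_lt_trans (h x); rewrite (le_trans (ler_norm _))// normrM normrX normrN1 expr1n mul1r.
have := h (x, false); have := h (x, true); rewrite /= expr0 expr1 mul1r mulN1r ltr_norml => k1 k2.
by apply/andP; split; lra.
Qed.

Let pzE u : pzA u = pZ vj u.
Proof.
congr gE; apply/funext => t; rewrite forall_sign; congr (nat_of_bool _)%:R.
by apply: eq_forallb => j; rewrite /vj linZ.
Qed.

Local Notation T' := (cmpT J N (Ce^-1) eta kap).

(** On [good1] the error differs from its first-order term by at most [eR <= kap], which is the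
    margin built into [comparison_up] and [comparison_down]. *)
Theorem gaussian_precision u : `|pF u - pzA u| <= T' + gP bad.
Proof.
have mgd := mb_good1; have mbd : mb bad by exact: measurable_neg.
have Mneg : Mj j1' = - Mj j1 by rewrite /Mj /= expr1 expr0 scale1r scaleN1r.
have vneg : vj j1' = - vj j1 by rewrite /vj /= expr1 expr0 scale1r scaleN1r.
have Msym j : (Mj j)^T = Mj j by rewrite /Mj linearZ/= ML_sym.
have s0 : 0 < Ce^-1 by rewrite invr_gt0.
have D0 : 0 < kap ^+ 2 by rewrite exprn_gt0.
have up := comparison_up Msym vM Mneg vneg s0 hs0 DC DF D0 q0 N1 heta eN kap0 kap1 (lexx _) lnk u.
have dn := comparison_down Msym vM Mneg vneg s0 hs0 DC DF D0 q0 N1 heta eN kap0 kap1 (lexx _) lnk u.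
have Q j t : qf (Mj j) t = (-1) ^+ j.2 * Lf j.1 t by rewrite /Mj qfZ.
have near x t : good1 t -> `|Ff x t - Lf x t| <= kap.
  by move=> gt; have [h _ _] := good1_expand x gt; exact: le_trans h eR_kap.
have sgn (b : bool) (y : R) : (-1) ^+ b * y <= `|y|.
  by rewrite (le_trans (ler_norm _))// normrM normrX normrN1 expr1n mul1r.
have A : pF u <= pL Mj (u + kap) + gP bad.
  rewrite /pL; apply: le_trans (gP_or (mb_pL _ _) mbd).
  apply: gP_le => //; first by apply: mb_or => //; exact: mb_pL.
  move=> t /forallP h; case: (boolP (good1 t)) => [gt|//]; rewrite ?orbT// orbF; apply/forallP => j.
  rewrite Q; have := sgn j.2 (Ff j.1 t); have := near j.1 t gt; have := h j.1.
  have := sgn j.2 (Lf j.1 t - Ff j.1 t); rewrite distrC mulrBr.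
  by move: (_ * _) (_ * _) (`|_|) (`|_|) => x1 x2 x3 x4 *; lra.
have B : pL Mj (u - kap) <= pF u + gP bad.
  rewrite /pF; apply: le_trans (gP_or (mF _) mbd).
  apply: gP_le => //; [exact: mb_pL|by apply: mb_or => //; exact: mF|].
  move=> t /forallP h; case: (boolP (good1 t)) => [gt|//]; rewrite ?orbT// orbF.
  rewrite forall_sign; apply/forallP => j; have := h j; rewrite Q.
  have := sgn j.2 (Ff j.1 t - Lf j.1 t); have := near j.1 t gt; rewrite mulrBr.
  by move: (_ * _) (_ * _) (`|_|) => x1 x2 x3 *; lra.
rewrite pzE; move: up dn A B; rewrite ler_norml.
move: (pF u) (pL _ _) (pL _ _) (pZ _ _) (gP bad) (cmpT _ _ _ _ _) => x1 x2 x3 x4 x5 x6 *.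
by apply/andP; split; lra.
Qed.

End covariance.
End precision.

(** * Transfer to the linear process *)

Section spectrum.
Context {R : realType} (p : nat).
Implicit Types (A : 'M[R]_p) (v : 'rV[R]_p).

(* The largest [t] with [t |v|^2 <= v A v] is an eigenvalue: otherwise [A - t] is invertible and positive
   semidefinite, hence bounded below. *)
Lemma eigenvalue_lower A (c : R) : A^T = A -> (forall a, eigenvalue A a -> c <= a) ->
  forall v, c * dotp v v <= dotp (v *m A) v.
Proof.
move=> AT hc v.
have [->|v0] := eqVneq v 0; first by rewrite mul0mx !dotp0l mulr0.
have vv0 : 0 < dotp v v.
  rewrite lt_neqAle dotp_ge0 andbT eq_sym; apply: contraNneq v0 => h.
  apply/eqP/rowP => a; rewrite mxE; apply/eqP; rewrite -sqrf_eq0; apply/eqP/le_anti; rewrite sqr_ge0 andbT -h dotp_sqE.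
  by rewrite (bigD1 a)//= lerDl; apply: sumr_ge0 => i _; exact: sqr_ge0.
pose S : set R := [set t | forall v, t * dotp v v <= dotp (v *m A) v].
have supS : has_sup S.
  split; last first.
    by exists (dotp (v *m A) v / dotp v v) => t /(_ v); rewrite ler_pdivlMr.
  exists (- (1 + fro A)) => u; rewrite mulNr lerNl.
  have h1 := dotp_CS (u *m A) u; have h2 := fro_le u A.
  have h3 : dotp (u *m A) u ^+ 2 <= ((1 + fro A) * dotp u u) ^+ 2.
    apply: (le_trans h1); rewrite exprMn [dotp u u ^+ 2]expr2 mulrA ler_wpM2r ?dotp_ge0// (le_trans h2)//.
    rewrite ler_wpM2r ?dotp_ge0//; have := fro_ge0 A; move: (fro A) => x x0; nra.
  have u0 : 0 <= (1 + fro A) * dotp u u by rewrite mulr_ge0 ?dotp_ge0// addr_ge0 ?fro_ge0.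
  rewrite (le_trans (ler_norm _))// normrN -(@ler_pXn2r _ 2) ?nnegrE// real_normK ?num_real//.
pose t := sup S.
have tS : S t.
  move=> u; have [u0|u0] := eqVneq (dotp u u) 0.
    rewrite u0; by rewrite mulr0; have [s hs] := supS.1; have := hs u; rewrite u0 mulr0.
  have up : 0 < dotp u u by rewrite lt_neqAle eq_sym u0 dotp_ge0.
  rewrite -ler_pdivlMr//; apply: ge_sup; first exact: supS.1.
  by move=> s /(_ u); rewrite ler_pdivlMr.
suff e : eigenvalue A t by apply: le_trans (tS v); rewrite ler_wpM2r ?dotp_ge0// hc.
apply: contrapT => ne.
pose B := A - t%:M.
have BE u : dotp (u *m B) u = dotp (u *m A) u - t * dotp u u.
  by rewrite /B mulmxBr dotpBl mul_mx_scalar dotpZl.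
have [F FF] : exists F : 'M[R]_p, B = F *m F^T.
  apply: psd_factor; split; first by rewrite /B linearB/= AT tr_scalar_mx.
  by move=> u; rewrite -dotpE BE subr_ge0; exact: tS.
have uB : B \in unitmx.
  rewrite -row_free_unit; apply: inj_row_free => u uB; apply/eqP; apply: contrapT => u0; apply: ne.
  apply/eigenvalueP; exists u; last exact/negP.
  by apply/eqP; rewrite -subr_eq0 -mul_mx_scalar -mulmxBr -/B uB.
have uF : F \in unitmx by move: uB; rewrite FF unitmx_mul => /andP[].
pose d := (1 + fro (invmx F))^-1.
have f0 : 0 < 1 + fro (invmx F) by rewrite ltr_pwDl// fro_ge0.
have d0 : 0 < d by rewrite invr_gt0.
have : S (t + d).
  move=> u; rewrite mulrDl -lerBrDl -BE FF mulmxA dotpMl trmxK /d mulrC ler_pdivrMr// mulrC.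
  rewrite -{1 2}[u](mulmxK uF); apply: (le_trans (fro_le _ _)).
  by rewrite ler_wpM2r ?dotp_ge0// lerDr.
by move=> /(ub_le_sup supS.2); rewrite -/t gerDl leNgt d0.
Qed.

Lemma spectrum_bounds A (c C : R) : A^T = A -> spectrum_within A c C ->
  (forall v, c * dotp v v <= dotp (v *m A) v) /\ forall a, A a a <= C.
Proof.
move=> AT h; split; first by apply: eigenvalue_lower => // a /h/andP[].
move=> a; have AN : (- A)^T = - A by rewrite linearN/= AT.
have := @eigenvalue_lower (- A) (- C) AN.
have hN (x : R) : eigenvalue (- A) x -> - C <= x.
  move=> /eigenvalueP[v vA v0]; rewrite lerNl.
  suff /h/andP[] : eigenvalue A (- x) by [].
  by apply/eigenvalueP; exists v => //; rewrite -[LHS]opprK -mulmxN vA scaleNr.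
move=> /(_ hN (delta_mx 0 a)).
by rewrite !dotp_deltar -rowE !mxE !eqxx mulr1 lerN2.
Qed.

End spectrum.

Lemma gP_prob (R : realType) K (b : K.-tuple R -> bool) : mb b -> fine (gauss K [set t | b t]) = gP b.
Proof.
move=> mbb; have m : measurable [set t | b t].
  by have := mbb measurableT [set true]; rewrite setTI; apply.
rewrite /gP /gE /Rintegral; congr fine; rewrite -[X in gauss K X](setIT) -(integral_indic _ measurableT m).
apply: eq_integral => t _; rewrite indicE; congr (nat_of_bool _)%:R%:E.
by apply/idP/idP => [/set_mem|h]; [|exact/mem_set].
Qed.

Lemma gvec_same_law (R : realType) d (T : measurableType d) (P : probability T R) k (Y : T -> 'cV[R]_k) K (S : 'M[R]_(k, K)) :
  measurable_mx Y -> gaussian_vector P Y -> mean_mx P Y = 0 -> S *m S^T = cov_mx P Y ->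
  same_law P (gauss K) (fun w => [tuple Y w i 0 | i < k]) (fun t => [tuple lin (row i S) t | i < k]).
Proof.
move=> mY gY Y0 SS F mF F0.
have Ed (a : 'rV_k) w : lin a [tuple Y w i 0 | i < k] = ((a^T)^T *m Y w) 0 0.
  by rewrite lcE; apply: eq_bigr => i _; rewrite tnth_mktuple mxE.
have EL (a : 'rV_k) t : lin a [tuple lin (row i S) t | i < k] = lin (a *m S) t.
  rewrite /lin; under eq_bigr do rewrite tnth_mktuple mulr_sumr.
  rewrite exchange_big/=; apply: eq_bigr => j _.
  rewrite mxE mulr_suml; apply: eq_bigr => i _; rewrite mxE; ring.
have Eq (a : 'rV_k) : dotp (a *m S) (a *m S) = ((a^T)^T *m cov_mx P Y *m a^T) 0 0.
  by rewrite dotpE trmx_mul mulmxA -(mulmxA a) SS trmxK.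
apply: (law_unique _ _ _ _ mF F0).
- apply/measurable_fun_tnthP => i; rewrite (_ : _ \o _ = fun w => Y w i 0); first exact: mY.
  by apply/funext => w /=; rewrite tnth_mktuple.
- apply/measurable_fun_tnthP => i; rewrite (_ : _ \o _ = lin (row i S)); first exact: measurable_lin.
  by apply/funext => w /=; rewrite tnth_mktuple.
- move=> a; under eq_Rintegral do rewrite Ed; under [RHS]eq_Rintegral do rewrite EL.
  by rewrite (gvec_charfun mY gY Y0 _).1 -Eq; exact/esym/(gE_trig _).1.
- move=> a; under eq_Rintegral do rewrite Ed; under [RHS]eq_Rintegral do rewrite EL.
  by rewrite (gvec_charfun mY gY Y0 _).2; exact/esym/(gE_trig _).2.
Qed.

Lemma cov_psd (R : realType) d (T : measurableType d) (P : probability T R) k (Y : T -> 'cV[R]_k) :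
  measurable_mx Y -> gaussian_vector P Y -> mean_mx P Y = 0 -> psd (cov_mx P Y).
Proof.
move=> mY gY Y0; split.
  apply/matrixP => i j; rewrite mxE !gvec_cov//; apply: eq_Rintegral => w _; exact: mulrC.
move=> u; have := gvec_lin2 mY gY Y0 u^T; rewrite trmxK => <-.
by apply: Rintegral_ge0 => w _; exact: sqr_ge0.
Qed.

Lemma measurable_invmx (R : realType) d (T : measurableType d) p (G : T -> 'M[R]_p) :
  (forall a b, measurable_fun setT (fun t => G t a b)) ->
  forall j k, measurable_fun setT (fun t => invmx (G t) j k).
Proof.
move=> mG j k.
have mdet q (G' : T -> 'M[R]_q) : (forall a b, measurable_fun setT (fun t => G' t a b)) -> measurable_fun setT (fun t => \det (G' t)).
  move=> m; apply: measurable_sum => s; apply: measurable_funM => //; exact: measurable_prod.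
(* On singular matrices [invmx] returns its argument, so measurability holds everywhere. *)
rewrite (_ : (fun t => _) = fun t => if \det (G t) == 0 then G t j k else (\det (G t))^-1 * cofactor (G t) k j).
  apply: measurable_fun_if => //.
  - apply: measurable_fun_eqr; [exact: mdet|exact: measurable_cst].
  - by apply: measurable_funS (mG j k).
  - apply: (@measurable_funS _ _ _ _ setT) => //; apply: measurable_funM.
      (* The reciprocal is written as x (x^2)^(-1) to use the measurability of real powers; at 0
         both sides vanish. *)
      rewrite (_ : (fun t => _) = fun t => \det (G t) * ((\det (G t) ^+ 2) `^ (-1))).
        apply: measurable_funM; first exact: mdet.
        apply: (measurableT_comp (measurable_powR (-1))); apply: measurable_funX; exact: mdet.
      apply/funext => t; rewrite powR_inv1 ?sqr_ge0//; have [->|x0] := eqVneq (\det (G t)) 0; first by rewrite invr0 mul0r.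
      by field.
    rewrite /cofactor; apply: measurable_funM => //; apply: mdet => a b.
    rewrite (_ : (fun t => _) = fun t => G t (lift k a) (lift j b)); first exact: mG.
    by apply/funext => t; rewrite !mxE.
apply/funext => t; rewrite /invmx unitmxE unitfE; case: eqP => //= _; by rewrite !mxE.
Qed.

Lemma dotp_row (R : realType) k K (S : 'M[R]_(k, K)) i j : dotp (row i S) (row j S) = (S *m S^T) i j.
Proof. by rewrite mxE; apply: eq_bigr => l _; rewrite !mxE. Qed.

Lemma gE_lin2 (R : realType) K (u v : 'rV[R]_K) : gE (fun t => lin u t * lin v t) = dotp u v.
Proof. by rewrite (gE_ibp_lin u (hasgrad_lin v)) gE_cst. Qed.

Lemma mx_norm_lt (R : realType) q m (A : 'M[R]_(q, m)) (c u : R) : 0 < c -> 0 < u ->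
  (c * mx_norm A < u) = [forall x, `|c * A x.1 x.2| < u].
Proof.
move=> c0 u0; rewrite -ltr_pdivlMl// mx_normrE; apply/bigmax_ltP/forallP.
  by move=> [_ h] x; rewrite normrM gtr0_norm// -ltr_pdivlMl// h.
by move=> h; split; [rewrite mulr_gt0// invr_gt0|move=> x _; have := h x; rewrite normrM gtr0_norm// -ltr_pdivlMl].
Qed.

(** * Realisation of the sample and of [Z] on one Gaussian space *)

Section transfer.
Context {R : realType} (p n : nat) (M : linear_process R p) (Z : gaussian_rv R (p * p)).
Context (beta C0 c0 ce Ce b1 e : R).
Hypotheses (C00 : 0 < C0) (hb : 3 / 4 < beta).
Hypotheses (e0 : 0 < e) (b11 : b1 <= 1) (b1b : b1 <= beta) (be : 1 + e <= 2 * b1).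
Hypotheses (ce0 : 0 < ce) (as_ : assumptions M beta C0 c0 ce Ce n Z).
Local Notation P := (lp_prob M).
Local Notation I := ('I_n.+1 * 'I_p)%type.
Local Notation N1 := #|{: I}|.
Local Notation Sg := (Sigma M).
Local Notation Om := (Omega M).
Local Notation D := (@datT R p M n.+1).

Let hA : condition_A M beta C0. Proof. by case: as_ => _ []. Qed.
Let n0 : (0 < n)%N. Proof. by case: as_ => /andP[_ h] *; apply: leq_ltn_trans h. Qed.

(** The stretch of times is 0, ..., n: time 0 serves [Sigma], and [lift ord0] moves to the
    observations 1, ..., n. *)
Definition rk (i : 'I_n) (a : 'I_p) : 'I_N1 := enum_rank ((lift ord0 i, a) : I).
Definition Gm (s : N1.-tuple R) : 'M[R]_p := \matrix_(a, b) (n%:R^-1 * \sum_i tnth s (rk i a) * tnth s (rk i b)).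
Definition Phi (x : 'I_p * 'I_p) s := Num.sqrt n%:R * (invmx (Gm s) - Om) x.1 x.2.

Let hD := datX_same_law hA C00 hb e0 b11 b1b be.

Lemma measurable_Phi x : measurable_fun setT (Phi x).
Proof.
apply: measurable_funM => //.
rewrite (_ : (fun s => _) = fun s => invmx (Gm s) x.1 x.2 - Om x.1 x.2); last by apply/funext => s; rewrite !mxE.
apply: measurable_funB => //; apply: measurable_invmx => a b.
under eq_fun do rewrite mxE.
apply: measurable_funM => //; apply: measurable_sum => i; apply: measurable_funM; exact: measurable_tnth.
Qed.

Lemma Sigma_hatE w : Sigma_hat n w = Gm (D w).
Proof.
apply/matrixP => a b; rewrite /Sigma_hat [LHS]mxE summxE [RHS]mxE; congr (_ * _).
rewrite big_add1 big_mkord; apply: eq_bigr => i _; rewrite !tnth_mktuple !enum_rankK /datX/=.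
by rewrite mxE big_ord1 [(_^T) _ _]mxE.
Qed.

Lemma Omega_errE w j k : Omega_err n w j k = Phi (j, k) (D w).
Proof. by rewrite /Omega_err mxE /Omega_hat Sigma_hatE. Qed.

Let mdatT : measurable_fun setT (D).
Proof.
apply/measurable_fun_tnthP => i; rewrite (_ : _ \o _ = @datX R p M n.+1 (enum_val i)); first exact: measurable_datX.
by apply/funext => w /=; rewrite tnth_mktuple.
Qed.

Lemma Sigma_entry a b : Sg a b = covlim M 0 0 a b.
Proof.
have [S SS] := psd_factor (covX_psd hA C00 hb e0 b11 b1b be n.+1).
have h := hD (esym SS).
pose i (c : 'I_p) : 'I_N1 := enum_rank ((ord0, c) : I).
transitivity (\int[P]_w (tnth (D w) (i a) * tnth (D w) (i b))).
  rewrite !mxE unlock /Rintegral; congr fine; apply: eq_integral => w _.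
  by rewrite !tnth_mktuple !enum_rankK mxE big_ord1 [(_^T) _ _]mxE.
rewrite (same_law_Rintegral h (f := fun s => tnth s (i a) * tnth s (i b))); last first.
  by apply: measurable_funM; exact: measurable_tnth.
transitivity (gE (fun t => lin (row (i a) S) t * lin (row (i b) S) t)).
  by apply: eq_Rintegral => t _; rewrite !tnth_mktuple.
by rewrite gE_lin2 dotp_row -SS mxE !enum_rankK.
Qed.

Let lenP x : (fun w => Omega_err n w x.1 x.2) \in Lfun P 2%:E.
Proof. by case: as_ => _ _ _ _ [h _ _]. Qed.

Let ErrE x : (fun w => Omega_err n w x.1 x.2) = fun w => Phi x (D w).
Proof. by apply/funext => w; rewrite Omega_errE; case: x. Qed.

(** The sample and [Z] use disjoint blocks of coordinates, whence the orthogonality of [z] and [xi].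
    [rho_Omega] depends only on the two laws, so the original probability spaces can be left behind,
    and [is_ZOmega] fixes the products of the [z x]. *)
Theorem transfer : exists (K : nat) (xi : 'I_n -> 'I_p -> 'rV[R]_K) (z : 'I_p * 'I_p -> 'rV[R]_K),
  [/\ forall i a b, dotp (xi i a) (xi i b) = Sg a b,
      forall i l a b, `|dotp (xi i a) (xi l b)| <= acov_const C0 e * wt (2 * b1 - 1 - e) (i - l + (l - i))%N,
      forall x, L2 (Ff xi Om x),
      forall x x', dotp (z x) (z x') = gE (fun t => Ff xi Om x t * Ff xi Om x' t) - gE (Ff xi Om x) * gE (Ff xi Om x') &
   (forall x i a, dotp (z x) (xi i a) = 0) /\
   forall B, (forall u, `|pF xi Om u - pzA z u| <= B) -> rho_Omega M n Z <= B].
Proof.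
have [S1 SS1] := psd_factor (covX_psd hA C00 hb e0 b11 b1b be n.+1).
have [_ _ _ _ [_ Z0 ZC]] := as_.
have [S2 SS2] := psd_factor (cov_psd (@gv_measurable _ _ Z) (@gv_gaussian _ _ Z) Z0).
pose K := (N1 + (p * p))%N.
pose S : 'M[R]_(N1, K) := row_mx S1 0.
pose S' : 'M[R]_(p * p, K) := row_mx 0 S2.
have SS : S *m S^T = covX M n.+1 by rewrite /S tr_row_mx mul_row_col trmx0 mulmx0 addr0 -SS1.
have SS' : S' *m S'^T = cov_mx (gv_prob Z) Z by rewrite /S' tr_row_mx mul_row_col trmx0 mulmx0 add0r -SS2.
have SoS : S' *m S^T = 0 by rewrite /S /S' tr_row_mx mul_row_col trmx0 mulmx0 mul0mx addr0.
have lX := hD SS.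
have lZ := gvec_same_law (@gv_measurable _ _ Z) (@gv_gaussian _ _ Z) Z0 SS'.
pose L (t : K.-tuple R) := [tuple lin (row i S) t | i < N1].
have lX' : same_law (gauss K) P L (D) by move=> F mF F0; rewrite lX.
have mL : measurable_fun setT L.
  apply/measurable_fun_tnthP => i; rewrite (_ : _ \o _ = lin (row i S)); first exact: measurable_lin.
  by apply/funext => w /=; rewrite tnth_mktuple.
(* [Vec] stacks columns by transposing a row-major vectorisation, so the column index comes
   first. *)
pose idx (x : 'I_p * 'I_p) : 'I_(p * p) := mxvec_index x.2 x.1.
pose xi (i : 'I_n) (a : 'I_p) : 'rV[R]_K := row (rk i a) S.
pose z x : 'rV[R]_K := row (idx x) S'.
have FE x t : Ff xi Om x t = Phi x (L t).
  rewrite /Ff /Phi; congr (_ * (invmx _ - _) _ _); apply/matrixP => a b; rewrite !mxE; congr (_ * _).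
  by apply: eq_bigr => i _; rewrite !tnth_mktuple.
have iErr x : P.-integrable setT (EFin \o (fun w => Phi x (D w))).
  rewrite -ErrE; apply/Lfun1_integrable; apply: (Lfun_subset12 _ (lenP x)); exact: fin_num_measure.
have iErr2 x x' : P.-integrable setT (EFin \o (fun w => Phi x (D w) * Phi x' (D w))).
  have := Lfun2_mul_Lfun1 (lenP x) (lenP x'); rewrite !ErrE => /Lfun1_integrable; by [].
exists K, xi, z; split.
- by move=> i a b; rewrite dotp_row SS mxE !enum_rankK /datcov/= covlim_diag Sigma_entry covlim_diag.
- move=> i l a b; rewrite dotp_row SS mxE !enum_rankK /datcov/=.
  have := covlim_le hA C00 hb e0 b11 b1b be i.+1 l.+1 a b; by rewrite !subSS.
- move=> x; split.
    rewrite (_ : Ff xi Om x = Phi x \o L); last by apply/funext => t; rewrite FE.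
    exact: measurableT_comp (measurable_Phi x) mL.
  have := same_law_integrable mL lX' (f := fun s => Phi x s ^+ 2) (measurable_funX _ (measurable_Phi x)) (iErr2 x x).
  by apply: eq_integrable => // t _ /=; rewrite FE.
- move=> x x'; rewrite dotp_row SS' ZC mxE.
  have V y : (fun w => Vec (Omega_err n w) (idx y) 0) = fun w => Phi y (D w).
    by rewrite -ErrE; apply/funext => w; rewrite /Vec mxE mxvecE mxE.
  rewrite !V covarianceE; last 3 first.
  + exact/Lfun1_integrable/iErr.
  + exact/Lfun1_integrable/iErr.
  + exact/Lfun1_integrable/iErr2.
  have fn y : ('E_P[fun w => Phi y (D w)] = (gE (Ff xi Om y))%:E)%E.
    rewrite unlock -[LHS]fineK; last by apply: integrable_fin_num => //; exact: iErr.
    congr EFin; rewrite -[LHS]/(\int[P]_w Phi y (D w)) (same_law_Rintegral lX (measurable_Phi y)).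
    by apply: eq_Rintegral => t _; rewrite FE.
  rewrite !fn unlock -[X in (X - _)%E]fineK; last by apply: integrable_fin_num => //; exact: iErr2.
  rewrite -EFinM -EFinB /=; congr (_ - _).
  rewrite -[LHS]/(\int[P]_w (Phi x (D w) * Phi x' (D w))).
  rewrite (same_law_Rintegral lX (f := fun s => Phi x s * Phi x' s)); last by apply: measurable_funM; exact: measurable_Phi.
  by apply: eq_Rintegral => t _; rewrite !FE.
split.
- move=> x i a; have -> : dotp (z x) (xi i a) = (S' *m S^T) (idx x) (rk i a).
    by rewrite mxE; apply: eq_bigr => l _; rewrite !mxE.
  by rewrite SoS mxE.
move=> B hB; have [pn _ _ _ _] := as_; have p0 : (0 < p)%N by case/andP: pn.
apply: ge_sup; first by exists `|fine (P [set w | 0 <= Num.sqrt n%:R * mx_norm (Omega_hat n w - Om)]) - fine (gv_prob Z [set w | 0 <= mx_norm (Z w)])|, 0.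
move=> _ [u _ <-].
have B0 : 0 <= B by apply: le_trans (hB 0).
(* Levels [u <= 0] are reached surely on both sides; [mx_norm_lt] needs [0 < u]. *)
have [u0|u0] := leP u 0.
  rewrite (_ : [set w | _] = setT); last first.
    by apply/seteqP; split => // w _ /=; rewrite (le_trans u0)// mulr_ge0 ?sqrtr_ge0// mx_normrE bigmax_idl le_max lexx.
  rewrite (_ : [set w | u <= mx_norm (Z w)] = setT); last first.
    by apply/seteqP; split => // w _ /=; rewrite (le_trans u0)// mx_normrE bigmax_idl le_max lexx.
  by rewrite !probability_setT subrr normr0.
have mPhi : measurable [set s | [forall x, `|Phi x s| < u]].
  have mb' : measurable_fun setT (fun s => [forall x, `|Phi x s| < u]).
    rewrite (_ : (fun s => _) = (fun s => all (fun x => `|Phi x s| < u) (enum [set: 'I_p * 'I_p]%SET))).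
      elim: (enum _) => [|x l IH] /=; first exact: measurable_cst.
      apply: measurable_and => //; apply: measurable_fun_ltr; last exact: measurable_cst.
      by apply: measurableT_comp => //; exact: measurable_Phi.
    by apply/funext => s; apply/forallP/allP => [h x _|h x]; [exact: h|apply: h; rewrite mem_enum inE].
  by have := mb' measurableT [set true]; rewrite setTI; apply.
have sn : 0 < Num.sqrt (n%:R : R) by rewrite sqrtr_gt0 ltr0n.
have mFf : mb (fun t => [forall x, `|Ff xi Om x t| < u]).
  apply: mb_forall => x; apply: measurable_fun_ltr; last exact: measurable_cst.
  apply: measurableT_comp => //; rewrite (_ : Ff xi Om x = Phi x \o L); last by apply/funext => t; rewrite FE.
  exact: measurableT_comp (measurable_Phi x) mL.
have EF : fine (P [set w | u <= Num.sqrt n%:R * mx_norm (Omega_hat n w - Om)]) = 1 - pF xi Om u.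
  rewrite -(gP_not mFf) -gP_prob; last exact: measurable_neg.
  rewrite (_ : [set w | _] = D @^-1` (~` [set s | [forall x, `|Phi x s| < u]])); last first.
    apply/seteqP; split => w /=; rewrite leNgt mx_norm_lt// => h; [|apply/negP].
      move=> hh; move/negP: h; apply; apply/forallP => x; move/forallP: hh => /(_ x).
      by rewrite /Phi -Sigma_hatE.
    move=> hh; apply: h; apply/forallP => x; move/forallP: hh => /(_ x).
    by rewrite /Phi -Sigma_hatE.
  rewrite (same_law_prob mdatT mL lX (measurableC mPhi)); congr (fine (gauss K _)).
  have EE t : [forall x, `|Ff xi Om x t| < u] = [forall x, `|Phi x (L t)| < u] by apply: eq_forallb => x; rewrite FE.
  apply/seteqP; split => t h.
    by apply/negP => h'; apply: h; rewrite EE in h'; exact: h'.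
  by move=> h'; move/negP: h; apply; rewrite EE; exact: h'.
pose LZ (t : K.-tuple R) := [tuple lin (row i S') t | i < (p * p)%N].
have mZ : measurable_fun setT (fun w => [tuple Z w i 0 | i < (p * p)%N]).
  apply/measurable_fun_tnthP => i; rewrite (_ : _ \o _ = fun w => Z w i 0); first exact: gv_measurable.
  by apply/funext => w /=; rewrite tnth_mktuple.
have mLZ : measurable_fun setT LZ.
  apply/measurable_fun_tnthP => i; rewrite (_ : _ \o _ = lin (row i S')); first exact: measurable_lin.
  by apply/funext => w /=; rewrite tnth_mktuple.
have mEZ : measurable [set s : (p * p).-tuple R | [forall i, `|tnth s i| < u]].
  have mb' : measurable_fun setT (fun s : (p * p).-tuple R => [forall i, `|tnth s i| < u]).
    rewrite (_ : (fun s => _) = (fun s => all (fun i => `|tnth s i| < u) (enum 'I_(p * p)))).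
      elim: (enum _) => [|x l IH] /=; first exact: measurable_cst.
      apply: measurable_and => //; apply: measurable_fun_ltr; last exact: measurable_cst.
      by apply: measurableT_comp => //; exact: measurable_tnth.
    by apply/funext => s; apply/forallP/allP => [h x _|h x]; [exact: h|apply: h; rewrite mem_enum].
  by have := mb' measurableT [set true]; rewrite setTI; apply.
have mpz : mb (fun t => [forall x, `|lin (z x) t| < u]).
  by apply: mb_forall => x; apply: mb_lt; [apply: tame_norm; exact: tame_lin|exact: tame_cst].
have EZ : fine (gv_prob Z [set w | u <= mx_norm (Z w)]) = 1 - pzA z u.
  rewrite -(gP_not mpz) -gP_prob; last exact: measurable_neg.
  rewrite (_ : [set w | _] = (fun w => [tuple Z w i 0 | i < (p * p)%N]) @^-1` (~` [set s | [forall i, `|tnth s i| < u]])); last first.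
    apply/seteqP; split => w /=; rewrite -[mx_norm _]mul1r leNgt mx_norm_lt// => h; [|apply/negP].
      move=> hh; move/negP: h; apply; apply/forallP => -[k j]; move/forallP: hh => /(_ k) /=.
      by rewrite tnth_mktuple mul1r ord1.
    move=> hh; apply: h; apply/forallP => k; move/forallP: hh => /(_ (k, 0)) /=.
    by rewrite tnth_mktuple mul1r.
  rewrite (same_law_prob mZ mLZ lZ (measurableC mEZ)); congr (fine (gauss K _)).
  apply/seteqP; split => t /=; [move=> h; apply/negP => /forallP hh; apply: h|move=> /negP h /forallP hh; apply: h]; apply/forallP.
    by move=> k; rewrite tnth_mktuple; case/mxvec_indexP: k => j i; exact: (hh (i, j)).
  by move=> x; have := hh (idx x); rewrite tnth_mktuple.
rewrite EF EZ; have := hB u; rewrite distrC; congr (`|_| <= _); ring.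
Qed.

End transfer.

(** * Size of the error terms *)

Definition cmpC (R : realType) (s0 : R) : R := 9 * (2 * bandC s0 + 1) + 3 * bandC s0 + 24 * expR 4 / s0.

Lemma bandC_ge0 (R : realType) (s0 : R) : 0 < s0 -> 0 <= bandC s0.
Proof.
by move=> s00; rewrite /bandC addr_ge0// divr_ge0 ?mulr_ge0 ?exprn_ge0 ?mulr_ge0 ?expR_ge0 ?(ltW s00).
Qed.

Lemma cmpT_le (R : realType) (J : finType) (N s0 eta kap : R) : 1 <= N -> 0 < s0 -> 0 <= eta -> 0 <= kap ->
  (0 < #|J|)%N ->
  cmpT J N s0 eta kap <= cmpC s0 * (N ^+ 6 * kap) + (150 + 40 * expR 4) * (N ^+ 2 * (#|J|%:R ^+ 2 * eta)).
Proof.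
move=> N1 s00 eta0 kap0 J0; have J1 : 1 <= #|J|%:R :> R by rewrite ler1n.
have b0 := bandC_ge0 s00; have c0 := expR_ge0 (4 : R).
rewrite /cmpT /cmpI /cmpE /cmpX /cmpC; set c := expR 4 in c0 *; move: (bandC s0) b0 => Cb b0.
have cs0 : 0 <= c / s0 by rewrite divr_ge0// ltW.
move: (#|J|%:R) J1 => j j1.
have Je : j * eta <= j ^+ 2 * eta by rewrite ler_wpM2r// expr2 ler_peMl// (le_trans ler01 j1).
have je0 : 0 <= j * eta by rewrite mulr_ge0// (le_trans ler01 j1).
have N2 : 1 <= N ^+ 2 by rewrite exprn_ege1.
have NN : N <= N ^+ 2 by rewrite expr2 ler_peMl// (le_trans ler01 N1).
have jj0 : 0 <= j ^+ 2 * eta by exact: le_trans je0 Je.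
have h1 : j ^+ 2 * eta <= N ^+ 2 * (j ^+ 2 * eta) by rewrite ler_peMl.
have h2 : N * (j ^+ 2 * eta) <= N ^+ 2 * (j ^+ 2 * eta) by rewrite ler_wpM2r.
have h3 : N * (j * eta) <= N ^+ 2 * (j ^+ 2 * eta) by apply: le_trans h2; rewrite ler_wpM2l// (le_trans ler01 N1).
have h4 : N ^+ 3 * (N * kap) <= N ^+ 6 * kap.
  by rewrite mulrA -exprSr ler_wpM2r// ler_weXn2l.
have h5 : N * (N ^+ 2 * kap) <= N ^+ 6 * kap.
  by rewrite mulrA -exprS ler_wpM2r// ler_weXn2l.
rewrite [leLHS](_ : _ = 9 * (2 * Cb + 1) * (N ^+ 6 * kap) + 3 * Cb * (N ^+ 3 * (N * kap)) + 24 * (c / s0) * (N * (N ^+ 2 * kap)) +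
  (126 * (N * (j ^+ 2 * eta)) + 36 * c * (N ^+ 2 * (j ^+ 2 * eta)) + 7 * (j * eta) + 2 * c * (N * (j * eta)))); last by ring.
rewrite [24 * c / s0](_ : _ = 24 * (c / s0)); last by ring.
move: (c / s0) cs0 => d d0.
have g1 : 3 * Cb * (N ^+ 3 * (N * kap)) <= 3 * Cb * (N ^+ 6 * kap) by rewrite ler_wpM2l// mulr_ge0.
have g2 : 24 * d * (N * (N ^+ 2 * kap)) <= 24 * d * (N ^+ 6 * kap) by rewrite ler_wpM2l// mulr_ge0.
have g3 : 2 * c * (N * (j * eta)) <= 2 * c * (N ^+ 2 * (j ^+ 2 * eta)) by rewrite ler_wpM2l// mulr_ge0.
have g4 : 0 <= c * (N ^+ 2 * (j ^+ 2 * eta)) by rewrite mulr_ge0// (le_trans jj0).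
move: g1 g2 g3 g4 h1 h2 Je je0 jj0; rewrite !(mulrDl _ _ (_ * kap)) !(mulrDl _ _ (N ^+ 2 * _)) -!(mulrA _ c) -!(mulrA _ Cb) -!(mulrA _ d).
move: (N ^+ 6 * kap) (N ^+ 2 * (j ^+ 2 * eta)) (N * (j ^+ 2 * eta)) (j ^+ 2 * eta) (j * eta) (N ^+ 3 * (N * kap)) (N * (N ^+ 2 * kap)) (N * (j * eta)) => A B C1 D E F G H.
by move: (Cb * A) (Cb * F) (d * A) (d * G) (c * B) (c * H) => *; lra.
Qed.

Section assembly.
Context {R : realType}.
Variables ce Ce S2 : R.
Hypotheses (ce0 : 0 < ce) (Ce0 : 0 < Ce) (S20 : 0 < S2).

Definition Kc := 16 * S2 + 16 * (S2 / ce ^+ 3) + S2 + 13.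
Definition Kt := 2 * (momC 4 * S2 ^+ 4) + 9 + 6 * 256 ^+ 2 + 6 * ce^-1 ^+ 2 + Cg Ce.
(** The sum of the thresholds imposed by the estimates below, so that one smallness condition with
    [Kb] yields each of them. *)
Definition Kb := 30 + Kc + Kc * Ce ^+ 2 + 4 * Ce ^+ 2 * S2 / ce ^+ 2 + 24 * Ce ^+ 2 / ce + `|ln (2 * Ce ^+ 2)| +
  Kt * Ce ^+ 4 + ((cmpC Ce^-1 + 4 * (150 + 40 * expR 4) + 3) * Num.sqrt Kc).

Let Kc1 : 13 <= Kc.
Proof.
have : 0 <= S2 / ce ^+ 3 by rewrite divr_ge0 ?exprn_ge0 ?ltW.
by rewrite /Kc; move: S20 (S2 / ce ^+ 3) => *; lra.
Qed.

Let parts : [/\ 0 <= Kc * Ce ^+ 2, 0 <= 4 * Ce ^+ 2 * S2 / ce ^+ 2, 0 <= 24 * Ce ^+ 2 / ce,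
   0 <= Kt & 0 <= (cmpC Ce^-1 + 4 * (150 + 40 * expR 4) + 3) * Num.sqrt Kc].
Proof.
have Kc0 : 0 <= Kc by apply: le_trans Kc1.
have S2' := ltW S20; have ce' := ltW ce0; have Ce' := ltW Ce0; have e4 := expR_ge0 (4 : R).
split.
- by rewrite mulr_ge0// sqr_ge0.
- by rewrite divr_ge0 ?sqr_ge0// mulr_ge0// mulr_ge0// sqr_ge0.
- by rewrite divr_ge0// mulr_ge0// sqr_ge0.
- have := Cg_ge0 Ce0; have : 0 <= momC 4 * S2 ^+ 4 :> R by rewrite mulr_ge0 ?momC_ge0// exprn_ge0.
  have := sqr_ge0 (ce^-1); rewrite /Kt; move: (ce^-1 ^+ 2) (momC 4 * _) (Cg Ce) => *; lra.
- have b0 : 0 <= bandC Ce^-1 by rewrite bandC_ge0// invr_gt0.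
  have c0 : 0 <= cmpC Ce^-1.
    rewrite /cmpC; have : 0 <= 24 * expR 4 / Ce^-1 by rewrite divr_ge0 ?invr_ge0// mulr_ge0.
    by move: (bandC _) b0 (24 * _ / _) => *; lra.
  rewrite mulr_ge0 ?sqrtr_ge0//; move: (cmpC _) (expR 4) c0 e4 => *; lra.
Qed.

Lemma Kb_ge : [/\ 43 <= Kb, Kc <= Kb, Kc * Ce ^+ 2 <= Kb, 4 * Ce ^+ 2 * S2 / ce ^+ 2 <= Kb &
  [/\ 24 * Ce ^+ 2 / ce <= Kb, 1 + `|ln (2 * Ce ^+ 2)| <= Kb, Kt * Ce ^+ 4 <= Kb &
   (cmpC Ce^-1 + 4 * (150 + 40 * expR 4) + 3) * Num.sqrt Kc <= Kb]].
Proof.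
have [a1 a2 a3 a4 a5] := parts; have a6 := normr_ge0 (ln (2 * Ce ^+ 2)); have a7 := Kc1.
have a8 : 0 <= Kt * Ce ^+ 4 by rewrite mulr_ge0// exprn_ge0// ltW.
have ar (x1 x2 x3 x4 x5 x6 x7 : R) : 13 <= x1 -> 0 <= x2 -> 0 <= x3 -> 0 <= x4 -> 0 <= x5 -> 0 <= x6 -> 0 <= x7 ->
    let S := 30 + x1 + x2 + x3 + x4 + x5 + x6 + x7 in
    [/\ 43 <= S, x1 <= S, x2 <= S, x3 <= S & [/\ x4 <= S, 1 + x5 <= S, x6 <= S & x7 <= S]].
  by cbv zeta; move=> *; do ?split; lra.
by apply: ar.
Qed.

Section numbers.
Variables (n p : nat) (w S1 N : R).
Hypotheses (n0 : (0 < n)%N) (p0 : (0 < p)%N) (pn : (p <= n)%N).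
Hypotheses (wC : Ce^-1 <= w) (wn : w <= n%:R) (S11 : 1 <= S1) (N1 : 1 <= N) (Nn : N <= n%:R).
Local Notation X := (n%:R : R).
Local Notation P := (p%:R : R).
Local Notation sn := (Num.sqrt X).
(** The size of the covariance errors. Up to [S2], the first term is the square root of the bound in
    [fro_MLML]; the second comes from the third moments [B3], the last from the remainders of the
    expansion. *)
Definition Qn := (w ^+ 4 * sn + P * w ^+ 5 + P ^+ 2 * w ^+ 2) * (S1 / X).
Hypotheses (hQ : Kb * N ^+ 4 * Qn <= 1) (hN : Kb * (1 + ln X) <= N).

Let X1 : 1 <= X. Proof. by rewrite ler1n. Qed.
Let X0 : 0 < X. Proof. exact: lt_le_trans X1. Qed.
Let P1 : 1 <= P. Proof. by rewrite ler1n. Qed.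
Let P0 : 0 < P. Proof. exact: lt_le_trans P1. Qed.
Let PX : P <= X. Proof. by rewrite ler_nat. Qed.
Let Ci0 : 0 < Ce^-1. Proof. by rewrite invr_gt0. Qed.
Let w0 : 0 < w. Proof. exact: lt_le_trans wC. Qed.
Let N0 : 0 < N. Proof. exact: lt_le_trans N1. Qed.
Let sn2' : sn ^+ 2 = X. Proof. by rewrite sqr_sqrtr// ltW. Qed.
Let sn1 : 1 <= sn. Proof. by rewrite -[leLHS]sqrtr1 ler_sqrt. Qed.
Let s1 : X^-1 <= S1 / X. Proof. by rewrite -[leLHS]mul1r ler_wpM2r// invr_ge0 ltW. Qed.
Let s0 : 0 < S1 / X. Proof. by apply: lt_le_trans s1; rewrite invr_gt0. Qed.

Lemma Qn_parts : [/\ 0 <= Qn, w ^+ 4 * sn * (S1 / X) <= Qn, P * w ^+ 5 * (S1 / X) <= Qn,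
  P ^+ 2 * w ^+ 2 * (S1 / X) <= Qn & P ^+ 2 * (S1 / X) <= Ce ^+ 2 * Qn].
Proof.
have a1 : 0 <= w ^+ 4 * sn * (S1 / X) by rewrite !mulr_ge0 ?exprn_ge0 ?sqrtr_ge0 ?(ltW w0) ?invr_ge0// (le_trans ler01).
have a2 : 0 <= P * w ^+ 5 * (S1 / X) by apply: mulr_ge0 (ltW s0); rewrite mulr_ge0// exprn_ge0// ltW.
have a3 : 0 <= P ^+ 2 * w ^+ 2 * (S1 / X) by apply: mulr_ge0 (ltW s0); rewrite mulr_ge0// sqr_ge0.
have a4 : P ^+ 2 * w ^+ 2 * (S1 / X) <= Qn.
  rewrite /Qn !mulrDl; move: a1 a2; move: (_ * _ * (S1 / X)) (_ * _ * (S1 / X)) (_ * _ * (S1 / X)) => *; lra.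
split=> //; rewrite /Qn ?mulrDl.
- by move: a1 a2 a3; move: (_ * _ * (S1 / X)) (_ * _ * (S1 / X)) (_ * _ * (S1 / X)) => *; lra.
- by move: a1 a2 a3; move: (_ * _ * (S1 / X)) (_ * _ * (S1 / X)) (_ * _ * (S1 / X)) => *; lra.
- by move: a1 a2 a3; move: (_ * _ * (S1 / X)) (_ * _ * (S1 / X)) (_ * _ * (S1 / X)) => *; lra.
rewrite -/Qn -!mulrDl -/Qn; apply: (@le_trans _ _ (Ce ^+ 2 * (P ^+ 2 * w ^+ 2 * (S1 / X)))); last by rewrite ler_wpM2l// sqr_ge0.
have : 1 <= Ce ^+ 2 * w ^+ 2.
  by rewrite -exprMn exprn_ege1// -ler_pdivrMl// mulr1.
move=> h; rewrite [leRHS](_ : _ = (Ce ^+ 2 * w ^+ 2) * (P ^+ 2 * (S1 / X))); last by ring.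
by rewrite ler_peMl// mulr_ge0 ?sqr_ge0 ?(ltW s0).
Qed.

(** [Qn] decays no faster than 1 / n, which lets it absorb all higher negative powers of n. *)
Lemma Qn_ge : Ce^-1 ^+ 4 / X <= Qn.
Proof.
have [_ h _ _ _] := Qn_parts; apply: le_trans h; rewrite -mulrA ler_pM ?exprn_ge0 ?(ltW Ci0) ?invr_ge0 ?(ltW X0)//.
  by rewrite lerXn2r ?nnegrE ?(ltW Ci0) ?(ltW w0).
by rewrite (le_trans s1)// ler_peMl// ltW.
Qed.

Let N41 : 1 <= N ^+ 4. Proof. by rewrite exprn_ege1. Qed.

Lemma Qn_le (k : R) : 0 <= k -> k <= Kb -> k * N ^+ 4 * Qn <= 1.
Proof.
move=> k0 kb; have [q0 _ _ _ _] := Qn_parts; apply: le_trans hQ.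
apply: ler_wpM2r => //; apply: ler_wpM2r => //; exact: exprn_ge0 (ltW N0).
Qed.

(** The last part holds because the square of a minimum is at most the product of its two
    arguments. *)
Lemma fG_le : 0 < fG n ce w S1 S2 /\ fG n ce w S1 S2 <= S1 / X / ce /\ X * fG n ce w S1 S2 ^+ 2 <= w ^+ 2 * S2 * (S1 / X / ce).
Proof.
have S10 : 0 < S1 by exact: lt_le_trans S11.
have f0 := @fG_gt0 R n ce w S1 S2 n0 ce0 S20 S10 w0.
have e1 : fG n ce w S1 S2 <= w ^+ 2 * S2 / X by rewrite /fG ge_min lexx.
have e2 : fG n ce w S1 S2 <= S1 / X / ce by rewrite /fG ge_min (_ : S1 / ce / X = S1 / X / ce) ?lexx ?orbT// mulrAC.
split=> //; split=> //; rewrite expr2 (mulrA X); apply: ler_pM => //; rewrite ?mulr_ge0 ?(ltW f0) ?(ltW X0)//.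
by rewrite mulrC -ler_pdivlMr.
Qed.

(** The smoothing scale is the square root of the covariance error, as [hk2] requires, with the
    powers of [N] that the deviations in [covE] produce. *)
Definition kapn := Num.sqrt Kc * N ^+ 2 * Num.sqrt Qn.

Let Kc0 : 0 < Kc. Proof. exact: lt_le_trans Kc1. Qed.

Lemma kapn2 : kapn ^+ 2 = Kc * N ^+ 4 * Qn.
Proof.
have [q0 _ _ _ _] := Qn_parts.
by rewrite /kapn exprMn exprMn !sqr_sqrtr ?(ltW Kc0)//; ring.
Qed.

Lemma covE_le tau : 0 <= tau -> tau <= Qn -> covE n p ce w S1 S2 N tau <= kapn ^+ 2.
Proof.
move=> t0 tQ; have [q0 qa qb qc qd] := Qn_parts; have [f0 [f1 f2]] := fG_le.
have Q1 : Qn <= 1.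
  have [k30 _ _ _ _] := Kb_ge; have k1 : 1 <= Kb by apply: le_trans k30; rewrite ler1n.
  by have := Qn_le ler01 k1; rewrite mul1r; apply: le_trans; rewrite ler_peMl.
have b3 : B3 n p w S1 S2 <= 8 * S2 * Qn.
  rewrite /B3 [leLHS](_ : _ = 8 * S2 * (P * w ^+ 5 * (S1 / X))); last by ring.
  by rewrite ler_wpM2l// mulr_ge0// ltW.
have k3 : 0 <= S2 / ce ^+ 3 by rewrite divr_ge0 ?exprn_ge0 ?ltW.
have le3 : aL w S2 N * e3 n p ce w S1 S2 N <= 2 * (S2 / ce ^+ 3) * (N ^+ 4 * Qn).
  rewrite /aL /e3 /aD /aG exprMn sqr_sqrtr ?(ltW f0)//.
  (* The normalisation sqrt n cancels the 1 / sqrt n of the deviation [aD]. *)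
  have sS : Num.sqrt S2 * (sn * Num.sqrt (S2 / X)) = S2.
    have -> : sn * Num.sqrt (S2 / X) = Num.sqrt S2 by rewrite -sqrtrM ?(ltW X0)// mulrCA mulfV ?mulr1// gt_eqF.
    by rewrite -expr2 sqr_sqrtr// ltW.
  rewrite [leLHS](_ : _ = 2 / ce ^+ 2 * N ^+ 4 * (Num.sqrt S2 * (sn * Num.sqrt (S2 / X))) * (P ^+ 2 * w ^+ 2 * fG n ce w S1 S2)); last by ring.
  rewrite sS.
  apply: (@le_trans _ _ (2 / ce ^+ 2 * N ^+ 4 * S2 * (P ^+ 2 * w ^+ 2 * (S1 / X / ce)))).
    apply: ler_wpM2l; first by apply: mulr_ge0 (ltW S20); apply: mulr_ge0 (exprn_ge0 4 (ltW N0)); rewrite divr_ge0 ?sqr_ge0.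
    by apply: ler_wpM2l => //; apply: mulr_ge0; exact: sqr_ge0.
  rewrite [leLHS](_ : _ = 2 * (S2 / ce ^+ 3) * (N ^+ 4 * (P ^+ 2 * w ^+ 2 * (S1 / X)))); last by field; rewrite !gt_eqF.
  by apply: ler_wpM2l; [exact: mulr_ge0|apply: ler_wpM2l => //; exact: exprn_ge0 (ltW N0)].
have eR2 : eR n p ce w S1 S2 N ^+ 2 <= 4 * (S2 / ce ^+ 3) * (N ^+ 4 * Qn).
  rewrite /eR /aG [(N * _) ^+ 2]exprMn sqr_sqrtr ?(ltW f0)// exprMn sn2'.
  rewrite [leLHS](_ : _ = 4 / ce ^+ 2 * N ^+ 4 * (P ^+ 2 * (X * fG n ce w S1 S2 ^+ 2))); last by field; rewrite gt_eqF.
  apply: (@le_trans _ _ (4 / ce ^+ 2 * N ^+ 4 * (P ^+ 2 * (w ^+ 2 * S2 * (S1 / X / ce))))).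
    apply: ler_wpM2l; first by apply: mulr_ge0 (exprn_ge0 4 (ltW N0)); rewrite divr_ge0 ?sqr_ge0.
    by apply: ler_wpM2l f2; exact: sqr_ge0.
  rewrite [leLHS](_ : _ = 4 * (S2 / ce ^+ 3) * (N ^+ 4 * (P ^+ 2 * w ^+ 2 * (S1 / X)))); last by field; rewrite !gt_eqF.
  by apply: ler_wpM2l; [exact: mulr_ge0|apply: ler_wpM2l => //; exact: exprn_ge0 (ltW N0)].
have NQ : Qn <= N ^+ 4 * Qn by rewrite ler_peMl.
have t1 := le_trans tQ Q1.
have ND0 : 0 <= N ^+ 4 * Qn by exact: le_trans q0 NQ.
have b3' : B3 n p w S1 S2 <= 8 * (S2 * (N ^+ 4 * Qn)).
  by apply: (le_trans b3); rewrite -mulrA; apply: ler_wpM2l => //; apply: ler_wpM2l NQ; exact: ltW.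
have cQ : 0 <= S2 * (N ^+ 4 * Qn) by rewrite mulr_ge0// ltW.
have ar (b le eR t S D k : R) : b <= 8 * S -> le <= 2 * k -> eR ^+ 2 <= 4 * k -> 0 <= S -> 0 <= t -> t <= 1 -> t <= D ->
    2 * b + 2 * le + eR ^+ 2 + (eR + 2 * t) ^+ 2 + 4 * t <= 16 * S + 16 * k + S + 13 * D.
  move=> h1 h2 h3 h5 h6 h7 h8.
  have g1 : (eR + 2 * t) ^+ 2 <= 2 * eR ^+ 2 + 8 * t ^+ 2.
    by have := sqr_ge0 (eR - 2 * t); move: (eR) (t) => x y; nra.
  have g2 : t ^+ 2 <= t by rewrite expr2 ler_piMr.
  by move: (eR ^+ 2) (t ^+ 2) ((eR + _) ^+ 2) h3 g1 g2 => *; lra.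
rewrite kapn2 /covE -mulrA.
rewrite [leRHS](_ : _ = 16 * (S2 * (N ^+ 4 * Qn)) + 16 * (S2 / ce ^+ 3 * (N ^+ 4 * Qn)) + S2 * (N ^+ 4 * Qn) + 13 * (N ^+ 4 * Qn)); last first.
  by rewrite /Kc; move: (S2 / ce ^+ 3) (N ^+ 4 * Qn) => y1 y2; ring.
apply: ar => //; [by rewrite mulrA|by rewrite mulrA|exact: le_trans tQ NQ].
Qed.

Let K30 : 43 <= Kb. Proof. by have [] := Kb_ge. Qed.
Let Kb0 : 0 < Kb. Proof. by apply: lt_le_trans K30. Qed.

Lemma Qn_gt0 : 0 < Qn.
Proof. by apply: lt_le_trans Qn_ge; rewrite divr_gt0// exprn_gt0. Qed.

Lemma kapn_gt0 : 0 < kapn.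
Proof. by rewrite /kapn !mulr_gt0 ?sqrtr_gt0 ?exprn_gt0 ?Qn_gt0. Qed.

Lemma kapn_le1 : kapn <= 1.
Proof.
have [_ k _ _ _] := Kb_ge; rewrite -(@ler_pXn2r _ 2) ?nnegrE ?(ltW kapn_gt0)// kapn2 expr1n.
by apply: Qn_le k; exact: ltW.
Qed.

Lemma kapn_leC : kapn ^+ 2 <= Ce^-1 ^+ 2.
Proof.
have [_ _ k _ _] := Kb_ge; rewrite kapn2 exprVn -[leRHS]mul1r ler_pdivlMr ?exprn_gt0//.
have := Qn_le (mulr_ge0 (ltW Kc0) (sqr_ge0 Ce)) k; apply: le_trans; apply: eq_leW; ring.
Qed.

Lemma Qn_kapn : Qn <= kapn ^+ 2 /\ Qn <= kapn.
Proof.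
have [q0 _ _ _ _] := Qn_parts.
have h : Qn <= kapn ^+ 2.
  rewrite kapn2 -{1}[Qn]mul1r ler_wpM2r// -[leLHS]mulr1 ler_pM//; apply: le_trans Kc1; by rewrite ler1n.
by split=> //; apply: (le_trans h); rewrite expr2 ler_piMl ?(ltW kapn_gt0)// kapn_le1.
Qed.

Lemma small_aD : P * aD n S2 N <= ce / 2.
Proof.
have [_ _ _ k _] := Kb_ge; have [q0 _ _ _ qd] := Qn_parts.
have k0 : 0 <= 4 * Ce ^+ 2 * S2 / ce ^+ 2 by rewrite divr_ge0 ?sqr_ge0// mulr_ge0 ?(ltW S20)// mulr_ge0// sqr_ge0.
have S2n : 0 <= S2 / X by rewrite divr_ge0 ?ltW.
have l0 : 0 <= P * aD n S2 N by rewrite mulr_ge0 ?(ltW P0)// /aD mulr_ge0 ?sqrtr_ge0 ?(ltW N0).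
rewrite -(@ler_pXn2r _ 2) ?nnegrE ?divr_ge0 ?(ltW ce0)//.
rewrite /aD !exprMn sqr_sqrtr//.
have h := Qn_le k0 k.
have N24 : N ^+ 2 <= N ^+ 4 by rewrite ler_weXn2l.
apply: (@le_trans _ _ (N ^+ 4 * (S2 * (Ce ^+ 2 * Qn)))).
  rewrite [leLHS](_ : _ = N ^+ 2 * (S2 * (P ^+ 2 * X^-1))); last by ring.
  apply: ler_pM => //; rewrite ?sqr_ge0 ?mulr_ge0 ?(ltW S20) ?sqr_ge0 ?invr_ge0 ?(ltW X0)//.
  by apply: ler_wpM2l; [exact: ltW|apply: le_trans qd; rewrite ler_wpM2l// sqr_ge0].
have c2 : 0 < ce ^+ 2 by rewrite exprn_gt0.
rewrite [leLHS](_ : _ = (4 * Ce ^+ 2 * S2 / ce ^+ 2 * N ^+ 4 * Qn) * (ce ^+ 2 / 4)); last by field; rewrite gt_eqF.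
rewrite [leRHS](_ : _ = 1 * (ce ^+ 2 / 4)); last by field.
by rewrite ler_wpM2r// divr_ge0// ltW.
Qed.

Lemma small_hm : (24 * p ^ 2)%N%:R * S1 <= X * ce.
Proof.
have [_ _ _ _ [k _ _ _]] := Kb_ge; have [q0 _ _ _ qd] := Qn_parts.
have k0 : 0 <= 24 * Ce ^+ 2 / ce by rewrite divr_ge0 ?(ltW ce0)// mulr_ge0// sqr_ge0.
have h := Qn_le k0 k.
rewrite natrM -mulnn natrM -expr2 [leLHS](_ : _ = X * (24 * (P ^+ 2 * (S1 / X)))); last by field; rewrite gt_eqF.
rewrite ler_wpM2l ?(ltW X0)//; apply: (@le_trans _ _ (24 * (Ce ^+ 2 * (N ^+ 4 * Qn)))).
  by rewrite ler_wpM2l//; apply: (le_trans qd); rewrite ler_wpM2l ?sqr_ge0// ler_peMl.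
rewrite [leLHS](_ : _ = (24 * Ce ^+ 2 / ce * N ^+ 4 * Qn) * ce); last by field; rewrite gt_eqF.
by rewrite -[leRHS]mul1r ler_wpM2r// ltW.
Qed.

Let lnX0 : 0 <= ln X. Proof. exact: ln_ge0. Qed.

Lemma kapn_ln : ln (2 / kapn) <= N.
Proof.
have [_ _ _ _ [_ k _ _]] := Kb_ge.
have C0' : 0 < 2 * Ce ^+ 2 by rewrite mulr_gt0// exprn_gt0.
have sq := le_trans Qn_ge Qn_kapn.1; have kp0 := kapn_gt0.
apply: (@le_trans _ _ (ln (2 * Ce ^+ 2 * X))).
  move: kapn kp0 sq => kp kp0 sq.
  have d0 : 0 < Ce ^+ 2 * X by rewrite mulr_gt0// exprn_gt0.
  rewrite ler_ln ?posrE ?divr_gt0 ?mulr_gt0 ?exprn_gt0// -mulrA ler_pM2l// -div1r ler_pdivrMr//.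
  have sq1 (y : R) : 0 <= y -> 1 <= y ^+ 2 -> 1 <= y by move=> y0 h; nra.
  apply: sq1; first by rewrite mulr_ge0 ?(ltW d0) ?(ltW kp0).
  rewrite exprMn.
  apply: (le_trans X1); rewrite [leLHS](_ : _ = (Ce ^+ 2 * X) ^+ 2 * (Ce^-1 ^+ 4 / X)); last by field; rewrite !gt_eqF.
  by rewrite ler_wpM2l// sqr_ge0.
rewrite lnM ?posrE//; apply: le_trans hN; have := ler_norm (ln (2 * Ce ^+ 2)); move: (`|_|) k (normr_ge0 (ln (2 * Ce ^+ 2))) => a k a0 h.
apply: (@le_trans _ _ ((1 + a) * (1 + ln X))); last by rewrite ler_wpM2r// addr_ge0.
by move: (ln X) lnX0 (ln _) h => y y0 z zh; nra.
Qed.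

Let i0 : 0 < X^-1. Proof. by rewrite invr_gt0. Qed.
Let i1 : X^-1 <= 1. Proof. by rewrite invf_le1. Qed.
Let iX : X^-1 * X = 1. Proof. by rewrite mulVf// gt_eqF. Qed.

Lemma expN_le : expR (- N) <= X^-1 ^+ 40.
Proof.
have h : 40 * ln X <= N.
  apply: le_trans hN; have := K30; move: Kb (ln X) lnX0 => c y y0 c1; nra.
have -> : X^-1 ^+ 40 = expR (- (40 * ln X)) by rewrite expRN expRM_natl lnK ?posrE// exprVn.
by rewrite ler_expR lerN2.
Qed.

Lemma Kt_le : Kt * X^-1 ^+ 5 <= Qn.
Proof.
have [_ _ _ _ [_ _ k _]] := Kb_ge.
have KX : Kt * Ce ^+ 4 <= X.
  by apply: (le_trans k); apply: le_trans Nn; apply: le_trans hN; rewrite ler_peMr ?(ltW Kb0)// lerDl.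
apply: le_trans Qn_ge; rewrite [leRHS](_ : _ = X^-1 / Ce ^+ 4); last by field; rewrite !gt_eqF.
rewrite ler_pdivlMr ?exprn_gt0// [leLHS](_ : _ = Kt * Ce ^+ 4 * X^-1 ^+ 4 * X^-1); last by ring.
rewrite ler_piMl ?(ltW i0)//; apply: (@le_trans _ _ (X * X^-1 ^+ 4)).
  by apply: ler_wpM2r KX; exact: exprn_ge0 (ltW i0).
by rewrite exprS mulrA mulfV ?gt_eqF// mul1r exprn_ile1// ltW.
Qed.

(** Here [g] is at most 3 n^-38. The weight n^-24 turns the eighth-moment part into n^(3 - 24 + 16)
    = n^-5, and its inverse against [g] leaves n^-11; the resolution n^-6 / 256 contributes n^-25
    and n^-11. Everything is at most n^-5, which [Kt_le] absorbs. *)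
Lemma tau_num (g : R) : 0 <= g -> g <= 3 * P ^+ 2 * X^-1 ^+ 40 ->
  2 * X * P ^+ 2 * (X^-1 ^+ 24 * (momC 4 * (X ^+ 4 * S2) ^+ 4) + (X^-1 ^+ 24)^-1 * g) +
  (1 + 2 * X * ((X^-1 ^+ 6 / 256) ^- 2 + ce^-1 ^+ 2)) * g + 16 * X * Cg Ce * (X^-1 ^+ 6 / 256) ^+ 2 <= Qn.
Proof.
move=> g0 hg; apply: le_trans Kt_le.
have a1 : (P * X^-1) ^+ 2 <= 1.
  by rewrite exprn_ile1 ?mulr_ge0 ?(ltW P0) ?(ltW i0)// ler_pdivrMr// mul1r.
have a0 : 0 <= (P * X^-1) ^+ 2 by exact: sqr_ge0.
have PE : P ^+ 2 = (P * X^-1) ^+ 2 * X ^+ 2 by field; rewrite gt_eqF.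
move: ((P * X^-1) ^+ 2) a0 a1 PE => a a0 a1 PE.
have {}hg : g <= 3 * X^-1 ^+ 38.
  apply: (le_trans hg); rewrite PE [leLHS](_ : _ = a * (3 * X^-1 ^+ 38)); last by field; rewrite gt_eqF.
  by rewrite ler_piMl// mulr_ge0// exprn_ge0// ltW.
rewrite PE /Kt; have m0 : 0 <= momC 4 * S2 ^+ 4 :> R by rewrite mulr_ge0 ?momC_ge0// exprn_ge0// ltW.
have c0 := Cg_ge0 Ce0; have d0 := sqr_ge0 (ce^-1).
move: (Cg Ce) (ce^-1 ^+ 2) c0 d0 => c d c0 d0.
have pw (j : nat) : (5 <= j)%N -> X^-1 ^+ j <= X^-1 ^+ 5 by move=> h; rewrite ler_wiXn2l// ltW.
have t1 : 2 * X * (a * X ^+ 2) * (X^-1 ^+ 24 * (momC 4 * (X ^+ 4 * S2) ^+ 4)) <= 2 * (momC 4 * S2 ^+ 4) * X^-1 ^+ 5.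
  rewrite [leLHS](_ : _ = a * (2 * (momC 4 * S2 ^+ 4) * X^-1 ^+ 5)); last first.
    by move: (momC 4) => m; field; rewrite gt_eqF.
  by rewrite ler_piMl// mulr_ge0// mulr_ge0.
have t2 : 2 * X * (a * X ^+ 2) * ((X^-1 ^+ 24)^-1 * g) <= 6 * X^-1 ^+ 5.
  apply: (@le_trans _ _ (2 * X * (a * X ^+ 2) * ((X^-1 ^+ 24)^-1 * (3 * X^-1 ^+ 38)))).
    apply: ler_wpM2l; first by rewrite !mulr_ge0 ?(ltW X0) ?sqr_ge0.
    by apply: ler_wpM2l => //; rewrite invr_ge0 exprn_ge0// ltW.
  rewrite [leLHS](_ : _ = a * (6 * X^-1 ^+ 11)); last by field; rewrite gt_eqF.
  apply: (@le_trans _ _ (6 * X^-1 ^+ 11)); first by rewrite ler_piMl// mulr_ge0// exprn_ge0// ltW.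
  by rewrite ler_wpM2l// pw.
have t3 : g <= 3 * X^-1 ^+ 5 by apply: (le_trans hg); rewrite ler_wpM2l// pw.
have t4' : 2 * X * (X^-1 ^+ 6 / 256) ^- 2 * g <= 6 * 256 ^+ 2 * X^-1 ^+ 5.
  apply: (@le_trans _ _ (2 * X * (X^-1 ^+ 6 / 256) ^- 2 * (3 * X^-1 ^+ 38))).
    by apply: ler_wpM2l hg; apply: mulr_ge0; [exact: mulr_ge0 (ltW X0)|rewrite invr_ge0 sqr_ge0].
  rewrite [leLHS](_ : _ = 6 * 256 ^+ 2 * X^-1 ^+ 25); last by field; rewrite gt_eqF.
  by rewrite ler_wpM2l ?pw// mulr_ge0// sqr_ge0.
have t5 : 2 * X * d * g <= 6 * d * X^-1 ^+ 5.
  apply: (@le_trans _ _ (2 * X * d * (3 * X^-1 ^+ 38))); first by apply: ler_wpM2l => //; rewrite !mulr_ge0// ltW.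
  rewrite [leLHS](_ : _ = 6 * d * X^-1 ^+ 37); last by field; rewrite gt_eqF.
  by rewrite ler_wpM2l ?pw// mulr_ge0.
have t6 : 16 * X * c * (X^-1 ^+ 6 / 256) ^+ 2 <= c * X^-1 ^+ 5.
  apply: (@le_trans _ _ (c * X^-1 ^+ 11)); last by rewrite ler_wpM2l// pw.
  rewrite [leLHS](_ : _ = c * X^-1 ^+ 11 * (16 / 256 ^+ 2)); last by field; rewrite gt_eqF.
  rewrite ler_piMr ?mulr_ge0 ?exprn_ge0 ?(ltW i0)//; lra.
rewrite [X in X + _ + _]mulrDr [X in _ + X + _]mulrDl mul1r [2 * X * (_ + d)]mulrDr [X in _ + (_ + X) + _]mulrDl.
rewrite [leRHS](_ : _ = 2 * (momC 4 * S2 ^+ 4) * X^-1 ^+ 5 + 6 * X^-1 ^+ 5 + (3 * X^-1 ^+ 5 + (6 * 256 ^+ 2 * X^-1 ^+ 5 + 6 * d * X^-1 ^+ 5)) + c * X^-1 ^+ 5); last first.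
  by move: (momC 4 * _) (X^-1 ^+ 5) => y1 y2; ring.
apply: lerD t6; apply: lerD; first exact: lerD t1 t2.
apply: lerD t3 _; exact: lerD t4' t5.
Qed.

Lemma final_num (eta j : R) : 0 <= eta -> eta <= X^-1 ^+ 40 -> j = 2 * P ^+ 2 ->
  N ^+ 2 * (j ^+ 2 * eta) <= 4 * kapn /\ 3 * P ^+ 2 * eta <= 3 * kapn.
Proof.
move=> e0 he ->.
have hK : X^-1 ^+ 5 <= kapn.
  apply: le_trans Qn_kapn.2; apply: le_trans Kt_le; rewrite ler_peMl ?exprn_ge0 ?(ltW i0)//.
  have c0 := Cg_ge0 Ce0; have d0 := sqr_ge0 (ce^-1); have m0 : 0 <= momC 4 * S2 ^+ 4 :> R by rewrite mulr_ge0 ?momC_ge0// exprn_ge0// ltW.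
  by rewrite /Kt; move: (Cg Ce) (ce^-1 ^+ 2) (momC 4 * _) c0 d0 m0 => *; lra.
have Pi (k : nat) : P ^+ k * X^-1 ^+ k <= 1.
  by rewrite -exprMn exprn_ile1 ?mulr_ge0 ?(ltW P0) ?(ltW i0)// ler_pdivrMr// mul1r.
have Ni : N ^+ 2 * X^-1 ^+ 2 <= 1.
  by rewrite -exprMn exprn_ile1 ?mulr_ge0 ?(ltW N0) ?(ltW i0)// ler_pdivrMr// mul1r.
have pw (k : nat) : (5 <= k)%N -> X^-1 ^+ k <= kapn by move=> h; apply: le_trans hK; rewrite ler_wiXn2l// ltW.
have ie k : 0 <= X^-1 ^+ k by exact: exprn_ge0 (ltW i0).
split.
  apply: (@le_trans _ _ (N ^+ 2 * ((2 * P ^+ 2) ^+ 2 * X^-1 ^+ 40))).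
    by apply: ler_wpM2l; [exact: sqr_ge0|apply: ler_wpM2l => //; exact: sqr_ge0].
  rewrite [leLHS](_ : _ = 4 * (N ^+ 2 * X^-1 ^+ 2 * (P ^+ 4 * X^-1 ^+ 4) * X^-1 ^+ 34)); last by ring.
  have PN : N ^+ 2 * X^-1 ^+ 2 * (P ^+ 4 * X^-1 ^+ 4) <= 1.
    have q1 : 0 <= N ^+ 2 * X^-1 ^+ 2 := mulr_ge0 (sqr_ge0 _) (ie 2%N).
    have q2 : 0 <= P ^+ 4 * X^-1 ^+ 4 := mulr_ge0 (exprn_ge0 4 (ltW P0)) (ie 4%N).
    by have := ler_pM q1 q2 Ni (Pi 4%N); rewrite mulr1.
  by apply: ler_wpM2l => //; apply: le_trans (pw 34%N isT); apply: ler_piMl PN.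
apply: (@le_trans _ _ (3 * P ^+ 2 * X^-1 ^+ 40)).
  by apply: ler_wpM2l => //; rewrite mulr_ge0// sqr_ge0.
rewrite [leLHS](_ : _ = 3 * (P ^+ 2 * X^-1 ^+ 2 * X^-1 ^+ 38)); last by ring.
by rewrite ler_wpM2l//; apply: le_trans (pw 38%N isT); rewrite ler_piMl.
Qed.

End numbers.

Theorem gaussian_bound (K n p : nat) (xi : 'I_n -> 'I_p -> 'rV[R]_K) (Sg Om : 'M[R]_p)
    (w S1 N : R) (r : 'I_n -> 'I_n -> R) (z : 'I_p * 'I_p -> 'rV[R]_K) (q : nat) :
  (0 < n)%N -> (0 < p)%N -> (p <= n)%N ->
  (forall i a b, dotp (xi i a) (xi i b) = Sg a b) ->
  Sg *m Om = 1%:M -> Om^T = Om ->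
  (forall v : 'rV[R]_p, ce * dotp v v <= dotp (v *m Sg) v) ->
  (forall a, Sg a a <= Ce) ->
  (forall i l, 0 <= r i l) -> (forall i l, r i l = r l i) ->
  (forall i l a b, `|dotp (xi i a) (xi l b)| <= r i l) ->
  (forall i, \sum_l r i l <= S1) -> (forall i, \sum_l r i l ^+ 2 <= S2) ->
  (forall j, \sum_a `|Om a j| <= w) ->
  (forall x, L2 (Ff xi Om x)) ->
  (forall x x', dotp (z x) (z x') = gE (fun t => Ff xi Om x t * Ff xi Om x' t) - gE (Ff xi Om x) * gE (Ff xi Om x')) ->
  (forall x i a, dotp (z x) (xi i a) = 0) ->
  (0 < q)%N -> tail_small q N (n%:R^-1 ^+ 40) ->
  Ce^-1 <= w -> w <= n%:R -> 1 <= S1 -> 1 <= N -> N <= n%:R ->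
  Kb * N ^+ 4 * Qn n p w S1 <= 1 -> Kb * (1 + ln n%:R) <= N ->
  forall u, `|pF xi Om u - pzA z u| <= Kb * (N ^+ 8 * Num.sqrt (Qn n p w S1)).
Proof.
move=> n0 p0 pn hS SO OT hce hCe r0 rC hr h1 h2 hw hF hz zx q0 heta wC wn S11 N1 Nn hQ hN u.
have wp : 0 < w by apply: lt_le_trans wC; rewrite invr_gt0.
have w0 := ltW wp; have S10 : 0 < S1 by exact: lt_le_trans S11.
have X0 : 0 < n%:R :> R by rewrite ltr0n.
have X1 : 1 <= n%:R :> R by rewrite ler1n.
have i0 : 0 < n%:R^-1 :> R by rewrite invr_gt0.
have PX : p%:R <= n%:R :> R by rewrite ler_nat.
have sm : p%:R * aD n S2 N <= ce / 2 by apply: (@small_aD n p w S1 N).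
have hm : (24 * p ^ 2)%N%:R * S1 <= n%:R * ce by apply: (@small_hm n p w S1 N).
have kap0 : 0 < kapn n p w S1 N by apply: kapn_gt0.
have kap1 : kapn n p w S1 N <= 1 by apply: kapn_le1.
have kCe : kapn n p w S1 N ^+ 2 <= Ce^-1 ^+ 2 by apply: kapn_leC.
have lnk : ln (2 / kapn n p w S1 N) <= N by apply: kapn_ln.
have eN : expR (- N) <= n%:R^-1 ^+ 40 by apply: (@expN_le n N).
have eta0 : 0 <= n%:R^-1 ^+ 40 :> R by exact: exprn_ge0 (ltW i0).
have [fn1 fn2] : N ^+ 2 * ((2 * p%:R ^+ 2) ^+ 2 * n%:R^-1 ^+ 40) <= 4 * kapn n p w S1 N /\ 3 * p%:R ^+ 2 * n%:R^-1 ^+ 40 <= 3 * kapn n p w S1 N.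
  by apply: final_num.
have [Q0 Qa _ _ _] : [/\ 0 <= Qn n p w S1, w ^+ 4 * Num.sqrt n%:R * (S1 / n%:R) <= Qn n p w S1, p%:R * w ^+ 5 * (S1 / n%:R) <= Qn n p w S1,
  p%:R ^+ 2 * w ^+ 2 * (S1 / n%:R) <= Qn n p w S1 & p%:R ^+ 2 * (S1 / n%:R) <= Ce ^+ 2 * Qn n p w S1] by apply: Qn_parts.
have k2 : kapn n p w S1 N ^+ 2 = Kc * N ^+ 4 * Qn n p w S1 by apply: kapn2.
have N41 : 1 <= N ^+ 4 by rewrite exprn_ege1.
have x0 : 0 < n%:R^-1 ^+ 24 :> R by rewrite exprn_gt0.
have wpow (k : nat) : (k <= 4)%N -> w ^+ k <= n%:R ^+ 4.
  move=> k4; apply: (@le_trans _ _ (n%:R ^+ k)); first by rewrite lerXn2r ?nnegrE.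
  by rewrite ler_weXn2l.
have B2 : w ^+ 2 * S2 <= n%:R ^+ 4 * S2 by rewrite ler_wpM2r ?(ltW S20)// wpow.
have B4 : w ^+ 4 * S2 <= n%:R ^+ 4 * S2 by rewrite ler_wpM2r ?(ltW S20)// wpow.
(* As [p <= n], this resolution gives (16 n p)^2 e <= n^-2, within the condition of [good_prob4]. *)
pose e : R := n%:R^-1 ^+ 6 / 256.
have i1 : n%:R^-1 <= 1 :> R by rewrite invf_le1.
have e0 : 0 < e by rewrite /e divr_gt0// exprn_gt0.
have e4 : e <= 4^-1.
  have : n%:R^-1 ^+ 6 <= 1 :> R by rewrite exprn_ile1// ltW.
  by rewrite /e; move: (n%:R^-1 ^+ 6) => y; lra.
have he : (16 * n%:R * p%:R) ^+ 2 * e <= 1.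
  apply: (@le_trans _ _ ((16 * n%:R * n%:R) ^+ 2 * e)).
    rewrite ler_wpM2r ?(ltW e0)// lerXn2r ?nnegrE ?mulr_ge0// ?(ltW X0)//.
    by rewrite ler_wpM2l// mulr_ge0// ltW.
  rewrite /e [leLHS](_ : _ = n%:R^-1 ^+ 2); last by field; rewrite gt_eqF.
  by rewrite exprn_ile1// ltW.
have [t0 t1 tF tL tR] := @tau_bounds R K n p xi Sg Om ce Ce w S1 S2 r n0 p0 hS SO ce0 hce hCe r0 rC hr h1 h2 w0 hw N S20 S10 _ _ x0 B2 B4 S11 Ce0 hm e e0 e4 he hF.
have gb := @gP_bad R K n p xi Sg Om ce w S1 S2 r n0 hS SO OT ce0 hce r0 rC hr h1 h2 w0 hw N N1 S20 S10 wp _ q q0 heta.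
have tQ : tauE xi Om ce Ce w S1 S2 N (n%:R ^+ 4 * S2) (n%:R^-1 ^+ 24) e <= Qn n p w S1.
  by apply: (@tau_num n p w S1 N) => //; exact: gP_ge0.
have hk2 : covE n p ce w S1 S2 N (tauE xi Om ce Ce w S1 S2 N (n%:R ^+ 4 * S2) (n%:R^-1 ^+ 24) e) <= kapn n p w S1 N ^+ 2.
  by apply: covE_le.
have hk1 : w ^+ 8 * S1 ^+ 2 * S2 / n%:R <= kapn n p w S1 N ^+ 4.
  have sn2 : Num.sqrt n%:R ^+ 2 = n%:R :> R by rewrite sqr_sqrtr// ltW.
  apply: (@le_trans _ _ (S2 * (w ^+ 4 * Num.sqrt n%:R * (S1 / n%:R)) ^+ 2)).
    rewrite !exprMn sn2; apply: eq_leW; field; by rewrite gt_eqF.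
  apply: (@le_trans _ _ (S2 * Qn n p w S1 ^+ 2)).
    apply: ler_wpM2l; first exact: ltW.
    by rewrite lerXn2r ?nnegrE// !mulr_ge0 ?exprn_ge0 ?sqrtr_ge0 ?invr_ge0 ?(ltW X0) ?(ltW S10).
  have -> : kapn n p w S1 N ^+ 4 = (Kc * N ^+ 4) ^+ 2 * Qn n p w S1 ^+ 2 by rewrite -exprMn -k2 -exprM.
  have SK : S2 <= Kc.
    rewrite /Kc; have : 0 <= S2 / ce ^+ 3 by rewrite divr_ge0 ?exprn_ge0 ?ltW.
    by move: (S2 / _) S20 => *; lra.
  have K1 : 1 <= Kc * N ^+ 4 by rewrite -[leLHS]mulr1 ler_pM//; apply: le_trans Kc1; rewrite ler1n.
  apply: (ler_wpM2r (sqr_ge0 (Qn n p w S1))); apply: (@le_trans _ _ (Kc * N ^+ 4)); last by rewrite expr2 ler_peMl// (le_trans ler01 K1).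
  by rewrite -[S2]mulr1; apply: ler_pM => //; exact: ltW.
have gp := @gaussian_precision R K n p xi Sg Om ce Ce w S1 S2 r n0 p0 hS SO OT ce0 hce hCe r0 rC hr h1 h2 w0 hw N N1 S20 S10 sm _ hF t1 tF tL tR z _ _ q hz zx q0 heta eN kap0 kap1 lnk hk1 hk2 kCe Ce0 t0 u.
apply: (le_trans gp).
have cJ : #|{: ('I_p * 'I_p) * bool}|%:R = 2 * p%:R ^+ 2 :> R.
  by rewrite card_prod card_prod card_ord card_bool !natrM; ring.
have J0 : (0 < #|{: ('I_p * 'I_p) * bool}|)%N.
  by rewrite -(ltr_nat R) cJ mulr_gt0// exprn_gt0// ltr0n.
have si0 : 0 < Ce^-1 by rewrite invr_gt0.
have ct := cmpT_le N1 si0 eta0 (ltW kap0) J0.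
rewrite cJ in ct.
have [_ _ _ _ [_ _ _ kb]] := Kb_ge.
apply: (@le_trans _ _ ((cmpC Ce^-1 + 4 * (150 + 40 * expR 4) + 3) * (N ^+ 6 * kapn n p w S1 N))).
  have gb2 := le_trans gb fn2; have e40 := expR_ge0 (4 : R).
  have N6 : kapn n p w S1 N <= N ^+ 6 * kapn n p w S1 N by rewrite ler_peMl ?(ltW kap0)// exprn_ege1.
  have fn1' : (150 + 40 * expR 4) * (N ^+ 2 * ((2 * p%:R ^+ 2) ^+ 2 * n%:R^-1 ^+ 40)) <= (150 + 40 * expR 4) * (4 * (N ^+ 6 * kapn n p w S1 N)).
    apply: ler_wpM2l; first by move: (expR 4) e40 => y y0; lra.
    by apply: (le_trans fn1); rewrite ler_wpM2l.
  apply: (le_trans (lerD ct gb2)).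
  rewrite [leRHS](_ : _ = cmpC Ce^-1 * (N ^+ 6 * kapn n p w S1 N) + (150 + 40 * expR 4) * (4 * (N ^+ 6 * kapn n p w S1 N)) + 3 * (N ^+ 6 * kapn n p w S1 N)); last first.
    by move: (cmpC _) (expR 4) (N ^+ 6 * _) => y1 y2 y3; ring.
  by apply: lerD; [exact: lerD|rewrite ler_wpM2l].
rewrite /kapn [leLHS](_ : _ = (cmpC Ce^-1 + 4 * (150 + 40 * expR 4) + 3) * Num.sqrt Kc * (N ^+ 8 * Num.sqrt (Qn n p w S1))); last by ring.
by apply: ler_wpM2r kb; rewrite mulr_ge0 ?sqrtr_ge0// exprn_ge0// (le_trans ler01 N1).
Qed.

End assembly.

(** * Choice of the exponents and final constants *)

Lemma log_power (R : realType) (t K : R) : 0 < t ->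
  exists n0 : nat, forall n : nat, (n0 <= n)%N -> (0 < n)%N -> K * (1 + ln n%:R) <= n%:R `^ t.
Proof.
move=> t0; pose Y := Num.max 1 (8 * `|K| / t ^+ 2).
exists (Num.bound (expR Y)) => n hn n0.
have X0 : 0 < n%:R :> R by rewrite ltr0n.
have hY : Y <= ln n%:R.
  rewrite -ler_expR lnK ?posrE// ltW//; apply: lt_le_trans (archi_boundP (expR_ge0 Y)) _; by rewrite ler_nat.
have [y1 y2] : 1 <= ln (n%:R : R) /\ 8 * `|K| / t ^+ 2 <= ln (n%:R : R).
  by split; apply: le_trans hY; rewrite /Y le_max lexx ?orbT.
have -> : n%:R `^ t = expR (t * ln n%:R / 2) ^+ 2.
  by rewrite /powR gt_eqF// -expRM_natl; congr expR; field.
move: (ln n%:R) y1 y2 => y y1 y2 {hY}.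
have e1 := expR_ge1Dx (t * y / 2).
have t2 : 0 < t ^+ 2 by rewrite exprn_gt0.
have ty : 0 <= t * y by rewrite mulr_ge0 ?(ltW t0)// (le_trans ler01).
apply: (@le_trans _ _ ((1 + t * y / 2) ^+ 2)); last first.
  by rewrite lerXn2r ?nnegrE ?expR_ge0// addr_ge0// divr_ge0.
rewrite ler_pdivrMr// in y2.
have k := ler_norm K; have k0 := normr_ge0 K.
apply: (@le_trans _ _ (`|K| * (2 * y))).
  apply: (@le_trans _ _ (`|K| * (1 + y))); first by rewrite ler_wpM2r// addr_ge0// (le_trans ler01).
  by rewrite ler_wpM2l//; lra.
have : 8 * `|K| * y <= y * t ^+ 2 * y by rewrite ler_wpM2r// (le_trans ler01).
move: (`|K|) => a; rewrite sqrrD expr1n mul1r; move: ty; have -> : (t * y / 2) ^+ 2 = y * t ^+ 2 * y / 4 by field.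
move: (t * y) (y * t ^+ 2 * y) => u v u0; rewrite -(mulrA 8) (mulrCA a) -mulr_natl; move: (a * y) => b h; lra.
Qed.

(** [d] is the exponent lost in the autocovariance bounds, [th] the power of n gained in every error
    term. For [beta <= 1] the room is x = 4 beta - 3, as e1 <= x / 8; for [beta > 1] it is 1/4 - e1
    = 2 / (4 tb + 8). Small fractions of it serve as [d] and [th]. *)
Lemma exponents (R : realType) (beta : R) : 3 / 4 < beta ->
  let m := Num.min beta 1 in let tb := Num.min (4 * beta - 3) (2 * beta - 1) in
  let e1 := tb / (4 * tb + 8) in let e3 := Num.min (beta - 1 / 4) (3 / 4) in
  exists d th : R, [/\ 0 < d, 0 < th, th <= 1, 3 * d <= 4 * m - 3 & [/\ 0 <= e1, e1 <= 1,
    1 / 2 + 2 * e1 + th <= 2 * m - 1 - 2 * d, 2 * e3 + 9 * e1 + 4 * th <= 4 * (2 * m - 1 - 2 * d) &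
    e3 + e1 + th <= 2 * m - 1 - 2 * d]].
Proof.
move=> hb m tb e1 e3.
have [b1|b1] := lerP beta 1.
  have mE : m = beta by rewrite /m; apply/min_idPl.
  have tbE : tb = 4 * beta - 3 by rewrite /tb; apply/min_idPl; lra.
  have e3E : e3 = beta - 1 / 4 by rewrite /e3; apply/min_idPl; lra.
  pose x := 4 * beta - 3; have x0 : 0 < x by rewrite /x; lra.
  have x1 : x <= 1 by rewrite /x; lra.
  have e10 : 0 <= e1 by rewrite /e1 tbE -/x divr_ge0 ?(ltW x0)// addr_ge0// mulr_ge0// ltW.
  have e1x : e1 <= x / 8.
    rewrite /e1 tbE -/x ler_pdivrMr ?addr_gt0 ?mulr_gt0//; nra.
  exists (x / 32), (x / 16); rewrite mE e3E; move: (e1) e10 e1x => y y0 y1.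
  have bE : beta = (x + 3) / 4 by rewrite /x; field.
  rewrite bE; move: (x) x0 x1 y1 => z z0 z1 y2 {bE}; by do ?split; lra.
have mE : m = 1 by rewrite /m; apply/min_idPr; rewrite ltW.
have tbE : tb = 2 * beta - 1 by rewrite /tb; apply/min_idPr; lra.
have e3E : e3 = 3 / 4 by rewrite /e3; apply/min_idPr; lra.
have e10 : 0 <= e1 by rewrite /e1 divr_ge0//; lra.
have gE : 4^-1 - e1 = 2 / (4 * tb + 8) by rewrite /e1; field; lra.
have g0 : 0 < 4^-1 - e1 by rewrite gE divr_gt0//; lra.
exists ((4^-1 - e1) / 4), ((4^-1 - e1) / 2); rewrite mE e3E; move: (e1) e10 g0 => y y0 y1.
by do ?split; lra.
Qed.

(** With truncated subtraction [i - l + (l - i)] is the distance |i - l|, which is injective in [l]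
    on each side of [i]. *)
Lemma sum_dist_le (R : realType) (n : nat) (f : nat -> R) (i : 'I_n) : (forall k, 0 <= f k) ->
  \sum_(l < n) f (i - l + (l - i))%N <= 2 * \sum_(k < n) f k.
Proof.
move=> f0.
have inj (h : 'I_n -> 'I_n) (A : {set 'I_n}) : {in A &, injective h} -> \sum_(l in A) f (h l) <= \sum_(k < n) f k.
  move=> hi; rewrite -(big_imset (fun k : 'I_n => f k) hi)/= [leRHS](bigID (mem (h @: A)))/= lerDl.
  exact: sumr_ge0.
pose h1 (l : 'I_n) : 'I_n := Ordinal (leq_ltn_trans (leq_subr l i) (ltn_ord i)).
pose h2 (l : 'I_n) : 'I_n := Ordinal (leq_ltn_trans (leq_subr i l) (ltn_ord l)).
pose A : {set 'I_n} := [set l : 'I_n | (l <= i)%N]%SET.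
rewrite (bigID (mem A))/= (_ : 2 * _ = \sum_(k < n) f k + \sum_(k < n) f k); last by ring.
apply: lerD.
  rewrite (eq_bigr (fun l => f (h1 l))) => [|l]; last by rewrite /A inE /h1 /= => h; rewrite (_ : (i - l + (l - i) = i - l)%N)//; lia.
  apply: (inj h1) => k l; rewrite !inE => hk hl /(congr1 val) /= h; apply/val_inj => /=; lia.
rewrite (eq_bigl (fun l => l \in ~: A)) => [|l]; last by rewrite finset.in_setC.
rewrite (eq_bigr (fun l => f (h2 l))) => [|l]; last by rewrite /A !inE -ltnNge /h2 /= => h; rewrite (_ : (i - l + (l - i) = l - i)%N)//; lia.
apply: (inj h2) => k l; rewrite !inE -!ltnNge => hk hl /(congr1 val) /= h; apply/val_inj => /=; lia.
Qed.

Lemma pF_pz_le1 (R : realType) K n p (xi : 'I_n -> 'I_p -> 'rV[R]_K) Om (z : 'I_p * 'I_p -> 'rV[R]_K) u :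
  (forall x, L2 (Ff xi Om x)) -> `|pF xi Om u - pzA z u| <= 1.
Proof.
move=> hF.
have m1 : mb (fun t => [forall x, `|Ff xi Om x t| < u]).
  apply: mb_forall => x; apply: measurable_fun_ltr; last exact: measurable_cst.
  by apply: measurableT_comp => //; have [] := hF x.
have m2 : mb (fun t => [forall x, `|lin (z x) t| < u]).
  by apply: mb_forall => x; apply: mb_lt; [apply: tame_norm; exact: tame_lin|exact: tame_cst].
have := gP_le1 m1; have := gP_le1 m2; have := gP_ge0 (fun t => [forall x, `|Ff xi Om x t| < u]); have := gP_ge0 (fun t => [forall x, `|lin (z x) t| < u]).
rewrite -/(pF xi Om u) -/(pzA z u) ler_norml; move: (pF _ _ _) (pzA _ _) => a b *.
by apply/andP; split; lra.
Qed.

(* The three terms of the error of [gaussian_bound], in powers of [n]: [E1], [E3] stand for the powers in the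
   first and third terms of Psi, [A] for the decay of the row sums, and [D] is the gain. *)
Lemma error_powers (R : realType) (w P y k Ce ce E1 E3 A D sn : R) :
  0 < w -> 1 <= P -> 0 <= y -> y <= 1 -> 1 <= k -> 0 < Ce -> 0 < ce -> 0 < E1 -> 0 < E3 -> 0 < A -> 0 < D -> 1 <= sn ->
  1 <= Ce * w -> w ^+ 2 <= k * y * E1 ->
  (P = 1 /\ w <= ce^-1) \/ w * P ^+ 2 <= k * y * E3 ->
  E1 ^+ 2 * sn * A <= D -> E3 ^+ 2 * E1 ^+ 9 * A ^+ 4 <= D ^+ 4 -> E3 * E1 * A <= D ->
  (w ^+ 4 * sn + P * w ^+ 5 + P ^+ 2 * w ^+ 2) * A <=
   (k ^+ 2 + k ^+ 3 + Ce * k ^+ 2 + k ^+ 2 / ce + k ^+ 2 * Ce ^+ 2) * (y ^+ 2 * D).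
Proof.
move=> w0 P1 y0 y1 k1 Ce0 ce0 E10 E30 A0 D0 sn1 Cw hw hP d1 d2 d3.
have k0 : 0 <= k by apply: le_trans k1.
have yD : 0 <= y ^+ 2 * D by rewrite mulr_ge0 ?sqr_ge0// ltW.
have t1 : w ^+ 4 * sn * A <= k ^+ 2 * (y ^+ 2 * D).
  apply: (@le_trans _ _ ((k * y * E1) ^+ 2 * sn * A)).
    have -> : w ^+ 4 = (w ^+ 2) ^+ 2 by ring.
    rewrite -!(mulrA _ sn); apply: ler_wpM2r; first by rewrite mulr_ge0 ?(ltW A0)// (le_trans ler01).
    by rewrite lerXn2r ?nnegrE ?sqr_ge0// !mulr_ge0 ?(ltW E10).
  rewrite [leLHS](_ : _ = k ^+ 2 * (y ^+ 2 * (E1 ^+ 2 * sn * A))); last by ring.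
  by apply: ler_wpM2l; [exact: sqr_ge0|apply: ler_wpM2l => //; exact: sqr_ge0].
have w4 : w ^+ 4 * A <= w ^+ 4 * sn * A.
  by rewrite ler_wpM2r ?(ltW A0)// ler_peMr// exprn_ge0// ltW.
have n2 : 0 <= k ^+ 2 * (y ^+ 2 * D) by rewrite mulr_ge0// sqr_ge0.
have n3 : 0 <= k ^+ 3 * (y ^+ 2 * D) by rewrite mulr_ge0// exprn_ge0.
have n4 : 0 <= Ce * (k ^+ 2 * (y ^+ 2 * D)) by rewrite mulr_ge0// ltW.
have n5 : 0 <= ce^-1 * (k ^+ 2 * (y ^+ 2 * D)) by rewrite mulr_ge0// invr_ge0 ltW.
have n6 : 0 <= Ce ^+ 2 * (k ^+ 2 * (y ^+ 2 * D)) by rewrite mulr_ge0// sqr_ge0.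
rewrite [leRHS](_ : _ = k ^+ 2 * (y ^+ 2 * D) + k ^+ 3 * (y ^+ 2 * D) + Ce * (k ^+ 2 * (y ^+ 2 * D)) +
  ce^-1 * (k ^+ 2 * (y ^+ 2 * D)) + Ce ^+ 2 * (k ^+ 2 * (y ^+ 2 * D))); last by ring.
rewrite !mulrDl.
suff [t2 t3] : P * w ^+ 5 * A <= k ^+ 3 * (y ^+ 2 * D) + ce^-1 * (k ^+ 2 * (y ^+ 2 * D)) /\
    P ^+ 2 * w ^+ 2 * A <= Ce * (k ^+ 2 * (y ^+ 2 * D)) + Ce ^+ 2 * (k ^+ 2 * (y ^+ 2 * D)).
  by apply: (le_trans (lerD (lerD t1 t2) t3)); apply: eq_leW; ring.
have t4 := le_trans w4 t1.
case: hP => [[-> wc]|hP].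
  split.
    apply: (@le_trans _ _ (ce^-1 * (k ^+ 2 * (y ^+ 2 * D)))); last by rewrite lerDr.
    apply: (@le_trans _ _ (ce^-1 * (w ^+ 4 * A))); last by rewrite ler_wpM2l// invr_ge0 ltW.
    rewrite mul1r exprS -mulrA; apply: ler_wpM2r wc; exact: mulr_ge0 (exprn_ge0 4 (ltW w0)) (ltW A0).
  apply: (@le_trans _ _ (Ce ^+ 2 * (k ^+ 2 * (y ^+ 2 * D)))); last by rewrite lerDr.
  apply: (@le_trans _ _ (Ce ^+ 2 * (w ^+ 4 * A))); last by rewrite ler_wpM2l// sqr_ge0.
  rewrite expr1n mul1r [leRHS](_ : _ = (Ce * w) ^+ 2 * (w ^+ 2 * A)); last by ring.
  by rewrite ler_peMl ?exprn_ege1// mulr_ge0 ?sqr_ge0// ltW.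
split.
  apply: (@le_trans _ _ (k ^+ 3 * (y ^+ 2 * D))); last by rewrite lerDl.
  have l0 : 0 <= P * w ^+ 5 * A by rewrite !mulr_ge0 ?exprn_ge0 ?(ltW w0) ?(ltW A0)// (le_trans ler01).
  rewrite -(@ler_pXn2r _ 4) ?nnegrE//.
  rewrite [leLHS](_ : _ = (w * P ^+ 2) ^+ 2 * (w ^+ 2) ^+ 9 * A ^+ 4); last by ring.
  have h1 : (w * P ^+ 2) ^+ 2 <= (k * y * E3) ^+ 2.
    by rewrite lerXn2r ?nnegrE ?(mulr_ge0 (ltW w0) (sqr_ge0 _))// mulr_ge0 ?(ltW E30)// mulr_ge0.
  have h2 : (w ^+ 2) ^+ 9 <= (k * y * E1) ^+ 9 by rewrite lerXn2r ?nnegrE ?sqr_ge0// !mulr_ge0 ?(ltW E10).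
  apply: (@le_trans _ _ ((k * y * E3) ^+ 2 * (k * y * E1) ^+ 9 * A ^+ 4)).
    apply: ler_wpM2r; first exact: exprn_ge0 (ltW A0).
    by apply: ler_pM => //; [exact: sqr_ge0|exact: exprn_ge0 (sqr_ge0 w)].
  rewrite [leLHS](_ : _ = k ^+ 11 * y ^+ 11 * (E3 ^+ 2 * E1 ^+ 9 * A ^+ 4)); last by ring.
  rewrite [leRHS](_ : _ = k ^+ 12 * y ^+ 8 * D ^+ 4); last by ring.
  apply: ler_pM => //; rewrite ?mulr_ge0 ?exprn_ge0 ?(ltW E30) ?(ltW E10) ?(ltW A0)//.
  apply: ler_pM; rewrite ?exprn_ge0//; first by rewrite ler_weXn2l.
  by rewrite ler_wiXn2l.
apply: (@le_trans _ _ (Ce * (k ^+ 2 * (y ^+ 2 * D)))); last by rewrite lerDl.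
apply: (@le_trans _ _ (w * P ^+ 2 * (Ce * w ^+ 2) * A)).
  rewrite [leRHS](_ : _ = (Ce * w) * (P ^+ 2 * w ^+ 2 * A)); last by ring.
  by rewrite ler_peMl// mulr_ge0 ?(ltW A0)// mulr_ge0// sqr_ge0.
apply: (@le_trans _ _ (k * y * E3 * (Ce * (k * y * E1)) * A)).
  apply: ler_wpM2r; first exact: ltW.
  apply: ler_pM => //; [by rewrite mulr_ge0 ?sqr_ge0 ?(ltW w0)|by rewrite mulr_ge0 ?sqr_ge0 ?(ltW Ce0)|by rewrite ler_wpM2l// ltW].
rewrite [leLHS](_ : _ = Ce * (k ^+ 2 * (y ^+ 2 * (E3 * E1 * A)))); last by ring.
apply: ler_wpM2l; first exact: ltW. apply: ler_wpM2l; first exact: sqr_ge0. by apply: ler_wpM2l d3; exact: sqr_ge0.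
Qed.

Section main.
Context {R : realType} (beta C0 c0 ce Ce : R).
Hypotheses (hb : 3 / 4 < beta) (C00 : 0 < C0) (ce0 : 0 < ce) (Ce0 : 0 < Ce).
Local Notation m := (Num.min beta 1).
Local Notation tb := (Num.min (4 * beta - 3) (2 * beta - 1)).
Local Notation e1 := (tb / (4 * tb + 8)).
Local Notation e3 := (Num.min (beta - 1 / 4) (3 / 4)).

Let m1 : m <= 1. Proof. by rewrite ge_min lexx orbT. Qed.
Let mb' : m <= beta. Proof. by rewrite ge_min lexx. Qed.
Let tb0 : 0 < tb. Proof. by have h := hb; rewrite lt_min; apply/andP; split; move: h; lra. Qed.
Let e30 : 0 <= e3. Proof. by have h := hb; rewrite le_min; apply/andP; split; move: h; lra. Qed.

(** A lower bound for the logarithmic factors of the first and third terms of Psi, the latter for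
    [p >= 2]. *)
Definition l0 : R := Num.min (ln 2 `^ ((5 * tb + 12) / (4 * tb + 8))) (ln 2).
Let ln2 : 0 < ln (2 : R). Proof. by rewrite ln_gt0// ltr1n. Qed.

Lemma l0_gt0 : 0 < l0. Proof. by rewrite lt_min powR_gt0//=. Qed.

Section one_process.
Variables (p n : nat) (M : linear_process R p) (Z : gaussian_rv R (p * p)).
Hypothesis as_ : assumptions M beta C0 c0 ce Ce n Z.
Local Notation Om := (Omega M).
Local Notation X := (n%:R : R).
Local Notation P := (p%:R : R).
Local Notation w := (mx_norm1 Om).
Local Notation y := (Psi_Omega M beta n).

Let p0 : (0 < p)%N. Proof. by case: as_ => /andP[]. Qed.
Let pn : (p < n)%N. Proof. by case: as_ => /andP[]. Qed.
Let n0 : (0 < n)%N. Proof. exact: leq_ltn_trans pn. Qed.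
Let n2 : (2 <= n)%N. Proof. exact: leq_ltn_trans pn. Qed.
Let X0 : 0 < X. Proof. by rewrite ltr0n. Qed.
Let X1 : 1 <= X. Proof. by rewrite ler1n. Qed.
Let P1 : 1 <= P. Proof. by rewrite ler1n. Qed.
Let lnP0 : 0 <= ln P. Proof. exact: ln_ge0. Qed.

Lemma w_col j : \sum_a `|Om a j| <= w.
Proof. by rewrite /mx_norm1; apply: (le_bigmax_cond _ (fun j => \sum_(i < p) `|Om i j|)). Qed.

Lemma w_ge0 : 0 <= w. Proof. by rewrite /mx_norm1; elim/big_rec: _ => // i a _ a0; rewrite le_max a0 orbT. Qed.

(** Psi dominates each of its nonnegative terms. The case [p = 1] stands apart because ln p vanishes
    there. *)
Lemma Psi_lower : 0 <= y /\ w ^+ 2 * l0 <= y * X `^ e1 /\ (p = 1%N \/ w * P ^+ 2 * l0 <= y * X `^ e3).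
Proof.
have w0 := w_ge0.
have E10 : 0 < X `^ e1 by exact: powR_gt0.
have E30 : 0 < X `^ e3 by exact: powR_gt0.
pose T1 := w ^+ 2 * ln (P * X) `^ ((5 * tb + 12) / (4 * tb + 8)) / X `^ e1.
pose T2 := P ^+ 4 * ln X `^ (5 / 2) / X `^ (Num.min (2 * beta - 1 / 2) (3 / 2)).
pose T3 := w * P ^+ 2 * ln P / X `^ e3.
have yE : y = T1 + T2 + T3 by [].
have t1 : 0 <= T1 by rewrite divr_ge0 ?(ltW E10)// mulr_ge0 ?sqr_ge0 ?powR_ge0.
have t2 : 0 <= T2 by rewrite divr_ge0 ?powR_ge0// mulr_ge0 ?exprn_ge0 ?powR_ge0.
have t3 : 0 <= T3 by rewrite divr_ge0 ?powR_ge0// mulr_ge0// mulr_ge0// sqr_ge0.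
have y0 : 0 <= y by rewrite yE !addr_ge0.
split=> //; split.
  rewrite -ler_pdivrMr//; apply: (@le_trans _ _ T1); last by rewrite yE -addrA lerDl addr_ge0.
  rewrite /T1 ler_wpM2r ?invr_ge0 ?(ltW E10)//; apply: ler_wpM2l; first exact: sqr_ge0.
  apply: (@le_trans _ _ (ln 2 `^ ((5 * tb + 12) / (4 * tb + 8)))); first by rewrite ge_min lexx.
  apply: ge0_ler_powR; rewrite ?nnegrE ?(ltW ln2)//.
  - by rewrite divr_ge0// addr_ge0// mulr_ge0// ltW.
  - by rewrite ln_ge0// -[leLHS]mulr1 ler_pM.
  - rewrite ler_ln ?posrE ?mulr_gt0 ?(lt_le_trans _ P1)// -[leLHS]mul1r ler_pM// ler_nat //.
have [p1|p1] := leqP p 1; first by left; apply/eqP; rewrite eqn_leq p1 p0.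
right; rewrite -ler_pdivrMr//; apply: (@le_trans _ _ T3); last by rewrite yE lerDr addr_ge0.
rewrite /T3 ler_wpM2r ?invr_ge0 ?(ltW E30)//; apply: ler_wpM2l; first by rewrite mulr_ge0 ?sqr_ge0.
apply: (@le_trans _ _ (ln 2)); first by rewrite ge_min lexx orbT.
by rewrite ler_ln ?posrE ?ltr0n// ler_nat.
Qed.

Variables (d th : R) (q : nat) (k : R).
Hypotheses (d0 : 0 < d) (th0 : 0 < th) (th1 : th <= 1) (dm : 3 * d <= 4 * m - 3).
Hypotheses (e10 : 0 <= e1) (e11 : e1 <= 1).
Local Notation a := (2 * m - 1 - 2 * d).
Hypotheses (x1 : 1 / 2 + 2 * e1 + th <= a) (x2 : 2 * e3 + 9 * e1 + 4 * th <= 4 * a) (x3 : e3 + e1 + th <= a).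
Definition Ac := acov_const C0 d.
Definition Cs := 2 * (Ac * (2 + d^-1)) + 1.
Definition S2c := 2 * (Ac ^+ 2 * (2 + d^-1)).
Definition kap0 := 1 + l0^-1.
Definition Kq := Cs * (kap0 ^+ 2 + kap0 ^+ 3 + Ce * kap0 ^+ 2 + kap0 ^+ 2 / ce + kap0 ^+ 2 * Ce ^+ 2).
Local Notation N := (X `^ (th / 32)).
Local Notation KB := (Kb ce Ce S2c).
Hypothesis hbig : (KB + KB * Kq + kap0 + momC q * 32 ^+ q + 1) * (1 + ln X) <= N.
Hypotheses (q0 : (0 < q)%N) (hq : 41 <= th / 16 * q%:R) (y1 : y <= 1).

Let be' : 1 + d <= 2 * m. Proof. by have := dm; have := m1; have := d0; move: m => z; lra. Qed.
Let Ac0 : 0 < Ac. Proof. by rewrite /Ac /acov_const mulr_gt0 ?exprn_gt0// addr_gt0 ?invr_gt0. Qed.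
Let D0 : 0 < 2 + d^-1. Proof. by rewrite addr_gt0 ?invr_gt0. Qed.
Let S20 : 0 < S2c. Proof. by rewrite /S2c !mulr_gt0 ?exprn_gt0. Qed.
Let Cs1 : 1 <= Cs. Proof. by rewrite /Cs lerDr; apply: mulr_ge0 => //; exact: ltW (mulr_gt0 Ac0 D0). Qed.
Let kap1 : 1 <= kap0. Proof. by rewrite /kap0 lerDl invr_ge0 ltW// l0_gt0. Qed.
Let Kq0 : 0 <= Kq.
Proof.
have k0 : 0 <= kap0 by exact: le_trans kap1.
rewrite /Kq mulr_ge0 ?(le_trans ler01 Cs1)//.
have h2 : 0 <= kap0 ^+ 2 by exact: sqr_ge0.
apply: addr_ge0; last by rewrite mulr_ge0// sqr_ge0.
apply: addr_ge0; last by rewrite divr_ge0// ltW.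
apply: addr_ge0; last by rewrite mulr_ge0// ltW.
by apply: addr_ge0 => //; exact: exprn_ge0.
Qed.

Lemma powX (u v : R) : X `^ (u + v) = X `^ u * X `^ v.
Proof. by rewrite powRD//; apply/implyP => _; rewrite gt_eqF. Qed.

Lemma powXn (u : R) (j : nat) : (X `^ u) ^+ j = X `^ (u * j%:R).
Proof. by rewrite powRrM powR_mulrn// powR_ge0. Qed.

Local Notation c := (2 * m - 1 - d).
Let r (i l : 'I_n) : R := Ac * wt c (i - l + (l - i)).
Local Notation S1 := (Cs * X `^ (1 - a)).

Let r_ge0 i l : 0 <= r i l. Proof. exact: mulr_ge0 (ltW Ac0) (wt_ge0 _ _). Qed.
Let r_sym i l : r i l = r l i. Proof. by rewrite /r addnC. Qed.

Let r_sum i : \sum_l r i l <= S1.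
Proof.
rewrite /r -mulr_sumr; apply: (@le_trans _ _ (Ac * (2 * (X `^ (1 - a) * (2 + d^-1))))).
  apply: ler_wpM2l; first exact: ltW.
  apply: (le_trans (sum_dist_le i (wt_ge0 c))); apply: ler_wpM2l => //.
  apply: sum_wt_pow => //; last by apply: eq_leW; ring.
  have h := m1; have h' := d0; move: h h'; move: m => z; lra.
rewrite [leLHS](_ : _ = 2 * (Ac * (2 + d^-1)) * X `^ (1 - a)); last by ring.
by apply: ler_wpM2r; [exact: powR_ge0|rewrite /Cs lerDl].
Qed.

Let r_sqsum i : \sum_l r i l ^+ 2 <= S2c.
Proof.
rewrite (eq_bigr (fun l : 'I_n => Ac ^+ 2 * wt (c + c) (i - l + (l - i)))) => [|l _]; last first.
  by rewrite /r exprMn (wtD c c) (expr2 (wt c _)).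
rewrite -mulr_sumr; apply: (@le_trans _ _ (Ac ^+ 2 * (2 * (2 + d^-1)))); last first.
  by rewrite /S2c; apply: eq_leW; ring.
apply: ler_wpM2l; first exact: sqr_ge0.
apply: (le_trans (sum_dist_le i (wt_ge0 (c + c)))); apply: ler_wpM2l => //.
(* Squares are summable because 2 c = 4 m - 2 - 2 d >= 1 + d; the room for this is what [beta > 3/4]
   provides. *)
apply: le_trans (sum_wt_le n d0); apply: ler_sum => l _; apply: wt_le_exp.
have h := dm; move: h; move: m => z; lra.
Qed.

Let th32 : 0 < th / 32. Proof. by rewrite divr_gt0. Qed.
Let pow_ge1 u : 0 <= u -> 1 <= X `^ u. Proof. by move=> u0; rewrite -[leLHS](powRr0 X) ler_powR. Qed.
Let pow_le1 u : u <= 0 -> X `^ u <= 1. Proof. by move=> u0; rewrite -[leRHS](powRr0 X) ler_powR. Qed.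
Let N1 : 1 <= N. Proof. exact: pow_ge1 (ltW th32). Qed.
Let N0 : 0 < N. Proof. exact: lt_le_trans N1. Qed.
Let NX : N <= X.
Proof. by rewrite -[leRHS](powRr1 (ltW X0)) ler_powR//; have h := th1; have h' := th0; move: h h'; lra. Qed.
Let KB43 : 43 <= KB. Proof. by have [] := Kb_ge ce0 Ce0 S20. Qed.
Let KB0 : 0 <= KB. Proof. exact: le_trans KB43. Qed.
Let mq0 : 0 <= momC q * 32 ^+ q :> R.
Proof. by rewrite /momC !mulr_ge0 ?exprn_ge0 ?mulr_ge0 ?exprn_ge0. Qed.
Let lnX0 : 0 <= ln X. Proof. exact: ln_ge0. Qed.

Let big_ge (v : R) : 0 <= v -> v <= KB + KB * Kq + kap0 + momC q * 32 ^+ q + 1 -> v * (1 + ln X) <= N.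
Proof. by move=> v0 h; apply: le_trans hbig; apply: ler_wpM2r h; rewrite addr_ge0. Qed.

Let big_ge1 (v : R) : 0 <= v -> v <= KB + KB * Kq + kap0 + momC q * 32 ^+ q + 1 -> v <= N.
Proof. by move=> v0 h; apply: le_trans (big_ge v0 h); rewrite ler_peMr// lerDl. Qed.

Let KK0 : 0 <= KB * Kq. Proof. exact: mulr_ge0. Qed.
Let kap00 : 0 <= kap0. Proof. exact: le_trans kap1. Qed.

Let le_sum5 (u1 u2 u3 u4 : R) : 0 <= u1 -> 0 <= u2 -> 0 <= u3 -> 0 <= u4 ->
  [/\ u1 <= u1 + u2 + u3 + u4 + 1, u2 <= u1 + u2 + u3 + u4 + 1, u3 <= u1 + u2 + u3 + u4 + 1 & u4 <= u1 + u2 + u3 + u4 + 1].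
Proof. by move=> *; split; lra. Qed.

Let bigs : [/\ KB * (1 + ln X) <= N, KB * Kq <= N, kap0 <= N & momC q * 32 ^+ q <= N].
Proof.
by have [s1 s2 s3 s4] := le_sum5 KB0 KK0 kap00 mq0; split; [exact: big_ge|exact: big_ge1..].
Qed.
Let KBln : KB * (1 + ln X) <= N. Proof. by have [] := bigs. Qed.
Let KqN : KB * Kq <= N. Proof. by have [] := bigs. Qed.
Let kapN : kap0 <= N. Proof. by have [] := bigs. Qed.
Let momN : momC q * 32 ^+ q <= N. Proof. by have [] := bigs. Qed.

(** By [hq], N^(2q) is at least n^41; the power beyond 40 pays for the constant, which is at most
    [N <= n]. *)
Let tails : tail_small q N (X^-1 ^+ 40).
Proof.
rewrite /tail_small ler_pdivrMr ?exprn_gt0// exprVn [leRHS]mulrC ler_pdivlMr ?exprn_gt0//.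
apply: (@le_trans _ _ (X `^ 41)).
  rewrite -[41]/(41%:R) powR_mulrn ?(ltW X0)// (exprS X 40).
  by apply: ler_wpM2r; [exact: exprn_ge0 (ltW X0)|exact: le_trans NX].
rewrite powXn ler_powR// natrM; apply: (le_trans hq).
by apply: eq_leW; field.
Qed.

Lemma spectrum_facts : [/\ Ce^-1 <= w, forall v : 'rV_p, ce * dotp v v <= dotp (v *m Sigma M) v,
  forall j, Sigma M j j <= Ce, Sigma M *m Om = 1%:M & Om^T = Om].
Proof.
have [K [xi [z [hS _ _ _ _]]]] := transfer C00 hb d0 m1 mb' be' as_.
have [_ _ sp _ _] := as_.
have ST : (Sigma M)^T = Sigma M.
  by apply/matrixP => a' b'; rewrite mxE -(hS (Ordinal n0)) dotpC hS.
have [hce hCe] := spectrum_bounds ST sp.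
have uS : Sigma M \in unitmx by apply: (lower_unitmx ce0) => v; rewrite -dotp_sqE -dotpE.
have SO : Sigma M *m Om = 1%:M by rewrite /Omega mulmxV.
have OT : Om^T = Om by rewrite /Omega trmx_inv ST.
split=> //; apply: (le_trans (Om_diag_ge n0 hS SO OT hCe (Ordinal p0))).
apply: le_trans (w_col (Ordinal p0)); rewrite (bigD1 (Ordinal p0))//=.
by apply: (le_trans (ler_norm _)); rewrite lerDl sumr_ge0.
Qed.

(** [error_powers] bounds [Qn] by a multiple of y^2 n^(-th), whose square root is y n^(-th/2). With
    N = n^(th/32) the factor N^8 costs only n^(th/4). *)
Lemma main_bound : rho_Omega M n Z <= KB * Num.sqrt Kq * y.
Proof.
have [K [xi [z [hS hr hF hz [zx hrho]]]]] := transfer C00 hb d0 m1 mb' be' as_.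
have [wC hce hCe SO OT] := spectrum_facts.
have w0 : 0 < w by apply: lt_le_trans wC; rewrite invr_gt0.
have [y0 [Pw Pp]] := Psi_lower.
have L0 := l0_gt0.
have kl v u : 0 <= u -> v * l0 <= u -> v <= kap0 * u.
  move=> u0 h; have v1 : v <= l0^-1 * u by rewrite mulrC ler_pdivlMr.
  by apply: (le_trans v1); apply: ler_wpM2r => //; rewrite /kap0 lerDr.
have E10 : 0 < X `^ e1 by exact: powR_gt0.
have E30 : 0 < X `^ e3 by exact: powR_gt0.
have hw2 : w ^+ 2 <= kap0 * y * X `^ e1 by rewrite -mulrA; apply: kl => //; rewrite mulr_ge0// ltW.
(* For [p = 1] the norm [w] is the absolute value of a single entry, which [Om_entry] bounds by 1 /
   ce. *)
have hwP : (P = 1 /\ w <= ce^-1) \/ w * P ^+ 2 <= kap0 * y * X `^ e3.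
  case: Pp => [p1|h]; [left|by right; rewrite -mulrA; apply: kl => //; rewrite mulr_ge0// ltW].
  split; first by rewrite p1.
  rewrite /mx_norm1; elim/big_ind: _ => [|u v hu hv|j _]; first by rewrite invr_ge0 ltW.
    by rewrite ge_max hu.
  apply: (@le_trans _ _ (\sum_(i < p) ce^-1)); first by apply: ler_sum => i _; exact: Om_entry SO ce0 hce _ _.
  by rewrite sumr_const card_ord p1.
have wX : w <= X.
  rewrite -(@ler_pXn2r _ 2) ?nnegrE ?(ltW w0)//; apply: (le_trans hw2).
  rewrite expr2; apply: ler_pM; rewrite ?mulr_ge0 ?(ltW E10)//.
    by apply: (@le_trans _ _ kap0); [by rewrite ler_piMr|exact: le_trans kapN NX].
  by rewrite -[leRHS](powRr1 (ltW X0)) ler_powR.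
have sq : Num.sqrt X = X `^ 2^-1 by rewrite powR12_sqrt// ltW.
have sn1 : 1 <= Num.sqrt X by rewrite sq; apply: pow_ge1; rewrite invr_ge0.
have Cw : 1 <= Ce * w by rewrite mulrC -ler_pdivrMr// mul1r.
have A0 : 0 < X `^ (- a) by exact: powR_gt0.
have D1 : 0 < X `^ (- th) by exact: powR_gt0.
have d1 : (X `^ e1) ^+ 2 * Num.sqrt X * X `^ (- a) <= X `^ (- th).
  rewrite sq powXn -!powX ler_powR//; have h := x1; move: h; move: e1 m => u v; lra.
have d2 : (X `^ e3) ^+ 2 * (X `^ e1) ^+ 9 * (X `^ (- a)) ^+ 4 <= (X `^ (- th)) ^+ 4.
  rewrite !powXn -!powX ler_powR//; have h := x2; move: h; move: e1 m e3 => u v s; lra.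
have d3 : X `^ e3 * X `^ e1 * X `^ (- a) <= X `^ (- th).
  rewrite -!powX ler_powR//; have h := x3; move: h; move: e1 m e3 => u v s; lra.
have err := error_powers w0 P1 y0 y1 kap1 Ce0 ce0 E10 E30 A0 D1 sn1 Cw hw2 hwP d1 d2 d3.
have S1X : S1 / X = Cs * X `^ (- a).
  by rewrite -mulrA -(powR_inv1 (ltW X0)) -powX; congr (_ * _ `^ _); ring.
have hQ : Qn n p w S1 <= Kq * (y ^+ 2 * X `^ (- th)).
  rewrite /Qn S1X mulrCA /Kq -(mulrA Cs); apply: ler_wpM2l err; exact: le_trans Cs1.
have Kpow : KB * N ^+ 4 * Qn n p w S1 <= 1.
  apply: (@le_trans _ _ (KB * N ^+ 4 * (Kq * (y ^+ 2 * X `^ (- th))))).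
    by apply: ler_wpM2l hQ; exact: mulr_ge0 KB0 (exprn_ge0 4 (ltW N0)).
  rewrite [leLHS](_ : _ = KB * Kq * (N ^+ 4 * X `^ (- th)) * y ^+ 2); last by ring.
  apply: (@le_trans _ _ (N * (N ^+ 4 * X `^ (- th)) * 1)); last first.
    rewrite mulr1 mulrA -exprS powXn -powX; apply: pow_le1; have h := th0; move: h; lra.
  apply: ler_pM; [|exact: sqr_ge0| |exact: exprn_ile1].
    apply: mulr_ge0 => //; exact: mulr_ge0 (exprn_ge0 4 (ltW N0)) (ltW D1).
  apply: ler_wpM2r KqN; exact: mulr_ge0 (exprn_ge0 4 (ltW N0)) (ltW D1).
have S11 : 1 <= S1.
  rewrite -[leLHS]mulr1; apply: ler_pM => //; apply: pow_ge1.
  have h := m1; have h' := d0; move: h h'; move: m => v; lra.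
apply: hrho => u.
have G := gaussian_bound ce0 Ce0 S20 n0 p0 (ltnW pn) hS SO OT hce hCe r_ge0 r_sym hr r_sum r_sqsum w_col hF hz zx q0 tails
  wC wX S11 N1 NX Kpow KBln u.
apply: (le_trans G); rewrite -(mulrA KB); apply: ler_wpM2l => //.
have NE : N ^+ 8 * Num.sqrt (X `^ (- th)) <= 1.
  rewrite -powR12_sqrt ?powR_ge0// -powRrM powXn -powX; apply: pow_le1.
  have h := th0; move: h; lra.
apply: (@le_trans _ _ (N ^+ 8 * Num.sqrt (Kq * (y ^+ 2 * X `^ (- th))))).
  have N8 : 0 <= N ^+ 8 by exact: exprn_ge0 (ltW N0).
  by apply: (ler_wpM2l N8); rewrite ler_wsqrtr.
rewrite (sqrtrM _ Kq0) (sqrtrM _ (sqr_ge0 y)) sqrtr_sqr (ger0_norm y0).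
rewrite [leLHS](_ : _ = Num.sqrt Kq * y * (N ^+ 8 * Num.sqrt (X `^ (- th)))); last by ring.
by rewrite ler_piMr// mulr_ge0// sqrtr_ge0.
Qed.

End one_process.

Lemma rho_le1 p n M Z (as_ : @assumptions R p M beta C0 c0 ce Ce n Z) (d : R) : 0 < d -> 1 + d <= 2 * m -> rho_Omega M n Z <= 1.
Proof.
move=> d0 dm; have [K [xi [z [_ _ hF _ [_ hrho]]]]] := transfer C00 hb d0 m1 mb' dm as_.
by apply: hrho => u; exact: pF_pz_le1.
Qed.

(** For bounded n, Psi is bounded below since the norm of [Omega] is at least 1 / Ce; there the
    trivial bound [rho_le1] suffices. *)
Lemma Psi_ge p n M Z (as_ : @assumptions R p M beta C0 c0 ce Ce n Z) (d : R) (n1 : nat) : 0 < d -> 3 * d <= 4 * m - 3 -> 0 <= e1 -> e1 <= 1 ->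
  (n <= n1)%N -> 1 <= Ce ^+ 2 * n1%:R / l0 * Psi_Omega M beta n.
Proof.
move=> d0 dm e10 e11 nn1; have [wC _ _ _ _] := spectrum_facts as_ d0 dm.
have [y0 [Pw _]] := Psi_lower as_.
have n0 : (0 < n)%N by have [/andP[_ pn] _ _ _ _] := as_; exact: leq_ltn_trans pn.
have X1 : 1 <= n%:R :> R by rewrite ler1n.
have L0 := l0_gt0.
have Cw : 1 <= Ce * mx_norm1 (Omega M) by rewrite mulrC -ler_pdivrMr// mul1r.
rewrite mulrAC ler_pdivlMr// mul1r; apply: (@le_trans _ _ ((Ce * mx_norm1 (Omega M)) ^+ 2 * l0)).
  by rewrite ler_peMl ?(ltW L0)// exprn_ege1.
rewrite [leLHS](_ : _ = Ce ^+ 2 * (mx_norm1 (Omega M) ^+ 2 * l0)); last by ring.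
rewrite -[leRHS]mulrA; apply: (ler_wpM2l (sqr_ge0 Ce)).
apply: (le_trans Pw); rewrite [leRHS]mulrC; apply: ler_wpM2l => //.
apply: (@le_trans _ _ (n%:R `^ 1)); first by rewrite ler_powR.
by rewrite powRr1 ?(le_trans ler01)// ler_nat.
Qed.
End main.

Lemma rho_ge0 (R : realType) p n (M : linear_process R p) (Z : gaussian_rv R (p * p)) : 0 <= rho_Omega M n Z.
Proof.
rewrite /rho_Omega; set S := [set _ | _ in _].
(* Without a supremum [sup] takes the default value 0. *)
have [hs|hs] := pselect (has_sup S); last by rewrite sup_out.
have S0 : S (`|fine (lp_prob M [set w | 0 <= Num.sqrt n%:R * mx_norm (Omega_hat n w - Omega M)]) -
  fine (gv_prob Z [set w | 0 <= mx_norm (Z w)])|) by exists 0.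
exact: le_trans (normr_ge0 _) (ub_le_sup hs.2 S0).
Qed.

(** A diagonal entry of [Sigma] lies between [ce] and [Ce], and one exists because [0 < p]. *)
Lemma Ce_gt0 (R : realType) (beta C0 c0 ce Ce : R) p n M Z :
  3 / 4 < beta -> 0 < C0 -> 0 < ce -> @assumptions R p M beta C0 c0 ce Ce n Z -> 0 < Ce.
Proof.
move=> hb C00 ce0 as_; have [/andP[p0 pn] _ sp _ _] := as_.
have b2 : 1 + Num.min (2 * Num.min beta 1 - 1) 1 <= 2 * Num.min beta 1.
  by rewrite -lerBrDl ge_min lexx.
have d0 : 0 < Num.min (2 * Num.min beta 1 - 1) 1.
  by rewrite lt_min ltr01 andbT; have : 3 / 4 < Num.min beta 1 by [rewrite lt_min hb; lra]; lra.
have m1 : Num.min beta 1 <= 1 by rewrite ge_min lexx orbT.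
have mb' : Num.min beta 1 <= beta by rewrite ge_min lexx.
have [K [xi [z [hS _ _ _ _]]]] := transfer C00 hb d0 m1 mb' b2 as_.
have n0 : (0 < n)%N by exact: leq_ltn_trans pn.
have ST : (Sigma M)^T = Sigma M.
  by apply/matrixP => a' b'; rewrite mxE -(hS (Ordinal n0)) dotpC hS.
have [hce hCe] := spectrum_bounds ST sp.
apply: lt_le_trans (hCe (Ordinal p0)).
apply: lt_le_trans ce0 _; have := hce (delta_mx 0 (Ordinal p0)).
by rewrite !dotp_deltar -rowE !mxE !eqxx mulr1.
Qed.

Theorem theorem3 (R : realType) (beta C0 c0 ce Ce : R)
    (hbeta : 3 / 4 < beta) (hC0 : 0 < C0) (hc0 : 0 < c0) (hce : 0 < ce) :
  (exists2 C' : R, 0 < C' &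
     forall (p n : nat) (M : linear_process R p) (Z : gaussian_rv R (p * p)),
       assumptions M beta C0 c0 ce Ce n Z ->
       rho_Omega M n Z <= C' * Psi_Omega M beta n)
  /\
  (forall (p : nat -> nat) (M : forall n, linear_process R (p n))
      (Z : forall n, gaussian_rv R (p n * p n)),
     (\forall n \near \oo, assumptions (M n) beta C0 c0 ce Ce n (Z n)) ->
     (fun n : nat => Psi_Omega (M n) beta n) @ \oo --> (0 : R) ->
     (fun n : nat => rho_Omega (M n) n (Z n)) @ \oo --> (0 : R)).
Proof.
suff main : exists2 C' : R, 0 < C' &
     forall (p n : nat) (M : linear_process R p) (Z : gaussian_rv R (p * p)),
       assumptions M beta C0 c0 ce Ce n Z ->
       rho_Omega M n Z <= C' * Psi_Omega M beta n.
  split=> // p M Z as_ Psi0; have [C' C'0 hC'] := main.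
  have CPsi0 : (fun n : nat => C' * Psi_Omega (M n) beta n) @ \oo --> (0 : R).
    by rewrite -(mulr0 C'); apply: cvgMr.
  apply: (@squeeze_cvgr _ _ _ _ (cst 0) _ _ _ 0 _ CPsi0); last exact: cvg_cst.
  by near=> n; rewrite rho_ge0/=; apply: hC'; near: n.
(* For [Ce <= 0] no process satisfies the assumptions, and any constant works. *)
have [Ce0|Ce0] := ltrP 0 Ce; last first.
  by exists 1 => // p n M Z as_; have := Ce_gt0 hbeta hC0 hce as_; rewrite ltNge Ce0.
have [d [th [d0 th0 th1 dm [e10 e11 x1 x2 x3]]]] := exponents hbeta.
(* 656 = 16 * 41, so that th q / 16 >= 41. *)
pose q := (Num.truncn (656 / th)).+1.
have hq : 41 <= th / 16 * q%:R.
  have : 656 / th < q%:R by rewrite /q truncnS_gt.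
  by rewrite ltr_pdivrMr// => h; move: h; rewrite mulrC mulrAC; lra.
have th32 : 0 < th / 32 by rewrite divr_gt0.
pose KB := Kb ce Ce (S2c C0 d).
pose KQ := Kq beta C0 ce Ce d.
have [n1 hn1] := log_power (KB + KB * KQ + kap0 beta + momC q * 32 ^+ q + 1) th32.
have b2 : 1 + d <= 2 * Num.min beta 1.
  by have : Num.min beta 1 <= 1 by [rewrite ge_min lexx orbT]; lra.
pose C2 := Ce ^+ 2 * n1%:R / l0 beta.
have L0 := l0_gt0 beta.
have S0 := sqrtr_ge0 KQ.
have C20 : 0 <= C2 by rewrite /C2 divr_ge0 ?(ltW L0)// mulr_ge0// sqr_ge0.
have S20 : 0 < S2c C0 d.
  by rewrite /S2c /Ac /acov_const !mulr_gt0 ?exprn_gt0 ?addr_gt0 ?invr_gt0// mulr_gt0 ?exprn_gt0 ?addr_gt0 ?invr_gt0.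
have K0 : 0 <= KB * Num.sqrt KQ.
  by apply: mulr_ge0 => //; have [k43 _ _ _ _] := Kb_ge hce Ce0 S20; exact: le_trans k43.
(* The three summands serve, in this order, large n with Psi <= 1, the case Psi > 1, and
   [n <= n1]. *)
have C2E := erefl C2; rewrite {2}/C2 in C2E; clearbody C2; exists (KB * Num.sqrt KQ + 1 + C2) => [|p n M Z as_].
  by rewrite ltr_wpDr// ltr_wpDl.
have [y0 _] := Psi_lower hbeta as_.
have r1 := rho_le1 hbeta hC0 as_ d0 b2.
have n0 : (0 < n)%N by have [/andP[_ pn] _ _ _ _] := as_; exact: leq_ltn_trans pn.
have t1 : 0 <= KB * Num.sqrt KQ * Psi_Omega M beta n by exact: mulr_ge0.
have t2 : 0 <= C2 * Psi_Omega M beta n by exact: mulr_ge0.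
rewrite [leRHS](_ : _ = KB * Num.sqrt KQ * Psi_Omega M beta n + Psi_Omega M beta n + C2 * Psi_Omega M beta n); last by ring.
have [y1|y1] := lerP (Psi_Omega M beta n) 1; last first.
  by apply: (le_trans r1); apply: (le_trans (ltW y1)); rewrite addrAC lerDr addr_ge0.
have [nn|nn] := leqP n n1.
  apply: (le_trans r1); apply: (le_trans (Psi_ge hbeta hC0 hce Ce0 as_ d0 dm e10 e11 nn)).
  by rewrite -C2E lerDr addr_ge0.
rewrite -addrA; apply: (@le_trans _ _ (KB * Num.sqrt KQ * Psi_Omega M beta n)); last by rewrite lerDl addr_ge0.
exact: (main_bound hbeta hC0 hce Ce0 as_ d0 th0 th1 dm e11 x1 x2 x3 (hn1 _ (ltnW nn) n0) (ltn0Sn _) hq y1).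
Unshelve. all: by end_near.
Qed.
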